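(* Let $\varphi\colon A\to B$ be a surjective map of commutative noetherian local rings with common residue field $k$, whose kernel is generated by an $A$-regular sequence $f_1,\dots,f_c$. Let $M$ be a finitely generated $B$-module whose projective dimension over $A$ is finite, and put $M^*=\mathrm{RHom}_B(M,B)$. Then the multiplicities of the finitely generated graded $\mathcal S$-modules $\mathrm{Ext}_B(M,k)$ and $\mathrm{Ext}_B(M^*,k)$ coincide, where $\mathcal S=k[\chi_1,\dots,\chi_c]$ is the ring of cohomology operators of $\varphi$. In particular, the leading terms of the quasi-polynomials eventually modeling the Betti numbers $\beta_i^B(M)$ and $\beta_i^B(M^* )$ agree.
   Context: Cohomology operators. Let $K=A\langle e_1,\dots,e_c\mid \partial e_i=f_i\rangle$ be the Koszul complex on $f_1,\dots,f_c$ over $A$, a dg $A$-algebra (exterior algebra over $A$ on degree $1$ variables). Since $f_1,\dots,f_c$ is $A$-regular, $K\to B$ is a quasi-isomorphism, so complexes of $B$-modules may be viewed as dg $K$-modules and $\mathrm{RHom}_B(N,k)\simeq \mathrm{RHom}_K(N,k)$. Let $\mathcal S=k[\chi_1,\dots,\chi_c]$ be the graded polynomial ring with each $\chi_i$ in cohomological degree $2$. For a complex $N$ of $B$-modules that is perfect over $A$, choose a semifree resolution $F\xrightarrow{\simeq}N$ over $K$; then $\mathrm{RHom}_B(N,k)$ is represented by the dg $\mathcal S$-module $\mathrm{Hom}_A(F,k)\otimes_k\mathcal S$ with differential $\partial^{\mathrm{Hom}(F,k)}\otimes 1+\sum_{i=1}^c \mathrm{Hom}(e_i-,k)\otimes\chi_i$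 (where $\mathrm{Hom}(e_i-,k)$ is precomposition with multiplication by $e_i$, with the usual Koszul sign $g\mapsto(-1)^{|g|}g(e_i-)$). This is independent of $F$ up to quasi-isomorphism and makes $\mathrm{Ext}_B(N,k)=\bigoplus_i\mathrm{Ext}^i_B(N,k)$ a finitely generated graded $\mathcal S$-module. Both $N=M$ and $N=M^*$ are perfect over $A$. Multiplicity. For a nonzero finitely generated graded $\mathcal S$-module $X$ of Krull dimension $d$, its multiplicity is $\lim_{n\to\infty} d!\,\mathrm{rank}_k\big(X/(\chi_1,\dots,\chi_c)^nX\big)/n^d$; the multiplicity of $X=0$ is $0$. Betti numbers. $\beta_i^B(N)=\mathrm{rank}_k\mathrm{Ext}^i_B(N,k)$. For $N$ perfect over $A$ there are polynomials $q_{\mathrm{ev}},q_{\mathrm{odd}}$ having the same degree and the same leading coefficient (or both zero) such that for $i\gg0$, $\beta^B_i(N)=q_{\mathrm{ev}}(i)$ for $i$ even and $\beta^B_i(N)=q_{\mathrm{odd}}(i)$ for $i$ odd. The leading term of this quasi-polynomial of period two is the common leading term of $q_{\mathrm{ev}}$ and $q_{\mathrm{odd}}$. *)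

(* Defs.v *)
(* [mpoly] has to be imported before [topology]: in the other order their
   notations clash. *)
From HB Require Import structures.
From mathcomp Require Import all_boot all_order all_algebra.
From mathcomp Require Import mpoly.
From mathcomp Require Import boolp classical_sets functions reals.
From mathcomp Require Import topology normedtype sequences.

Set Implicit Arguments.
Unset Strict Implicit.
Unset Printing Implicit Defensive.

Import GRing.Theory numFieldNormedType.Exports.
Local Open Scope ring_scope.
Local Open Scope quotient_scope.

Definition surjective (T U : Type) (g : T -> U) : Prop :=
  forall y, exists x, g x = y.

(* [idealr_closed] is the library's notion of a proper ideal; an arbitrary ideal
   of [R] is a submodule of [R^o]. *)
Definition prime_ideal (R : comNzRingType) (I : {pred R}) : Prop :=
  idealr_closed I /\ prime_idealr_closed I.

Definition maximal_ideal (R : comNzRingType) (I : {pred R}) : Prop :=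
  idealr_closed I /\
  forall J : {pred R}, idealr_closed J -> {subset I <= J} -> I =i J.

Definition local_ring (R : comNzRingType) : Prop :=
  exists2 I : {pred R}, maximal_ideal I &
    forall J : {pred R}, maximal_ideal J -> J =i I.

Definition finitely_generated (R : comNzRingType) (V : lmodType R)
    (U : {pred V}) : Prop :=
  exists (n : nat) (v : 'I_n -> V), forall x : V,
    x \in U <-> exists a : 'I_n -> R, x = \sum_i a i *: v i.

Definition noetherian (R : comNzRingType) : Prop :=
  forall I : {pred R^o}, GRing.submod_closed I -> finitely_generated I.

Definition in_ideal (R : comNzRingType) (c : nat) (f : 'I_c -> R)
    (P : pred 'I_c) (x : R) : Prop :=
  exists a : 'I_c -> R, x = \sum_(i | P i) a i * f i.

Definition regular_sequence (R : comNzRingType) (c : nat) (f : 'I_c -> R) :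
    Prop :=
  (forall (i : 'I_c) (x : R),
     in_ideal f [pred j : 'I_c | (j < i)%N] (f i * x) ->
     in_ideal f [pred j : 'I_c | (j < i)%N] x)
  /\ ~ in_ideal f predT 1.

Definition projective (R : comNzRingType) (P : lmodType R) : Prop :=
  forall (X Y : lmodType R) (g : {linear X -> Y}) (h : {linear P -> Y}),
    surjective g -> exists h' : {linear P -> X}, forall x, g (h' x) = h x.

(* Restriction of scalars along [phi] is expressed by [phi]-semilinear maps. *)
Definition finite_proj_dim (A B : comNzRingType) (phi : {rmorphism A -> B})
    (M : lmodType B) : Prop :=
  exists (P : nat -> lmodType A) (d : forall n, {linear P n.+1 -> P n})
         (aug : {linear P 0%N -> M | phi \; *:%R}) (m : nat),
    [/\ forall n, projective (P n),
        surjective aug,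
        forall x, aug x = 0 <-> exists y, x = d 0%N y,
        forall n x, d n x = 0 <-> exists y, x = d n.+1 y
      & forall n, (m < n)%N -> forall x : P n, x = 0].

Section QuotientModule.
Variables (R : comNzRingType) (V : lmodType R).
Variables (W : {pred V}) (W_closed : GRing.submod_closed W).

Definition submod_zmod : zmodClosed V :=
  HB.pack W (GRing.isZmodClosed.Build V W (GRing.submod_closedB W_closed)).

Definition submod_quot : Type := @Quotient.quot V submod_zmod.

HB.instance Definition _ := GRing.Zmodule.on submod_quot.

Definition quot_pi (x : V) : submod_quot := \pi_(@Quotient.quot V submod_zmod) x.

Definition quot_scale (a : R) (x : submod_quot) : submod_quot :=
  quot_pi (a *: repr (x : @Quotient.quot V submod_zmod)).

Lemma quot_piP (P : submod_quot -> Prop) :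
  (forall x, P (quot_pi x)) -> forall x, P x.
Proof.
by move=> h x; have := h (repr (x : @Quotient.quot V submod_zmod));
  rewrite /quot_pi reprK.
Qed.

Lemma quot_piD x y : quot_pi (x + y) = quot_pi x + quot_pi y.
Proof. exact: pi_addr. Qed.

Lemma quot_piZ a x : quot_scale a (quot_pi x) = quot_pi (a *: x).
Proof.
apply/eqP; rewrite /quot_scale /quot_pi -Quotient.idealrBE -scalerBr.
have := GRing.subsemimod_closedZ (GRing.submod_closed_semi W_closed).
by apply; rewrite (Quotient.idealrBE submod_zmod) reprK.
Qed.

Lemma quot_scaleA a b x :
  quot_scale a (quot_scale b x) = quot_scale (a * b) x.
Proof. by elim/quot_piP: x => x; rewrite !quot_piZ scalerA. Qed.

Lemma quot_scale1 : left_id 1 quot_scale.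
Proof. by elim/quot_piP => x; rewrite quot_piZ scale1r. Qed.

Lemma quot_scaleDr : right_distributive quot_scale +%R.
Proof.
move=> a; elim/quot_piP => x; elim/quot_piP => y.
by rewrite !quot_piZ -!quot_piD quot_piZ scalerDr.
Qed.

Lemma quot_scaleDl x : {morph quot_scale^~ x : a b / a + b}.
Proof.
by elim/quot_piP: x => x a b; rewrite !quot_piZ scalerDl quot_piD.
Qed.

HB.instance Definition _ := GRing.Zmodule_isLmodule.Build R submod_quot
  quot_scaleA quot_scale1 quot_scaleDr quot_scaleDl.

End QuotientModule.

Section Multiplicity.
Variables (k : fieldType) (c : nat).
Local Notation S := {mpoly k[c]}.
Variable X : lmodType S.

(* [n] is the [k]-dimension of [U / W], for [k]-subspaces [W] and [U] of [X]. *)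
Definition is_rank_mod (U W : {pred X}) (n : nat) : Prop :=
  exists v : 'I_n -> X, (forall i, v i \in U) /\
    forall x, x \in U ->
      exists! a : {ffun 'I_n -> k}, x - \sum_i (a i)%:MP *: v i \in W.

(* Like the other functions defined by [xget 0%N] below, this takes the junk
   value 0 when no natural number qualifies. *)
Definition rank_mod (U W : {pred X}) : nat :=
  xget 0%N [set n | is_rank_mod U W n]%classic.

(* Membership in [(chi_1, ..., chi_c)^n X]; the variable ['X_i] is [chi_i]. *)
Fixpoint in_power_submod (n : nat) (x : X) : Prop :=
  if n is n'.+1 then
    exists y : 'I_c -> X,
      (forall i, in_power_submod n' (y i)) /\ x = \sum_i ('X_i : S) *: y i
  else True.

Definition power_submod (n : nat) : {pred X} :=
  fun x => `[< in_power_submod n x >].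

Definition prime_chain (n : nat) (p : nat -> {pred S}) : Prop :=
  (forall i, (i <= n)%N -> prime_ideal (p i) /\
     forall s, (forall x : X, s *: x = 0) -> s \in p i) /\
  (forall i, (i < n)%N ->
     {subset p i <= p i.+1} /\ ~ {subset p i.+1 <= p i}).

Definition is_krull_dim (d : nat) : Prop :=
  (exists p, prime_chain d p) /\ (forall n p, prime_chain n p -> (n <= d)%N).

Definition krull_dim : nat := xget 0%N [set d | is_krull_dim d]%classic.

Definition multiplicity (R : realType) : R :=
  if `[< forall x : X, x = 0 >] then 0 else
  limn (fun n : nat =>
    (krull_dim`!)%:R * (rank_mod predT (power_submod n))%:R
      / n%:R ^+ krull_dim : R).

End Multiplicity.

(* A dg module over the Koszul complex
     [K = A<e_1, ..., e_c | d e_i = f_i>],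
   graded homologically.  As a graded algebra [K] is the exterior algebra on the
   [e_i], so a [K]-module structure is given by the operators [kdg_e i] of
   multiplication by [e_i], subject to the exterior relations and to the Leibniz
   rule.  The grading is given by the projections [kdg_pr j] onto the summands
   of degree [j]. *)
Record koszul_dgmod (A : comNzRingType) (c : nat) (f : 'I_c -> A) := KoszulDg {
  kdg_sort :> lmodType A;
  kdg_pr : int -> {linear kdg_sort -> kdg_sort};
  kdg_d : {linear kdg_sort -> kdg_sort};
  kdg_e : 'I_c -> {linear kdg_sort -> kdg_sort};
  kdg_pr_pr : forall i j x,
    kdg_pr i (kdg_pr j x) = if i == j then kdg_pr j x else 0;
  kdg_pr_sum : forall x, exists s : seq int,
    uniq s /\ x = \sum_(j <- s) kdg_pr j x;
  kdg_d_deg : forall j x, kdg_d (kdg_pr j x) = kdg_pr (j - 1) (kdg_d x);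
  kdg_e_deg : forall i j x,
    kdg_e i (kdg_pr j x) = kdg_pr (j + 1) (kdg_e i x);
  kdg_dd : forall x, kdg_d (kdg_d x) = 0;
  kdg_ee : forall i x, kdg_e i (kdg_e i x) = 0;
  kdg_eC : forall i j x, kdg_e i (kdg_e j x) = - kdg_e j (kdg_e i x);
  kdg_leibniz : forall i x,
    kdg_d (kdg_e i x) = f i *: x - kdg_e i (kdg_d x)
}.

(* A cochain complex [0 -> N^0 -> N^1 -> ...] of [B]-modules, with [N^n] in
   homological degree [-n].  This covers both [M] and [RHom_B(M, B)]. *)
Record cochain_complex (B : comNzRingType) := CochainComplex {
  cc_ob :> nat -> lmodType B;
  cc_d : forall n, {linear cc_ob n -> cc_ob n.+1};
  cc_dd : forall n x, cc_d n.+1 (cc_d n x) = 0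
}.
Arguments cc_d [B] N n : rename.

Definition coboundary (B : comNzRingType) (N : cochain_complex B) (n : nat) :
    N n -> Prop :=
  match n with
  | 0%N => fun x => x = 0
  | n'.+1 => fun x => exists y : N n', x = cc_d N n' y
  end.

Section Resolution.
Variables (A B : comNzRingType) (phi : {rmorphism A -> B}).
Variables (c : nat) (f : 'I_c -> A).
Implicit Types (F : koszul_dgmod f) (N : cochain_complex B).

(* Multiplication by the product of the [e_i], [i \in I], in increasing order;
   these products form the standard [A]-basis of [K]. *)
Definition koszul_mul F (I : {set 'I_c}) (x : F) : F :=
  foldr (fun i y => kdg_e F i y) x (enum I).

(* [F] has a semibasis: homogeneous elements [b t], [t : T], forming a basis
   over the graded algebra underlying [K], filtered by [lev] in such a way that
   [d (b t)] is in the [K]-span of the elements of lower level. *)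
Definition semifree F : Prop :=
  exists (T : choiceType) (b : T -> F) (deg : T -> int) (lev : T -> nat),
    let elt (p : T * {set 'I_c}) := koszul_mul p.2 (b p.1) in
    [/\ forall t, kdg_pr F (deg t) (b t) = b t,
        forall x : F, exists (s : seq (T * {set 'I_c})) (a : _ -> A),
          x = \sum_(p <- s) a p *: elt p,
        forall (s : seq (T * {set 'I_c})) (a : _ -> A), uniq s ->
          \sum_(p <- s) a p *: elt p = 0 -> forall p, p \in s -> a p = 0
      & forall t, exists (s : seq (T * {set 'I_c})) (a : _ -> A),
          (forall p, p \in s -> (lev p.1 < lev t)%N) /\
          kdg_d F (b t) = \sum_(p <- s) a p *: elt p].

(* A quasi-isomorphism [F -> N] of dg [K]-modules, where [K] acts on [N] through
   [K -> B]: scalars act through [phi] and each [e_i] acts as 0.  Its component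
   [eps n] vanishes outside degree [-n]. *)
Definition dg_quasi_iso F N
    (eps : forall n, {linear F -> N n | phi \; *:%R}) : Prop :=
  [/\ forall n x, eps n (kdg_pr F (- n%:Z) x) = eps n x,
      (forall x, eps 0%N (kdg_d F x) = 0) /\
      (forall n x, eps n.+1 (kdg_d F x) = cc_d N n (eps n x)),
      forall n i x, eps n (kdg_e F i x) = 0,
      forall x, kdg_d F x = 0 -> (forall n, coboundary (eps n x)) ->
        exists y, x = kdg_d F y
    & forall n (z : N n), cc_d N n z = 0 ->
        exists x, kdg_d F x = 0 /\ coboundary (eps n x - z)].

Definition semifree_resolution F N : Prop :=
  semifree F /\ exists eps, @dg_quasi_iso F N eps.

End Resolution.

Section Complexes.
Variables (B : comNzRingType) (M : lmodType B).

Definition single_ob (n : nat) : lmodType B := if n is 0%N then M else 'rV[B]_0.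

Definition single_d (n : nat) : {linear single_ob n -> single_ob n.+1} := \0.

Lemma single_dd n x : single_d n.+1 (single_d n x) = 0.
Proof. by []. Qed.

Definition single_complex := CochainComplex single_dd.

(* A resolution of [M] by finitely generated free [B]-modules
   [G_n = 'rV_(fr_rank n)], with differential [u |-> u *m fr_mx n]. *)
Record free_resolution := FreeResolution {
  fr_rank : nat -> nat;
  fr_mx : forall n, 'M[B]_(fr_rank n.+1, fr_rank n);
  fr_aug : {linear 'rV[B]_(fr_rank 0) -> M};
  fr_aug_surj : surjective fr_aug;
  fr_exact0 : forall u, fr_aug u = 0 <-> exists w, u = w *m fr_mx 0;
  fr_exact : forall n (u : 'rV_(fr_rank n.+1)),
    u *m fr_mx n = 0 <-> exists w, u = w *m fr_mx n.+1
}.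

Variable G : free_resolution.

(* [Hom_B(G, B)]: the functional [u |-> u *m v] on [G_n] is identified with the
   column vector [v]; the differential is [h |-> - (-1)^|h| (h \o d)]. *)
Definition dual_ob (n : nat) : lmodType B := 'cV[B]_(fr_rank G n).

Definition dual_d (n : nat) : {linear dual_ob n -> dual_ob n.+1} :=
  mulmx ((-1) ^+ n.+1 *: fr_mx G n).

Lemma dual_dd n x : dual_d n.+1 (dual_d n x) = 0.
Proof.
rewrite /dual_d /= mulmxA -scalemxAl -scalemxAr.
suff -> : fr_mx G n.+1 *m fr_mx G n = 0 by rewrite !scaler0 mul0mx.
apply/row_matrixP => i; rewrite row0 row_mul.
by apply/fr_exact; exists (delta_mx 0 i); rewrite rowE.
Qed.

Definition dual_complex := CochainComplex dual_dd.

End Complexes.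

Section Ext.
Variables (A B : comNzRingType) (k : fieldType).
Variables (phi : {rmorphism A -> B}) (pi : {rmorphism B -> k}).
Variables (c : nat) (f : 'I_c -> A) (F : koszul_dgmod f).
Local Notation S := {mpoly k[c]}.

(* An element [\sum_r g_r (x) s_r] of [Hom_A(F, k) (x)_k S] is identified with
   the function [x |-> \sum_r g_r x *: s_r].  Here [Hom_A(F, k)] is the graded
   module [\bigoplus_j Hom_A(F_j, k)], so that the functions obtained are the
   [A]-linear maps [F -> S] that vanish on all but finitely many [F_j] and take
   values of bounded degree.  The codomain is written [S^o] so that functions
   get the pointwise [S]-module structure. *)
Definition cochain (g : F -> S^o) : Prop :=
  (forall a x y, g (a *: x + y) = pi (phi a) *: (g x : S) + g y) /\
  exists n : nat, forall x : F, (msize (g x : S) <= n)%N /\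
    forall j : int, (n < `|j|)%N -> g (kdg_pr F j x) = 0.

(* [h] is the image of [g] under the differential
   [d^Hom(F, k) (x) 1 + \sum_i Hom(e_i -, k) (x) chi_i].  On [F_j] only the
   component of [g] of degree [j - 1] contributes to the first term,
   [- (-1)^(j - 1) (g \o d)], and only that of degree [j + 1] to the second,
   with sign [(-1)^(j + 1)]. *)
Definition cochain_diff (g h : F -> S^o) : Prop :=
  forall (j : int) (x : F),
    h (kdg_pr F j x) =
      (-1) ^+ `|j| * (g (kdg_d F (kdg_pr F j x))
                      - \sum_i 'X_i * g (kdg_e F i (kdg_pr F j x))).

Definition cocycle : {pred F -> S^o} :=
  fun g => `[< cochain g /\ cochain_diff g 0 >].

Let fun0E x : (0 : F -> S^o) x = 0. Proof. by []. Qed.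

Let funDZE (s : S) (g h : F -> S^o) x : (s *: g + h) x = s * g x + h x.
Proof. by []. Qed.

Lemma cochain0 : cochain 0.
Proof.
split=> [a x y|]; first by rewrite !fun0E scaler0 addr0.
by exists 0%N => x; rewrite !fun0E mmeasure0.
Qed.

Lemma cochain_add (s : S) g h : cochain g -> cochain h -> cochain (s *: g + h).
Proof.
move=> [gl [m gb]] [hl [n hb]]; split=> [a x y|].
  by rewrite !funDZE gl hl mulrDr -scalerAr scalerDr addrACA.
exists (msize s + m + n)%N => x; split.
  rewrite funDZE; apply: leq_trans (msizeD_le _ _) _; rewrite geq_max.
  apply/andP; split; last by apply: leq_trans (hb x).1 _; apply: leq_addl.
  apply: leq_trans (leq_addr n _).
  have [->|s0] := eqVneq s 0; first by rewrite mul0r mmeasure0.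
  have [->|g0] := eqVneq (g x : S) 0; first by rewrite mulr0 mmeasure0.
  rewrite msizeM // -subn1 leq_subLR.
  by apply: leq_trans (leq_addl 1 _); rewrite leq_add2l (gb x).1.
move=> j jn; rewrite funDZE (gb x).2 ?(hb x).2 ?mulr0 ?addr0 //.
  by apply: leq_ltn_trans jn; rewrite leq_addl.
by apply: leq_ltn_trans jn; rewrite -addnA addnCA leq_addr.
Qed.

Lemma cochain_diff_add (s : S) g g' h h' :
  cochain_diff g h -> cochain_diff g' h' ->
  cochain_diff (s *: g + g') (s *: h + h').
Proof.
move=> gh gh' j x; rewrite !funDZE gh gh'.
under [in RHS]eq_bigr => i _ do rewrite funDZE mulrDr mulrCA.
rewrite big_split /= -mulr_sumr opprD addrACA -mulrBr [RHS]mulrDr.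
by rewrite [in RHS]mulrCA.
Qed.

Lemma cochain_diff0 : cochain_diff 0 0.
Proof.
by move=> j x; rewrite !fun0E big1 ?subr0 ?mulr0 // => i _; rewrite mulr0.
Qed.

Lemma cocycle_closed : GRing.subsemimod_closed cocycle.
Proof.
apply: GRing.submod_closed_semi; split.
  by apply/asboolP; split; [exact: cochain0|exact: cochain_diff0].
move=> s g h /asboolP[gc gd] /asboolP[hc hd]; apply/asboolP; split.
  exact: cochain_add.
by have := cochain_diff_add s gd hd; rewrite scaler0 addr0.
Qed.

HB.instance Definition _ := GRing.isSubmodClosed.Build S (F -> S^o) cocycle
  cocycle_closed.

Record cocycles := Cocycle {
  cocycle_val :> F -> S^o;
  cocycle_valP : cocycle_val \in cocycle
}.

HB.instance Definition _ := [isSub for cocycle_val].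
HB.instance Definition _ := [Choice of cocycles by <:].
HB.instance Definition _ := [SubChoice_isSubLmodule of cocycles by <:].

Definition cobound : {pred cocycles} :=
  fun g => `[< exists h, cochain h /\ cochain_diff h g >].

Lemma cobound_closed : GRing.submod_closed cobound.
Proof.
split.
  by apply/asboolP; exists 0; split; [exact: cochain0|exact: cochain_diff0].
move=> s g g' /asboolP[h [hc hd]] /asboolP[h' [hc' hd']]; apply/asboolP.
exists (s *: h + h'); split; first exact: cochain_add.
exact: cochain_diff_add.
Qed.

(* For a semifree resolution [F] of [N] over [K], this is the direct sum
   [Ext_B(N, k)] of all the [Ext^n_B(N, k)]; see [Ext_degree] for the summands. *)
Definition Ext : lmodType S := submod_quot cobound_closed.

(* In cohomological grading [Hom_A(F_j, k)] has degree [j], and [chi_i] has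
   degree 2. *)
Definition homogeneous (n : int) (g : F -> S^o) : Prop :=
  forall (j : int) (x : F) (m : 'X_{1..c}),
    m \in msupp (g (kdg_pr F j x) : S) -> j + (2 * mdeg m)%:Z = n.

Definition Ext_degree (n : int) : {pred Ext} :=
  fun x => `[< exists2 g : cocycles,
    homogeneous n g & x = quot_pi cobound_closed g >].

Definition betti (n : int) : nat := rank_mod (Ext_degree n) (pred1 0).

End Ext.

Definition lead_term (p : {poly rat}) : {poly rat} :=
  lead_coef p *: 'X^((size p).-1).

Definition quasi_poly_models (b : nat -> nat) (q_ev q_odd : {poly rat}) : Prop :=
  lead_term q_ev = lead_term q_odd /\
  exists n0 : nat, forall n, (n0 <= n)%N ->
    (b n)%:R = (if odd n then q_odd else q_ev).[n%:R].

(* Main.v *)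
(* There is a finite free dg module [E] over the Koszul complex [K], quasi-isomorphic
   to [M]: attach free [K]-cells along a free resolution of [M] over [B], and truncate
   in high degrees, using that [M] has finite projective dimension over [A].  The
   [A]-dual of [E], whose operators are the transposed matrices, is then
   quasi-isomorphic to [RHom_B(M, B)] up to a shift by [c], since [K] is self-dual.
   Semifree resolutions compare with these two models, and so there is a homogeneous
   square matrix [D] over [S] with [D^2 = 0] such that [Ext_B(M, k)] is the homology
   of [D] and [Ext_B(M^*, k)] is the homology of the transpose of [D].

   The Hilbert functions [h] and [h'] of these homology modules have the same growth.
   If the rank of [D] over the field of fractions is less than half its size, then [h]
   and [h'] agree up to lower order terms by rank counting.  Otherwise some homogeneous
   [s <> 0] has the form [D T + T D].  Extending [k], one can change coordinates so
   that [s] becomes monic of degree [e] in the last variable; then [S / s] is free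
   over a polynomial ring in one variable less, and reduction modulo [s] turns [D] and
   its transpose into a matrix over that ring and its transpose, by duality with
   respect to the coefficient of [x^(e - 1)] modulo [s].  As [s] kills the homology,
   the reduced Hilbert function is [h_n + h_(n + 1 - 2 e)], and induction on the number
   of variables applies.

   The common growth exponent is the Krull dimension of both modules, and
   [rank (X / (chi)^n X)] differs by lower order terms from the sum of the [h_i] for
   [i < 2 n]. *)

Require Import Defs.
From HB Require Import structures.
From mathcomp Require Import all_boot all_order all_algebra.
From mathcomp Require Import mpoly.
From mathcomp Require Import boolp classical_sets functions reals.
From mathcomp Require Import ring lra zify.

Set Implicit Arguments.
Unset Strict Implicit.
Unset Printing Implicit Defensive.

Import Order.TTheory GRing.Theory Num.Theory.
Import Pdiv.Ring Pdiv.RingMonic.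
Local Open Scope ring_scope.

(** * Dg modules over the Koszul complex given by matrices *)

(** The homology of [D] may have Krull dimension below [c]; counting ranks then says only that [h]
    and [h'] are of lower order, which is what forces the reduction modulo [s]. Hilbert functions
    are quasi-polynomial of period two and duality shifts degrees by integers of either parity, so
    [h] and [h'] cannot be compared degree by degree. All comparisons are between partial sums, up
    to an error of order one less than the common exponent. As the two polynomials of a
    quasi-polynomial share their leading term, partial sums still determine that term. With
    matrices, both the [A]-dual of a model and the passage from [D] to its dual are literal
    transposition. Reduction modulo [s] stays within this class of data because the trace form of
    [S / s] is perfect and homogeneous, and it doubles partial sums up to lower order, so that a
    comparison of the reduced pair descends to the original one. *)

Lemma level_choice (T X : Type) (lev : T -> nat) (good : T -> (T -> X) -> X -> Prop)
    (x0 : X) :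
  (forall t U U' y, (forall t', (lev t' < lev t)%N -> U t' = U' t') ->
     good t U y -> good t U' y) ->
  (forall t U, (forall t', (lev t' < lev t)%N -> good t' U (U t')) ->
     exists y, good t U y) ->
  exists U, forall t, good t U (U t).
Proof.
move=> loc step.
have [ch chP] : {ch : T -> (T -> X) -> X | forall t U,
    (exists y, good t U y) -> good t U (ch t U)}.
  apply: constructive_indefinite_description.
  have /choice[ch chP] : forall p : T * (T -> X), exists y,
      (exists y, good p.1 p.2 y) -> good p.1 p.2 y.
    move=> [t U] /=; case: (pselect (exists y, good t U y)) => [[y yP]|n].
      by exists y.
    by exists x0.
  by exists (fun t U => ch (t, U)) => t U; apply: (chP (t, U)).
(* [V n] is final on levels below [n]: [V m.+1] keeps the values of [V m] below level [m] and
   chooses those on level [m] from them. *)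
pose V := fix V (n : nat) : T -> X :=
  if n is m.+1 then fun t => if (lev t < m)%N then V m t else ch t (V m)
  else fun=> x0.
have Vst n t : (lev t < n)%N -> V n t = V (lev t).+1 t.
  elim: n => // n IH /=; rewrite ltnS leq_eqVlt => /orP[/eqP <-|ltn].
    by rewrite ltnn.
  by rewrite ltn ltnn IH //= ltnn.
pose U t := V (lev t).+1 t.
have UV n t : (lev t < n)%N -> V n t = U t by exact: Vst.
exists U => t; have [n] := ubnP (lev t); elim: n t => // n IH t ltn.
have agree t' : (lev t' < lev t)%N -> V (lev t) t' = U t' by move=> /UV.
rewrite /U /= ltnn; apply: (loc t (V (lev t))) => //.
apply: chP; apply: step => t' lt'.
rewrite agree //; apply: (loc t' U); last first.
  by apply: IH; rewrite (leq_trans lt').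
by move=> t'' lt''; rewrite UV // (ltn_trans lt'').
Qed.

Section GradedMatrices.
Variable R : comNzRingType.

(** Matrices act on row vectors from the right, so row [a] is the image of a generator of degree
    [dr a], and [w] is the degree of the map. *)
Definition hommx m n (dr : 'I_m -> int) (dc : 'I_n -> int) (w : int)
    (M : 'M[R]_(m, n)) : Prop :=
  forall a b, M a b != 0 -> dc b = dr a + w.

Definition degpr n (dg : 'I_n -> int) (j : int) : 'M[R]_n :=
  diag_mx (\row_a (dg a == j)%:R).

Lemma mul_degpr m n (dg : 'I_n -> int) j (x : 'M[R]_(m, n)) a b :
  (x *m degpr dg j) a b = if dg b == j then x a b else 0.
Proof.
by rewrite mul_mx_diag !mxE; case: ifP; rewrite ?mulr1 ?mulr0.
Qed.

Lemma degpr_mul m n (dg : 'I_m -> int) j (x : 'M[R]_(m, n)) a b :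
  (degpr dg j *m x) a b = if dg a == j then x a b else 0.
Proof.
by rewrite mul_diag_mx !mxE; case: ifP; rewrite ?mul1r ?mul0r.
Qed.

(** Homogeneity in the form used for calculations. It allows a lift to be made homogeneous
    afterwards by one multiplication with a degree projection. *)
Lemma hommx_degpr m n dr dc w (M : 'M[R]_(m, n)) j :
  hommx dr dc w M -> degpr dr j *m M = M *m degpr dc (j + w).
Proof.
move=> hM; apply/matrixP => a b; rewrite mul_degpr degpr_mul.
have [-> |/hM ->] := eqVneq (M a b) 0; first by rewrite !if_same.
by rewrite (inj_eq (addIr _)).
Qed.

Lemma degpr_tr n (dg : 'I_n -> int) j : (degpr dg j)^T = degpr dg j.
Proof. by rewrite /degpr tr_diag_mx. Qed.

Lemma degpr_degpr n (dg : 'I_n -> int) i j :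
  degpr dg i *m degpr dg j = if i == j then degpr dg j else 0.
Proof.
apply/matrixP => a b; rewrite mul_degpr; case: (eqVneq i j) => [->|ij].
  rewrite !mxE; case: (eqVneq a b) => [->|]; rewrite ?mulr1n ?mulr0n ?if_same //.
  by case: eqP.
rewrite !mxE; case: (eqVneq a b) => [->|]; rewrite ?mulr1n ?mulr0n ?if_same //.
by case: (eqVneq (dg b) j) => // ->; rewrite eq_sym (negbTE ij).
Qed.

Lemma hommx0 m n dr dc w : hommx dr dc w (0 : 'M[R]_(m, n)).
Proof. by move=> a b; rewrite mxE eqxx. Qed.

Lemma hommxD m n dr dc w (M N : 'M[R]_(m, n)) :
  hommx dr dc w M -> hommx dr dc w N -> hommx dr dc w (M + N).
Proof.
move=> hM hN a b; rewrite mxE.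
by have [->|/hM//] := eqVneq (M a b) 0; rewrite add0r => /hN.
Qed.

Lemma hommxN m n dr dc w (M : 'M[R]_(m, n)) :
  hommx dr dc w M -> hommx dr dc w (- M).
Proof. by move=> hM a b; rewrite mxE oppr_eq0 => /hM. Qed.

Lemma hommxM m n p dr ds dt w w' (M : 'M[R]_(m, n)) (N : 'M[R]_(n, p)) :
  hommx dr ds w M -> hommx ds dt w' N -> hommx dr dt (w + w') (M *m N).
Proof.
move=> hM hN a b; rewrite mxE; apply: contraNeq => ne.
rewrite big1 // => i _.
have [->|/hM Ma] := eqVneq (M a i) 0; first by rewrite mul0r.
have [->|/hN Nb] := eqVneq (N i b) 0; first by rewrite mulr0.
by move: ne; rewrite Nb Ma addrA eqxx.
Qed.

Lemma hommx1 m (dr : 'I_m -> int) x : hommx dr dr 0 (x%:M : 'M[R]_m).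
Proof.
move=> a b; rewrite mxE; have [->|] := eqVneq a b; first by rewrite addr0.
by rewrite mulr0n eqxx.
Qed.

Lemma hommx_tr m n dr dc w (M : 'M[R]_(m, n)) :
  hommx dr dc w M -> hommx dc dr (- w) M^T.
Proof. by move=> hM a b; rewrite mxE => /hM ->; rewrite addrK. Qed.

Definition catdeg m n (d1 : 'I_m -> int) (d2 : 'I_n -> int) (a : 'I_(m + n)) :=
  match fintype.split a with inl i => d1 i | inr i => d2 i end.

Lemma hommx_row m n1 n2 dr d1 d2 w (M : 'M[R]_(m, n1)) (N : 'M[R]_(m, n2)) :
  hommx dr d1 w M -> hommx dr d2 w N -> hommx dr (catdeg d1 d2) w (row_mx M N).
Proof.
move=> hM hN a b; rewrite /catdeg mxE.
by case: (fintype.split b) => i; [apply: hM|apply: hN].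
Qed.

Lemma hommx_col m1 m2 n d1 d2 dc w (M : 'M[R]_(m1, n)) (N : 'M[R]_(m2, n)) :
  hommx d1 dc w M -> hommx d2 dc w N -> hommx (catdeg d1 d2) dc w (col_mx M N).
Proof.
move=> hM hN a b; rewrite /catdeg mxE.
by case: (fintype.split a) => i; [apply: hM|apply: hN].
Qed.

Lemma hommx_block m1 m2 n1 n2 d1 d2 e1 e2 w
    (M : 'M[R]_(m1, n1)) (N : 'M[R]_(m1, n2)) (P : 'M[R]_(m2, n1))
    (Q : 'M[R]_(m2, n2)) :
  hommx d1 e1 w M -> hommx d1 e2 w N -> hommx d2 e1 w P -> hommx d2 e2 w Q ->
  hommx (catdeg d1 d2) (catdeg e1 e2) w (block_mx M N P Q).
Proof. by move=> hM hN hP hQ; apply: hommx_col; apply: hommx_row. Qed.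

End GradedMatrices.

Lemma hommx_map (R R' : comNzRingType) (g : {rmorphism R -> R'}) m n dr dc w
    (M : 'M[R]_(m, n)) :
  hommx dr dc w M -> hommx dr dc w (map_mx g M).
Proof.
move=> hM a b; rewrite mxE => ne; apply: hM.
by apply: contraNneq ne => ->; rewrite rmorph0.
Qed.

Lemma map_degpr (R R' : comNzRingType) (g : {rmorphism R -> R'}) n
    (dg : 'I_n -> int) j :
  map_mx g (degpr R dg j) = degpr R' dg j.
Proof. by apply/matrixP => a b; rewrite !mxE rmorphMn rmorph_nat. Qed.

(** A finite free graded [A]-module with a differential and multiplication operators, all acting on
    row vectors. The axioms are kept apart, in [klaws] and [khom], because intermediate stages
    satisfy only a part of the Leibniz rules. *)
Record dgmx (A : comNzRingType) (c : nat) := DgMx {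
  dg_rk : nat;
  dg_deg : 'I_dg_rk -> int;
  dg_d : 'M[A]_dg_rk;
  dg_e : 'I_c -> 'M[A]_dg_rk
}.
Arguments dg_deg [A c] d _.

Section Koszul.
Variables (A : comNzRingType) (c : nat) (f : 'I_c -> A).

(** For the Koszul complex on some of the [f i], the Leibniz rule holds with [f i] on the indices in
    [P] and with 0 on the others. *)
Definition klaws (P : pred 'I_c) (X : dgmx A c) : Prop :=
  [/\ dg_d X *m dg_d X = 0,
      forall i, dg_e X i *m dg_e X i = 0,
      forall i j, dg_e X i *m dg_e X j = - (dg_e X j *m dg_e X i)
    & forall i, dg_d X *m dg_e X i + dg_e X i *m dg_d X
        = if P i then (f i)%:M else 0].

Definition khom (X : dgmx A c) : Prop :=
  hommx (dg_deg X) (dg_deg X) (-1) (dg_d X) /\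
  forall i, hommx (dg_deg X) (dg_deg X) 1 (dg_e X i).

Definition eprod r (e : 'I_c -> 'M[A]_r) (l : seq 'I_c) : 'M[A]_r :=
  foldl (fun M i => M *m e i) 1%:M l.

Lemma eprod_rcons r (e : 'I_c -> 'M[A]_r) l i :
  eprod e (rcons l i) = eprod e l *m e i.
Proof. by rewrite /eprod foldl_rcons. Qed.

Lemma eprod_block r1 r2 (e1 : 'I_c -> 'M[A]_r1) (e2 : 'I_c -> 'M[A]_r2) l :
  eprod (fun i => block_mx (e1 i) 0 0 (e2 i)) l
  = block_mx (eprod e1 l) 0 0 (eprod e2 l).
Proof.
elim/last_ind: l => [|l i IH]; first by rewrite /eprod /= -scalar_mx_block.
by rewrite !eprod_rcons IH mulmx_block !mulmx0 !mul0mx !addr0 add0r.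
Qed.

Lemma eq_eprod r (e e' : 'I_c -> 'M[A]_r) l :
  {in l, e =1 e'} -> eprod e l = eprod e' l.
Proof.
elim/last_ind: l => [//|l i IH] h; rewrite !eprod_rcons IH; last first.
  by move=> j jl; apply: h; rewrite mem_rcons inE jl orbT.
by rewrite h // mem_rcons mem_head.
Qed.

Definition ords (p : nat) : seq 'I_c := [seq i : 'I_c <- enum 'I_c | (i < p)%N].

Lemma ordsS p (lt : (p < c)%N) : ords p.+1 = rcons (ords p) (Ordinal lt).
Proof.
apply: (inj_map val_inj); rewrite map_rcons /ords.
have F q : (q <= c)%N -> map val [seq i : 'I_c <- enum 'I_c | (i < q)%N] = iota 0 q.
  move=> qc; transitivity [seq x <- map val (enum 'I_c) | (x < q)%N].
    by rewrite filter_map.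
  rewrite val_enum_ord.
  have -> : iota 0 c = iota 0 q ++ iota q (c - q).
    by rewrite -iotaD subnKC.
  rewrite filter_cat [X in _ ++ X](_ : _ = [::]) ?cats0.
    by apply/all_filterP/allP => x; rewrite mem_iota.
  apply/eqP; rewrite -(negbK (_ == _)) -has_filter; apply/hasPn => x.
  by rewrite mem_iota -leqNgt => /andP[].
by rewrite F // F ?(ltnW lt) // -[in iota _ _]addn1 iotaD cats1.
Qed.

Lemma mem_ords p i : (i \in ords p) = (i < p)%N.
Proof. by rewrite mem_filter mem_enum andbT. Qed.

Lemma ords_c : ords c = enum 'I_c.
Proof. by apply/all_filterP/allP => i _; apply: ltn_ord. Qed.

Definition idealp (I : A -> Prop) := I 0 /\ forall a x y, I x -> I y -> I (a * x + y).

(** Matrix form of: [tau] induces an isomorphism from the homology of [d] onto [(A / I)^s], the rows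
    of [sg] being cycles that represent the standard basis. In this form it can be asked of a
    transposed matrix as well. *)
Definition resolves r s (d : 'M[A]_r) (tau : 'M[A]_(r, s)) (I : A -> Prop) :=
  [/\ forall a b, I ((d *m tau) a b),
      forall x : 'rV_r, x *m d = 0 -> (forall b, I ((x *m tau) 0 b)) ->
        exists y, x = y *m d
    & exists sg : 'M[A]_(s, r), sg *m d = 0 /\ sg *m tau = 1%:M].

Section Ideal.
Variables (I : A -> Prop) (hI : idealp I).

Lemma idealD x y : I x -> I y -> I (x + y).
Proof. by move=> hx hy; rewrite -[x]mul1r; apply: hI.2. Qed.
Lemma idealM a x : I x -> I (a * x).
Proof. by move=> hx; rewrite -[_ * _]addr0; apply: hI.2 => //; apply: hI.1. Qed.
Lemma idealN x : I x -> I (- x).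
Proof. by move=> hx; rewrite -mulN1r; apply: idealM. Qed.
Lemma ideal_sum (J : Type) (l : seq J) (P : pred J) (F : J -> A) :
  (forall j, P j -> I (F j)) -> I (\sum_(j <- l | P j) F j).
Proof.
by move=> h; elim/big_rec: _ => [|j x Pj]; [apply: hI.1|apply/idealD/h].
Qed.

Lemma ideal_mulmx m n p (x : 'M[A]_(m, n)) (M : 'M[A]_(n, p)) :
  (forall a b, I (M a b)) -> forall a b, I ((x *m M) a b).
Proof. by move=> h a b; rewrite mxE; apply: ideal_sum => j _; apply: idealM. Qed.
End Ideal.

Section Ind.
Variables (I I' : A -> Prop) (g : A) (hI : idealp I).
Hypothesis I'P : forall x, I' x <-> exists a, I (x - a * g).
Hypothesis reg : forall x, I (g * x) -> I x.

Lemma I'E n (x : 'rV[A]_n) : (forall b, I' (x 0 b)) ->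
  exists a : 'rV[A]_n, forall b, I ((x - g *: a) 0 b).
Proof.
move=> h; have /choice[a aP] b : exists a, I (x 0 b - a * g) by apply/I'P.
by exists (\row_b a b) => b; rewrite !mxE mulrC.
Qed.

Lemma I'I x : I x -> I' x.
Proof. by move=> h; apply/I'P; exists 0; rewrite mul0r subr0. Qed.

Lemma I'g x : I' (g * x).
Proof. by apply/I'P; exists x; rewrite mulrC subrr; apply: hI.1. Qed.

(** The block matrix is the mapping cone of multiplication by [g] on [d]. In a cycle [(x1, x2)] the
    class of [x2] is killed by [g], which is regular modulo [I], so [x2] is a boundary and only [x1]
    modulo [g] matters. *)
Lemma resolves_ind r s (d : 'M[A]_r) (tau : 'M[A]_(r, s)) :
  d *m d = 0 -> resolves d tau I ->
  resolves (block_mx d 0 g%:M (- d)) (col_mx tau 0) I'.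
Proof.
move=> dd [h1 h2 [sg [h3 h4]]]; split.
- move=> a b; rewrite mul_block_col !mulmx0 !addr0.
  case: (split_ordP a) => i ->; rewrite ?col_mxEu ?col_mxEd; first exact/I'I.
  by rewrite mul_scalar_mx mxE; apply: I'g.
- move=> x; rewrite -[x]hsubmxK; move: (lsubmx x) (rsubmx x) => x1 x2 {x}.
  rewrite mul_row_block mulmx0 add0r -(row_mx0 A 1 r r) => /eq_row_mx[e1 e2].
  rewrite mul_row_col mulmx0 addr0 => hx.
  have {}e2 : x2 *m d = 0 by apply: oppr_inj; rewrite -mulmxN e2 oppr0.
  rewrite mul_mx_scalar in e1.
  have [w2 w2P] : exists w2, x2 = w2 *m d.
    apply: h2 => // b; apply: reg.
    have := ideal_mulmx hI x1 h1 0 b.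
    move/(idealN hI); congr I; rewrite mulmxA.
    have -> : x1 *m d = - (g *: x2) by apply/eqP; rewrite -addr_eq0 e1.
    by rewrite mulNmx -scalemxAl !mxE opprK.
  have [a aP] : exists a : 'rV[A]_s,
      forall b, I (((x1 + g *: w2) *m tau - g *: a) 0 b).
    apply: I'E => b; rewrite mulmxDl mxE -scalemxAl [in X in _ + X]mxE.
    have /I'P[u uP] := hx b; apply/I'P; exists (u + (w2 *m tau) 0 b).
    by move: uP; congr I; rewrite !mxE; ring.
  (* Correcting [w2] by the cycle [a *m sg] leaves its boundary unchanged and moves the value of
     [x1 + g *: w] under [tau] into [I]. *)
  pose w := w2 - a *m sg.
  have [w1 w1P] : exists w1, x1 + g *: w = w1 *m d.
    apply: h2 => [|b].
      by rewrite mulmxDl -scalemxAl mulmxBl -mulmxA h3 mulmx0 subr0 -w2P.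
    have -> : (x1 + g *: w) *m tau = (x1 + g *: w2) *m tau - g *: a.
      by rewrite scalerBr addrA [LHS]mulmxBl -[X in _ - X]scalemxAl -mulmxA h4 mulmx1.
    exact: aP.
  exists (row_mx w1 (- w)); rewrite mul_row_block mulmx0 add0r mul_mx_scalar.
  by rewrite scalerN -w1P addrK mulmxN mulNmx opprK mulmxBl -mulmxA h3 mulmx0
    subr0 -w2P.
- exists (row_mx sg 0); rewrite mul_row_block !mul0mx mulmx0 !addr0 h3 row_mx0.
  by rewrite mul_row_col mulmx0 addr0 h4.
Qed.

(** The shape of the transposed cone. Here the homology sits in the second summand, the one shifted
    by a degree; repeated [c] times, this is the shift in the self-duality of the Koszul complex. *)
Lemma resolves_coind r s (d : 'M[A]_r) (tau : 'M[A]_(r, s)) :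
  d *m d = 0 -> resolves d tau I ->
  resolves (block_mx d g%:M 0 (- d)) (col_mx 0 tau) I'.
Proof.
move=> dd [h1 h2 [sg [h3 h4]]]; split.
- move=> a b; rewrite mul_block_col !mulmx0 !add0r.
  case: (split_ordP a) => i ->; rewrite ?col_mxEu ?col_mxEd.
    by rewrite mul_scalar_mx mxE; apply: I'g.
  by apply: I'I; rewrite mulNmx mxE; apply: idealN.
- move=> x; rewrite -[x]hsubmxK; move: (lsubmx x) (rsubmx x) => y1 y2 {x}.
  rewrite mul_row_block mulmx0 addr0 -(row_mx0 A 1 r r) => /eq_row_mx[e1 e2].
  rewrite mul_row_col mulmx0 add0r => hy.
  have {}e2 : y2 *m d = g *: y1.
    by apply/eqP; rewrite eq_sym -subr_eq0 -mulmxN -mul_mx_scalar e2.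
  have [w1 w1P] : exists w1, y1 = w1 *m d.
    apply: h2 => // b; apply: reg.
    have := ideal_mulmx hI y2 h1 0 b; congr I.
    by rewrite mulmxA e2 -scalemxAl !mxE.
  have [a aP] : exists a : 'rV[A]_s,
      forall b, I (((y2 - g *: w1) *m tau - g *: a) 0 b).
    apply: I'E => b; rewrite mulmxBl mxE -scalemxAl [in X in _ + X]mxE.
    have /I'P[u uP] := hy b; apply/I'P; exists (u - (w1 *m tau) 0 b).
    by move: uP; congr I; rewrite !mxE; ring.
  pose w := w1 + a *m sg.
  have [w2 w2P] : exists w2, y2 - g *: w = w2 *m d.
    apply: h2 => [|b].
      by rewrite mulmxBl -scalemxAl mulmxDl -mulmxA h3 mulmx0 addr0 -w1P e2 subrr.
    have -> : (y2 - g *: w) *m tau = (y2 - g *: w1) *m tau - g *: a.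
      by rewrite scalerDr opprD addrA [LHS]mulmxBl -[X in _ - X]scalemxAl -mulmxA h4 mulmx1.
    exact: aP.
  exists (row_mx w (- w2)); rewrite mul_row_block mulmx0 addr0 mul_mx_scalar.
  by rewrite mulNmx mulmxN opprK -w2P addrC subrK mulmxDl -mulmxA h3 mulmx0 addr0
    -w1P.
- exists (row_mx 0 sg); rewrite mul_row_block !mul0mx mulmx0 mulmxN h3 oppr0 !addr0 row_mx0.
  by rewrite mul_row_col mul0mx add0r h4.
Qed.

End Ind.
End Koszul.

Ltac blk := rewrite ?(opp_block_mx, mulmx_block, mul_row_block, mul_block_col, mul_row_col,
  mul_col_row, mul_col_mx, opp_col_mx, mulmx0, mul0mx, addr0, add0r, mulNmx, mulmxN,
  opprK, oppr0, mulmx1, mul1mx, add_block_mx, mul_scalar_mx,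
  mul_mx_scalar).

(** * Koszul cells and their self-duality *)

Section KCell.
Variables (A : comNzRingType) (c : nat) (f : 'I_c -> A).

Definition below (p : nat) : pred 'I_c := [pred i : 'I_c | (i < p)%N].

Lemma belowE p i : below p i = (i < p)%N.
Proof. by []. Qed.

Lemma belowS (p i : 'I_c) : below p.+1 i = (i == p) || below p i.
Proof. by rewrite !belowE ltnS leq_eqVlt. Qed.

Lemma in_ideal_idealp P : idealp (in_ideal f P).
Proof.
split; first by exists (fun=> 0); rewrite big1 // => i _; rewrite mul0r.
move=> a x y [u ->] [v ->]; exists (fun i => a * u i + v i).
by rewrite mulr_sumr -big_split; apply: eq_bigr => i _; rewrite mulrDl mulrA.
Qed.

Lemma in_ideal_succ (p : 'I_c) x :
  in_ideal f (below p.+1) x <-> exists a, in_ideal f (below p) (x - a * f p).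
Proof.
have E (u : 'I_c -> A) : \sum_(i | below p.+1 i) u i * f i
    = u p * f p + \sum_(i | below p i) u i * f i.
  rewrite (bigD1 p) /=; last exact: ltnSn.
    congr +%R; apply: eq_bigl => i.
  by rewrite !belowE ltnS ltn_neqAle andbC -(inj_eq val_inj).
split=> [[u ->]|[a [u e]]].
  by exists (u p); rewrite E addrC addKr; exists u.
exists (fun i => if i == p then a else u i).
rewrite E eqxx -[LHS](subrK (a * f p)) e addrC; congr (_ + _).
by apply: eq_bigr => i; case: eqP => // ->; rewrite belowE ltnn.
Qed.

(** Adjoining one exterior variable: the second summand is [e_p X], one degree higher, and the signs
    come from moving the operators past [e_p]. *)
Definition ind_dgmx (X : dgmx A c) (p : 'I_c) : dgmx A c :=
  DgMx (catdeg (dg_deg X) (fun a => dg_deg X a + 1))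
    (block_mx (dg_d X) 0 (f p)%:M (- dg_d X))
    (fun i => if i == p then block_mx 0 1%:M 0 0
              else block_mx (dg_e X i) 0 0 (- dg_e X i)).

(** [X] is the sum of [s] copies of the Koszul complex on the first [p] elements, generated in
    degree [n]. The map [q] projects to the bottom modulo the ideal, [t] includes the top products
    of the [e_i], and [kc_t] says that the dual resolves the same module through [t]. The field
    [kc_univ] is freeness: an attaching map [z] on the bottom extends to [ph], anticommuting with
    the operators. The term with [psi] records that [ph] agrees with [q *m z] modulo images of the
    [e_i], which later augmentations kill. *)
Record kcell (p s : nat) (n : int) (X : dgmx A c) (q : 'M[A]_(dg_rk X, s))
    (t : 'M[A]_(s, dg_rk X)) : Prop := KCell {
  kc_laws : klaws f (below p) X;
  kc_e0 : forall i : 'I_c, (p <= i)%N -> dg_e X i = 0;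
  kc_hom : khom X;
  kc_pos : forall a, (n <= dg_deg X a)%R;
  kc_qhom : hommx (dg_deg X) (fun=> n) 0 q;
  kc_thom : hommx (fun=> n) (dg_deg X) p%:Z t;
  kc_q : resolves (dg_d X) q (in_ideal f (below p));
  kc_t : resolves (dg_d X)^T t^T (in_ideal f (below p));
  kc_eq : forall i, dg_e X i *m q = 0;
  kc_te : forall i, t *m dg_e X i = 0;
  kc_qt : q *m t = eprod (dg_e X) (ords c p);
  kc_univ : forall (Y : dgmx A c) (z : 'M[A]_(s, dg_rk Y)),
    klaws f predT Y -> khom Y -> z *m dg_d Y = 0 ->
    hommx (fun=> n) (dg_deg Y) (-1) z ->
    exists (ph : 'M[A]_(dg_rk X, dg_rk Y)) (psi : 'I_c -> 'M[A]_(dg_rk X, dg_rk Y)),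
      [/\ dg_d X *m ph = - (ph *m dg_d Y),
          forall i, below p i -> dg_e X i *m ph = - (ph *m dg_e Y i),
          ph = q *m z + \sum_i psi i *m dg_e Y i,
          t *m ph = (-1) ^+ p *: (z *m eprod (dg_e Y) (ords c p))
        & hommx (dg_deg X) (dg_deg Y) (-1) ph]
}.

Arguments kcell p s n X q t : clear implicits.

Lemma kcell0 s n : kcell 0 s n (DgMx (fun _ : 'I_s => n) 0 (fun=> 0)) 1%:M 1%:M.
Proof.
have eI x : in_ideal f (below 0) x -> x = 0.
  by move=> [a ->]; rewrite big_pred0.
have res : resolves (0 : 'M[A]_s) (1%:M : 'M_s) (in_ideal f (below 0)).
  split=> [a b|x _ h|].
  - by rewrite mul0mx mxE; apply: (in_ideal_idealp _).1.
  - exists 0; rewrite mul0mx; apply/rowP => b.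
    by have := h b; rewrite mulmx1 mxE => /eI.
  - by exists 1%:M; rewrite mulmx0 mulmx1.
split=> //=.
- by split=> [|i|i j|i]; rewrite ?mulmx0 ?mul0mx ?oppr0 ?addr0.
- by split=> [|i]; apply: hommx0.
- by move=> a b; rewrite addr0.
- by move=> a b; rewrite addr0.
- by rewrite trmx0 trmx1.
- by move=> i; rewrite mul0mx.
- by move=> i; rewrite mulmx0.
- by rewrite mulmx1 /ords (eq_filter (a2 := pred0)) // filter_pred0.
- move=> Y z _ _ zd zh; exists z, (fun=> 0); split=> //.
  + by rewrite mul0mx zd oppr0.
  + by rewrite mul1mx big1 ?addr0 // => i _; rewrite mul0mx.
  + by rewrite mul1mx expr0 scale1r /ords (eq_filter (a2 := pred0)) //
      filter_pred0 mulmx1.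
Qed.

Hypothesis reg : forall (i : 'I_c) (x : A),
  in_ideal f (below i) (f i * x) -> in_ideal f (below i) x.

Lemma block_mx00 m1 m2 n1 n2 :
  block_mx 0 0 0 0 = 0 :> 'M[A]_(m1 + m2, n1 + n2).
Proof. by rewrite /block_mx !row_mx0 col_mx0. Qed.

Lemma ind_klaws (p : 'I_c) X : klaws f (below p) X ->
  klaws f (below p.+1) (ind_dgmx X p).
Proof.
case=> dd ee eC de; split=> [|i|i j|i] /=.
- blk; rewrite dd; blk; by rewrite subrr block_mx00.
- case: eqP => _; blk; rewrite ?ee; by rewrite ?block_mx00.
- case: (eqVneq i p) => [_|ip]; case: (eqVneq j p) => [_|jp]; blk => //.
  by rewrite eC.
- case: (eqVneq i p) => [->|ip]; blk.
    by rewrite belowE ltnSn addrN -scalar_mx_block.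
  rewrite de addrN belowS (negbTE ip) /=.
  by case: ifP => _; rewrite -?scalar_mx_block ?block_mx00.
Qed.

Lemma ind_khom (p : 'I_c) X : khom X -> khom (ind_dgmx X p).
Proof.
move=> [dh eh]; split=> [|i] /=.
  apply: hommx_block; [done|exact: hommx0| |].
    by move=> a b /(@hommx1 _ _ (dg_deg X)) ->; ring.
  by move=> a b /(hommxN dh) ->; ring.
case: ifP => _; apply: hommx_block; rewrite //; try exact: hommx0.
  by move=> a b /(@hommx1 _ _ (dg_deg X)) ->; ring.
by move=> a b /(hommxN (eh i)) ->; ring.
Qed.

Lemma ords_succ (p : 'I_c) : ords c p.+1 = rcons (ords c p) p.
Proof. by rewrite (ordsS (ltn_ord p)); congr rcons; apply: val_inj. Qed.

Lemma ind_eprod (p : 'I_c) X r (q : 'M_(dg_rk X, r)) t :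
  q *m t = eprod (dg_e X) (ords c p) ->
  col_mx q 0 *m row_mx 0 t = eprod (dg_e (ind_dgmx X p)) (ords c p.+1).
Proof.
move=> qt; rewrite ords_succ eprod_rcons /= eqxx.
rewrite (eq_eprod (e' := fun i => block_mx (dg_e X i) 0 0 (- dg_e X i))); last first.
  by move=> i; rewrite mem_ords => ip; rewrite -(inj_eq val_inj) ltn_eqF.
by rewrite (eprod_block (dg_e X) (fun i => - dg_e X i)) mulmx_block mul_col_row; blk; rewrite qt.
Qed.

Lemma ind_univ (p : 'I_c) X s (q : 'M_(dg_rk X, s)) t Y (z : 'M_(s, dg_rk Y)) ph
    (psi : 'I_c -> 'M[A]_(dg_rk X, dg_rk Y)) :
  klaws f predT Y -> khom Y ->
  [/\ dg_d X *m ph = - (ph *m dg_d Y),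
      forall i, below p i -> dg_e X i *m ph = - (ph *m dg_e Y i),
      ph = q *m z + \sum_i psi i *m dg_e Y i,
      t *m ph = (-1) ^+ p *: (z *m eprod (dg_e Y) (ords c p))
    & hommx (dg_deg X) (dg_deg Y) (-1) ph] ->
  let X' := ind_dgmx X p in
  exists (ph : 'M[A]_(dg_rk X', dg_rk Y)) (psi : 'I_c -> 'M[A]_(dg_rk X', dg_rk Y)),
  [/\ dg_d X' *m ph = - (ph *m dg_d Y),
      forall i, below p.+1 i -> dg_e X' i *m ph = - (ph *m dg_e Y i),
      ph = col_mx q 0 *m z + \sum_i psi i *m dg_e Y i,
      row_mx 0 t *m ph = (-1) ^+ p.+1 *: (z *m eprod (dg_e Y) (ords c p.+1))
    & hommx (dg_deg X') (dg_deg Y) (-1) ph].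
Proof.
move=> [dY eY eYC deY] Yh [h1 h2 h3 h4 h5] X'.
(* The value on the second summand is forced by anticommutation with [e_p]. *)
exists (col_mx ph (- (ph *m dg_e Y p))).
exists (fun i => col_mx (psi i) (if i == p then - ph else 0)); split=> /=.
- blk; rewrite h1; congr col_mx; rewrite mulmxA h1 -mulmxA.
  rewrite -mul_mx_scalar.
  by move: (deY p) => /= <-; rewrite mulmxDr mulNmx !mulmxA addrAC addrN add0r.
- move=> i; rewrite belowS => /predU1P[->|ip].
    by rewrite eqxx; blk; rewrite -mulmxA eY mulmx0.
  rewrite -(inj_eq val_inj) ltn_eqF //; blk; rewrite h2 //; congr col_mx.
  by rewrite mulmxA h2 // mulNmx -!mulmxA [in LHS]eYC mulmxN opprK.
- rewrite mul_col_mx mul0mx.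
  have -> : \sum_i col_mx (psi i) (if i == p then - ph else 0) *m dg_e Y i
    = col_mx (\sum_i psi i *m dg_e Y i) (\sum_i (if i == p then - ph else 0) *m dg_e Y i).
    elim/big_rec3: _ => [|i x y w _ ->]; first by rewrite col_mx0.
    by rewrite mul_col_mx add_col_mx.
  rewrite add_col_mx -h3 add0r; congr col_mx.
  rewrite (bigD1 p) //= eqxx big1 ?addr0 ?mulNmx // => i /negbTE ->.
  by rewrite mul0mx.
- rewrite mul_row_col; blk; rewrite mulmxA h4 ords_succ eprod_rcons.
  by rewrite -scalemxAl exprS mulN1r scaleNr mulmxA.
- apply: hommx_col => //; have := hommxM h5 (Yh.2 p) => h a b.
  by rewrite mxE oppr_eq0 => /h ->; ring.
Qed.

Lemma kcellS (p : 'I_c) s n X q t : kcell p s n X q t ->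
  kcell p.+1 s n (ind_dgmx X p) (col_mx q 0) (row_mx 0 t).
Proof.
case=> Xl e0 Xh Xp qh th kq kt eq te qt univ.
have [dd _ _ _] := Xl.
have ep0 : dg_e X p = 0 by apply: e0.
split.
- exact: ind_klaws.
- move=> i pi /=; rewrite e0 ?(ltnW pi) // oppr0 -(inj_eq val_inj) gtn_eqF //.
  by rewrite block_mx00.
- exact: ind_khom.
- move=> a; rewrite /= /catdeg; case: fintype.split => i //.
  by rewrite (le_trans (Xp i)) // lerDl.
- by apply: hommx_col; last exact: hommx0.
- apply: hommx_row; first exact: hommx0.
  by move=> a b /th ->; rewrite -addn1 PoszD; ring.
- apply: (resolves_ind (in_ideal_idealp _) (in_ideal_succ p)) => //; exact: reg.
- rewrite /= tr_block_mx tr_row_mx !trmx0 tr_scalar_mx linearN /=.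
  apply: (resolves_coind (in_ideal_idealp _) (in_ideal_succ p)) => //.
    exact: reg.
  by rewrite -trmx_mul dd trmx0.
- by move=> i /=; case: eqP => _; blk; rewrite ?eq col_mx0.
- by move=> i /=; case: eqP => _; blk; rewrite ?te ?oppr0 row_mx0.
- exact: ind_eprod.
- move=> Y z Yl Yh zd zh; have [ph [psi h]] := univ Y z Yl Yh zd zh.
  exact: (ind_univ Yl Yh h).
Qed.

Lemma kcell_ex s n : exists X q t, kcell c s n X q t.
Proof.
have : forall p, (p <= c)%N -> exists X q t, kcell p s n X q t.
  elim=> [_|p IH pc]; first by do 3 eexists; apply: kcell0.
  have [X [q [t h]]] := IH (ltnW pc).
  by do 3 eexists; apply: (@kcellS (Ordinal pc)); apply: h.
by apply.
Qed.

End KCell.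
Arguments kcell {A c} f p s n X q t : rename.

(** * The five lemma for mapping cones *)

Section FiveLemma.
Variables (X1 X2 Y1 Y2 : zmodType).
Variables (d1 : {additive X1 -> X1}) (d2 : {additive X2 -> X2}).
Variables (ph : {additive X2 -> X1}) (D1 : {additive Y1 -> Y1}).
Variables (D2 : {additive Y2 -> Y2}) (u : {additive Y2 -> Y1}).
Variables (q1 : {additive X1 -> Y1}) (q2 : {additive X2 -> Y2}).
Hypothesis q1d : forall x, q1 (d1 x) = D1 (q1 x).
Hypothesis q2d : forall x, q2 (d2 x) = D2 (q2 x).
Hypothesis q1ph : forall x, q1 (ph x) = u (q2 x).
Hypothesis D1u : forall y, D1 (u y) = - u (D2 y).
Hypothesis d1ph : forall x, d1 (ph x) = - ph (d2 x).
Hypothesis inj1 : forall x, d1 x = 0 -> forall y, q1 x = D1 y -> exists w, x = d1 w.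
Hypothesis inj2 : forall x, d2 x = 0 -> forall y, q2 x = D2 y -> exists w, x = d2 w.
Hypothesis surj1 : forall y, D1 y = 0 ->
  exists x, d1 x = 0 /\ exists w, q1 x = y + D1 w.
Hypothesis surj2 : forall y, D2 y = 0 ->
  exists x, d2 x = 0 /\ exists w, q2 x = y + D2 w.

(** [v] bounds [x2], but its value differs from [y2] by a class which need not vanish; the cycle
    [z2] represents that class, and after correction by it the rest of [x1] falls under [inj1]. *)
Lemma five_inj x1 x2 : d1 x1 + ph x2 = 0 -> d2 x2 = 0 -> forall y1 y2,
  q1 x1 = D1 y1 + u y2 -> q2 x2 = D2 y2 ->
  exists w1 w2, x1 = d1 w1 + ph w2 /\ x2 = d2 w2.
Proof.
move=> e1 e2 y1 y2 f1 f2; have [v vP] := inj2 e2 f2.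
have [|z2 [z2c [w wP]]] := @surj2 (y2 - q2 v).
  by rewrite raddfB -f2 vP q2d subrr.
have [||w1 w1P] := @inj1 (x1 - ph v - ph z2) _ (y1 + u w).
- rewrite !raddfB /= !d1ph z2c raddf0 oppr0 subr0 -vP opprK.
  exact: e1.
- rewrite !raddfB /= !q1ph wP f1 raddfD raddfB raddfD /= D1u.
  by rewrite opprD opprB addrA addrA subrK addrK.
exists w1, (v + z2); split; last by rewrite raddfD /= z2c addr0.
by rewrite -w1P raddfD addrA addrAC subrK subrK.
Qed.

(** A cycle [x2] lifting [y2] is completed in the first summand once [ph x2] bounds, which [inj1]
    gives since its image bounds; [surj1] then adjusts the class there. *)
Lemma five_surj y1 y2 : D1 y1 + u y2 = 0 -> D2 y2 = 0 ->
  exists x1 x2, [/\ d1 x1 + ph x2 = 0, d2 x2 = 0 & exists w1 w2,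
    q1 x1 = y1 + (D1 w1 + u w2) /\ q2 x2 = y2 + D2 w2].
Proof.
move=> e1 e2; have [x2 [x2c [w2 w2P]]] := surj2 e2.
have q1x : q1 (ph x2) = D1 (- y1 - u w2).
  rewrite q1ph w2P raddfD raddfB raddfN /= D1u opprK; congr (_ + _).
  by apply/eqP; rewrite -addr_eq0 addrC e1.
have [|v vP] := @inj1 (ph x2) _ _ q1x.
  by rewrite d1ph x2c raddf0 oppr0.
have [|z [zc [w1 w1P]]] := @surj1 (y1 + q1 v + u w2).
  rewrite !raddfD /= -q1d -vP q1x raddfB raddfN /=.
  by rewrite addrA addrN sub0r addNr.
exists (z - v), x2; split=> //.
  by rewrite raddfB zc sub0r vP addNr.
exists w1, w2; split=> //; rewrite raddfB w1P.
rewrite -!addrA; congr (_ + _).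
by rewrite addrC -!addrA addNr addr0 addrC.
Qed.
End FiveLemma.

Section Qiso.
Variables (A B : comNzRingType) (phi : {rmorphism A -> B}).

(** The comparison map sends a row over [A] to its image under [phi] times [q]; the two clauses are
    injectivity and surjectivity on homology. *)
Definition qiso r g (d : 'M[A]_r) (D : 'M[B]_g) (q : 'M[B]_(r, g)) : Prop :=
  (forall x : 'rV_r, x *m d = 0 -> forall y, map_mx phi x *m q = y *m D ->
     exists w, x = w *m d) /\
  (forall y : 'rV_g, y *m D = 0 -> exists x, x *m d = 0 /\
     exists w, map_mx phi x *m q = y + w *m D).

Section Block.
Variables (r1 r2 g1 g2 : nat).
Variables (d1 : 'M[A]_r1) (d2 : 'M[A]_r2) (ph : 'M[A]_(r2, r1)).
Variables (D1 : 'M[B]_g1) (D2 : 'M[B]_g2) (u : 'M[B]_(g2, g1)).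
Variables (q1 : 'M[B]_(r1, g1)) (q2 : 'M[B]_(r2, g2)).
Hypothesis q1d : map_mx phi d1 *m q1 = q1 *m D1.
Hypothesis q2d : map_mx phi d2 *m q2 = q2 *m D2.
Hypothesis q1ph : map_mx phi ph *m q1 = q2 *m u.
Hypothesis D1u : u *m D1 = - (D2 *m u).
Hypothesis d1ph : ph *m d1 = - (d2 *m ph).
Hypothesis k1 : qiso d1 D1 q1.
Hypothesis k2 : qiso d2 D2 q2.

Let qf r g (q : 'M[B]_(r, g)) : {additive 'rV[A]_r -> 'rV[B]_g} :=
  mulmxr q \o map_mx phi.
Let mf (R : comNzRingType) m n (M : 'M[R]_(m, n)) :
  {additive 'rV[R]_m -> 'rV[R]_n} := mulmxr M.

Lemma qiso_lblock :
  qiso (block_mx d1 0 ph d2) (block_mx D1 0 u D2) (block_mx q1 0 0 q2).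
Proof.
have [i1 s1] := k1; have [i2 s2] := k2.
have A1 x : qf q1 (mf d1 x) = mf D1 (qf q1 x).
  by rewrite /= map_mxM -!mulmxA q1d.
have A2 x : qf q2 (mf d2 x) = mf D2 (qf q2 x).
  by rewrite /= map_mxM -!mulmxA q2d.
have A3 x : qf q1 (mf ph x) = mf u (qf q2 x).
  by rewrite /= map_mxM -!mulmxA q1ph.
have A4 y : mf D1 (mf u y) = - mf u (mf D2 y).
  by rewrite /= -!mulmxA D1u mulmxN.
have A5 x : mf d1 (mf ph x) = - mf ph (mf d2 x).
  by rewrite /= -!mulmxA d1ph mulmxN.
split=> x; rewrite -[x]hsubmxK; move: (lsubmx x) (rsubmx x) => x1 x2 {x}.
  rewrite mul_row_block mulmx0 add0r -(row_mx0 _ 1 r1 r2) => /eq_row_mx[e1 e2] y.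
  rewrite -[y]hsubmxK; move: (lsubmx y) (rsubmx y) => y1 y2 {y}.
  rewrite map_row_mx !mul_row_block !mulmx0 addr0 !add0r => /eq_row_mx[h1 h2].
  have [w1 [w2 [-> ->]]] := five_inj A2 A3 A4 A5 i1 i2 s2 e1 e2 h1 h2.
  by exists (row_mx w1 w2); rewrite mul_row_block mulmx0 add0r.
rewrite mul_row_block mulmx0 add0r -(row_mx0 _ 1 g1 g2) => /eq_row_mx[e1 e2].
have [y1 [y2 [h1 h2 [w1 [w2 [h3 h4]]]]]] := five_surj A1 A3 A4 A5 i1 s1 s2 e1 e2.
exists (row_mx y1 y2); rewrite mul_row_block mulmx0 add0r; split.
  by rewrite -(row_mx0 _ 1 r1 r2); congr row_mx.
exists (row_mx w1 w2); rewrite map_row_mx !mul_row_block !mulmx0 addr0 !add0r.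
by rewrite add_row_mx; congr row_mx.
Qed.
End Block.

Section Block'.
Variables (r1 r2 g1 g2 : nat).
Variables (d1 : 'M[A]_r1) (d2 : 'M[A]_r2) (ph : 'M[A]_(r1, r2)).
Variables (D1 : 'M[B]_g1) (D2 : 'M[B]_g2) (u : 'M[B]_(g1, g2)).
Variables (q1 : 'M[B]_(r1, g1)) (q2 : 'M[B]_(r2, g2)).
Hypothesis q1d : map_mx phi d1 *m q1 = q1 *m D1.
Hypothesis q2d : map_mx phi d2 *m q2 = q2 *m D2.
Hypothesis q1ph : map_mx phi ph *m q2 = q1 *m u.
Hypothesis D1u : u *m D2 = - (D1 *m u).
Hypothesis d1ph : ph *m d2 = - (d1 *m ph).
Hypothesis k1 : qiso d1 D1 q1.
Hypothesis k2 : qiso d2 D2 q2.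

(** Duals of mapping cones have this transposed shape; exchanging the two summands reduces it to
    [qiso_lblock]. *)
Lemma qiso_ublock :
  qiso (block_mx d1 ph 0 d2) (block_mx D1 u 0 D2) (block_mx q1 0 0 q2).
Proof.
have [hi hs] := qiso_lblock q2d q1d q1ph D1u d1ph k2 k1.
split=> x; rewrite -[x]hsubmxK; move: (lsubmx x) (rsubmx x) => x1 x2 {x}.
  rewrite mul_row_block mulmx0 addr0 -(row_mx0 _ 1 r1 r2) => /eq_row_mx[e1 e2] y.
  rewrite -[y]hsubmxK; move: (lsubmx y) (rsubmx y) => y1 y2 {y}.
  rewrite map_row_mx !mul_row_block !mulmx0 !addr0 !add0r => /eq_row_mx[h1 h2].
  have [||w] := hi (row_mx x2 x1) _ (row_mx y2 y1).
  - by rewrite mul_row_block mulmx0 add0r -(row_mx0 _ 1 r2 r1) addrC e2 e1.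
  - rewrite map_row_mx !mul_row_block !mulmx0 addr0 !add0r h1 h2.
    by rewrite [y2 *m _ + _]addrC.
  rewrite -[w]hsubmxK mul_row_block mulmx0 add0r => /eq_row_mx[-> ->].
  exists (row_mx (rsubmx w) (lsubmx w)).
  by rewrite mul_row_block mulmx0 addr0 [lsubmx w *m _ + _]addrC.
rewrite mul_row_block mulmx0 addr0 -(row_mx0 _ 1 g1 g2) => /eq_row_mx[e1 e2].
have [|x [xc [w wP]]] := hs (row_mx x2 x1).
  by rewrite mul_row_block mulmx0 add0r -(row_mx0 _ 1 g2 g1) addrC e2 e1.
exists (row_mx (rsubmx x) (lsubmx x)).
move: xc wP; rewrite -[x]hsubmxK -[w]hsubmxK !row_mxKl !row_mxKr.
rewrite map_row_mx !mul_row_block !mulmx0 addr0 !add0r add_row_mx.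
rewrite -(row_mx0 _ 1 r2 r1) => /eq_row_mx[h1 h2] /eq_row_mx[h3 h4].
rewrite h2 addr0 [X in row_mx _ X]addrC h1 row_mx0; split=> //.
exists (row_mx (rsubmx w) (lsubmx w)).
rewrite map_row_mx !mul_row_block !mulmx0 !addr0 !add0r add_row_mx h3 h4.
by rewrite [lsubmx w *m _ + _]addrC.
Qed.
End Block'.

End Qiso.

(** * Attaching Koszul cells along a truncated free resolution *)

Section TruncatedResolution.
Variables (A B : comNzRingType) (phi : {rmorphism A -> B}).
Variables (c : nat) (f : 'I_c -> A) (M : lmodType B) (G : free_resolution M).
Hypothesis phi_surj : surjective phi.
Hypothesis f_regular : regular_sequence f.
Hypothesis ker_phi : forall a : A, phi a = 0 <-> in_ideal f predT a.

Lemma ker_phi_below a : phi a = 0 <-> in_ideal f (below c) a.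
Proof.
rewrite ker_phi; split=> -[u ->]; exists u; apply: eq_bigl => i;
  by rewrite belowE ltn_ord.
Qed.

Lemma map_surj m n (y : 'M[B]_(m, n)) : exists x, map_mx phi x = y.
Proof.
have /choice[g gP] (p : 'I_m * 'I_n) : exists a, phi a = y p.1 p.2.
  exact: phi_surj.
exists (\matrix_(i, j) g (i, j)); apply/matrixP => i j.
by rewrite !mxE gP.
Qed.

Lemma resolves_qiso r s (d : 'M[A]_r) (q : 'M[A]_(r, s)) :
  resolves d q (in_ideal f (below c)) -> qiso phi d 0 (map_mx phi q).
Proof.
move=> [h1 h2 [sg [h3 h4]]]; split.
  move=> x xd y; rewrite mulmx0 => e; apply: h2 => // b; apply/ker_phi_below.
  by move/rowP/(_ b): e; rewrite -map_mxM !mxE.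
move=> y _; have [x <-] := map_surj y; exists (x *m sg).
split; first by rewrite -mulmxA h3 mulmx0.
by exists 0; rewrite -map_mxM -mulmxA h4 mulmx1 mul0mx addr0.
Qed.

Lemma resolves_map0 r s (d : 'M[A]_r) (q : 'M[A]_(r, s)) :
  resolves d q (in_ideal f (below c)) -> map_mx phi d *m map_mx phi q = 0.
Proof.
move=> [h1 _ _]; apply/matrixP => a b; rewrite -map_mxM !mxE.
by apply/ker_phi_below; have := h1 a b; rewrite mxE.
Qed.

Lemma fr_mx_mx n : fr_mx G n.+1 *m fr_mx G n = 0.
Proof.
apply/row_matrixP => i; rewrite row0 row_mul.
by apply/fr_exact; exists (delta_mx 0 i); rewrite rowE.
Qed.

(** The resolution up to degree [n] is packed into one free module of rank [gt n], with total
    differential [gD n]; [ulast n] is the differential leaving [G_(n+1)], along which the next cells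
    are attached. *)
Fixpoint gt (n : nat) : nat :=
  if n is m.+1 then (gt m + fr_rank G m.+1)%N else fr_rank G 0.

Fixpoint gdeg (n : nat) : 'I_(gt n) -> int :=
  if n is m.+1 return 'I_(gt n) -> int
  then catdeg (@gdeg m) (fun=> m.+1%:Z) else fun=> 0.

Definition ulast (n : nat) : 'M[B]_(fr_rank G n.+1, gt n) :=
  match n return 'M[B]_(fr_rank G n.+1, gt n) with
  | 0 => fr_mx G 0
  | m.+1 => row_mx 0 (fr_mx G m.+1)
  end.

Fixpoint gD (n : nat) : 'M[B]_(gt n) :=
  if n is m.+1 return 'M[B]_(gt n)
  then block_mx (gD m) 0 (ulast m) 0 else 0.

Lemma ulast_gD n : ulast n *m gD n = 0.
Proof.
case: n => [|n] /=; first by rewrite mulmx0.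
rewrite mul_row_block !mulmx0 mul0mx !add0r.
suff -> : fr_mx G n.+1 *m ulast n = 0 by rewrite row_mx0.
case: n => [|n] /=; first exact: fr_mx_mx.
by rewrite mul_mx_row mulmx0 fr_mx_mx row_mx0.
Qed.

Lemma ulast_hom n : hommx (fun=> n.+1%:Z) (@gdeg n) (-1) (ulast n).
Proof.
case: n => [|n] /=; first by move=> a b _.
apply: hommx_row; first exact: hommx0.
by move=> a b _; lia.
Qed.

Lemma gD_hom n : hommx (@gdeg n) (@gdeg n) (-1) (gD n).
Proof.
elim: n => [|n IH] /=; first exact: hommx0.
apply: hommx_block; rewrite //; try exact: hommx0.
exact: ulast_hom.
Qed.

(* Through degree [n] of the resolution, [X] has been built by attaching cells; [q] maps
   it onto the truncated resolution, and the transpose of [t] exhibits the dual of [X]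
   as its dual, shifted by [c]. *)
Record approx (n : nat) (X : dgmx A c) (q : 'M[B]_(dg_rk X, gt n))
    (t : 'M[B]_(gt n, dg_rk X)) : Prop := Approx {
  ap_laws : klaws f predT X;
  ap_hom : khom X;
  ap_pos : forall a, 0 <= dg_deg X a;
  ap_qhom : hommx (dg_deg X) (@gdeg n) 0 q;
  ap_thom : hommx (@gdeg n) (dg_deg X) c%:Z t;
  ap_qd : map_mx phi (dg_d X) *m q = q *m gD n;
  ap_td : t *m map_mx phi (dg_d X) = ((-1) ^+ c *: gD n) *m t;
  ap_qe : forall i, map_mx phi (dg_e X i) *m q = 0;
  ap_te : forall i, t *m map_mx phi (dg_e X i) = 0;
  ap_qt : q *m t = map_mx phi (eprod (dg_e X) (enum 'I_c));
  ap_qsurj : forall m (y : 'M_(m, gt n)), exists x, map_mx phi x *m q = y;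
  ap_q : qiso phi (dg_d X) (gD n) q;
  ap_t : qiso phi (dg_d X)^T ((-1) ^+ c *: gD n)^T t^T
}.
Arguments approx n X q t : clear implicits.

Lemma kcell_laws s n X q t : kcell f c s n X q t -> klaws f predT X.
Proof.
case=> -[h1 h2 h3 h4] *; split=> // i.
by have := h4 i; rewrite belowE ltn_ord.
Qed.

Lemma kcell_qsurj s n X q t : kcell f c s n X q t ->
  forall m (y : 'M_(m, s)), exists x, map_mx phi x *m map_mx phi q = y.
Proof.
move=> h m y; have [_ _ [sg [_ h4]]] := kc_q h; have [x <-] := map_surj y.
by exists (x *m sg); rewrite -map_mxM -mulmxA h4 mulmx1.
Qed.

Lemma approx0 s X q t : s = fr_rank G 0 -> kcell f c s 0 X q t ->
  exists q t, approx 0 X q t.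
Proof.
move=> e; subst s => h; exists (map_mx phi q), (map_mx phi t).
have ht := kc_t h.
split=> /=.
- exact: kcell_laws h.
- exact: kc_hom h.
- exact: kc_pos h.
- by apply: hommx_map; apply: kc_qhom h.
- by apply: hommx_map; apply: kc_thom h.
- by rewrite mulmx0; apply: resolves_map0; apply: kc_q h.
- rewrite scaler0 mul0mx -[LHS]trmxK trmx_mul !map_trmx.
  by rewrite resolves_map0 ?trmx0.
- by move=> i; rewrite -map_mxM (kc_eq h) map_mx0.
- by move=> i; rewrite -map_mxM (kc_te h) map_mx0.
- by rewrite -map_mxM (kc_qt h) ords_c.
- by move=> m y; apply: kcell_qsurj h _ _.
- by apply: resolves_qiso; apply: kc_q h.
- by rewrite scaler0 trmx0 map_trmx; apply: resolves_qiso.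
Qed.

(** The attaching map. Surjectivity of [q] on homology lifts each row of [ulast] only up to a
    boundary; surjectivity of [q] on elements removes this boundary, and projection to degree [n]
    makes the lift homogeneous. *)
Lemma approx_cycles n X q t : approx n X q t ->
  exists z : 'M[A]_(fr_rank G n.+1, dg_rk X),
  [/\ z *m dg_d X = 0, map_mx phi z *m q = ulast n
    & hommx (fun=> n.+1%:Z) (dg_deg X) (-1) z].
Proof.
move=> h; have [_ hs] := ap_q h; have [dh _] := ap_hom h.
have [dd _ _ _] := ap_laws h.
have /choice[z zP] i : exists x : 'rV[A]_(dg_rk X),
    [/\ x *m dg_d X = 0, map_mx phi x *m q = row i (ulast n)
      & x *m degpr A (dg_deg X) n%:Z = x].
  have [|x [xd [w e]]] := hs (row i (ulast n)).
    by rewrite -row_mul ulast_gD row0.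
  have [y yP] := ap_qsurj h w; rewrite -yP in e.
  exists ((x - y *m dg_d X) *m degpr A (dg_deg X) n%:Z); split.
  - have := hommx_degpr (n%:Z) dh; rewrite -mulmxA => ->.
    by rewrite mulmxA mulmxBl xd -mulmxA dd mulmx0 subrr mul0mx.
  - rewrite map_mxM map_degpr -mulmxA (hommx_degpr _ (ap_qhom h)) mulmxA addr0.
    rewrite map_mxB map_mxM mulmxBl e -[_ *m q in X in _ - X]mulmxA (ap_qd h) mulmxA.
    rewrite addrK; apply/rowP => j; rewrite mul_degpr mxE.
    have [->|/ulast_hom ->] := eqVneq (ulast n i j) 0; first by rewrite if_same.
    by case: eqP => // ne; exfalso; apply: ne; lia.
  - by rewrite -mulmxA degpr_degpr eqxx.
exists (\matrix_i z i); split.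
- by apply/row_matrixP => i; rewrite row_mul rowK row0; case: (zP i).
- apply/row_matrixP => i; rewrite row_mul -map_row rowK; by case: (zP i).
- move=> i b; rewrite mxE => ne; have [_ _ e] := zP i.
  by move: ne; rewrite -e mul_degpr; have [-> _|_] := eqVneq (dg_deg X b) n%:Z; [lia|rewrite eqxx].
Qed.

Lemma scale_block m1 m2 n1 n2 (R : pzRingType) (a : R) (Aul : 'M_(m1, n1))
    (Aur : 'M_(m1, n2)) (Adl : 'M_(m2, n1)) (Adr : 'M_(m2, n2)) :
  a *: block_mx Aul Aur Adl Adr
  = block_mx (a *: Aul) (a *: Aur) (a *: Adl) (a *: Adr).
Proof. by rewrite scale_block_mx. Qed.

(** The new module is the mapping cone of [ph], and the maps [q] and [t] become block diagonal. The
    block forms of the five lemma apply to the cone and to its transpose. *)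
Lemma approxS n X q t XK qK tK : approx n X q t ->
  kcell f c (fr_rank G n.+1) n.+1%:Z XK qK tK ->
  exists X' q' t', approx n.+1 X' q' t'.
Proof.
move=> h hK; have [z [zd zq zh]] := approx_cycles h.
have Xl := ap_laws h; have [dd ee eC de] := Xl.
have [dK eK eKC deK] := kcell_laws hK.
have [ph [psi [h1 h2 h3 h4 h5]]] := kc_univ hK Xl (ap_hom h) zd zh.
have {}h2 i : dg_e XK i *m ph = - (ph *m dg_e X i).
  by apply: h2; rewrite belowE.
rewrite ords_c in h4.
(* The terms with [psi] end in some [e_i], and [q] kills these. *)
have phq : map_mx phi ph *m q = map_mx phi qK *m ulast n.
  rewrite h3 map_mxD mulmxDl map_mxM -mulmxA zq -[RHS]addr0; congr (_ + _).
  rewrite map_mx_sum mulmx_suml big1 // => i _.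
  by rewrite map_mxM -mulmxA (ap_qe h) mulmx0.
(* On the top products [ph] is the attaching map followed by the full product of the [e_i], which is
   [q *m t]; the sign from [kc_univ] is the reason for [(-1) ^+ c] in [ap_td]. *)
have tKph : map_mx phi tK *m map_mx phi ph = ((-1) ^+ c *: ulast n) *m t.
  rewrite -map_mxM h4 map_mxZ map_mxM rmorphXn rmorphN1 -(ap_qt h) mulmxA zq.
  by rewrite -scalemxAl.
have [dh eh] := ap_hom h; have [dKh eKh] := kc_hom hK.
exists (DgMx (catdeg (dg_deg X) (dg_deg XK))
  (block_mx (dg_d X) 0 ph (dg_d XK))
  (fun i => block_mx (dg_e X i) 0 0 (dg_e XK i))).
exists (block_mx q 0 0 (map_mx phi qK)), (block_mx t 0 0 (map_mx phi tK)).
have DK0 : map_mx phi (dg_d XK) *m map_mx phi qK = 0.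
  by apply: resolves_map0; apply: kc_q hK.
have KD0 : map_mx phi tK *m map_mx phi (dg_d XK) = 0.
  rewrite -[LHS]trmxK trmx_mul !map_trmx resolves_map0 ?trmx0 //.
  exact: kc_t hK.
split=> /=.
- split=> /= [|i|i j|i]; blk.
  + by rewrite dd dK h1 addrN block_mx00.
  + by rewrite ee eK block_mx00.
  + by rewrite eC eKC.
  + by rewrite de deK h2 addrN -scalar_mx_block.
- split=> /= [|i]; apply: hommx_block; rewrite //; exact: hommx0.
- move=> a; rewrite /catdeg; case: fintype.split => i; first exact: ap_pos h _.
  by apply: le_trans (kc_pos hK i).
- apply: hommx_block; try exact: hommx0; first exact: ap_qhom h.
  by apply: hommx_map; apply: kc_qhom hK.
- apply: hommx_block; try exact: hommx0; first exact: ap_thom h.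
  by apply: hommx_map; apply: kc_thom hK.
- by rewrite map_block_mx !map_mx0; blk; rewrite (ap_qd h) phq DK0.
- rewrite map_block_mx !map_mx0 scale_block !scaler0; blk.
  by rewrite (ap_td h) tKph KD0.
- move=> i; rewrite map_block_mx !map_mx0; blk.
  by rewrite (ap_qe h) -map_mxM (kc_eq hK) map_mx0 block_mx00.
- move=> i; rewrite map_block_mx !map_mx0; blk.
  by rewrite (ap_te h) -map_mxM (kc_te hK) map_mx0 block_mx00.
- rewrite eprod_block map_block_mx map_mx0; blk.
  by rewrite (ap_qt h) -map_mxM (kc_qt hK) ords_c map_mx0.
- move=> m y; have [x1 e1] := ap_qsurj h (lsubmx y).
  have [x2 e2] := kcell_qsurj hK (rsubmx y).
  exists (row_mx x1 x2); rewrite map_row_mx mul_row_block !mulmx0 addr0 add0r e1 e2.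
  exact: hsubmxK.
- apply: qiso_lblock => //.
  + exact: ap_qd h.
  + by rewrite mulmx0.
  + by rewrite ulast_gD mul0mx oppr0.
  + by rewrite h1 opprK.
  + exact: ap_q h.
  + by apply: resolves_qiso; apply: kc_q hK.
- rewrite scale_block !scaler0 !tr_block_mx !trmx0.
  apply: qiso_ublock.
  + by rewrite -map_trmx -!trmx_mul (ap_td h).
  + by rewrite mulmx0 -map_trmx -trmx_mul KD0 trmx0.
  + by rewrite -!map_trmx -!trmx_mul tKph.
  + by rewrite mulmx0 -trmx_mul -scalemxAl -scalemxAr ulast_gD !scaler0 trmx0 oppr0.
  + by rewrite -!trmx_mul h1 linearN.
  + exact: ap_t h.
  + by rewrite map_trmx; apply: resolves_qiso; apply: kc_t hK.
Qed.

Lemma approx_ex n : exists X q t, approx n X q t.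
Proof.
elim: n => [|n [X [q [t h]]]].
  have [X [q [t h]]] := kcell_ex f_regular.1 (fr_rank G 0) 0.
  by have [q' [t' h']] := approx0 erefl h; exists X, q', t'.
have [XK [qK [tK hK]]] := kcell_ex f_regular.1 (fr_rank G n.+1) n.+1%:Z.
exact: approxS h hK.
Qed.

End TruncatedResolution.
Arguments approx {A B} phi {c} f {M} {G} n X q t : rename.

Section Components.
Variables (B : comNzRingType) (M : lmodType B) (G : free_resolution M).

Fixpoint gproj (n j : nat) : 'M[B]_(gt G n, fr_rank G j) :=
  if n is m.+1 return 'M[B]_(gt G n, fr_rank G j)
  then col_mx (gproj m j) (if j == m.+1 then pid_mx (fr_rank G j) else 0)
  else if j == 0%N then pid_mx (fr_rank G j) else 0.

Lemma gproj_big n j : (n < j)%N -> gproj n j = 0.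
Proof.
elim: n j => [|n IH] [|j] //= nj.
by rewrite IH 1?ltnW // gtn_eqF // col_mx0.
Qed.

Lemma gproj_hom n j : hommx (@gdeg _ _ G n) (fun=> j%:Z) 0 (gproj n j).
Proof.
elim: n j => [|n IH] j /=.
  by case: eqP => [->|_] a b //; rewrite mxE eqxx.
apply: hommx_col => //; case: eqP => [->|_]; last exact: hommx0.
by move=> a b _; rewrite addr0.
Qed.

Lemma gprojK n j : (j <= n)%N -> (gproj n j)^T *m gproj n j = 1%:M.
Proof.
elim: n j => [|n IH] j /=.
  by rewrite leqn0 => /eqP ->; rewrite eqxx pid_mx_1 trmx1 mulmx1.
rewrite leq_eqVlt => /predU1P[->|jn].
  rewrite eqxx gproj_big // pid_mx_1 tr_col_mx trmx0 trmx1.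
  by rewrite mul_row_col mulmx0 mulmx1 add0r.
by rewrite ltn_eqF // tr_col_mx trmx0 mul_row_col mulmx0 addr0 IH.
Qed.

Lemma gproj_degpr n (j : nat) :
  degpr B (@gdeg _ _ G n) j%:Z = gproj n j *m (gproj n j)^T.
Proof.
elim: n j => [|n IH] j /=.
  case: (eqVneq j 0%N) => [->|j0].
    rewrite pid_mx_1 trmx1 mulmx1; apply/matrixP => a b; rewrite !mxE eqxx.
    by [].
  rewrite mul0mx; apply/matrixP => a b; rewrite !mxE.
  by rewrite eqz_nat eq_sym (negbTE j0) mul0rn.
have -> : degpr B (catdeg (@gdeg _ _ G n) (fun=> n.+1%:Z)) j
    = block_mx (degpr B (@gdeg _ _ G n) j) 0 0
        (degpr B (fun _ : 'I_(fr_rank G n.+1) => n.+1%:Z) j).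
  rewrite /degpr -diag_mx_row; congr diag_mx; apply/rowP => a.
  rewrite !mxE /catdeg; by case: fintype.split => i; rewrite !mxE.
rewrite IH tr_col_mx mul_col_row; case: (eqVneq j n.+1) => [->|jn].
  rewrite gproj_big // trmx0 !mul0mx mulmx0 pid_mx_1 trmx1 mulmx1.
  congr block_mx; apply/matrixP => a b; rewrite !mxE eqxx //.
rewrite trmx0 !mulmx0 mul0mx; congr block_mx; apply/matrixP => a b; rewrite !mxE.
by rewrite eqz_nat eq_sym (negbTE jn) mul0rn.
Qed.

Lemma gD_gproj n j : gD G n *m gproj n j = gproj n j.+1 *m fr_mx G j.
Proof.
elim: n j => [|n IH] j /=; first by rewrite !mul0mx.
rewrite mul_block_col !mul0mx !addr0 mul_col_mx IH; congr col_mx.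
rewrite eqSS; case: (eqVneq j n) => [->|jn].
  rewrite pid_mx_1 mul1mx; case: n {IH} => [|n] /=.
    by rewrite pid_mx_1 mulmx1.
  by rewrite mul_row_col mul0mx add0r eqxx pid_mx_1 mulmx1.
rewrite mul0mx; case: n jn {IH} => [|n] /= jn; first by rewrite (negbTE jn) mulmx0.
by rewrite mul_row_col mul0mx add0r (negbTE jn) mulmx0.
Qed.

Lemma gprojT_gD n j : (j < n)%N ->
  (gproj n j.+1)^T *m gD G n = fr_mx G j *m (gproj n j)^T.
Proof.
move=> jn; have h : hommx (fun=> j.+1%:Z) (@gdeg _ _ G n) (-1) ((gproj n j.+1)^T *m gD G n).
  rewrite -[-1]add0r; apply: hommxM (@gD_hom _ _ G n).
  by rewrite -[0]oppr0; apply: hommx_tr; apply: gproj_hom.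
have <- : (gproj n j.+1)^T *m gD G n *m degpr B (@gdeg _ _ G n) j%:Z
  = (gproj n j.+1)^T *m gD G n.
  apply/matrixP => a b; rewrite mul_degpr.
  have [->|/h ->] := eqVneq (((gproj n j.+1)^T *m gD G n) a b) 0.
    by rewrite if_same.
  by case: eqP => // ne; exfalso; apply: ne; lia.
rewrite gproj_degpr mulmxA -[_ *m _ *m gproj n j]mulmxA gD_gproj mulmxA.
by rewrite gprojK // mul1mx.
Qed.

Lemma gprojT0_gD n : (gproj n 0)^T *m gD G n = 0.
Proof.
apply/matrixP => a b; rewrite [RHS]mxE; apply: contraTeq isT => ne.
have h : hommx (fun=> 0) (@gdeg _ _ G n) (-1) ((gproj n 0)^T *m gD G n).
  rewrite -[-1]add0r; apply: hommxM (@gD_hom _ _ G n).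
  by rewrite -[0]oppr0; apply: hommx_tr; apply: gproj_hom.
have := h a b ne; have : 0 <= @gdeg _ _ G n b.
  elim: n b {a ne h} => [|n IH] b //=; rewrite /catdeg.
  by case: fintype.split.
by move=> h1 h2; exfalso; lia.
Qed.
End Components.

Section ApproxFacts.
Variables (A B : comNzRingType) (phi : {rmorphism A -> B}).
Variables (c : nat) (f : 'I_c -> A) (M : lmodType B) (G : free_resolution M).
Hypothesis phi_surj : surjective phi.
Variables (n : nat) (X : dgmx A c) (q : 'M[B]_(dg_rk X, gt G n))
  (t : 'M[B]_(gt G n, dg_rk X)).
Hypothesis h : approx phi f n X q t.

Definition ap_aug (x : 'rV[A]_(dg_rk X)) : M :=
  fr_aug G (map_mx phi x *m q *m gproj G n 0).

Lemma ap_aug_linear a x y : ap_aug (a *: x + y) = phi a *: ap_aug x + ap_aug y.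
Proof. by rewrite /ap_aug map_mxD map_mxZ !mulmxDl -!scalemxAl linearP. Qed.

Lemma ap_aug_d x : ap_aug (x *m dg_d X) = 0.
Proof.
apply/fr_exact0; rewrite map_mxM -[map_mx _ _ *m _ *m q]mulmxA (ap_qd h) -!mulmxA gD_gproj.
by rewrite !mulmxA; eexists.
Qed.

Lemma ap_aug_e i x : ap_aug (x *m dg_e X i) = 0.
Proof.
by rewrite /ap_aug map_mxM -[map_mx _ _ *m _ *m q]mulmxA (ap_qe h) mulmx0 mul0mx linear0.
Qed.

Lemma ap_aug_degpr x : ap_aug (x *m degpr A (dg_deg X) 0) = ap_aug x.
Proof.
rewrite /ap_aug map_mxM map_degpr -[map_mx _ _ *m _ *m q]mulmxA.
rewrite (hommx_degpr _ (ap_qhom h)) addr0.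
rewrite (gproj_degpr G n 0) -!mulmxA gprojK // mulmx1 //.
Qed.

Lemma ap_aug_surj y : exists2 x, ap_aug x = y & x *m degpr A (dg_deg X) 0 = x.
Proof.
have [v <-] := @fr_aug_surj _ _ G y.
have [x xP] := ap_qsurj h (v *m (gproj G n 0)^T).
exists (x *m degpr A (dg_deg X) 0).
  by rewrite ap_aug_degpr /ap_aug xP -mulmxA gprojK // mulmx1.
by rewrite -mulmxA degpr_degpr eqxx.
Qed.

(** The image of [x] in the packed resolution lies in degree [l < n], where the truncated resolution
    is still exact apart from [M] in degree 0; so it bounds, and injectivity of [q] on homology
    applies. *)
Lemma ap_exact (l : nat) x : (l < n)%N -> x *m degpr A (dg_deg X) l%:Z = x ->
  x *m dg_d X = 0 -> (l = 0%N -> ap_aug x = 0) ->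
  exists2 w, x = w *m dg_d X & w *m degpr A (dg_deg X) l.+1%:Z = w.
Proof.
move=> ln xl xd ax; have [hi _] := ap_q h; have [dh _] := ap_hom h.
have [y yP] : exists y, map_mx phi x *m q = y *m gD G n.
  pose v := map_mx phi x *m q *m gproj G n l.
  have vE : map_mx phi x *m q = v *m (gproj G n l)^T.
    rewrite -mulmxA -gproj_degpr -{1}xl map_mxM map_degpr.
    by rewrite -mulmxA (hommx_degpr _ (ap_qhom h)) addr0 mulmxA.
  have [w vw] : exists w, v = w *m fr_mx G l.
    case: (l) @v vE ln xl ax => [|l'] v vE ln xl ax.
      by apply/fr_exact0; apply: ax.
    apply/fr_exact; rewrite /v -!mulmxA -gD_gproj [q *m _]mulmxA -(ap_qd h).
    by rewrite -[_ *m q *m _]mulmxA mulmxA -map_mxM xd map_mx0 mul0mx.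
  exists (w *m (gproj G n l.+1)^T); rewrite vE vw -!mulmxA.
  by rewrite gprojT_gD.
have [w wP] := hi x xd y yP.
exists (w *m degpr A (dg_deg X) l.+1%:Z).
  rewrite -mulmxA (hommx_degpr _ dh) mulmxA -wP -{1}xl; congr (_ *m degpr A _ _).
  by lia.
by rewrite -mulmxA degpr_degpr eqxx.
Qed.

(** Columns are functionals: this takes a functional on [X], nonzero only in degree [j + c], to one
    on [G_j]. *)
Definition ap_th (j : nat) : 'M[B]_(fr_rank G j, dg_rk X) := (gproj G n j)^T *m t.

Lemma ap_th_hom j : hommx (fun=> j%:Z) (dg_deg X) c%:Z (ap_th j).
Proof.
rewrite -[c%:Z]add0r; apply: hommxM (ap_thom h).
by rewrite -[0]oppr0; apply: hommx_tr; apply: gproj_hom.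
Qed.

Lemma ap_th_d0 : ap_th 0 *m map_mx phi (dg_d X) = 0.
Proof. by rewrite -mulmxA (ap_td h) mulmxA -scalemxAr gprojT0_gD scaler0 mul0mx. Qed.

Lemma ap_th_d j : (j < n)%N ->
  ap_th j.+1 *m map_mx phi (dg_d X) = (-1) ^+ c *: (fr_mx G j *m ap_th j).
Proof.
move=> jn; rewrite -mulmxA (ap_td h) mulmxA -scalemxAr gprojT_gD //.
by rewrite -scalemxAl mulmxA.
Qed.

Lemma ap_th_e j i : ap_th j *m map_mx phi (dg_e X i) = 0.
Proof. by rewrite -mulmxA (ap_te h) mulmx0. Qed.

Lemma ap_dual_inj (l : int) (y : 'cV[A]_(dg_rk X)) :
  degpr A (dg_deg X) l *m y = y -> dg_d X *m y = 0 ->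
  ap_th 0 *m map_mx phi y = 0 ->
  (forall j, (j < n)%N -> exists w, ap_th j.+1 *m map_mx phi y = fr_mx G j *m w) ->
  exists2 w, y = dg_d X *m w & degpr A (dg_deg X) (l - 1) *m w = w.
Proof.
move=> yl yd th0 thS; have [hi _] := ap_t h; have [dh _] := ap_hom h.
have tl : degpr B (@gdeg _ _ G n) (l - c%:Z) *m (t *m map_mx phi y) = t *m map_mx phi y.
  rewrite mulmxA (hommx_degpr _ (ap_thom h)) subrK -{2}yl map_mxM map_degpr.
  by rewrite mulmxA.
have [w wP] : exists w, t *m map_mx phi y = gD G n *m w.
  case: (l - c%:Z) tl => [[|j]|j] tl.
  - exists 0; rewrite mulmx0 -tl (gproj_degpr G n 0) -!mulmxA [(gproj G n 0)^T *m _]mulmxA th0.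
    by rewrite mulmx0.
  - have [jn|jn] := ltnP j n.
      have [w wP] := thS j jn; exists (gproj G n j *m w).
      rewrite mulmxA gD_gproj -tl gproj_degpr -!mulmxA [(gproj G n j.+1)^T *m _]mulmxA.
      by rewrite wP.
    by exists 0; rewrite mulmx0 -tl gproj_degpr gproj_big // !mul0mx.
  - exists 0; rewrite mulmx0 -tl; apply/matrixP => a b; rewrite degpr_mul [RHS]mxE.
    have : 0 <= @gdeg _ _ G n a.
      elim: (n) a => [|n' IH] a //=; rewrite /catdeg.
      by case: fintype.split.
    by case: eqP => // ->.
have [||w' w'P] := hi y^T _ ((-1) ^+ c *: w)^T.
- by rewrite -trmx_mul yd trmx0.
- rewrite -map_trmx -!trmx_mul wP -scalemxAl -scalemxAr scalerA.
  by rewrite -expr2 sqrr_sign scale1r.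
exists (degpr A (dg_deg X) (l - 1) *m w'^T).
  have := hommx_degpr l dh; rewrite mulmxA => <-; rewrite -mulmxA -[dg_d X]trmxK.
  by rewrite -trmx_mul -w'P trmxK.
by rewrite mulmxA degpr_degpr eqxx.
Qed.

(** The error is a coboundary of [Hom_B(G, B)] in packed form; [gprojT_gD] and [gprojT0_gD] turn it
    into the usual form later. *)
Lemma ap_dual_surj (j : nat) (v : 'cV[B]_(fr_rank G j)) :
  (j < n)%N -> fr_mx G j *m v = 0 ->
  exists y : 'cV[A]_(dg_rk X),
    [/\ dg_d X *m y = 0, degpr A (dg_deg X) (j%:Z + c%:Z) *m y = y
      & exists w : 'cV[B]_(gt G n), ap_th j *m map_mx phi y
         = v + (gproj G n j)^T *m gD G n *m w].
Proof.
move=> jn vd; have [_ hs] := ap_t h; have [dh _] := ap_hom h.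
have [|x [xd [w wP]]] := hs (gproj G n j *m v)^T.
  by rewrite -trmx_mul -scalemxAl mulmxA gD_gproj -mulmxA vd mulmx0 scaler0 trmx0.
exists (degpr A (dg_deg X) (j%:Z + c%:Z) *m x^T); split.
- have := hommx_degpr (j%:Z + c%:Z + 1) dh; rewrite addrK mulmxA => <-.
  by rewrite -mulmxA -[dg_d X]trmxK -trmx_mul xd trmx0 mulmx0.
- by rewrite mulmxA degpr_degpr eqxx.
- exists ((-1) ^+ c *: w^T).
  have e : t *m map_mx phi x^T = gproj G n j *m v + ((-1) ^+ c *: gD G n) *m w^T.
    by rewrite -[LHS]trmxK trmx_mul map_trmx trmxK wP linearD /= !trmx_mul !trmxK.
  rewrite map_mxM map_degpr /ap_th -[LHS]mulmxA [t *m _]mulmxA.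
  rewrite -(hommx_degpr _ (ap_thom h)) -[_ *m t *m _]mulmxA e gproj_degpr.
  rewrite !mulmxA gprojK ?(ltnW jn) // mul1mx mulmxDr mulmxA gprojK ?(ltnW jn) //.
  by rewrite mul1mx -scalemxAl -!scalemxAr mulmxA.
Qed.
End ApproxFacts.

Section SubModule.
Variables (R : comNzRingType) (V : lmodType R) (W : {pred V}).
Definition sub_pred (_ : GRing.submod_closed W) : {pred V} := W.
Variable Wc : GRing.submod_closed W.

HB.instance Definition _ := GRing.isSubmodClosed.Build R V (sub_pred Wc)
  (GRing.submod_closed_semi Wc).

Record subm := SubM { subm_val :> V; subm_valP : subm_val \in sub_pred Wc }.
HB.instance Definition _ := [isSub for subm_val].
HB.instance Definition _ := [Choice of subm by <:].
HB.instance Definition _ := [SubChoice_isSubLmodule of subm by <:].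
End SubModule.

Section Restriction.
Variables (A B : comNzRingType) (phi : {rmorphism A -> B}) (M : lmodType B).
(** The argument tags the type, so that every morphism has its own structure of [A]-module on
    [M]. *)
Definition res (_ : {rmorphism A -> B}) : Type := M.
HB.instance Definition _ := GRing.Zmodule.on (res phi).
Definition res_scale (a : A) (x : res phi) : res phi := phi a *: (x : M).

Lemma res_scaleA a b x : res_scale a (res_scale b x) = res_scale (a * b) x.
Proof. by rewrite /res_scale scalerA rmorphM. Qed.
Lemma res_scale1 : left_id 1 res_scale.
Proof. by move=> x; rewrite /res_scale rmorph1 scale1r. Qed.
Lemma res_scaleDr : right_distributive res_scale +%R.
Proof. by move=> a x y; apply: scalerDr. Qed.
Lemma res_scaleDl x : {morph res_scale^~ x : a b / a + b}.
Proof. by move=> a b; rewrite /res_scale rmorphD scalerDl. Qed.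
HB.instance Definition _ := GRing.Zmodule_isLmodule.Build A (res phi)
  res_scaleA res_scale1 res_scaleDr res_scaleDl.
End Restriction.

Lemma linear_pack (R : comNzRingType) (V W : lmodType R) (g : V -> W) :
  (forall a x y, g (a *: x + y) = a *: g x + g y) ->
  exists g' : {linear V -> W}, forall x, g' x = g x.
Proof.
move=> gl; pose g' : {linear V -> W} :=
  HB.pack g (GRing.isLinear.Build R V W *:%R g gl).
by exists g'.
Qed.

(** Since [projective] speaks of surjections, the target [Y] is replaced by the image of [d]. *)
Lemma projective_lift (R : comNzRingType) (P X Y : lmodType R)
    (d : {linear X -> Y}) (h : {linear P -> Y}) : projective P ->
  (forall p, exists x, d x = h p) ->
  exists h' : {linear P -> X}, forall p, d (h' p) = h p.
Proof.
move=> projP im.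
pose W : {pred Y} := fun y => `[< exists x, d x = y >].
have Wc : GRing.submod_closed W.
  split; first by apply/asboolP; exists 0; rewrite linear0.
  move=> a x y /asboolP[u <-] /asboolP[v <-]; apply/asboolP.
  by exists (a *: u + v); rewrite linearP.
have dW x : d x \in sub_pred Wc by apply/asboolP; exists x.
have hW x : h x \in sub_pred Wc by apply/asboolP/im.
have [d' d'E] : exists d' : {linear X -> subm Wc}, forall x, d' x = SubM (dW x).
  by apply: linear_pack => a x y; apply: val_inj; rewrite /= linearP.
have [h' h'E] : exists h' : {linear P -> subm Wc}, forall x, h' x = SubM (hW x).
  by apply: linear_pack => a x y; apply: val_inj; rewrite /= linearP.
have [|g gP] := projP _ _ d' h'.
  move=> [y yP]; have /asboolP[x xP] := yP; exists x.
  by apply: val_inj; rewrite d'E /= xP.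
by exists g => p; have := congr1 val (gP p); rewrite d'E h'E.
Qed.

Lemma projective_rV (R : comNzRingType) r : projective 'rV[R]_r.
Proof.
move=> X Y g h gs; have /choice[x xP] a := gs (h (delta_mx 0 a)).
have [h' h'E] : exists h' : {linear 'rV[R]_r -> X},
    forall v, h' v = \sum_a v 0 a *: x a.
  apply: linear_pack => a u v; rewrite scaler_sumr -big_split.
  by apply: eq_bigr => i _; rewrite !mxE scalerDl scalerA.
exists h' => v; rewrite h'E linear_sum [v in RHS]row_sum_delta linear_sum.
by apply: eq_bigr => a _; rewrite !linearZ /= xP.
Qed.

Lemma dep_choice (T : nat -> Type) (Inv : forall l, T l -> Prop)
    (Rel : forall l, T l -> T l.+1 -> Prop) (x0 : T 0%N) : Inv 0%N x0 ->
  (forall l x, Inv l x -> exists2 y, Inv l.+1 y & Rel l x y) ->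
  exists F : forall l, T l,
    [/\ F 0%N = x0, forall l, Inv l (F l) & forall l, Rel l (F l) (F l.+1)].
Proof.
move=> I0 step.
have step' l (x : {x | Inv l x}) : {y : {y | Inv l.+1 y} | Rel l (sval x) (sval y)}.
  apply: constructive_indefinite_description.
  by have [y yI yR] := step l (sval x) (svalP x); exists (exist _ y yI).
pose F := nat_rect (fun l => {x | Inv l x}) (exist _ x0 I0)
  (fun l x => sval (step' l x)).
exists (fun l => sval (F l)); split=> // l; first exact: svalP (F l).
exact: svalP (step' l (F l)).
Qed.

(** * Contraction in high degrees from a finite projective resolution *)

Section Homotopy.
Variables (A B : comNzRingType) (phi : {rmorphism A -> B}).
Variables (c : nat) (f : 'I_c -> A) (M : lmodType B) (G : free_resolution M).
Hypothesis phi_surj : surjective phi.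
Variables (n : nat) (X : dgmx A c) (q : 'M[B]_(dg_rk X, gt G n))
  (t : 'M[B]_(gt G n, dg_rk X)).
Hypothesis h : approx phi f n X q t.

Variables (Q : nat -> lmodType A) (dQ : forall l, {linear Q l.+1 -> Q l}).
Variables (augQ : {linear Q 0%N -> M | phi \; *:%R}).
Hypothesis Q_proj : forall l, projective (Q l).
Hypothesis augQ_surj : surjective augQ.
Hypothesis Q_exact0 : forall x, augQ x = 0 <-> exists y, x = dQ 0%N y.
Hypothesis Q_exact : forall l x, dQ l x = 0 <-> exists y, x = dQ l.+1 y.

Local Notation r := (dg_rk X).
Local Notation d := (dg_d X).
Local Notation pr l := (degpr A (dg_deg X) (l%N)%:Z).
Local Notation aug := (ap_aug phi q).

Let dd : d *m d = 0. Proof. by case: (ap_laws h). Qed.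

Let prd l : pr l.+1 *m d = d *m pr l.
Proof.
have [dh _] := ap_hom h; rewrite (hommx_degpr _ dh); congr (_ *m degpr _ _ _).
by lia.
Qed.

Let prpr l : pr l *m pr l = pr l.
Proof. by rewrite degpr_degpr eqxx. Qed.

Let kQ l : Q l -> Prop :=
  match l with 0%N => fun x => augQ x = 0 | l'.+1 => fun x => dQ l' x = 0 end.

Let kQP l x : kQ x <-> exists y, x = dQ l y.
Proof. by case: l x. Qed.

Let aug_lin : exists g : {linear 'rV[A]_r -> res M phi}, forall x, g x = aug x.
Proof.
apply: (@linear_pack A _ (res M phi) aug) => a x y.
exact: (ap_aug_linear phi q a x y).
Qed.

Let augQ_lin : exists g : {linear Q 0%N -> res M phi}, forall x, g x = augQ x.
Proof. by apply: (@linear_pack A _ (res M phi) augQ) => a x y; apply: linearP. Qed.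

Lemma comparison_alpha : exists al : forall l, {linear 'rV[A]_r -> Q l},
  (forall x, augQ (al 0%N x) = aug x) /\
  forall l x, dQ l (al l.+1 x) = al l (x *m pr l.+1 *m d).
Proof.
have [g gE] := aug_lin; have [gQ gQE] := augQ_lin.
have [|al0 al0P] := @projective_lift _ _ _ _ gQ g (@projective_rV A r).
  by move=> x; have [y yP] := augQ_surj (g x); exists y; rewrite gQE.
pose Inv l (al : {linear 'rV[A]_r -> Q l}) := forall x, kQ (al (x *m pr l.+1 *m d)).
pose Rel l (al : {linear 'rV[A]_r -> Q l}) (al' : {linear 'rV[A]_r -> Q l.+1}) :=
  forall x, dQ l (al' x) = al (x *m pr l.+1 *m d).
have [||F [F0 _ FR]] := @dep_choice (fun l => {linear 'rV[A]_r -> Q l}) Inv Rel al0.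
- by move=> x /=; rewrite -gQE al0P gE; apply: ap_aug_d h _.
- move=> l al hal.
  have [|al' al'P] := @projective_lift _ _ _ _ (dQ l)
      (al \o (mulmxr d \o mulmxr (pr l.+1))) (@projective_rV A r).
    by move=> x; have /kQP[y yP] := hal x; exists y; rewrite -yP.
  exists al'; last exact: al'P.
  move=> x; rewrite /kQ al'P /=.
  have -> : x *m pr l.+2 *m d *m pr l.+1 *m d = 0.
    by rewrite -!mulmxA prd (mulmxA d) dd mul0mx !mulmx0.
  by rewrite linear0.
by exists F; split=> // x; rewrite F0 -gQE al0P gE.
Qed.

(** The comparison back to [X] is a chain map only below [n], where [X] is known to be exact. *)
Lemma comparison_beta : exists be : forall l, {linear Q l -> 'rV[A]_r},
  [/\ forall y, aug (be 0%N y) = augQ y,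
      forall l y, be l y *m pr l = be l y
    & forall l y, (l < n)%N -> be l.+1 y *m d = be l (dQ l y)].
Proof.
have [g gE] := aug_lin; have [gQ gQE] := augQ_lin.
have [|be0 be0P] := @projective_lift A _ 'rV[A]_r _ g gQ (@Q_proj 0).
  move=> y; have [x xP _] := ap_aug_surj h (augQ y).
  by exists x; rewrite gE gQE.
pose Inv l (be : {linear Q l -> 'rV[A]_r}) :=
  (forall y, be y *m pr l = be y) /\
  forall y, be (dQ l y) *m d = 0 /\ (l = 0%N -> aug (be (dQ l y)) = 0).
pose Rel l (be : {linear Q l -> 'rV[A]_r}) (be' : {linear Q l.+1 -> 'rV[A]_r}) :=
  (l < n)%N -> forall y, be' y *m d = be (dQ l y).
have dQ0 l y : dQ l (dQ l.+1 y) = 0 by apply/Q_exact; exists y.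
have [||F [F0 FI FR]] := @dep_choice (fun l => {linear Q l -> 'rV[A]_r}) Inv Rel
    (mulmxr (pr 0) \o be0).
- split=> [y|y /=]; first by rewrite /= -mulmxA prpr.
  split.
  + have [dh _] := ap_hom h.
    rewrite -mulmxA (hommx_degpr _ dh) mulmxA; apply/rowP => b.
    rewrite mul_degpr [RHS]mxE; have := ap_pos h b.
    by case: eqP => // ->.
  + move=> _; rewrite (ap_aug_degpr h) -gE be0P gQE.
    by apply/Q_exact0; exists y.
- move=> l be [hbe hbe']; have [ln|ln] := ltnP l n; last first.
    exists \0; last by rewrite /Rel ltnNge ln.
    by split=> y; rewrite mul0mx.
  have [|be' be'P] := @projective_lift A _ 'rV[A]_r 'rV[A]_r (mulmxr d)
      (be \o dQ l) (@Q_proj l.+1).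
    move=> y; have [b2 b3] := hbe' y.
    by have [w wP _] := ap_exact h ln (hbe _) b2 b3; exists w; rewrite /= -wP.
  have be'd y : be' y *m pr l.+1 *m d = be (dQ l y).
    rewrite -mulmxA prd mulmxA; have /= -> := be'P y.
    exact: hbe.
  exists (mulmxr (pr l.+1) \o be') => [|_ y]; last exact: be'd.
  split=> y /=; first by rewrite -mulmxA prpr.
  by rewrite be'd dQ0 linear0.
exists F; split=> [y|l y|l y ln].
- by rewrite F0 /= (ap_aug_degpr h) -gE be0P gQE.
- exact: (FI l).1.
- exact: FR.
Qed.

(** Below degree [n] the composite of [al] and [be] is homotopic to the identity. Where [Q l]
    vanishes the composite is 0, so the homotopy is a contraction of [X] there. *)
Lemma comparison_homotopy : exists s : 'M[A]_r, hommx (dg_deg X) (dg_deg X) 1 s /\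
  forall l, (l < n)%N -> (forall x : Q l, x = 0) -> forall x : 'rV_r, x *m pr l = x ->
  x = x *m s *m d + x *m d *m s.
Proof.
have [al [al0 alS]] := comparison_alpha.
have [be [be0 beh beS]] := comparison_beta.
(* [K l s x] is what the next homotopy must have as boundary: identity minus composite minus the
   contribution of the homotopy already built in degree [l - 1]. It is again a cycle, so [ap_exact]
   and projectivity give the next step. *)
pose K l (s : {linear 'rV[A]_r -> 'rV[A]_r}) (x : 'rV[A]_r) : 'rV[A]_r :=
  x *m pr l - be l (al l (x *m pr l)) - s (x *m pr l *m d).
have K_lin l s : exists g : {linear 'rV[A]_r -> 'rV[A]_r}, forall x, g x = K l s x.
  by exists (mulmxr (pr l) \- (be l \o (al l \o mulmxr (pr l)))
    \- (s \o (mulmxr d \o mulmxr (pr l)))).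
have Kh l (s : {linear 'rV[A]_r -> 'rV[A]_r}) x : (forall y, s y *m pr l = s y) -> K l s x *m pr l = K l s x.
  by move=> sh; rewrite /K !mulmxBl beh sh -(mulmxA x (pr l) (pr l)) prpr.
pose Inv l (s : {linear 'rV[A]_r -> 'rV[A]_r}) :=
  (forall y, s y *m pr l = s y) /\
  ((l < n)%N -> forall x, K l s x *m d = 0 /\ (l = 0%N -> aug (K l s x) = 0)).
pose Rel l (s s' : {linear 'rV[A]_r -> 'rV[A]_r}) :=
  (l < n)%N -> forall x, s' x *m d = K l s x.
have pr0d (x : 'rV[A]_r) : x *m pr 0 *m d = 0.
  have [dh _] := ap_hom h.
  rewrite -mulmxA (hommx_degpr _ dh) mulmxA; apply/rowP => b.
  rewrite mul_degpr [RHS]mxE; have := ap_pos h b.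
  by case: eqP => // ->.
have [||F [F0 FI FR]] := @dep_choice (fun=> {linear 'rV[A]_r -> 'rV[A]_r}) Inv Rel \0.
- split=> [y|_ x] /=; first by rewrite mul0mx.
  rewrite /K /= subr0; split=> [|_].
    by rewrite mulmxBl pr0d -beh pr0d subrr.
  have [g gE] := aug_lin; rewrite -gE linearB /= !gE (ap_aug_degpr h) be0 al0.
  by rewrite (ap_aug_degpr h) subrr.
- move=> l s [sh sc]; have [ln|ln] := ltnP l n; last first.
    exists \0; last by rewrite /Rel ltnNge ln.
    by split=> [y|/ltnW]; rewrite ?mul0mx // leqNgt ltnS ln.
  have [g gE] := K_lin l s.
  have [|s1 s1P] := @projective_lift A _ 'rV[A]_r 'rV[A]_r (mulmxr d) g (@projective_rV A r).
    move=> x; have [k1 k2] := sc ln x.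
    have [w wP _] := ap_exact h ln (Kh l s x sh) k1 k2; exists w.
    by rewrite gE /= -wP.
  have s1d x : s1 x *m pr l.+1 *m d = K l s x.
    by rewrite -mulmxA prd mulmxA; have /= -> := s1P x; rewrite gE Kh.
  exists (mulmxr (pr l.+1) \o s1) => [|_ x]; last exact: s1d.
  split=> [y|ln' x] /=; first by rewrite -mulmxA prpr.
  split=> //; rewrite /K /= !mulmxBl s1d beS // alS -[_ *m pr l.+1 *m pr l.+1]mulmxA prpr.
  rewrite /K; have -> : x *m pr l.+1 *m d *m pr l = x *m pr l.+1 *m d.
    by rewrite -(mulmxA x (pr l.+1) d) prd -!mulmxA prpr.
  by rewrite -[_ *m d *m d]mulmxA dd mulmx0 linear0 subr0 subrr.
exists (\sum_(l < n) pr l *m lin1_mx (F l.+1)); split.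
  elim/big_rec: _ => [|l y _ hy]; first exact: hommx0.
  apply: hommxD => // a b; rewrite degpr_mul.
  have [->|_] := eqVneq (dg_deg X a) l%:Z; last by rewrite eqxx.
  have [Fh _] := FI l.+1; rewrite !mxE -Fh mul_degpr.
  by have [-> _|_] := eqVneq (dg_deg X b) l.+1%:Z; [lia|rewrite eqxx].
move=> l ln Q0 x xl.
have S l' y : (l' < n)%N -> y *m pr l' = y ->
    y *m (\sum_(i < n) pr i *m lin1_mx (F i.+1)) = F l'.+1 y.
  move=> ln' yl; rewrite mulmx_sumr (bigD1 (Ordinal ln')) //= mulmxA yl mul_rV_lin1.
  rewrite big1 ?addr0 // => i ne; rewrite mulmxA -yl -[y *m _ *m _]mulmxA degpr_degpr.
  case: eqP => [[e]|_]; last by rewrite mulmx0 mul0mx.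
  by case/eqP: ne; apply: val_inj.
rewrite (S l) // FR // /K xl (Q0 (al l x)) linear0 subr0.
case: l ln Q0 xl => [|l] ln Q0 xl.
  by rewrite F0 subr0 -xl pr0d mul0mx addr0.
rewrite (S l) ?subrK ?(ltnW ln) // -xl.
by rewrite -(mulmxA x (pr l.+1) d) prd -!mulmxA prpr.
Qed.

End Homotopy.

(** * Finite free models *)

Section LocalRing.
Variables (A : comNzRingType) (k : fieldType) (rho : {rmorphism A -> k}).
Hypothesis rho_surj : surjective rho.
Hypothesis A_local : local_ring A.

Lemma ker_maximal : maximal_ideal [pred x | rho x == 0].
Proof.
split.
  split; rewrite ?inE ?rmorph0 ?rmorph1 ?oner_eq0 // => a x y.
  by rewrite !inE rmorphD rmorphM => /eqP -> /eqP ->; rewrite mulr0 addr0.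
move=> J [J0 J1 JD] sub x; apply/idP/idP; first exact: sub.
move=> xJ; rewrite inE; apply: contraNT J1 => nz.
have [y yP] := rho_surj (rho x)^-1.
rewrite -[1](addrNK (y * x)) addrC; apply: JD => //.
by apply: sub; rewrite inE rmorphB rmorphM yP mulVf // rmorph1 subrr.
Qed.

(** A non-unit lies in a maximal ideal by Zorn's lemma, and the only maximal ideal is the kernel of
    [rho]. *)
Lemma local_unit x : rho x != 0 -> exists y, x * y = 1.
Proof.
move=> nz; case: (pselect (exists y, x * y = 1)) => // nu; exfalso.
pose P (I : set A) := I = set0 \/ [/\ I 0, ~ I 1, I x & forall a u v, I u -> I v -> I (a * u + v)].
have [|I [PI Imax]] := @Zorn_bigcup A P.
  move=> F FP Ftot; case: (pselect (exists2 I, F I & (I !=set0)%classic)) => [[I FI [z zI]]|n].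
    right; have [e|[I0 I1 Ix ID]] := FP _ FI; first by move: zI; rewrite e.
    split.
    - by exists I.
    - move=> [J FJ J1]; have [e|[_ /(_ J1)//]] := FP _ FJ.
      by move: J1; rewrite e.
    - by exists I.
    - move=> a u v [J1 F1 u1] [J2 F2 u2].
      have [s|s] := Ftot _ _ F1 F2.
        exists J2 => //; have [e|[_ _ _ D]] := FP _ F2; first by move: u2; rewrite e.
        by apply: D => //; apply: s.
      exists J1 => //; have [e|[_ _ _ D]] := FP _ F1; first by move: u1; rewrite e.
      by apply: D => //; apply: s.
  left; apply/seteqP; split=> // z [J FJ Jz]; apply: n; exists J => //.
  by exists z.
have xP : P [set z | exists y, z = x * y]%classic.
  right; split=> /=.
  - by exists 0; rewrite mulr0.
  - by move=> [y e]; apply: nu; exists y.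
  - by exists 1; rewrite mulr1.
  - by move=> a u v [y ->] [z ->]; exists (a * y + z); rewrite mulrDr mulrCA.
have [e|[I0 I1 Ix ID]] := PI.
  apply: (Imax _ _ xP); split; first by rewrite e.
  by rewrite e => /(_ x) h; apply: h; exists 1; rewrite mulr1.
pose I' : {pred A} := fun z => `[< I z >].
have I'm : maximal_ideal I'.
  split.
    split; first exact/asboolP.
      by apply/asboolP.
    by move=> a u v /asboolP hu /asboolP hv; apply/asboolP/ID.
  move=> J [J0 J1 JD] sub z; apply/idP/idP; first exact: sub.
  move=> zJ; apply: contrapT => zI.
  have JP : P [set z | z \in J]%classic.
    right; split=> /=; [exact: J0|exact/negP| |by move=> a u v; apply: JD].
    by apply: sub; apply/asboolP.
  apply: Imax JP; split; first by move=> w wI; apply: sub; apply/asboolP.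
  by move=> s; apply: zI; apply/asboolP; apply: s.
have [J Jm Juniq] := A_local.
have : x \in [pred x | rho x == 0].
  rewrite (Juniq _ ker_maximal) -(Juniq _ I'm); exact/asboolP.
by rewrite inE (negbTE nz).
Qed.

Lemma local_unitmx n (N : 'M[A]_n) : map_mx rho N = 1%:M ->
  exists W, N *m W = 1%:M /\ W *m N = 1%:M.
Proof.
move=> e; have [|y yP] := @local_unit (\det N).
  by rewrite -det_map_mx e det1 oner_eq0.
exists (y *: \adj N).
by rewrite -scalemxAr -scalemxAl mul_mx_adj mul_adj_mx scale_scalar_mx mulrC yP.
Qed.

(** Finite projective modules over a local ring are free. A rank factorization over [k] lifts to [U]
    and [V], and [U *m V] is invertible with inverse [W]. The difference [N] is then an idempotent
    that vanishes over [k]; since [1 - N] is invertible, [N = 0]. *)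
Lemma idempotent_split n (e : 'M[A]_n) : e *m e = e ->
  exists r (U : 'M[A]_(r, n)) (V : 'M[A]_(n, r)), U *m V = 1%:M /\ V *m U = e.
Proof.
move=> ee; pose e' := map_mx rho e.
have ee' : e' *m e' = e' by rewrite -map_mxM ee.
have [t [C [R [CR RC]]]] : exists t (C : 'M[k]_(n, t)) (R : 'M[k]_(t, n)),
    C *m R = e' /\ R *m C = 1%:M.
  exists (\rank e'), (col_base e'), (row_base e').
  have CR := mulmx_base e'; split=> //.
  apply: (row_free_inj (row_base_free e')); apply: (row_full_inj (col_base_full e')).
  rewrite mul1mx; transitivity ((col_base e' *m row_base e') *m (col_base e' *m row_base e')).
    by rewrite !mulmxA.
  by rewrite [in LHS]CR ee' CR.
have lift m p (N : 'M[k]_(m, p)) : exists N', map_mx rho N' = N.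
  have /choice[g gP] (i : 'I_m * 'I_p) := rho_surj (N i.1 i.2).
  exists (\matrix_(i, j) g (i, j)); apply/matrixP => i j.
  by rewrite !mxE gP.
have [V0 V0P] := lift _ _ C; have [U0 U0P] := lift _ _ R.
pose U := U0 *m e; pose V := e *m V0.
have UV : map_mx rho (U *m V) = 1%:M.
  rewrite /U /V !mulmxA -(mulmxA U0) ee !map_mxM U0P V0P -/e' -CR !mulmxA RC mul1mx.
  by rewrite RC.
have eV : e *m V = V by rewrite mulmxA ee.
have Ue : U *m e = U by rewrite -mulmxA ee.
have mV : map_mx rho V = e' *m C by rewrite map_mxM V0P.
have mU : map_mx rho U = R *m e' by rewrite map_mxM U0P.
clearbody U V; have [W [W1 W2]] := local_unitmx UV.
pose N := e - V *m W *m U.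
have NN : N *m N = N.
  rewrite /N mulmxBl !mulmxBr ee !mulmxA eV -!(mulmxA _ U e) Ue.
  rewrite -(mulmxA (V *m W) U V) -(mulmxA V W (U *m V)) W2 mulmx1.
  by rewrite subrr subr0.
have N0 : map_mx rho N = 0.
  have RW : map_mx rho W = 1%:M by move: W1 => /(congr1 (map_mx rho)); rewrite map_mxM UV mul1mx map_mx1.
  rewrite /N map_mxB !map_mxM RW mulmx1 mU mV -/e' !mulmxA -(mulmxA e' C R) CR.
  by rewrite ee' ee' subrr.
have [|Z [Z1 _]] := @local_unitmx _ (1%:M - N).
  by rewrite map_mxB N0 map_mx1 subr0.
have N00 : N = 0.
  by rewrite -[N]mulmx1 -Z1 mulmxA mulmxBr mulmx1 NN subrr mul0mx.
exists _, U, (V *m W); split; first by rewrite mulmxA.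
by apply/eqP; rewrite -subr_eq0 -oppr_eq0 opprB -/N N00.
Qed.

Lemma graded_split r (dg : 'I_r -> int) (e : nat -> 'M[A]_r) :
  (forall l, e l *m e l = e l) -> (forall l l', l != l' -> e l *m e l' = 0) ->
  (forall l, degpr A dg l%:Z *m e l = e l) ->
  (forall l, e l *m degpr A dg l%:Z = e l) ->
  forall N, exists r' (dg' : 'I_r' -> int) (U : 'M[A]_(r', r)) (V : 'M[A]_(r, r')),
  [/\ U *m V = 1%:M, V *m U = \sum_(l < N) e l, hommx dg' dg 0 U, hommx dg dg' 0 V
    & forall a, 0 <= dg' a].
Proof.
move=> ee e0 pe ep; elim=> [|N [r1 [dg1 [U1 [V1 [h1 h2 h3 h4 h5]]]]]].
  exists 0%N, (fun=> 0), 0, 0; split; rewrite ?big_ord0 ?mulmx0 //.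
  - by apply/matrixP => -[].
  - exact: hommx0.
  - exact: hommx0.
have [r2 [U2 [V2 [g1 g2]]]] := idempotent_split (ee N).
have UN : U2 *m e N = U2 by rewrite -g2 mulmxA g1 mul1mx.
have VN : e N *m V2 = V2 by rewrite -g2 -mulmxA g1 mulmx1.
have s0 : (\sum_(l < N) e l) *m e N = 0.
  by rewrite mulmx_suml big1 // => l _; rewrite e0 // ltn_eqF.
have s0' : e N *m (\sum_(l < N) e l) = 0.
  by rewrite mulmx_sumr big1 // => l _; rewrite e0 // gtn_eqF.
exists (r1 + r2)%N, (catdeg dg1 (fun=> N%:Z)), (col_mx U1 U2), (row_mx V1 V2); split.
- rewrite mul_col_row h1 g1.
  have -> : U1 *m V2 = 0.
    by rewrite -VN -[U1]mul1mx -h1 -(mulmxA U1 V1) h2 !mulmxA -(mulmxA U1 _ (e N)) s0 mulmx0 mul0mx.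
  have -> : U2 *m V1 = 0.
    by rewrite -UN -[V1]mulmx1 -h1 [V1 *m _]mulmxA h2 !mulmxA -(mulmxA U2) s0' mulmx0 mul0mx.
  by rewrite -scalar_mx_block.
- by rewrite mul_row_col big_ord_recr /= h2 g2.
- apply: hommx_col => // a b.
  rewrite -UN -ep mulmxA mul_degpr; have [-> _|_] := eqVneq (dg b) N%:Z; last by rewrite eqxx.
  by rewrite addr0.
- apply: hommx_row => // a b.
  rewrite -VN -pe -mulmxA degpr_mul; have [-> _|_] := eqVneq (dg a) N%:Z; last by rewrite eqxx.
  by rewrite addr0.
- by move=> a; rewrite /catdeg; case: fintype.split.
Qed.

End LocalRing.

(** [E] resolves [M] through [eta], and its [A]-dual, made of columns, maps to [Hom_B(G, B)] through
    [th] by a quasi-isomorphism of degree shift [c]. No bound on degrees is left. The match in the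
    last field reflects that there are no coboundaries in degree 0. *)
Record finite_model (A B : comNzRingType) (phi : {rmorphism A -> B}) (c : nat)
    (f : 'I_c -> A) (M : lmodType B) (G : free_resolution M) (E : dgmx A c)
    (eta : 'rV[A]_(dg_rk E) -> M) (th : forall j, 'M[B]_(fr_rank G j, dg_rk E)) :
    Prop := FiniteModel {
  fm_laws : klaws f predT E;
  fm_hom : khom E;
  fm_pos : forall a, 0 <= dg_deg E a;
  fm_lin : forall a x y, eta (a *: x + y) = phi a *: eta x + eta y;
  fm_eta_d : forall x, eta (x *m dg_d E) = 0;
  fm_eta_e : forall i x, eta (x *m dg_e E i) = 0;
  fm_eta_deg : forall x, eta (x *m degpr A (dg_deg E) 0) = eta x;
  fm_exact : forall l x, x *m degpr A (dg_deg E) l = x -> x *m dg_d E = 0 ->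
    eta x = 0 -> exists w, x = w *m dg_d E;
  fm_surj : forall y, exists x, eta x = y /\ x *m degpr A (dg_deg E) 0 = x;
  fm_th_hom : forall j, hommx (fun=> j%:Z) (dg_deg E) c%:Z (th j);
  fm_th_d0 : th 0%N *m map_mx phi (dg_d E) = 0;
  fm_th_d : forall j, th j.+1 *m map_mx phi (dg_d E)
    = (-1) ^+ c *: (fr_mx G j *m th j);
  fm_th_e : forall j i, th j *m map_mx phi (dg_e E i) = 0;
  fm_th_inj : forall l y, degpr A (dg_deg E) l *m y = y -> dg_d E *m y = 0 ->
    th 0%N *m map_mx phi y = 0 ->
    (forall j, exists w, th j.+1 *m map_mx phi y = fr_mx G j *m w) ->
    exists w : 'cV_(dg_rk E), y = dg_d E *m w;
  fm_th_surj : forall j (v : 'cV_(fr_rank G j)), fr_mx G j *m v = 0 ->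
    exists y : 'cV_(dg_rk E), [/\ dg_d E *m y = 0,
      degpr A (dg_deg E) (j%:Z + c%:Z) *m y = y
    & match j return 'M[B]_(fr_rank G j, dg_rk E) -> 'cV[B]_(fr_rank G j) -> Prop with
      | 0 => fun t v => t *m map_mx phi y = v
      | j'.+1 => fun t v => exists w, t *m map_mx phi y = v + fr_mx G j' *m w
      end (th j) v]
}.
Arguments finite_model {A B} phi {c} f {M G} E eta th.

Section Truncation.
Variables (A B : comNzRingType) (phi : {rmorphism A -> B}).
Variables (k : fieldType) (rho : {rmorphism A -> k}).
Variables (c : nat) (f : 'I_c -> A) (M : lmodType B) (G : free_resolution M).
Hypothesis rho_surj : surjective rho.
Hypothesis A_local : local_ring A.
Hypothesis phi_surj : surjective phi.
Hypothesis f_regular : regular_sequence f.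
Hypothesis ker_phi : forall a : A, phi a = 0 <-> in_ideal f predT a.

Variable m : nat.
Hypothesis contr : forall n X q t, approx phi f (G := G) n X q t ->
  exists s : 'M[A]_(dg_rk X), hommx (dg_deg X) (dg_deg X) 1 s /\
  forall l, (m < l < n)%N -> forall x : 'rV_(dg_rk X),
    x *m degpr A (dg_deg X) l%:Z = x -> x = x *m s *m dg_d X + x *m dg_d X *m s.

(** The vanishing of [Ext_B^j(M, B)] for [j + c > m]: the class lifts to the dual of a long enough
    [X] in degree [j + c], where [s] contracts [X] and therefore its dual. *)
Lemma dual_exact j (v : 'cV_(fr_rank G j)) : (m < j + c)%N -> fr_mx G j *m v = 0 ->
  match j return 'cV[B]_(fr_rank G j) -> Prop with
  | 0 => fun v => v = 0
  | j'.+1 => fun v => exists w, v = fr_mx G j' *m w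
  end v.
Proof.
move=> mj vd; have [n jn] : exists n, (j + c < n)%N by exists (j + c).+1.
have [X [q [t h]]] := approx_ex G phi_surj f_regular ker_phi n.
have [s [sh hs]] := contr h; have [dh _] := ap_hom h.
have jn' : (j < n)%N by apply: leq_ltn_trans jn; apply: leq_addr.
have [y [yd yl [w wP]]] := ap_dual_surj h jn' vd.
have [w' w'P] : exists w', y = dg_d X *m w'.
  pose l := (j + c)%N; have lE : l%:Z = j%:Z + c%:Z by rewrite PoszD.
  have prE : degpr A (dg_deg X) l%:Z = degpr A (dg_deg X) l%:Z *m s *m dg_d X
      + degpr A (dg_deg X) l%:Z *m dg_d X *m s.
    apply/row_matrixP => i; rewrite linearD /= !row_mul.
    apply: (hs l); first by rewrite mj.
    by rewrite -row_mul degpr_degpr eqxx.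
  exists (degpr A (dg_deg X) (l%:Z - 1) *m s *m y).
  rewrite -{1}yl -lE prE mulmxDl -!mulmxA yd !mulmx0 add0r.
  by rewrite mulmxA (hommx_degpr _ dh) !mulmxA.
move: wP; rewrite w'P map_mxM mulmxA.
case: j v vd mj {jn} jn' y {yd yl} w'P => [|j] v vd mj jn y w'P.
  by rewrite (ap_th_d0 h) mul0mx gprojT0_gD mul0mx addr0.
have jn' := ltnW jn; rewrite (ap_th_d h) // gprojT_gD //.
move=> e; exists ((-1) ^+ c *: (ap_th t j *m map_mx phi w') - (gproj G n j)^T *m w).
by rewrite mulmxBr -scalemxAr mulmxA scalemxAl e mulmxA addrK.
Qed.

Variables (X : dgmx A c) (q : 'M[B]_(dg_rk X, gt G m.+2))
  (t : 'M[B]_(gt G m.+2, dg_rk X)).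
Hypothesis h : approx phi f m.+2 X q t.
Variable s : 'M[A]_(dg_rk X).
Hypothesis sh : hommx (dg_deg X) (dg_deg X) 1 s.
Hypothesis hs : forall x : 'rV_(dg_rk X), x *m degpr A (dg_deg X) m.+1%:Z = x ->
  x = x *m s *m dg_d X + x *m dg_d X *m s.

Local Notation r := (dg_rk X).
Local Notation d := (dg_d X).
Local Notation pr l := (degpr A (dg_deg X) (l%N)%:Z).

Let dd : d *m d = 0. Proof. by case: (ap_laws h). Qed.
Let dh : hommx (dg_deg X) (dg_deg X) (-1) d. Proof. by case: (ap_hom h). Qed.
Let eh i : hommx (dg_deg X) (dg_deg X) 1 (dg_e X i). Proof. by case: (ap_hom h). Qed.

Let prd l : pr l.+1 *m d = d *m pr l.
Proof. by rewrite (hommx_degpr _ dh); congr (_ *m degpr _ _ _); lia. Qed.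

Let pre l i : pr l *m dg_e X i = dg_e X i *m pr l.+1.
Proof. by rewrite (hommx_degpr _ (@eh i)); congr (_ *m degpr _ _ _); lia. Qed.

Let prsd l : pr l *m (s *m d) = s *m d *m pr l.
Proof.
have hsd := hommxM sh dh; rewrite (hommx_degpr _ hsd).
by congr (_ *m degpr _ _ _); lia.
Qed.

(** Truncation at degree [m]. There [s *m d] is an idempotent onto the boundaries, by the
    contraction in degree [m.+1], so [1 - s *m d] splits off the cokernel of the incoming
    differential. Lower degrees are kept and higher ones dropped. *)
Definition tr_idem (l : nat) : 'M[A]_r :=
  if (l < m)%N then pr l else if l == m then pr m *m (1%:M - s *m d) else 0.

Let dsd (x : 'rV_r) : x *m pr m.+1 = x -> x *m d *m s *m d = x *m d.
Proof.
move=> xl; rewrite [in RHS](hs xl) mulmxDl -[X in _ = X + _]mulmxA dd mulmx0 add0r.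
by [].
Qed.

Let prpr l : pr l *m pr l = pr l.
Proof. by rewrite degpr_degpr eqxx. Qed.

Let sd_idem : pr m *m (s *m d) *m (s *m d) = pr m *m (s *m d).
Proof.
apply/row_matrixP => i; rewrite !row_mul !mulmxA dsd //.
rewrite -[_ *m s *m _]mulmxA.
have -> : s *m pr m.+1 = pr m *m s.
  by rewrite (hommx_degpr _ sh); congr (_ *m degpr _ _ _); lia.
by rewrite mulmxA -row_mul prpr.
Qed.

Let comm1sd l : (1%:M - s *m d) *m pr l = pr l *m (1%:M - s *m d).
Proof. by rewrite mulmxBl mulmxBr mul1mx mulmx1 prsd. Qed.

Lemma tr_idem_idem l : tr_idem l *m tr_idem l = tr_idem l.
Proof.
rewrite /tr_idem; case: ltnP => _; first exact: prpr.
case: eqP => _; last by rewrite mulmx0.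
rewrite mulmxA -(mulmxA (pr m) _ (pr m)) comm1sd !mulmxA prpr.
rewrite (mulmxBr (pr m *m (1%:M - s *m d))) mulmx1.
rewrite [X in _ - X](_ : _ = 0) ?subr0 //.
by rewrite mulmxBr mulmx1 mulmxBl sd_idem subrr.
Qed.

Lemma tr_idem_pr l : tr_idem l *m pr l = tr_idem l.
Proof.
rewrite /tr_idem; case: ltnP => _; first exact: prpr.
case: eqP => [->|_]; last by rewrite mul0mx.
by rewrite -mulmxA comm1sd mulmxA prpr.
Qed.

Lemma pr_tr_idem l : pr l *m tr_idem l = tr_idem l.
Proof.
rewrite /tr_idem; case: ltnP => _; first exact: prpr.
case: eqP => [->|_]; last by rewrite mulmx0.
by rewrite mulmxA prpr.
Qed.

Let prpr0 l l' : l != l' -> pr l *m pr l' = 0.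
Proof. by move=> ne; rewrite degpr_degpr eqz_nat (negbTE ne). Qed.

Lemma tr_idem_orth l l' : l != l' -> tr_idem l *m tr_idem l' = 0.
Proof.
move=> ne; rewrite -tr_idem_pr -(pr_tr_idem l') mulmxA -(mulmxA _ (pr l)).
by rewrite prpr0 // mulmx0 mul0mx.
Qed.

Definition tr_proj : 'M[A]_r := \sum_(l < m.+1) tr_idem l.

Lemma row_tr_proj l (x : 'rV_r) : x *m pr l = x -> x *m tr_proj = x *m tr_idem l.
Proof.
move=> xl; rewrite -xl -!mulmxA pr_tr_idem mulmx_sumr.
have [lm|lm] := ltnP l m.+1.
  rewrite (bigD1 (Ordinal lm)) //= pr_tr_idem big1 ?addr0 // => i ne.
  rewrite -pr_tr_idem mulmxA prpr0 ?mul0mx // eq_sym.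
  by apply: contraNneq ne => e; apply/eqP/val_inj.
have -> : tr_idem l = 0.
  by rewrite /tr_idem ltnNge (ltnW lm) /= gtn_eqF.
rewrite big1 // => i _; rewrite -pr_tr_idem mulmxA prpr0 ?mul0mx //.
by rewrite gtn_eqF // (leq_trans _ lm).
Qed.

Lemma row_ext p (N N' : 'M[A]_(r, p)) :
  (forall l (x : 'rV_r), x *m pr l = x -> x *m N = x *m N') -> N = N'.
Proof.
move=> H; apply/row_matrixP => a; rewrite !rowE.
have := ap_pos h a; case e : (dg_deg X a) => [l|] // _.
apply: (H l); apply/rowP => b; rewrite mul_degpr mxE eqxx /=.
by have [->|] := eqVneq b a; rewrite ?e ?eqxx // if_same.
Qed.

Lemma tr_proj_lt l (x : 'rV_r) : (l < m)%N -> x *m pr l = x -> x *m tr_proj = x.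
Proof. by move=> lm xl; rewrite (row_tr_proj xl) /tr_idem lm xl. Qed.

Lemma tr_proj_eq (x : 'rV_r) : x *m pr m = x -> x *m tr_proj = x - x *m s *m d.
Proof.
move=> xl; rewrite (row_tr_proj xl) /tr_idem ltnn eqxx mulmxA xl.
by rewrite mulmxBr mulmx1 mulmxA.
Qed.

Lemma tr_proj_gt l (x : 'rV_r) : (m < l)%N -> x *m pr l = x -> x *m tr_proj = 0.
Proof.
move=> lm xl; rewrite (row_tr_proj xl) /tr_idem ltnNge (ltnW lm) /= gtn_eqF //.
by rewrite mulmx0.
Qed.

Let degd l (x : 'rV_r) : x *m pr l.+1 = x -> x *m d *m pr l = x *m d.
Proof. by move=> xl; rewrite -mulmxA -prd mulmxA xl. Qed.

Let dege l i (x : 'rV_r) : x *m pr l = x -> x *m dg_e X i *m pr l.+1 = x *m dg_e X i.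
Proof. by move=> xl; rewrite -mulmxA -pre mulmxA xl. Qed.

(** This says that the kernel of [tr_proj] is stable under [d], so the truncation is a quotient of
    [X]. In degree [m.+1] it uses that boundaries are killed in degree [m]. *)
Lemma tr_proj_d : tr_proj *m d *m tr_proj = d *m tr_proj.
Proof.
apply: row_ext => l x xl; rewrite !mulmxA.
have [lm|] := ltnP l m; first by rewrite (tr_proj_lt lm xl).
rewrite leq_eqVlt => /predU1P[e|ml].
  by subst l; rewrite (tr_proj_eq xl) mulmxBl -(mulmxA _ d d) dd mulmx0 subr0.
rewrite (tr_proj_gt ml xl) !mul0mx; case: l ml xl => // l ml xl.
move: ml; rewrite ltnS leq_eqVlt => /predU1P[e|ml]; last first.
  by rewrite (tr_proj_gt ml) // degd.
by subst l; rewrite tr_proj_eq ?degd // dsd // subrr.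
Qed.

Lemma tr_proj_e i : tr_proj *m dg_e X i *m tr_proj = dg_e X i *m tr_proj.
Proof.
apply: row_ext => l x xl; rewrite !mulmxA.
have [lm|] := ltnP l m; first by rewrite (tr_proj_lt lm xl).
rewrite leq_eqVlt => /predU1P[e|ml]; last first.
  rewrite (tr_proj_gt ml xl) !mul0mx (@tr_proj_gt l.+1) //.
    exact: ltnW.
  exact: dege.
subst l; rewrite (tr_proj_eq xl) mulmxBl mulmxBl [X in _ - X](_ : _ = 0) ?subr0 //.
rewrite (@tr_proj_gt m.+1) //; apply: dege.
by rewrite -(mulmxA x s d) -[LHS]mulmxA -prsd mulmxA xl.
Qed.

Lemma tr_proj_aug x : ap_aug phi q (x *m tr_proj) = ap_aug phi q x.
Proof.
have com : tr_proj *m pr 0 = pr 0 *m tr_proj.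
  rewrite mulmx_suml mulmx_sumr; apply: eq_bigr => l _.
  have [->|l0] := eqVneq (val l) 0%N; first by rewrite tr_idem_pr pr_tr_idem.
  rewrite -[in LHS]tr_idem_pr -[in RHS]pr_tr_idem -mulmxA prpr0 // mulmx0.
  by rewrite mulmxA prpr0 ?mul0mx // eq_sym.
rewrite -(ap_aug_degpr h) -mulmxA com mulmxA.
have xl : x *m pr 0 *m pr 0 = x *m pr 0 by rewrite -mulmxA prpr.
have [m0|m0] := posnP m; last by rewrite (tr_proj_lt m0 xl) (ap_aug_degpr h).
rewrite tr_proj_eq ?m0 // -[X in X - _]scale1r.
rewrite -[X in _ - X]scale1r -scaleNr -{1}[1]/(1 : A) addrC ap_aug_linear (ap_aug_d h).
by rewrite scaler0 add0r scale1r (ap_aug_degpr h).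
Qed.

Lemma col_tr_proj (l : int) (y : 'cV_r) : l < m%:Z -> degpr A (dg_deg X) l *m y = y ->
  tr_proj *m y = y.
Proof.
case: l => [l|l] lm yl; last first.
  suff -> : y = 0 by rewrite mulmx0.
  rewrite -yl; apply/colP => a; rewrite degpr_mul [RHS]mxE.
  by have := ap_pos h a; case: eqP => // ->.
rewrite -[in LHS]yl mulmxA -[in RHS]yl; congr (_ *m _).
rewrite mulmx_suml (bigD1 (Ordinal (ltnW lm : (l < m.+1)%N))) //=.
rewrite big1 ?addr0 => [|i ne].
  by have lm' : (l < m)%N by []; rewrite tr_idem_pr /tr_idem lm'.
by rewrite -tr_idem_pr -mulmxA prpr0 ?mulmx0.
Qed.

Lemma col_tr_proj_eq (y : 'cV_r) : d *m y = 0 -> pr m *m y = y -> tr_proj *m y = y.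
Proof.
move=> yd yl; rewrite -[in LHS]yl mulmxA mulmx_suml big_ord_recr /= big1 ?add0r.
  rewrite tr_idem_pr /tr_idem ltnn eqxx -mulmxA mulmxBl mul1mx -mulmxA yd mulmx0.
  by rewrite subr0.
move=> i _; rewrite -tr_idem_pr -mulmxA prpr0 ?mulmx0 //.
by rewrite ltn_eqF.
Qed.

Lemma col_tr_proj_gt (l : int) (y : 'cV_r) : m%:Z < l -> degpr A (dg_deg X) l *m y = y ->
  tr_proj *m y = 0.
Proof.
move=> ml yl; rewrite -yl mulmxA mulmx_suml big1 ?mul0mx // => i _.
rewrite -tr_idem_pr -mulmxA degpr_degpr; case: eqP => [e|_]; last by rewrite mulmx0.
by have := ltn_ord i; move: ml; rewrite -e; lia.
Qed.

Lemma truncation_model : exists E eta th, finite_model phi f (G := G) E eta th.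
Proof.
(* [V] is the quotient map from [X] onto the truncation and [U] an [A]-linear section of it; [Vd]
   and [Ve] say that [V] commutes with the transported operators. *)
have [r' [dg' [U [V [UV VU Uh Vh dg'0]]]]] :=
  graded_split rho_surj A_local tr_idem_idem tr_idem_orth pr_tr_idem tr_idem_pr m.+1.
rewrite -/tr_proj in VU.
have projV : tr_proj *m V = V by rewrite -VU -mulmxA UV mulmx1.
have Uproj : U *m tr_proj = U by rewrite -VU mulmxA UV mul1mx.
have Vd : V *m (U *m d *m V) = d *m V.
  by rewrite !mulmxA VU -[in RHS]projV -[in LHS]projV !mulmxA tr_proj_d.
have Ve i : V *m (U *m dg_e X i *m V) = dg_e X i *m V.
  by rewrite !mulmxA VU -[in RHS]projV -[in LHS]projV !mulmxA tr_proj_e.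
have MV (N N' : 'M[A]_r) : V *m (U *m N' *m V) = N' *m V ->
    (U *m N *m V) *m (U *m N' *m V) = U *m (N *m N') *m V.
  by move=> e; rewrite -[LHS]mulmxA e !mulmxA.
have [dd' ee eC de] := ap_laws h.
pose E := @DgMx A c r' dg' (U *m d *m V) (fun i => U *m dg_e X i *m V).
have dVy (y : 'cV_r') : U *m d *m V *m y = 0 -> d *m (V *m y) = 0.
  by move=> e; rewrite mulmxA -Vd -mulmxA e mulmx0.
have colV l (y : 'cV_r') : degpr A dg' l *m y = y ->
    degpr A (dg_deg X) l *m (V *m y) = V *m y.
  by move=> yl; rewrite mulmxA (hommx_degpr _ Vh) addr0 -mulmxA yl.
have colgt l (y : 'cV_r') : m%:Z < l -> degpr A dg' l *m y = y -> y = 0.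
  move=> ml yl; rewrite -[y]mul1mx -UV -mulmxA -projV -mulmxA.
  by rewrite (col_tr_proj_gt ml (colV _ _ yl)) mulmx0.
exists E, (fun x => ap_aug phi q (x *m U)), (fun j => ap_th t j *m map_mx phi V).
split=> /=.
- split=> /= [|i|i j|i].
  + by rewrite (MV _ _ Vd) dd' mulmx0 mul0mx.
  + by rewrite (MV _ _ (Ve i)) ee mulmx0 mul0mx.
  + by rewrite (MV _ _ (Ve j)) (MV _ _ (Ve i)) eC mulmxN mulNmx.
  + rewrite (MV _ _ (Ve i)) (MV _ _ Vd) -mulmxDl -mulmxDr de.
    by rewrite mul_mx_scalar -scalemxAl UV scalemx1.
- split=> /= [|i].
    by have := hommxM (hommxM Uh dh) Vh; rewrite add0r addr0.
  by have := hommxM (hommxM Uh (@eh i)) Vh; rewrite add0r addr0.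
- exact: dg'0.
- by move=> a x y; rewrite mulmxDl -scalemxAl ap_aug_linear.
- move=> x; rewrite !mulmxA -(mulmxA _ V U) VU tr_proj_aug; exact: ap_aug_d h _.
- move=> i x; rewrite !mulmxA -(mulmxA _ V U) VU tr_proj_aug; exact: ap_aug_e h _ _.
- move=> x; rewrite -mulmxA (hommx_degpr _ Uh) addr0 mulmxA; exact: ap_aug_degpr h _.
- move=> l x xl xd ax.
  have xUl : x *m U *m degpr A (dg_deg X) l = x *m U.
    by have := hommx_degpr l Uh; rewrite addr0 -mulmxA => <-; rewrite mulmxA xl.
  case: l xl xUl => [l|l] xl xUl; last first.
    exists 0; rewrite mul0mx -xl; apply/rowP => b; rewrite mul_degpr [RHS]mxE.
    by have := dg'0 b; case: eqP => // ->.
  have [lm|lm] := ltnP m l.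
    exists 0; rewrite mul0mx -[x]mulmx1 -UV mulmxA -projV mulmxA.
    by rewrite (tr_proj_gt lm xUl) mul0mx.
  have xUd : x *m U *m d = 0.
    have : x *m U *m d *m tr_proj = 0.
      by rewrite -VU !mulmxA -(mulmxA x U) -(mulmxA x) xd mul0mx.
    case: l lm xUl {xl} => [|l] lm xUl.
      have -> : x *m U *m d = 0; last by [].
      apply/rowP => b; rewrite -xUl -mulmxA (hommx_degpr _ dh) mulmxA mul_degpr [RHS]mxE.
      by have := ap_pos h b; case: eqP => // ->.
    by rewrite (tr_proj_lt lm) // degd.
  have [||w wP _] := ap_exact h _ xUl xUd _; first by rewrite ltnS leqW.
    by [].
  by exists (w *m V); rewrite -mulmxA Vd mulmxA -wP -mulmxA UV mulmx1.
- move=> y; have [x xP x0] := ap_aug_surj h y; exists (x *m V).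
  rewrite -mulmxA VU tr_proj_aug xP; split=> //.
  by rewrite -mulmxA -[X in degpr _ _ X]addr0 -(hommx_degpr _ Vh) mulmxA x0.
- move=> j; have := hommxM (ap_th_hom h (j := j)) (hommx_map (g := phi) Vh).
  by rewrite addr0.
- by rewrite -mulmxA -map_mxM Vd map_mxM mulmxA (ap_th_d0 h) mul0mx.
- move=> j; have [jm|jm] := ltnP j m.+2.
    by rewrite -mulmxA -map_mxM Vd map_mxM mulmxA (ap_th_d h) // -scalemxAl mulmxA.
  have prV l : (m < l)%N -> pr l *m V = 0.
    move=> ml; apply/row_matrixP => i; rewrite row_mul row0 -projV mulmxA.
    by rewrite (tr_proj_gt ml) ?mul0mx // -row_mul prpr.
  have -> : ap_th t j.+1 = 0 by rewrite /ap_th gproj_big ?trmx0 ?mul0mx.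
  have -> : ap_th t j *m map_mx phi V = 0; last by rewrite !mul0mx mulmx0 scaler0.
  have -> : ap_th t j = ap_th t j *m map_mx phi (pr (j + c)%N).
    apply/matrixP => a b; rewrite map_degpr mul_degpr.
    have [->|/(ap_th_hom h) ->] := eqVneq (ap_th t j a b) 0; first by rewrite if_same.
    by rewrite PoszD eqxx.
  rewrite -mulmxA -map_mxM prV ?map_mx0 ?mulmx0 //.
  by apply: leq_trans (leq_addr _ _); apply: leq_trans jm.
- by move=> j i; rewrite -mulmxA -map_mxM Ve map_mxM mulmxA (ap_th_e h) mul0mx.
- move=> l y yl yd th0 thS; have [ml|lm] := ltrP m%:Z l.
    by exists 0; rewrite mulmx0 (colgt _ _ ml yl).
  have [||w wP wl] := ap_dual_inj h (colV _ _ yl) (dVy _ yd).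
  + by rewrite map_mxM mulmxA.
  + by move=> j _; have [w wP] := thS j; exists w; rewrite map_mxM mulmxA.
  exists (U *m w); rewrite -[y]mul1mx -UV -mulmxA wP -!mulmxA (mulmxA V) VU.
  by rewrite (col_tr_proj _ wl) //; lia.
(* Where [j + c] exceeds [m] the truncated dual is zero, so the class has to be trivial, which is
   [dual_exact]; otherwise the lift from [X] survives truncation. *)
- move=> j v vd; have [mj|jm] := ltnP m (j + c)%N.
    exists 0; rewrite !mulmx0; split=> //.
    have := dual_exact mj vd; case: j v vd {mj} => [|j] v vd.
      by move=> ->; rewrite map_mx0 mulmx0.
    by move=> [w ->]; exists (- w); rewrite map_mx0 mulmx0 mulmxN subrr.
  have jm2 : (j < m.+2)%N by rewrite ltnS leqW // (leq_trans (leq_addr c j)).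
  have [y [yd yl [w wP]]] := ap_dual_surj h jm2 vd.
  have ty : tr_proj *m y = y.
    move: yl; rewrite -PoszD => yl; move: jm; rewrite leq_eqVlt => /predU1P[e|jm].
      by apply: col_tr_proj_eq => //; rewrite -e.
    exact: col_tr_proj yl.
  have VUy : V *m (U *m y) = y by rewrite mulmxA VU.
  exists (U *m y); split.
  + by rewrite -!mulmxA VUy yd mulmx0.
  + by rewrite mulmxA (hommx_degpr _ Uh) addr0 -mulmxA yl.
  + move: wP; case: j v vd yl jm jm2 {ty} => [|j] v vd yl jm jm2.
      by rewrite gprojT0_gD mul0mx addr0 -mulmxA -map_mxM VUy.
    rewrite gprojT_gD; last exact: ltnW.
    move=> wP; exists ((gproj G m.+2 j)^T *m w).
    by rewrite -mulmxA -map_mxM VUy wP mulmxA.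
Qed.

End Truncation.

Theorem finite_model_ex (A B : comNzRingType) (phi : {rmorphism A -> B})
    (k : fieldType) (rho : {rmorphism A -> k}) (c : nat) (f : 'I_c -> A)
    (M : lmodType B) (G : free_resolution M) :
  surjective rho -> local_ring A -> surjective phi -> regular_sequence f ->
  (forall a : A, phi a = 0 <-> in_ideal f predT a) -> finite_proj_dim phi M ->
  exists E eta th, finite_model phi f (G := G) E eta th.
Proof.
move=> rho_surj loc phi_surj reg kerP [P [dP [aug [m [Pp augs P0 Pe Pm]]]]].
have contr n X q t : approx phi f (G := G) n X q t ->
  exists s : 'M[A]_(dg_rk X), hommx (dg_deg X) (dg_deg X) 1 s /\
  forall l, (m < l < n)%N -> forall x : 'rV_(dg_rk X),
    x *m degpr A (dg_deg X) l%:Z = x -> x = x *m s *m dg_d X + x *m dg_d X *m s.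
  move=> h; have [s [sh hs]] := comparison_homotopy h Pp augs P0 Pe.
  by exists s; split=> // l /andP[ml ln]; apply: hs => //; apply: Pm.
(* The length [m.+2] makes degree [m.+1] fall inside the range of the contraction. *)
have [X [q [t h]]] := approx_ex G phi_surj reg kerP m.+2.
have [s [sh hs]] := contr _ _ _ _ h.
apply: (truncation_model rho_surj loc phi_surj reg kerP contr h sh).
by move=> x; apply: hs; rewrite !ltnSn.
Qed.

(** * Comparison with semifree resolutions *)

Section Basis.
Variables (A : comNzRingType) (F : lmodType A) (P : choiceType) (elt : P -> F).
Hypothesis span : forall x : F, exists (s : seq P) (a : P -> A),
  x = \sum_(p <- s) a p *: elt p.
Hypothesis indep : forall (s : seq P) (a : P -> A), uniq s ->
  \sum_(p <- s) a p *: elt p = 0 -> forall p, p \in s -> a p = 0.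

Definition inspan (D : P -> Prop) (x : F) : Prop :=
  exists (s : seq P) (a : P -> A),
    (forall p, p \in s -> D p) /\ x = \sum_(p <- s) a p *: elt p.

Lemma regroup (V : nmodType) (l : seq (P * A)) (G : P * A -> V) :
  \sum_(u <- l) G u = \sum_(p <- undup [seq u.1 | u <- l]) \sum_(u <- l | u.1 == p) G u.
Proof.
rewrite (exchange_big_dep xpredT) //= big_seq [RHS]big_seq.
apply: eq_bigr => u ul; rewrite -big_filter.
have e : [seq i <- undup [seq u.1 | u <- l] | u.1 == i] = [:: u.1].
  have -> : [seq i <- undup [seq u.1 | u <- l] | u.1 == i]
      = [seq i <- undup [seq u.1 | u <- l] | pred1 u.1 i].
    by apply: eq_filter => i; rewrite /= eq_sym.
  by rewrite filter_pred1_uniq ?undup_uniq // mem_undup map_f.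
by rewrite e big_seq1.
Qed.

Section Ext.
Variables (A' : comNzRingType) (psi : {rmorphism A -> A'}) (Z : lmodType A').

Lemma combination0 (w : P -> Z) (l : seq (P * A)) :
  \sum_(u <- l) u.2 *: elt u.1 = 0 -> \sum_(u <- l) psi u.2 *: w u.1 = 0.
Proof.
rewrite regroup => e.
have c0 p : p \in undup [seq u.1 | u <- l] -> \sum_(u <- l | u.1 == p) u.2 = 0.
  apply: (indep (a := fun p => \sum_(u <- l | u.1 == p) u.2) (undup_uniq _)).
  rewrite -[RHS]e; apply: eq_bigr => q _; rewrite scaler_suml.
  by apply: eq_bigr => u /eqP ->.
rewrite regroup big_seq big1 // => p /c0 h.
rewrite (eq_bigr (fun u => psi u.2 *: w p)); last by move=> u /eqP ->.
by rewrite -scaler_suml -rmorph_sum h rmorph0 scale0r.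
Qed.

(** Semilinear extension of values given on the basis. The last clause, dependence on the values
    over [D] alone, is the locality that [level_choice] asks for. *)
Lemma ext_ex : exists ext : (P -> Z) -> F -> Z,
  [/\ forall w a x y, ext w (a *: x + y) = psi a *: ext w x + ext w y,
      forall w p, ext w (elt p) = w p
    & forall w w' D x, inspan D x -> (forall p, D p -> w p = w' p) ->
        ext w x = ext w' x].
Proof.
have /choice[rep repP] x : exists l : seq (P * A), x = \sum_(u <- l) u.2 *: elt u.1.
  by have [s [a ->]] := span x; exists [seq (p, a p) | p <- s]; rewrite big_map.
pose ext (w : P -> Z) x := \sum_(u <- rep x) psi u.2 *: w u.1.
have extE w x (l : seq (P * A)) : x = \sum_(u <- l) u.2 *: elt u.1 ->
    ext w x = \sum_(u <- l) psi u.2 *: w u.1.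
  move=> xl; apply/eqP; rewrite -subr_eq0; apply/eqP.
  have := @combination0 w (rep x ++ [seq (u.1, - u.2) | u <- l]).
  rewrite !big_cat !big_map /= -repP.
  have -> : \sum_(u <- l) - u.2 *: elt u.1 = - x.
    by rewrite xl -sumrN; apply: eq_bigr => u _; rewrite scaleNr.
  rewrite subrr => /(_ erefl) h; rewrite -[RHS]h; congr (_ + _).
  by rewrite -sumrN; apply: eq_bigr => u _; rewrite rmorphN scaleNr.
exists ext; split.
- move=> w a x y.
  rewrite (extE w _ ([seq (u.1, a * u.2) | u <- rep x] ++ rep y)).
    rewrite big_cat big_map scaler_sumr; congr (_ + _).
    by apply: eq_bigr => u _; rewrite rmorphM scalerA.
  rewrite big_cat big_map /= -(repP y); congr (_ + _).
  by rewrite [in LHS](repP x) scaler_sumr; apply: eq_bigr => u _; rewrite scalerA.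
- move=> w p; rewrite (extE w _ [:: (p, 1)]).
    by rewrite big_seq1 rmorph1 scale1r.
  by rewrite big_seq1 scale1r.
- move=> w w' D x [s [a [sD xs]]] ww'.
  have xs' : x = \sum_(u <- [seq (p, a p) | p <- s]) u.2 *: elt u.1 by rewrite big_map.
  rewrite !(extE _ _ _ xs') !big_map !big_seq; apply: eq_bigr => p ps /=.
  by rewrite ww' //; apply: sD.
Qed.
End Ext.

Lemma inspan_lin D a x y : inspan D x -> inspan D y -> inspan D (a *: x + y).
Proof.
move=> [s [u [sD ->]]] [s' [u' [sD' ->]]].
pose l := [seq (p, a * u p) | p <- s] ++ [seq (p, u' p) | p <- s'].
exists (undup [seq v.1 | v <- l]), (fun p => \sum_(v <- l | v.1 == p) v.2); split.
  move=> p; rewrite mem_undup map_cat mem_cat -!map_comp.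
  by move=> /orP[] /mapP[q qs ->]; [apply: sD|apply: sD'].
transitivity (\sum_(v <- l) v.2 *: elt v.1).
  rewrite big_cat !big_map scaler_sumr; congr (_ + _).
  by apply: eq_bigr => p _; rewrite scalerA.
rewrite regroup; apply: eq_bigr => p _; rewrite scaler_suml.
by apply: eq_bigr => v /eqP <-.
Qed.

Lemma inspan0 D : inspan D 0.
Proof. by exists [::], (fun=> 0); rewrite big_nil. Qed.

Lemma inspan_elt (D : P -> Prop) p : D p -> inspan D (elt p).
Proof.
move=> Dp; exists [:: p], (fun=> 1); rewrite big_seq1 scale1r; split=> // q.
by rewrite inE => /eqP ->.
Qed.

Lemma inspanS (D D' : P -> Prop) x : (forall p, D p -> D' p) -> inspan D x -> inspan D' x.
Proof. by move=> h [s [a [sD ->]]]; exists s, a; split=> // p /sD /h. Qed.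

Lemma inspan_ind (D : P -> Prop) (Q : F -> Prop) : Q 0 ->
  (forall a x y, Q x -> Q y -> Q (a *: x + y)) -> (forall p, D p -> Q (elt p)) ->
  forall x, inspan D x -> Q x.
Proof.
move=> Q0 QD Qe x [s [a [sD ->]]]; rewrite big_seq.
by elim/big_rec: _ => // p y ps; apply: QD; apply/Qe/sD.
Qed.

Lemma inspanT x : inspan (fun=> True) x.
Proof. by have [s [a ->]] := span x; exists s, a. Qed.
End Basis.

Section ExteriorProducts.
Variables (c : nat).

Definition kmul (X : Type) (e : 'I_c -> X -> X) (I : {set 'I_c}) (y : X) : X :=
  foldr (fun i z => e i z) y (enum I).

Definition altops (X : zmodType) (e : 'I_c -> X -> X) : Prop :=
  [/\ forall i, e i 0 = 0, forall i, {morph e i : x / - x},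
      forall i x, e i (e i x) = 0
    & forall i j x, e i (e j x) = - e j (e i x)].

(** The sign in [e_i e_I] is the same for all alternating families of operators. This lets an
    extension from the [A]-basis of a semifree module commute with the [e_i] in any target. *)
Lemma kmul_e : exists sg : 'I_c -> {set 'I_c} -> bool,
  forall (X : zmodType) (e : 'I_c -> X -> X) i I y, altops e ->
    e i (kmul e I y) = if i \in I then 0 else
      if sg i I then - kmul e (i |: I) y else kmul e (i |: I) y.
Proof.
suff : forall i (I : {set 'I_c}), exists b : bool,
  forall (X : zmodType) (e : 'I_c -> X -> X) y, altops e ->
    e i (kmul e I y) = if i \in I then 0 else
      if b then - kmul e (i |: I) y else kmul e (i |: I) y.
  move=> h; have /choice[sg sgP] (p : 'I_c * {set 'I_c}) := h p.1 p.2.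
  by exists (fun i I => sg (i, I)) => X e i I y; apply: (sgP (i, I)).
move=> i I; rewrite /kmul /=.
have enE (J : {set 'I_c}) : enum J = [seq j <- enum 'I_c | j \in J].
  by rewrite enumT.
suff : forall l : seq 'I_c, uniq l -> i \in l -> exists b : bool,
  forall (X : zmodType) (e : 'I_c -> X -> X) y, altops e ->
    e i (foldr (fun i z => e i z) y [seq j <- l | j \in I]) = if i \in I then 0 else
      let z := foldr (fun i z => e i z) y [seq j <- l | j \in i |: I] in
      if b then - z else z.
  move=> /(_ _ (enum_uniq 'I_c) (mem_enum _ i))[b bP]; exists b => X e y he.
  by rewrite !enE bP.
elim=> // j l IH /= /andP[jl ul]; rewrite inE => /predU1P[ij|il].
  subst j; exists false => X e y [e0 eN ee eC]; rewrite !inE eqxx /=.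
  case: ifP => iI /=; first by rewrite ee.
  congr (e i _); congr foldr; apply: eq_in_filter => j jl'.
  by rewrite !inE; case: eqP => // ji; move: jl; rewrite -ji jl'.
have [b bP] := IH ul il.
have ji : j != i by apply: contraNneq jl => ->.
have [jI|jI] := boolP (j \in I).
  exists (~~ b) => X e y he; have [e0 eN ee eC] := he; rewrite !inE jI orbT /=.
  rewrite eC bP //; case: ifP => _; first by rewrite e0 oppr0.
  by case: b {bP}; rewrite /= ?eN ?opprK.
exists b => X e y he; rewrite !inE (negbTE ji) (negbTE jI) /=.
exact: bP.
Qed.

End ExteriorProducts.

Section Semifree.
Variables (A : comNzRingType) (c : nat) (f : 'I_c -> A) (F : koszul_dgmod f).
Variables (T : choiceType) (b : T -> F) (deg : T -> int) (lev : T -> nat).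
Local Notation P := (T * {set 'I_c})%type.
Definition kelt (p : P) : F := koszul_mul p.2 (b p.1).
Hypothesis b_deg : forall t, kdg_pr F (deg t) (b t) = b t.
Hypothesis span : forall x : F, exists (s : seq P) (a : P -> A),
  x = \sum_(p <- s) a p *: kelt p.
Hypothesis indep : forall (s : seq P) (a : P -> A), uniq s ->
  \sum_(p <- s) a p *: kelt p = 0 -> forall p, p \in s -> a p = 0.
Hypothesis filt : forall t, exists (s : seq P) (a : P -> A),
  (forall p, p \in s -> (lev p.1 < lev t)%N) /\
  kdg_d F (b t) = \sum_(p <- s) a p *: kelt p.

Lemma altops_kdg : altops (fun i => kdg_e F i).
Proof.
split=> [i|i x|i x|i j x]; rewrite ?linear0 ?linearN //.
  exact: kdg_ee.
exact: kdg_eC.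
Qed.

Definition spanT (D : T -> Prop) := inspan kelt (fun p => D p.1).

Lemma semifree_ind (D : T -> Prop) (Q : F -> Prop) : Q 0 ->
  (forall a x y, Q x -> Q y -> Q (a *: x + y)) ->
  (forall i x, Q x -> Q (kdg_e F i x)) -> (forall t, D t -> Q (b t)) ->
  forall x, spanT D x -> Q x.
Proof.
move=> Q0 QD Qe Qb; apply: inspan_ind => // -[t I] /= Dt.
by rewrite /kelt /koszul_mul /=; elim: (enum I) => [|i l IH] /=; [apply: Qb|apply: Qe].
Qed.

Lemma spanT_d t : spanT (fun t' => (lev t' < lev t)%N) (kdg_d F (b t)).
Proof. exact: filt. Qed.

Lemma kdg_pr_e j i x : kdg_pr F j (kdg_e F i x) = kdg_e F i (kdg_pr F (j - 1) x).
Proof. by rewrite kdg_e_deg subrK. Qed.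

Lemma kdg_pr_d j x : kdg_pr F j (kdg_d F x) = kdg_d F (kdg_pr F (j + 1) x).
Proof. by rewrite kdg_d_deg addrK. Qed.

Lemma kdg_prK j x : kdg_pr F j (kdg_pr F j x) = kdg_pr F j x.
Proof. by rewrite kdg_pr_pr eqxx. Qed.

Definition pdeg (p : P) : int := deg p.1 + #|p.2|%:Z.

Lemma kelt_deg p : kdg_pr F (pdeg p) (kelt p) = kelt p.
Proof.
rewrite /kelt /koszul_mul /pdeg cardE.
elim: (enum p.2) => [|i l IH] /=; first by rewrite addr0.
by rewrite kdg_pr_e -{2}IH -addn1 PoszD addrA addrK.
Qed.

Lemma inspan_deg D j x : inspan kelt D x -> kdg_pr F j x = x ->
  inspan kelt (fun p => D p /\ pdeg p = j) x.
Proof.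
move=> h <-; move: x h; apply: inspan_ind => [|a x y hx hy|p Dp].
- by rewrite linear0; apply: inspan0.
- by rewrite linearP; apply: inspan_lin.
- rewrite -kelt_deg kdg_pr_pr; case: eqP => [->|_]; last exact: inspan0.
  by rewrite kelt_deg; apply: inspan_elt.
Qed.

Section KExt.
Variables (A' : comNzRingType) (psi : {rmorphism A -> A'}) (Z : lmodType A').
Variable ext : (P -> Z) -> F -> Z.
Hypothesis ext_lin : forall w a x y, ext w (a *: x + y) = psi a *: ext w x + ext w y.
Hypothesis ext_elt : forall w p, ext w (kelt p) = w p.
Hypothesis ext_local : forall w w' D x, inspan kelt D x ->
  (forall p, D p -> w p = w' p) -> ext w x = ext w' x.
Variable eZ : 'I_c -> Z -> Z.
Hypothesis eZ_lin : forall i a x y, eZ i (a *: x + y) = a *: eZ i x + eZ i y.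
Hypothesis eZ_alt : altops eZ.

Definition kext (U : T -> Z) := ext (fun p => kmul eZ p.2 (U p.1)).

Lemma kext_lin U a x y : kext U (a *: x + y) = psi a *: kext U x + kext U y.
Proof. exact: ext_lin. Qed.

Lemma kext0 U : kext U 0 = 0.
Proof. by have := kext_lin U (-1) 0 0; rewrite scaler0 addr0 rmorphN1 scaleN1r addNr. Qed.

Lemma kextN U x : kext U (- x) = - kext U x.
Proof. by have := kext_lin U (-1) x 0; rewrite kext0 !addr0 rmorphN1 !scaleN1r. Qed.

Lemma kextD U x y : kext U (x + y) = kext U x + kext U y.
Proof. by have := kext_lin U 1 x y; rewrite rmorph1 !scale1r. Qed.

Lemma kextZ U a x : kext U (a *: x) = psi a *: kext U x.
Proof. by have := kext_lin U a x 0; rewrite kext0 !addr0. Qed.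

Lemma kext_b U t : kext U (b t) = U t.
Proof.
have -> : b t = kelt (t, finset.set0) by rewrite /kelt /koszul_mul enum_set0.
by rewrite /kext ext_elt /kmul enum_set0.
Qed.

Lemma kext_e U i x : kext U (kdg_e F i x) = eZ i (kext U x).
Proof.
have [eZ0 eZN _ _] := eZ_alt.
have [sg sgP] := kmul_e c.
move: x (inspanT span x); apply: inspan_ind => [|a x y hx hy|p _].
- by rewrite linear0 kext0 eZ0.
- by rewrite linearP !kext_lin eZ_lin hx hy.
rewrite /kext ext_elt (sgP Z eZ i p.2 (U p.1) eZ_alt).
have -> := sgP F (fun i => kdg_e F i) i p.2 (b p.1) altops_kdg.
case: ifP => _; first exact: kext0.
have E : kext U (kmul (fun i => kdg_e F i) (i |: p.2) (b p.1))
    = kmul eZ (i |: p.2) (U p.1) by apply: (ext_elt _ (p.1, i |: p.2)).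
by case: (sg i p.2); rewrite -/(kext U) ?kextN E.
Qed.

Lemma kext_local U U' D x : spanT D x -> (forall t, D t -> U t = U' t) ->
  kext U x = kext U' x.
Proof. by move=> h e; apply: ext_local h _ => p Dp; rewrite e. Qed.
End KExt.

End Semifree.

Record row_model (A B : comNzRingType) (phi : {rmorphism A -> B}) (c : nat)
    (f : 'I_c -> A) (E : dgmx A c) (N : cochain_complex B)
    (th : forall n, 'rV[A]_(dg_rk E) -> N n) : Prop := RowModel {
  rm_laws : klaws f predT E;
  rm_hom : khom E;
  rm_lin : forall n a x y, th n (a *: x + y) = phi a *: th n x + th n y;
  rm_deg : forall n x, th n (x *m degpr A (dg_deg E) (- n%:Z)) = th n x;
  rm_d0 : forall x, th 0%N (x *m dg_d E) = 0;
  rm_d : forall n x, th n.+1 (x *m dg_d E) = cc_d N n (th n x);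
  rm_e : forall n i x, th n (x *m dg_e E i) = 0;
  rm_inj : forall l x, x *m degpr A (dg_deg E) l = x -> x *m dg_d E = 0 ->
    (forall n, coboundary (th n x)) -> exists w, x = w *m dg_d E;
  rm_surj : forall n (z : N n), cc_d N n z = 0 -> exists x,
    [/\ x *m dg_d E = 0, x *m degpr A (dg_deg E) (- n%:Z) = x
      & coboundary (th n x - z)]
}.
Arguments row_model {A B} phi {c} f E N th.

Section Lift.
Variables (A B : comNzRingType) (phi : {rmorphism A -> B}).
Variables (c : nat) (f : 'I_c -> A) (F : koszul_dgmod f).
Variables (N : cochain_complex B).
Variables (T : choiceType) (b : T -> F) (deg : T -> int) (lev : T -> nat).
Local Notation P := (T * {set 'I_c})%type.
Local Notation kelt := (kelt b).
Hypothesis b_deg : forall t, kdg_pr F (deg t) (b t) = b t.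
Hypothesis span : forall x : F, exists (s : seq P) (a : P -> A),
  x = \sum_(p <- s) a p *: kelt p.
Hypothesis indep : forall (s : seq P) (a : P -> A), uniq s ->
  \sum_(p <- s) a p *: kelt p = 0 -> forall p, p \in s -> a p = 0.
Hypothesis filt : forall t, exists (s : seq P) (a : P -> A),
  (forall p, p \in s -> (lev p.1 < lev t)%N) /\
  kdg_d F (b t) = \sum_(p <- s) a p *: kelt p.
Variables (eps : forall n, {linear F -> N n | phi \; *:%R}).
Hypothesis eps_q : dg_quasi_iso eps.
Hypothesis phi_f : forall i, phi (f i) = 0.
Variables (E : dgmx A c) (th : forall n, 'rV[A]_(dg_rk E) -> N n).
Hypothesis hE : row_model phi f E N th.
Local Notation r := (dg_rk E).
Local Notation pr j := (degpr A (dg_deg E) j).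

Definition dN (nu : forall n, N n) (n : nat) : N n :=
  match n return N n with 0 => 0 | n'.+1 => cc_d N n' (nu n') end.

Let eE i (y : 'rV[A]_r) := y *m dg_e E i.
Let eN n (_ : 'I_c) (_ : N n) : N n := 0.

Let eE_lin i a x y : eE i (a *: x + y) = a *: eE i x + eE i y.
Proof. by rewrite /eE mulmxDl scalemxAl. Qed.
Let eE_alt : altops eE.
Proof.
have [_ ee eC _] := rm_laws hE.
split=> [i|i x|i x|i j x]; rewrite /eE ?mul0mx ?mulNmx //.
  by rewrite -mulmxA ee mulmx0.
by rewrite -!mulmxA eC mulmxN.
Qed.
Let eN_lin n i a x y : @eN n i (a *: x + y) = a *: @eN n i x + @eN n i y.
Proof. by rewrite /eN scaler0 addr0. Qed.
Let eN_alt n : altops (@eN n).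
Proof. by split=> [i|i x|i x|i j x]; rewrite /eN ?oppr0. Qed.

Let th0 n : th n 0 = 0.
Proof. by have := rm_lin hE n (-1) 0 0; rewrite scaler0 addr0 rmorphN1 scaleN1r addNr. Qed.
Let thN n x : th n (- x) = - th n x.
Proof. by have := rm_lin hE n (-1) x 0; rewrite th0 !addr0 rmorphN1 !scaleN1r. Qed.
Let thD n x y : th n (x + y) = th n x + th n y.
Proof. by have := rm_lin hE n 1 x y; rewrite rmorph1 !scale1r. Qed.

Lemma row_pr_d j (x : 'rV[A]_r) : x *m pr j *m dg_d E = x *m dg_d E *m pr (j - 1).
Proof. by have [dh _] := rm_hom hE; rewrite -mulmxA (hommx_degpr _ dh) mulmxA. Qed.
Lemma row_pr_e j i (x : 'rV[A]_r) : x *m pr j *m dg_e E i = x *m dg_e E i *m pr (j + 1).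
Proof. by have [_ eh] := rm_hom hE; rewrite -mulmxA (hommx_degpr _ (eh i)) mulmxA. Qed.

Lemma coboundary0 n : coboundary (0 : N n).
Proof. by case: n => //= n; exists 0; rewrite linear0. Qed.

Lemma th_other n j x : x *m pr j = x -> j != - n%:Z -> th n x = 0.
Proof.
move=> xj ne; rewrite -(rm_deg hE) -xj -mulmxA degpr_degpr (negbTE ne) mulmx0.
exact: th0.
Qed.

Lemma eps_other n j x : kdg_pr F j x = x -> j != - n%:Z -> eps n x = 0.
Proof.
have [e _ _ _ _] := eps_q.
by move=> xj ne; rewrite -e -xj kdg_pr_pr eq_sym (negbTE ne) linear0.
Qed.

(** As [F] is semifree and [th] is a quasi-isomorphism, [eps] lifts through [th] to a [K]-linear map
    [u], up to the homotopy [eta]. Both are constructed together on the semibasis by recursion on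
    its levels; [eta] vanishes on multiples of the [e_i] because these act as 0 on [N]. *)
Lemma lift_ex : exists (u : F -> 'rV[A]_r) (eta : forall n, F -> N n),
  [/\ forall a x y, u (a *: x + y) = a *: u x + u y,
      forall n a x y, eta n (a *: x + y) = phi a *: eta n x + eta n y,
      forall x, u (kdg_d F x) = u x *m dg_d E /\ forall i, u (kdg_e F i x) = u x *m dg_e E i,
      forall n x, th n (u x) - eps n x = dN (eta^~ x) n + eta n (kdg_d F x)
    & forall j x, u (kdg_pr F j x) = u x *m pr j].
Proof.
have [extE [E1 E2 E3]] := ext_ex span indep idfun 'rV[A]_r.
pose extN n := sval (cid (ext_ex span indep phi (N n))).
have extNP n := svalP (cid (ext_ex span indep phi (N n))).
pose X := ('rV[A]_r * forall n, N n)%type.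
pose u (U : T -> X) := kext extE eE (fun t => (U t).1).
pose eta (U : T -> X) n := kext (extN n) (@eN n) (fun t => (U t).2 n).
have uL U a x y : u U (a *: x + y) = a *: u U x + u U y by apply: kext_lin E1 _ _ _ _ _.
have u0 U : u U 0 = 0 by apply: kext0 E1 _ _.
have uB U x y : u U (x - y) = u U x - u U y by rewrite /u (kextD E1) (kextN E1).
have uZ U a x : u U (a *: x) = a *: u U x by apply: kextZ E1 _ _ _ _.
have ue U i x : u U (kdg_e F i x) = u U x *m dg_e E i.
  exact: (kext_e span E1 E2 eE_lin eE_alt).
have ub U t : u U (b t) = (U t).1 by apply: (kext_b E2).
have etaL U n a x y : eta U n (a *: x + y) = phi a *: eta U n x + eta U n y.
  by have [N1 _ _] := extNP n; apply: kext_lin N1 _ _ _ _ _.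
have eta0 U n : eta U n 0 = 0.
  by have [N1 _ _] := extNP n; apply: kext0 N1 _ _.
have etae U n i x : eta U n (kdg_e F i x) = 0.
  have [N1 N2 _] := extNP n.
  exact: (kext_e span N1 N2 (@eN_lin n) (@eN_alt n)).
have etab U n t : eta U n (b t) = (U t).2 n.
  by have [_ N2 _] := extNP n; apply: (kext_b N2).
have [epsd [eps0d epsd'] epse einj esurj] := eps_q.
have epsL n a x y : eps n (a *: x + y) = phi a *: eps n x + eps n y by exact: linearP.
pose hh U n x := th n (u U x) - eps n x = dN (fun n => eta U n x) n + eta U n (kdg_d F x).
(* The pair [y] holds the values of [u] and [eta] at [b t]. The third condition fixes the degree of
   [eta]: its component [n] can be nonzero only if [deg t = - n.+1]. *)
pose good t (U : T -> X) (y : X) :=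
  [/\ y.1 *m pr (deg t) = y.1, y.1 *m dg_d E = u U (kdg_d F (b t)),
      forall n, y.2 n = 0 \/ deg t = - n.+1%:Z
    & forall n, th n y.1 - eps n (b t) = dN y.2 n + eta U n (kdg_d F (b t))].
have prop D U : (forall t, D t -> good t U (U t)) -> forall x, spanT b D x ->
    [/\ u U (kdg_d F x) = u U x *m dg_d E, forall n, hh U n x,
        forall j, u U (kdg_pr F j x) = u U x *m pr j
      & forall n, eta U n (kdg_pr F (- n.+1%:Z) x) = eta U n x].
  move=> hg; apply: semifree_ind.
  - split=> [|n|j|n]; rewrite ?linear0 ?u0 ?mul0mx //.
      have ep0 : eps n 0 = 0 by apply: raddf0.
      have d0 : kdg_d F 0 = 0 by apply: raddf0.
      rewrite /hh d0 u0 th0 ep0 eta0 addr0 subr0.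
      by case: n {ep0} => //= n; rewrite eta0 linear0.
  - move=> a x y [x1 x2 x3 x4] [y1 y2 y3 y4]; split.
    + by rewrite linearP !uL x1 y1 mulmxDl scalemxAl.
    + move=> n; have hx := x2 n; have hy := y2 n; rewrite /hh in hx hy *.
      rewrite epsL linearP !uL !etaL (rm_lin hE) opprD addrACA -scalerBr hx hy.
      case: n {hx hy} => [|n] /=; rewrite ?etaL ?linearP /= scalerDr.
        by rewrite scaler0 !add0r.
      by rewrite addrACA.
    + by move=> j; rewrite linearP !uL x3 y3 mulmxDl scalemxAl.
    + by move=> n; rewrite linearP !etaL x4 y4.
  - move=> i x [x1 x2 x3 x4]; split.
    + have [_ _ _ de] := rm_laws hE; have /= e := de i.
      rewrite kdg_leibniz uB uZ !ue x1 -mul_mx_scalar -e mulmxDr !mulmxA.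
      by rewrite addrAC subrr add0r.
    + move=> n; rewrite /hh ue (rm_e hE) epse subr0 kdg_leibniz.
      have -> : dN (fun n => eta U n (kdg_e F i x)) n = 0.
        by case: (n) => //= n'; rewrite etae linear0.
      have [N1 _ _] := extNP n.
      by rewrite /eta (kextD N1) (kextN N1) (kextZ N1) -!/(eta _ _ _) etae phi_f
        scale0r oppr0 !addr0.
    + by move=> j; rewrite kdg_pr_e !ue x3 row_pr_e subrK.
    + by move=> n; rewrite kdg_pr_e !etae.
  - move=> t Dt; have [g1 g2 g3 g4] := hg t Dt; split.
    + by rewrite ub -g2.
    + move=> n; rewrite /hh ub g4; congr (_ + _).
      by case: (n) => //= n'; rewrite etab.
    + move=> j; rewrite -b_deg kdg_pr_pr; have [->|ne] := eqVneq j (deg t).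
        by rewrite b_deg ub g1.
      by rewrite u0 b_deg ub -g1 -mulmxA degpr_degpr eq_sym (negbTE ne) mulmx0.
    + move=> n; rewrite -b_deg kdg_pr_pr; case: eqP => [_|ne].
        by [].
      by rewrite eta0 b_deg etab; case: (g3 n) => // e; case: ne.
have [||U hU] := @level_choice T X lev good (0, fun=> 0).
- move=> t U U' y e [g1 g2 g3 g4].
  have ueq : u U (kdg_d F (b t)) = u U' (kdg_d F (b t)).
    by apply: (kext_local E3 _ (spanT_d filt t)) => t' lt; rewrite e.
  have etaeq n : eta U n (kdg_d F (b t)) = eta U' n (kdg_d F (b t)).
    have [_ _ N3] := extNP n.
    by apply: (kext_local N3 _ (spanT_d filt t)) => t' lt; rewrite e.
  split=> // [|n]; first by rewrite -ueq.
  by rewrite -etaeq.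
- move=> t U hlow; set x := kdg_d F (b t).
  have [p1 p2 p3 p4] := prop _ _ hlow x (filt t).
  have dx : kdg_d F x = 0 by apply: kdg_dd.
  have xdeg : kdg_pr F (deg t - 1) x = x by rewrite /x kdg_pr_d subrK b_deg.
  pose w := u U x.
  have wd : w *m dg_d E = 0 by rewrite -p1 dx u0.
  have wdeg : w *m pr (deg t - 1) = w by rewrite -p3 xdeg.
  have thw n : th n w = dN (fun n => eps n (b t) + eta U n x) n.
    have /eqP := p2 n; rewrite dx eta0 addr0 subr_eq => /eqP ->.
    case: n => [|n] /=; first by rewrite eps0d addr0.
    by rewrite linearD /= [in RHS]addrC -epsd'.
  have [n|y0 y0P] := rm_inj hE wdeg wd.
    by rewrite thw; case: n => //= n; eexists.
  pose y1 := y0 *m pr (deg t).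
  have y1d : y1 *m dg_d E = w by rewrite row_pr_d -y0P.
  have y1deg : y1 *m pr (deg t) = y1 by rewrite -mulmxA degpr_degpr eqxx.
  have btdeg := b_deg t.
  have etax n : deg t != - n%:Z -> eta U n x = 0.
    move=> ne; rewrite -p4 -xdeg kdg_pr_pr; case: eqP => [e|_]; last exact: eta0.
    by case/eqP: ne; lia.
  (* [nu y1] is the defect in the homotopy equation. It is a cocycle, so subtracting from [y1] a
     cycle with the same class makes the defect a coboundary, and a primitive of it is the value of
     [eta] at [b t]. *)
  pose nu y n := th n y - eps n (b t) - eta U n x.
  have nuc n : cc_d N n (nu y1 n) = 0.
    rewrite /nu !linearB /= -(rm_d hE) y1d thw /= linearD /= [LHS]addrAC addrK.
    exact: subrr.
  have nu0 y n : y *m pr (deg t) = y -> deg t != - n%:Z -> nu y n = 0.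
    move=> yt ne; rewrite /nu etax // (th_other yt) // (eps_other btdeg) //.
    by rewrite !subr0.
  have [y [yt yd yn]] : exists y, [/\ y *m pr (deg t) = y, y *m dg_d E = w
      & forall n, coboundary (nu y n)].
    case: (pselect (exists n : nat, deg t = - n%:Z)) => [[n0 tn0]|no].
      have [x1 [x1d x1t x1b]] := rm_surj hE (nuc n0); exists (y1 - x1).
      have yt : (y1 - x1) *m pr (deg t) = y1 - x1 by rewrite mulmxBl y1deg tn0 x1t.
      split=> // [|n]; first by rewrite mulmxBl x1d subr0.
      have [nn|nn] := eqVneq (deg t) (- n%:Z); last first.
        by rewrite nu0 //; apply: coboundary0.
      have -> : n = n0 by lia.
      have -> : nu (y1 - x1) n0 = - (th n0 x1 - nu y1 n0).
        by rewrite /nu thD thN opprB -!addrA; congr (_ + _); rewrite [LHS]addrC -!addrA.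
      case: (n0) x1b => /= [->|n' [v ->]]; first by rewrite oppr0.
      by exists (- v); rewrite linearN.
    exists y1; split=> // n; rewrite nu0 //; first exact: coboundary0.
    by apply/eqP => e; apply: no; exists n.
  have vex : forall m, exists v : N m, (deg t != - m.+1%:Z -> v = 0) /\
      cc_d N m v = nu y m.+1.
    move=> m; have [e|ne] := eqVneq (deg t) (- m.+1%:Z); last first.
      by exists 0; rewrite linear0 nu0.
    by have [v vP] := yn m.+1; exists v.
  pose v m := sval (cid (vex m)); have vP m := svalP (cid (vex m));
  exists (y, v); split=> //= n.
    by have [|/(vP n).1] := eqVneq (deg t) (- n.+1%:Z); [right|left].
  apply/eqP; rewrite -subr_eq; apply/eqP; rewrite -/(nu y n).
  case: n => [|n] /=; last by have [_ ->] := vP n.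
  exact: (yn 0%N).
exists (u U), (eta U).
have hp x := prop (fun=> True) U (fun t _ => hU t) x (inspanT span x).
split=> [a x y|n a x y|x|n x|j x].
- exact: uL.
- exact: etaL.
- by have [h1 _ _ _] := hp x; split=> // i; apply: ue.
- by have [_ h2 _ _] := hp x; apply: h2.
- by have [_ _ h3 _] := hp x.
Qed.

(** Two out of three: [eps] and [th] are isomorphisms on homology, and [th] after [u] is homotopic
    to [eps]. *)
Lemma lift_qiso : exists u : F -> 'rV[A]_r,
  [/\ forall a x y, u (a *: x + y) = a *: u x + u y,
      forall x, u (kdg_d F x) = u x *m dg_d E /\ forall i, u (kdg_e F i x) = u x *m dg_e E i,
      forall j x, u (kdg_pr F j x) = u x *m pr j,
      forall x, kdg_d F x = 0 -> (exists y, u x = y *m dg_d E) ->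
        exists w, x = kdg_d F w
    & forall j y, y *m pr j = y -> y *m dg_d E = 0 -> exists x w,
        [/\ kdg_pr F j x = x, kdg_d F x = 0 & u x = y + w *m dg_d E]].
Proof.
have [u [eta [uL etaL ued ueta upr]]] := lift_ex; exists u.
have [epsd [eps0d epsd'] epse einj esurj] := eps_q.
have u0 : u 0 = 0 by have := uL (-1) 0 0; rewrite scaler0 addr0 scaleN1r addNr.
have eta0 n : eta n 0 = 0.
  by have := etaL n (-1) 0 0; rewrite scaler0 addr0 rmorphN1 scaleN1r addNr.
have cobD n (x y : N n) : coboundary x -> coboundary y -> coboundary (x - y).
  case: n x y => [|n] x y /=; first by move=> -> ->; rewrite subr0.
  by move=> [x' ->] [y' ->]; exists (x' - y'); rewrite linearB.
have cobdN n nu : coboundary (dN nu n) by case: n => //= n; exists (nu n).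
have dpr j x : kdg_d F x = 0 -> kdg_d F (kdg_pr F j x) = 0.
  by move=> dx; rewrite kdg_d_deg dx linear0.
have epsu n x : kdg_d F x = 0 -> coboundary (th n (u x) - eps n x).
  by move=> dx; rewrite ueta dx eta0 addr0; apply: cobdN.
split=> // [x dx [y uy]|j y yj yd].
  apply: einj => // n.
  have -> : eps n x = th n (u x) - (th n (u x) - eps n x) by rewrite opprB addrCA subrr addr0.
  apply: cobD (epsu n x dx); rewrite uy.
  by case: (n) => [|n'] /=; [rewrite (rm_d0 hE)|exists (th n' y); rewrite (rm_d hE)].
have [x [xj dx xth]] : exists x, [/\ kdg_pr F j x = x, kdg_d F x = 0
    & forall n, coboundary (eps n x - th n y)].
  case: (pselect (exists n : nat, j = - n%:Z)) => [[n jn]|no]; last first.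
    exists 0; rewrite !linear0; split=> // n.
    have ep0 : eps n 0 = 0 by apply: raddf0.
    rewrite ep0 (th_other yj) ?subr0; first exact: coboundary0.
    by apply/eqP => e; apply: no; exists n.
  have [x [dx xz]] := esurj n (th n y) (etrans (esym (rm_d hE n y)) (etrans (congr1 _ yd) (th0 _))).
  exists (kdg_pr F j x); rewrite kdg_prK; split=> // [|m]; first exact: dpr.
  have [jm|jm] := eqVneq j (- m%:Z).
    by have -> : m = n by [lia]; rewrite jn epsd.
  by rewrite (th_other yj jm) (eps_other (kdg_prK _ _) jm) subr0; apply: coboundary0.
have [||n|w wP] := @rm_inj _ _ _ _ _ _ _ _ hE j (u x - y).
- by rewrite mulmxBl -upr xj yj.
- by rewrite mulmxBl yd subr0; have [<- _] := ued x; rewrite dx u0.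
- rewrite thD thN.
  have -> : th n (u x) - th n y = (th n (u x) - eps n x) - - (eps n x - th n y).
    by rewrite opprK addrA subrK.
  apply: (cobD n _ _ (epsu n x dx)).
  by have := cobD _ _ _ (coboundary0 n) (xth n); rewrite sub0r.
by exists x, w; rewrite -wP addrC subrK.
Qed.
End Lift.

Lemma inspan_sum (A : comNzRingType) (F : lmodType A) (P : choiceType) (elt : P -> F)
    (D : P -> Prop) (J : Type) (l : seq J) (G : J -> F) :
  (forall j, inspan elt D (G j)) -> inspan elt D (\sum_(j <- l) G j).
Proof.
move=> h; elim/big_rec: _ => [|j x _ hx]; first exact: inspan0.
by rewrite -[G j]scale1r; apply: inspan_lin.
Qed.

Lemma inspanZ (A : comNzRingType) (F : lmodType A) (P : choiceType) (elt : P -> F)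
    (D : P -> Prop) a x : inspan elt D x -> inspan elt D (a *: x).
Proof. by move=> h; rewrite -[a *: x]addr0; apply: inspan_lin h (inspan0 _ _). Qed.

(** * Contractions of semifree modules and of the cone of a comparison map *)

Section Cocone.
Variables (A : comNzRingType) (c : nat) (f : 'I_c -> A) (F : koszul_dgmod f).
Variables (T : choiceType) (b : T -> F) (deg : T -> int) (lev : T -> nat).
Local Notation P := (T * {set 'I_c})%type.
Local Notation kelt := (kelt b).
Hypothesis b_deg : forall t, kdg_pr F (deg t) (b t) = b t.
Hypothesis span : forall x : F, exists (s : seq P) (a : P -> A),
  x = \sum_(p <- s) a p *: kelt p.
Hypothesis indep : forall (s : seq P) (a : P -> A), uniq s ->
  \sum_(p <- s) a p *: kelt p = 0 -> forall p, p \in s -> a p = 0.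
Hypothesis filt : forall t, exists (s : seq P) (a : P -> A),
  (forall p, p \in s -> (lev p.1 < lev t)%N) /\
  kdg_d F (b t) = \sum_(p <- s) a p *: kelt p.

(** The differential of [e_I b_t] involves lower levels, or the same [t] with fewer exterior
    factors. Thus a semifree module over [K] is also filtered by free modules over [A]. *)
Lemma kelt_d (p : P) : inspan kelt (fun q : P => (lev q.1 < lev p.1)%N \/
  (q.1 = p.1 /\ (#|q.2| < #|p.2|)%N)) (kdg_d F (kelt p)).
Proof.
case: p => t I; rewrite /kelt /koszul_mul /= cardE.
suff h (l : seq 'I_c) : let z := foldr (fun i y => kdg_e F i y) (b t) l in
  inspan kelt (fun q : P => q.1 = t /\ (#|q.2| <= size l)%N) z /\
  inspan kelt (fun q : P => (lev q.1 < lev t)%N \/ (q.1 = t /\ (#|q.2| < size l)%N)) (kdg_d F z).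
  by have [] := h (enum I).
have ei i (D D' : P -> Prop) x : (forall q, D q -> forall J : {set 'I_c}, (#|J| <= #|q.2|.+1)%N -> D' (q.1, J)) ->
    inspan kelt D x -> inspan kelt D' (kdg_e F i x).
  move=> DD'; apply: (@inspan_ind _ _ _ kelt _ (fun x => inspan kelt D' (kdg_e F i x))) => [|a y z hy hz|p Dp].
  - by rewrite linear0; apply: inspan0.
  - by rewrite linearP; apply: inspan_lin.
  - have [sg sgP] := kmul_e c; have := sgP F (fun i => kdg_e F i) i p.2 (b p.1) (altops_kdg F).
    rewrite -/(kelt p) => e; rewrite [X in inspan _ _ X]e; case: ifP => _; first exact: inspan0.
    have h : inspan kelt D' (kelt (p.1, i |: p.2)).
      by apply: inspan_elt; apply: DD' => //; rewrite cardsU1; case: (_ \notin _).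
    by case: (sg _ _) => //; rewrite -scaleN1r; apply: inspanZ.
elim: l => [|i l [IH1 IH2]] /=; split.
- have -> : b t = kelt (t, finset.set0) by rewrite /kelt /koszul_mul enum_set0.
  by apply: inspan_elt; rewrite cards0.
- by apply: inspanS (filt t) => p h; left.
- by apply: ei IH1 => q [-> h] J hJ; split=> //; apply: leq_trans hJ _; rewrite ltnS.
- rewrite kdg_leibniz; apply: inspan_lin.
    by apply: inspanS IH1 => q [-> h]; right; rewrite ltnS.
  rewrite -scaleN1r; apply: inspanZ; apply: ei IH2 => q [h|[-> h]] J hJ; [by left|right].
  by split=> //; apply: leq_ltn_trans hJ _; rewrite ltnS.
Qed.

(** A contraction which anticommutes with the [e_i], and so causes no correction terms in the
    twisted differential. It will deal with cochains supported in very low degrees, where [E] is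
    zero and [F] is exact. *)
Lemma low_contraction_ex (a : int) :
  (forall j x, (j < a)%R -> kdg_pr F j x = x -> kdg_d F x = 0 -> exists y, x = kdg_d F y) ->
  exists s : F -> F,
  [/\ forall a x y, s (a *: x + y) = a *: s x + s y,
      forall i x, s (kdg_e F i x) = - kdg_e F i (s x),
      forall j x, kdg_pr F (j + 1) (s x) = s (kdg_pr F j x)
    & forall j x, (j < a)%R -> kdg_pr F j x = x -> kdg_d F (s x) + s (kdg_d F x) = x].
Proof.
move=> ex.
have [ext [e1 e2 e3]] := ext_ex span indep idfun F.
pose eZ i (x : F) := - kdg_e F i x.
have eZl i x y z : eZ i (x *: y + z) = x *: eZ i y + eZ i z.
  by rewrite /eZ linearP opprD scalerN.
have eZa : altops eZ.
  split=> [i|i x|i x|i j x]; rewrite /eZ.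
  - by rewrite raddf0 oppr0.
  - by rewrite raddfN.
  - by rewrite raddfN /= opprK kdg_ee.
  - by rewrite (raddfN (kdg_e F i)) (raddfN (kdg_e F j)) !opprK; apply: kdg_eC.
pose s U := kext ext eZ U.
have sL U x y z : s U (x *: y + z) = x *: s U y + s U z by apply: kext_lin e1 _ _ _ _ _.
have s0 U : s U 0 = 0 by apply: kext0 e1 _ _.
have sN U x : s U (- x) = - s U x by apply: kextN e1 _ _ _.
have sD U x y : s U (x + y) = s U x + s U y by apply: kextD e1 _ _ _ _.
have sZ U x y : s U (x *: y) = x *: s U y by apply: kextZ e1 _ _ _ _.
have se U i x : s U (kdg_e F i x) = - kdg_e F i (s U x).
  exact: (kext_e span e1 e2 eZl eZa).
have sb U t : s U (b t) = U t by apply: (kext_b e2).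
pose good t U y := kdg_pr F (deg t + 1) y = y /\
  ((deg t < a)%R -> kdg_d F y + s U (kdg_d F (b t)) = b t).
have prop1 (D : T -> Prop) U : (forall t, D t -> good t U (U t)) ->
    forall x, spanT b D x -> forall j, kdg_pr F (j + 1) (s U x) = s U (kdg_pr F j x).
  move=> hg; apply: semifree_ind => [j|x y z hy hz j|i x hx j|t Dt j].
  - by rewrite !(linear0, s0).
  - by rewrite linearP !sL linearP hy hz.
  - by rewrite kdg_pr_e !se linearN kdg_pr_e addrAC hx.
  - have [g1 _] := hg t Dt; rewrite sb -g1 -b_deg !kdg_pr_pr (inj_eq (addIr _)).
    by case: eqP => _; rewrite ?s0 // b_deg sb g1.
have prop2 (D : T -> Prop) U : (forall t, D t -> good t U (U t)) ->
    forall x, spanT b (fun t => D t /\ (deg t < a)%R) x ->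
    kdg_d F (s U x) + s U (kdg_d F x) = x.
  move=> hg; apply: semifree_ind => [|x y z hy hz|i x hx|t [Dt ta]].
  - by rewrite !(linear0, s0) addr0.
  - rewrite !(linearP, sL) /= -[in RHS]hy -[in RHS]hz scalerDr.
    by rewrite [LHS]addrACA.
  - rewrite se linearN /= !kdg_leibniz sD sZ sN se opprK opprB.
    by rewrite addrA subrK -linearD hx.
  - by have [_ g2] := hg t Dt; rewrite sb g2.
(* The [e_i] raise degrees, so an element of degree below [a] involves only those [b t] of degree
   below [a]. *)
have low (D : T -> Prop) (j : int) x : (j < a)%R -> kdg_pr F j x = x -> spanT b D x ->
    spanT b (fun t => D t /\ (deg t < a)%R) x.
  move=> ja xj hx; apply: inspanS (inspan_deg b_deg hx xj) => q [Dq qj].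
  split=> //; have h : (deg q.1 <= pdeg deg q)%R by rewrite lerDl.
  by apply: le_lt_trans h _; rewrite qj.
have [||U hU] := @level_choice _ F lev good 0.
- move=> t U U' y e [g1 g2]; split=> // ta; rewrite -[RHS]g2 //; congr (_ + _).
  by apply/esym; apply: (kext_local e3 _ (spanT_d filt t)) => t' lt; rewrite e.
- move=> t U hlow; have [ta|ta] := ltrP (deg t) a; last first.
    by exists 0; split; rewrite ?linear0 // ltNge ta.
  set x := kdg_d F (b t).
  have xdeg : kdg_pr F (deg t - 1) x = x by rewrite /x kdg_pr_d subrK b_deg.
  have sx : kdg_d F (s U x) = x.
    rewrite -[RHS](prop2 _ _ hlow); first by rewrite /x kdg_dd s0 addr0.
    by apply: low xdeg (spanT_d filt t); lia.
  have [||y y1] := ex (deg t) (b t - s U x) ta.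
  + rewrite linearB /= b_deg; congr (_ - _).
    by have := prop1 _ _ hlow x (spanT_d filt t) (deg t - 1); rewrite subrK xdeg.
  + by rewrite linearB /= sx subrr.
  exists (kdg_pr F (deg t + 1) y); split=> [|_]; first exact: kdg_prK.
  rewrite -kdg_pr_d -y1 linearB /= b_deg.
  have := prop1 _ _ hlow x (spanT_d filt t) (deg t - 1).
  by rewrite subrK xdeg => ->; rewrite subrK.
exists (s U); split=> [x y z|i x|j x|j x ja xj]; [exact: sL|exact: se| |].
  by apply: (prop1 (fun=> True) U (fun t _ => hU t)); apply: inspanT.
apply: (prop2 (fun=> True) U (fun t _ => hU t)).
by apply: low ja xj _; apply: inspanT.
Qed.
Variables (E : dgmx A c).
Local Notation r := (dg_rk E).
Local Notation pr j := (degpr A (dg_deg E) j).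
Hypothesis E_laws : klaws f predT E.
Hypothesis E_hom : khom E.
Variable u : F -> 'rV[A]_r.
Hypothesis u_lin : forall a x y, u (a *: x + y) = a *: u x + u y.
Hypothesis u_d : forall x, u (kdg_d F x) = u x *m dg_d E.
Hypothesis u_e : forall x i, u (kdg_e F i x) = u x *m dg_e E i.
Hypothesis u_pr : forall j x, u (kdg_pr F j x) = u x *m pr j.
Hypothesis u_inj : forall x, kdg_d F x = 0 -> (exists y, u x = y *m dg_d E) ->
  exists w, x = kdg_d F w.
Hypothesis u_surj : forall j y, y *m pr j = y -> y *m dg_d E = 0 -> exists x w,
  [/\ kdg_pr F j x = x, kdg_d F x = 0 & u x = y + w *m dg_d E].

(** The homotopy fibre of [u]: an element of [E] of degree [j + 1] is placed in degree [j]. *)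
Definition cone : lmodType A := (F * 'rV[A]_r)%type.
Implicit Types w : cone.

Definition cone_d w : cone := (kdg_d F w.1, u w.1 - w.2 *m dg_d E).
Definition cone_e i w : cone := (kdg_e F i w.1, - (w.2 *m dg_e E i)).
Definition cone_pr j w : cone := (kdg_pr F j w.1, w.2 *m pr (j + 1)).

Lemma u0 : u 0 = 0.
Proof. by have := u_lin (-1) 0 0; rewrite scaler0 addr0 scaleN1r addNr. Qed.
Lemma uN x : u (- x) = - u x.
Proof. by have := u_lin (-1) x 0; rewrite u0 !addr0 !scaleN1r. Qed.
Lemma uD x y : u (x + y) = u x + u y.
Proof. by have := u_lin 1 x y; rewrite !scale1r. Qed.

Lemma cone_d_lin a w w' : cone_d (a *: w + w') = a *: cone_d w + cone_d w'.
Proof.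
rewrite /cone_d /= linearP u_lin; congr (_, _).
rewrite [RHS](_ : _ = a *: (u w.1 - w.2 *m dg_d E) + (u w'.1 - w'.2 *m dg_d E)) //.
by rewrite mulmxDl -scalemxAl scalerBr opprD addrACA.
Qed.
Lemma cone_e_lin i a w w' : cone_e i (a *: w + w') = a *: cone_e i w + cone_e i w'.
Proof.
rewrite /cone_e /= linearP; congr (_, _).
rewrite [RHS](_ : _ = a *: - (w.2 *m dg_e E i) + - (w'.2 *m dg_e E i)) //.
by rewrite mulmxDl -scalemxAl opprD scalerN.
Qed.
Lemma cone_pr_lin j a w w' : cone_pr j (a *: w + w') = a *: cone_pr j w + cone_pr j w'.
Proof. by rewrite /cone_pr /= linearP mulmxDl -scalemxAl. Qed.

Lemma cone_dd w : cone_d (cone_d w) = 0.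
Proof.
have [dd _ _ _] := E_laws.
by rewrite /cone_d /= kdg_dd u_d mulmxBl -(mulmxA w.2) dd mulmx0 subr0 subrr.
Qed.

Lemma cone_leibniz i w : cone_d (cone_e i w) = f i *: w - cone_e i (cone_d w).
Proof.
have [_ _ _ /(_ i) /= de] := E_laws.
rewrite /cone_d /cone_e /= kdg_leibniz u_e; congr (_, _).
rewrite [RHS](_ : _ = f i *: w.2 + - - ((u w.1 - w.2 *m dg_d E) *m dg_e E i)) //.
rewrite mulNmx !opprK mulmxBl -mul_mx_scalar -de mulmxDr !mulmxA.
by rewrite [RHS]addrC addrA subrK.
Qed.

Lemma cone_pr_d j w : cone_pr j (cone_d w) = cone_d (cone_pr (j + 1) w).
Proof.
rewrite /cone_pr /cone_d /= kdg_pr_d u_pr mulmxBl; congr (_, _ - _).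
by have [dh _] := E_hom; rewrite -!mulmxA (hommx_degpr _ dh) addrK.
Qed.

Lemma cone_pr_e j i w : cone_pr (j + 1) (cone_e i w) = cone_e i (cone_pr j w).
Proof.
rewrite /cone_pr /cone_e /= kdg_pr_e addrK mulNmx; congr (_, - _).
by have [_ eh] := E_hom; rewrite -!mulmxA (hommx_degpr _ (eh i)).
Qed.

Lemma cone_pr_pr i j w : cone_pr i (cone_pr j w) = if i == j then cone_pr j w else 0.
Proof.
rewrite /cone_pr /= kdg_pr_pr -mulmxA degpr_degpr (inj_eq (addIr _)) eq_sym.
by case: eqP => [->|_] //; rewrite mulmx0.
Qed.

Lemma cone_exact j w : cone_pr j w = w -> cone_d w = 0 -> exists2 w',
  cone_pr (j + 1) w' = w' & w = cone_d w'.
Proof.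
case: w => x y [xj yj] [dx /eqP]; rewrite subr_eq0 => /eqP uy.
have [|x' xx'] := u_inj dx; first by exists y.
pose x1 := kdg_pr F (j + 1) x'.
have dx1 : kdg_d F x1 = x by rewrite -kdg_pr_d -xx' xj.
have [||x2 [v [x2j dx2 ux2]]] := @u_surj (j + 1) (u x1 - y).
- by rewrite mulmxBl yj -u_pr kdg_prK.
- by rewrite mulmxBl -u_d dx1 uy subrr.
pose v' := v *m pr (j + 2).
have v'd : v' *m dg_d E = v *m dg_d E *m pr (j + 1).
  have [dh _] := E_hom; rewrite /v' -mulmxA (hommx_degpr _ dh) mulmxA.
  by congr (_ *m degpr _ _ _); lia.
exists (x1 - x2, - v').
  rewrite /cone_pr /= linearB /= kdg_prK x2j mulNmx -mulmxA degpr_degpr.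
  by have -> : j + 1 + 1 = j + 2 by [lia]; rewrite eqxx.
rewrite /cone_d /= linearB /= dx1 dx2 subr0; congr (_, _).
rewrite uD uN ux2 mulNmx opprK v'd.
have -> : v *m dg_d E *m pr (j + 1) = v *m dg_d E.
  have -> : v *m dg_d E = u x2 - (u x1 - y) by rewrite ux2 addrC addKr.
  by rewrite !mulmxBl -!u_pr kdg_prK x2j yj.
by rewrite opprD opprB addrA addrCA subrr addr0 subrK.
Qed.

Definition cone_elt (q : P + 'I_r) : cone :=
  match q with inl p => (kelt p, 0) | inr i => (0, delta_mx 0 i) end.
Definition cone_deg (q : P + 'I_r) : int :=
  match q with inl p => pdeg deg p | inr i => dg_deg E i - 1 end.
Let L : nat := \sum_i `|dg_deg E i|%N.
Let Lle i : (`|dg_deg E i| <= L)%N.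
Proof. by rewrite /L (bigD1 i) //= leq_addr. Qed.
(** Generators of [E] take the levels 0 to [L + L], by degree. Those of [F] lie above, ordered first
    by [lev] and then by the number of exterior factors; the factor [c.+1] exceeds that number. *)
Definition cone_lev (q : P + 'I_r) : nat :=
  match q with
  | inl p => (L + L).+1 + lev p.1 * c.+1 + #|p.2|
  | inr i => `|dg_deg E i + L|
  end.

Lemma cone_elt_deg q j : cone_pr j (cone_elt q) = if cone_deg q == j then cone_elt q else 0.
Proof.
rewrite /cone_pr; case: q => [p|i] /=.
  rewrite mul0mx -(kelt_deg b_deg p) kdg_pr_pr eq_sym.
  by case: eqP => // _; rewrite kelt_deg.
rewrite linear0 subr_eq; have -> : delta_mx 0 i *m pr (j + 1)
    = if dg_deg E i == j + 1 then delta_mx 0 i else 0 :> 'rV[A]_r.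
  apply/rowP => l; rewrite mul_degpr !mxE eqxx /=.
  case: (eqVneq l i) => [->|ne]; first by case: ifP; rewrite ?mxE ?eqxx.
  by rewrite if_same; case: ifP => _; rewrite mxE // (negbTE ne) andbF.
by case: eqP.
Qed.

Lemma cone_split w : w = (w.1, 0 : 'rV[A]_r) + (0 : F, w.2) :> cone.
Proof. by case: w => x y; congr (_, _); rewrite ?addr0 ?add0r. Qed.

Lemma inspan_cone_l (D : P -> Prop) (D' : P + 'I_r -> Prop) x :
  (forall p, D p -> D' (inl p)) -> inspan kelt D x ->
  inspan cone_elt D' ((x, 0) : cone).
Proof.
move=> DD'; apply: (@inspan_ind _ _ _ kelt _ (fun x => inspan cone_elt D' ((x, 0) : cone))).
- exact: inspan0.
- move=> a y z hy hz.
  have -> : (a *: y + z, 0) = a *: (y, 0) + (z, 0) :> cone.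
    by rewrite [RHS](_ : _ = (a *: y + z, a *: 0 + 0)) // scaler0 addr0.
  exact: inspan_lin.
- by move=> p /DD' h; apply: (inspan_elt cone_elt h).
Qed.

Lemma inspan_cone_r (D' : P + 'I_r -> Prop) (y : 'rV[A]_r) :
  (forall i, y 0 i != 0 -> D' (inr i)) -> inspan cone_elt D' ((0, y) : cone).
Proof.
move=> h; have -> : (0, y) = \sum_i y 0 i *: cone_elt (inr i) :> cone.
  rewrite [y in LHS]row_sum_delta.
  elim/big_rec2: _ => // i y1 y2 _ <-.
  by rewrite [RHS](_ : _ = (y 0 i *: 0 + 0, y 0 i *: delta_mx 0 i + y2)) // scaler0 addr0.
apply: inspan_sum => i; have [->|ne] := eqVneq (y 0 i) 0.
  by rewrite scale0r; apply: inspan0.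
by apply: inspanZ; apply: inspan_elt; apply: h.
Qed.

Lemma cone_span w : exists (s : seq (P + 'I_r)) (a : P + 'I_r -> A),
  w = \sum_(q <- s) a q *: cone_elt q.
Proof.
suff [s [a [_ ->]]] : inspan cone_elt (fun=> True) w by exists s, a.
rewrite (cone_split w) -[(w.1, _)]scale1r; apply: inspan_lin.
  exact: (inspan_cone_l _ (inspanT span w.1)).
exact: inspan_cone_r.
Qed.

Lemma cone_indep (s : seq (P + 'I_r)) (a : P + 'I_r -> A) : uniq s ->
  \sum_(q <- s) a q *: cone_elt q = 0 -> forall q, q \in s -> a q = 0.
Proof.
move=> us s0.
have s01 : \sum_(q <- s) a q *: (cone_elt q).1 = 0.
  transitivity ((\sum_(q <- s) a q *: cone_elt q).1); last by rewrite s0.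
  by elim/big_rec2: _ => // i y1 y2 _ ->.
have s02 : \sum_(q <- s) a q *: (cone_elt q).2 = 0.
  transitivity ((\sum_(q <- s) a q *: cone_elt q).2); last by rewrite s0.
  by elim/big_rec2: _ => // i y1 y2 _ ->.
move=> [p|i] qs.
  pose g (q : P + 'I_r) := if q is inl p then Some p else None.
  apply: (indep (s := pmap g s) (a := fun p => a (inl p))).
  - by have gK : ocancel g inl by [case]; apply: (pmap_uniq gK).
  - rewrite -[RHS]s01; elim: (s) => [|[p'|i'] s' IH] /=; rewrite ?big_nil // !big_cons IH //=.
    by rewrite scaler0 add0r.
  - by rewrite mem_pmap; apply/mapP; exists (inl p).
have := congr1 (fun y : 'rV[A]_r => y 0 i) s02.
rewrite summxE (bigD1_seq (inr i)) //= !mxE !eqxx mulr1 big1_seq ?addr0 //.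
move=> [p|j] /andP[ne _]; rewrite !mxE ?mulr0 // eqxx /=.
by have [e|_] := eqVneq i j; [rewrite e eqxx in ne|rewrite mulr0].
Qed.

Lemma cone_lev_d q : inspan cone_elt (fun q' => (cone_lev q' < cone_lev q)%N)
  (cone_d (cone_elt q)).
Proof.
have rr i j : dg_deg E i = dg_deg E j - 1 -> (cone_lev (inr i) < cone_lev (inr j))%N.
  by rewrite /cone_lev => e; have := Lle i; have := Lle j; lia.
have rl i p : (cone_lev (inr i) < cone_lev (inl p))%N.
  by rewrite /cone_lev; have := Lle i; lia.
case: q => [p|j]; rewrite /cone_d /=.
  rewrite mul0mx subr0 (cone_split (_, _)) /= -[(kdg_d F _, _)]scale1r.
  apply: inspan_lin; last by apply: inspan_cone_r => i _; apply: rl.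
  apply: inspan_cone_l (kelt_d p) => q /= h.
  have q2 : (#|q.2| <= c)%N by have := max_card (mem q.2); rewrite card_ord.
  case: h => [h|[-> h]]; last by rewrite ltn_add2l.
  have : ((lev q.1).+1 * c.+1 <= lev p.1 * c.+1)%N by rewrite leq_mul2r h orbT.
  move: q2; set m := #|q.2|; rewrite mulSn; lia.
rewrite linear0 u0 sub0r; apply: inspan_cone_r => i.
rewrite mxE oppr_eq0 -rowE mxE => /E_hom.1 e; exact: rr.
Qed.

(** An acyclic complex filtered by free modules is contractible. This contraction is only
    [A]-linear: it is built on an [A]-basis and takes no account of the [e_i]. *)
Lemma contraction_ex : exists sg : cone -> cone,
  [/\ forall a w w', sg (a *: w + w') = a *: sg w + sg w',
      forall j w, cone_pr (j + 1) (sg w) = sg (cone_pr j w)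
    & forall w, cone_d (sg w) + sg (cone_d w) = w].
Proof.
have [ext [e1 e2 e3]] := ext_ex cone_span cone_indep idfun cone.
have e0 U : ext U 0 = 0.
  by have := e1 U (-1) 0 0; rewrite scaler0 addr0 /= scaleN1r addNr.
have eN U w : ext U (- w) = - ext U w.
  by have := e1 U (-1) w 0; rewrite e0 !addr0 /= !scaleN1r.
have eD U w w' : ext U (w + w') = ext U w + ext U w'.
  by have := e1 U 1 w w'; rewrite /= !scale1r.
have d0 : cone_d 0 = 0.
  by have := cone_d_lin (-1) 0 0; rewrite scaler0 addr0 scaleN1r addNr.
have dN w : cone_d (- w) = - cone_d w.
  by have := cone_d_lin (-1) w 0; rewrite d0 !addr0 !scaleN1r.
have dD w w' : cone_d (w + w') = cone_d w + cone_d w'.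
  by have := cone_d_lin 1 w w'; rewrite !scale1r.
have p0 j : cone_pr j 0 = 0.
  by have := cone_pr_lin j (-1) 0 0; rewrite scaler0 addr0 scaleN1r addNr.
pose good q U (y : cone) := cone_pr (cone_deg q + 1) y = y /\
  cone_d y + ext U (cone_d (cone_elt q)) = cone_elt q.
have prop (D : P + 'I_r -> Prop) U : (forall q, D q -> good q U (U q)) ->
    forall w, inspan cone_elt D w ->
    cone_d (ext U w) + ext U (cone_d w) = w /\
    forall j, cone_pr (j + 1) (ext U w) = ext U (cone_pr j w).
  move=> hg; apply: inspan_ind.
  - by split=> [|j]; rewrite ?(d0, e0, p0) ?addr0.
  - move=> a w w' [h1 h2] [h1' h2']; split=> [|j].
      rewrite !(cone_d_lin, e1) /= -[in RHS]h1 -[in RHS]h1' scalerDr.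
      by rewrite [LHS]addrACA.
    by rewrite !(cone_pr_lin, e1) h2 h2'.
  - move=> q Dq; have [g1 g2] := hg q Dq; rewrite e2; split=> // j.
    rewrite cone_elt_deg; case: eqP => [<-|ne]; first by rewrite g1 e2.
    rewrite -g1 cone_pr_pr e0; case: eqP => // /addIr e.
    by case: ne.
have [||U hU] := @level_choice _ cone cone_lev good 0.
- move=> q U U' y e [g1 g2]; split=> //; rewrite -[RHS]g2; congr (_ + _).
  by apply/esym; apply: e3 (cone_lev_d q) _ => q' lt; rewrite e.
- move=> q U hlow; set w := cone_d (cone_elt q).
  have [h1 h2] := prop _ _ hlow w (cone_lev_d q).
  have qdeg : cone_pr (cone_deg q) (cone_elt q) = cone_elt q by rewrite cone_elt_deg eqxx.
  have [||y y1 y2] := @cone_exact (cone_deg q) (cone_elt q - ext U w).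
  + have := h2 (cone_deg q - 1); rewrite subrK /w cone_pr_d subrK qdeg => e.
    have := cone_pr_lin (cone_deg q) (-1) (ext U w) (cone_elt q).
    by rewrite e qdeg !scaleN1r addrC => ->; rewrite addrC.
  + rewrite dD dN; have := h1; rewrite {2}/w cone_dd e0 addr0 => ->.
    by rewrite subrr.
  by exists y; split=> //; rewrite -y2 subrK.
exists (ext U); split=> [a w w'|j w|w]; first exact: e1.
  by have [_ ->] := prop (fun=> True) U (fun q _ => hU q) w (inspanT cone_span w).
by have [-> _] := prop (fun=> True) U (fun q _ => hU q) w (inspanT cone_span w).
Qed.

End Cocone.

Lemma quot_pi_eq0 (R : comNzRingType) (V : lmodType R) (W : {pred V})
    (Wc : GRing.submod_closed W) x : (quot_pi Wc x = 0) <-> x \in W.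
Proof.
have q0 : quot_pi Wc 0 = 0 by apply: (@addrI _ (quot_pi Wc 0)); rewrite -quot_piD !addr0.
have e : (quot_pi Wc x == 0) = (x \in W).
  by rewrite -q0 /quot_pi -Quotient.idealrBE subr0.
by rewrite -e; split => [->|/eqP].
Qed.

Lemma sum_alternating (V : zmodType) c (a : 'I_c -> 'I_c -> V) :
  (forall i, a i i = 0) -> (forall i j, a i j = - a j i) ->
  \sum_i \sum_j a i j = 0.
Proof.
move=> a0 aN.
have E i : \sum_j a i j = \sum_(j : 'I_c | (i < j)%N) a i j + \sum_(j : 'I_c | (j < i)%N) a i j.
  rewrite (bigID (fun j : 'I_c => (i < j)%N)) /=; congr (_ + _).
  rewrite (bigID (pred1 i)) /= big1 ?add0r => [|j /andP[_ /eqP -> //]].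
  by apply: eq_bigl => j; rewrite -leqNgt ltn_neqAle andbC.
under eq_bigr do rewrite E; rewrite big_split /= (exchange_big_dep xpredT) //=.
rewrite -big_split big1 // => i _ /=.
rewrite -big_split big1 // => j _ /=; by rewrite aN addNr.
Qed.

(** * Twisted cochains and their homology *)

Section Model.
Variables (A B : comNzRingType) (k : fieldType).
Variables (phi : {rmorphism A -> B}) (pi : {rmorphism B -> k}).
Variables (c : nat) (f : 'I_c -> A) (F : koszul_dgmod f).
Hypothesis phi_f : forall i, phi (f i) = 0.
Local Notation S := {mpoly k[c]}.

Definition psi : {rmorphism A -> S} := @mpolyC c k \o (pi \o phi).

Lemma psiE a (s : S) : psi a * s = pi (phi a) *: s.
Proof. by rewrite /psi /= mul_mpolyC. Qed.

Lemma psi_f i : psi (f i) = 0.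
Proof. by rewrite /psi /= phi_f !rmorph0. Qed.

Definition dgDelta (E : dgmx A c) : 'M[S]_(dg_rk E) :=
  map_mx psi (dg_d E) - \sum_i 'X_i *: map_mx psi (dg_e E i).

Definition colhom r (dg : 'I_r -> int) (n : int) (v : 'cV[S]_r) : Prop :=
  forall i m, m \in msupp (v i 0) -> dg i + (2 * mdeg m)%:Z = n.

(** [kappa] induces an isomorphism from the homology of [D] on columns onto [Ext], matching the
    gradings; only its values on cycles carry meaning. *)
Definition models r (dg : 'I_r -> int) (D : 'M[S]_r) : Prop :=
  exists kappa : 'cV[S]_r -> Ext phi pi F,
  [/\ forall s v w, D *m v = 0 -> D *m w = 0 ->
        kappa (s *: v + w) = s *: kappa v + kappa w,
      forall x, exists2 v, D *m v = 0 & x = kappa v,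
      forall v, D *m v = 0 -> (kappa v = 0 <-> exists w, v = D *m w)
    & forall n x, x \in Ext_degree n <->
        exists v, [/\ D *m v = 0, colhom dg n v & x = kappa v]].

(* The differential of cochains, stripped of its signs. *)
Definition twdiff (Z : Type) (d : Z -> Z) (e : 'I_c -> Z -> Z) (g : Z -> S) (x : Z) : S :=
  g (d x) - \sum_i 'X_i * g (e i x).

Definition semilin (Z : lmodType A) (g : Z -> S) : Prop :=
  forall a x y, g (a *: x + y) = psi a * g x + g y.

Section Semilin.
Variables (Z : lmodType A) (g : Z -> S).
Hypothesis g_lin : semilin g.
Lemma semilin0 : g 0 = 0.
Proof. by have := g_lin (-1) 0 0; rewrite scaler0 addr0 rmorphN1 mulN1r addNr. Qed.
Lemma semilinD x y : g (x + y) = g x + g y.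
Proof. by have := g_lin 1 x y; rewrite scale1r rmorph1 mul1r. Qed.
Lemma semilinZ a x : g (a *: x) = psi a * g x.
Proof. by have := g_lin a x 0; rewrite addr0 semilin0 addr0. Qed.
Lemma semilinN x : g (- x) = - g x.
Proof. by rewrite -scaleN1r semilinZ rmorphN1 mulN1r. Qed.
Lemma semilin_sum (J : Type) (l : seq J) (G : J -> Z) :
  g (\sum_(j <- l) G j) = \sum_(j <- l) g (G j).
Proof. by elim/big_rec2: _ => [|j y1 y2 _ <-]; rewrite ?semilin0 ?semilinD. Qed.
End Semilin.

Section Twdiff.
Variables (Z : lmodType A) (d : Z -> Z) (e : 'I_c -> Z -> Z).
Hypothesis d_lin : forall a x y, d (a *: x + y) = a *: d x + d y.
Hypothesis e_lin : forall i a x y, e i (a *: x + y) = a *: e i x + e i y.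
Hypothesis dd : forall x, d (d x) = 0.
Hypothesis e_alt : altops e.
Hypothesis leib : forall i x, d (e i x) = f i *: x - e i (d x).

Lemma twdiff_lin g : semilin g -> semilin (twdiff d e g).
Proof.
move=> gl a x y; rewrite /twdiff d_lin gl mulrBr -addrA -[RHS]addrA; congr (_ + _).
rewrite [RHS]addrCA; congr (_ + _); rewrite mulr_sumr -!sumrN -big_split /=.
by apply: eq_bigr => i _; rewrite e_lin gl mulrDr opprD mulrCA.
Qed.

Lemma twdiffD g h x : twdiff d e (fun x => g x + h x) x = twdiff d e g x + twdiff d e h x.
Proof.
rewrite /twdiff addrACA -opprD -big_split; congr (_ - _).
by apply: eq_bigr => i _; rewrite mulrDr.
Qed.

Lemma twdiffN g x : twdiff d e (fun x => - g x) x = - twdiff d e g x.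
Proof. by rewrite /twdiff opprB addrC; congr (_ - _); rewrite -sumrN; apply: eq_bigr => i _; rewrite mulrN opprK. Qed.

Lemma twdiff2 g : semilin g -> forall x, twdiff d e (twdiff d e g) x = 0.
Proof.
move=> gl x; have [e0 eN ee eC] := e_alt.
rewrite /twdiff dd (semilin0 gl) sub0r.
under [X in _ - X]eq_bigr => i _ do
  rewrite leib (semilinD gl) (semilinZ gl) psi_f mul0r add0r (semilinN gl) mulrBr mulrN.
rewrite big_split /= !sumrN opprD !opprK addrA addNr add0r.
under eq_bigr => i _ do rewrite mulr_sumr.
apply: (sum_alternating (a := fun i j => 'X_i * ('X_j * g (e j (e i x))))) => [i|i j].
  by rewrite ee (semilin0 gl) !mulr0.
by rewrite eC (semilinN gl) !mulrN mulrCA.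
Qed.

Variable sg : Z -> Z.
Hypothesis sg_lin : forall a x y, sg (a *: x + y) = a *: sg x + sg y.
Hypothesis sgd : forall x, d (sg x) + sg (d x) = x.

(** What is left of a twisted cocycle [g] after subtracting the twisted coboundary of [g \o sg]. It
    measures the failure of [sg] to anticommute with the [e_i]. *)
Definition twshift (g : Z -> S) (x : Z) : S := \sum_i 'X_i * g (e i (sg x) + sg (e i x)).

Lemma twshiftE g : semilin g -> (forall x, twdiff d e g x = 0) ->
  forall x, g x = twdiff d e (g \o sg) x + twshift g x.
Proof.
move=> gl g0 x; rewrite -{1}(sgd x) (semilinD gl).
have /eqP := g0 (sg x); rewrite subr_eq0 => /eqP ->.
rewrite /twdiff /twshift /= addrC -addrA; congr (_ + _).
rewrite addrC -sumrB; apply: eq_bigr => i _.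
by rewrite (semilinD gl) mulrDr addrK.
Qed.

Lemma twshift_lin g : semilin g -> semilin (twshift g).
Proof.
move=> gl a x y; rewrite /twshift mulr_sumr -big_split; apply: eq_bigr => i _ /=.
rewrite sg_lin !e_lin sg_lin addrACA -scalerDr gl mulrDr; congr (_ + _).
by rewrite mulrCA.
Qed.
End Twdiff.

Section Homogeneous.
Variables (Z : lmodType A) (pr : int -> Z -> Z) (d : Z -> Z) (e : 'I_c -> Z -> Z).
Variable sg : Z -> Z.
Hypothesis d_lin : forall a x y, d (a *: x + y) = a *: d x + d y.
Hypothesis e_lin : forall i a x y, e i (a *: x + y) = a *: e i x + e i y.
Hypothesis dd : forall x, d (d x) = 0.
Hypothesis e_alt : altops e.
Hypothesis leib : forall i x, d (e i x) = f i *: x - e i (d x).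
Hypothesis sg_lin : forall a x y, sg (a *: x + y) = a *: sg x + sg y.
Hypothesis sgd : forall x, d (sg x) + sg (d x) = x.
Hypothesis pr_sg : forall j x, pr (j + 1) (sg x) = sg (pr j x).
Hypothesis pr_e : forall i j x, pr (j + 1) (e i x) = e i (pr j x).
Hypothesis pr_lin : forall j a x y, pr j (a *: x + y) = a *: pr j x + pr j y.

Definition bounded_cochain (g : Z -> S) : Prop :=
  semilin g /\ exists n : nat, forall x, (msize (g x) <= n)%N /\
    forall j : int, (n < `|j|)%N -> g (pr j x) = 0.

Definition gradedcochain (n : int) (g : Z -> S) : Prop :=
  forall j x m, m \in msupp (g (pr j x)) -> j + (2 * mdeg m)%:Z = n.

Lemma bounded_cochainD g h : bounded_cochain g -> bounded_cochain h ->
  bounded_cochain (fun x => g x + h x).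
Proof.
move=> [gl [m gb]] [hl [n hb]]; split=> [a x y|].
  by rewrite gl hl mulrDr addrACA.
exists (m + n)%N => x; split.
  apply: leq_trans (msizeD_le _ _) _; rewrite geq_max.
  by rewrite (leq_trans (gb x).1 (leq_addr _ _)) (leq_trans (hb x).1 (leq_addl _ _)).
move=> j jn; rewrite (gb x).2 ?(hb x).2 ?addr0 //.
  by apply: leq_ltn_trans jn; rewrite leq_addl.
by apply: leq_ltn_trans jn; rewrite leq_addr.
Qed.

Lemma gradedcochainD n g h : gradedcochain n g -> gradedcochain n h ->
  gradedcochain n (fun x => g x + h x).
Proof. by move=> hg hh j x m /msuppD_le; rewrite mem_cat => /orP[/hg|/hh]. Qed.

Lemma bounded_cochain_sg g : bounded_cochain g -> bounded_cochain (g \o sg).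
Proof.
move=> [gl [m gb]]; split=> [a x y|]; first by rewrite /= sg_lin gl.
exists m.+1 => x; split; first by apply: leq_trans (gb _).1 _.
by move=> j jm; rewrite /= -pr_sg (gb _).2 //; lia.
Qed.

Lemma gradedcochain_sg n g : gradedcochain n g -> gradedcochain (n - 1) (g \o sg).
Proof. by move=> hg j x m; rewrite /= -pr_sg => /hg; lia. Qed.

Lemma twshift_pr g j x : twshift e sg g (pr j x)
  = \sum_i 'X_i * g (pr (j + 2) (e i (sg x) + sg (e i x))).
Proof.
apply: eq_bigr => i _; congr (_ * g _).
have prD j' y z : pr j' (y + z) = pr j' y + pr j' z.
  by have := pr_lin j' 1 y z; rewrite !scale1r.
have -> : j + 2 = j + 1 + 1 by lia.
by rewrite prD pr_e pr_sg pr_sg pr_e.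
Qed.

Lemma bounded_cochain_twshift g : bounded_cochain g -> bounded_cochain (twshift e sg g).
Proof.
move=> [gl [m gb]]; split; first exact: twshift_lin.
exists m.+3 => x; split.
  apply: leq_trans (msize_sum _ _ _) _; apply/bigmax_leqP => i _.
  have sX : msize ('X_i : S) = 2%N by rewrite msizeX mdeg1.
  apply: leq_trans (msizeM_le _ _) _; rewrite sX !ltnS.
  by apply: leq_trans (gb _).1 _.
move=> j jm; rewrite twshift_pr big1 // => i _.
by rewrite (gb _).2 ?mulr0 //; lia.
Qed.

Lemma gradedcochain_twshift n g : gradedcochain n g -> gradedcochain n (twshift e sg g).
Proof.
move=> hg j x m; rewrite twshift_pr => /msupp_sum_le /flatten_mapP[i _].
rewrite mulrC (perm_mem (msuppMX _ _)) => /mapP[m' /hg <- ->].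
by rewrite mdegD mdeg1; lia.
Qed.

(** Each use of [twshiftE] gives a cohomologous cocycle whose support lies two degrees lower, since
    [e_i] and [sg] both raise degrees by one. The total degree is unchanged because every [chi_i]
    has degree 2. *)
Lemma cochain_descent g (N : int) l : bounded_cochain g ->
  (forall x, twdiff d e g x = 0) -> (forall j x, (N <= j)%R -> g (pr j x) = 0) ->
  exists h r, [/\ bounded_cochain h, bounded_cochain r,
    forall x, g x = twdiff d e h x + r x /\ twdiff d e r x = 0,
    forall j x, (N - (2 * l)%:Z <= j)%R -> r (pr j x) = 0
  & forall n, gradedcochain n g -> gradedcochain (n - 1) h /\ gradedcochain n r].
Proof.
elim: l => [|l IH] gb g0 gN.
  exists (fun=> 0), g; split=> //.
  - split=> [a x y|]; first by rewrite mulr0 addr0.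
    by exists 0%N => x; rewrite msize0.
  - by move=> x; rewrite g0 /twdiff big1 ?subr0 ?add0r // => i _; rewrite mulr0.
  - by move=> j x h; apply: gN; lia.
  - by move=> n gn; split=> // j x m; rewrite msupp0.
have [h [r [hb rb E rN hn]]] := IH gb g0 gN.
have rE := twshiftE sgd rb.1 (fun x => (E x).2).
exists (fun x => h x + r (sg x)), (twshift e sg r); split.
- by apply: bounded_cochainD => //; apply: bounded_cochain_sg.
- exact: bounded_cochain_twshift.
- move=> x; rewrite twdiffD -addrA -(rE x); split; first exact: (E x).1.
  have -> : twdiff d e (twshift e sg r) x
      = twdiff d e (fun x => r x + - twdiff d e (r \o sg) x) x.
    rewrite /twdiff; congr (_ - _); last (apply: eq_bigr => i _; congr (_ * _)).
      by rewrite [in RHS]rE addrC addKr.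
    by rewrite [in RHS]rE addrC addKr.
  rewrite twdiffD (E x).2 add0r twdiffN twdiff2 ?oppr0 //.
  by have [] := bounded_cochain_sg rb.
- by move=> j x hj; rewrite twshift_pr big1 // => i _; rewrite rN ?mulr0 //; lia.
- move=> n /hn[h1 h2]; split; last exact: gradedcochain_twshift.
  by apply: gradedcochainD => //; apply: gradedcochain_sg.
Qed.
End Homogeneous.
End Model.

Lemma sign_absz_pred (R : pzRingType) (j : int) : (-1) ^+ `|j - 1| = - (-1) ^+ `|j| :> R.
Proof.
have [[n ->]|[n ->]] : (exists n : nat, j = n%:Z) \/ exists n : nat, j = - n.+1%:Z.
  - by case: j => n; [left|right]; exists n; rewrite ?NegzE.
- case: n => [|n]; first by rewrite sub0r abszN expr1 expr0.
  have -> : n.+1%:Z - 1 = n by lia.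
  by rewrite !absz_nat exprS mulN1r opprK.
- have -> : - n.+1%:Z - 1 = - n.+2%:Z by lia.
  by rewrite !abszN !absz_nat [(-1) ^+ n.+2]exprS mulN1r.
Qed.

Lemma sign_absz_succ (R : pzRingType) (j : int) : (-1) ^+ `|j + 1| = - (-1) ^+ `|j| :> R.
Proof. by rewrite -{2}(addrK 1 j) sign_absz_pred opprK. Qed.

Section Model.
Variables (A B : comNzRingType) (k : fieldType).
Variables (phi : {rmorphism A -> B}) (pi : {rmorphism B -> k}).
Variables (c : nat) (f : 'I_c -> A) (F : koszul_dgmod f).
Hypothesis phi_f : forall i, phi (f i) = 0.
Local Notation S := {mpoly k[c]}.
Variables (T : choiceType) (b : T -> F) (deg : T -> int) (lev : T -> nat).
Local Notation P := (T * {set 'I_c})%type.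
Local Notation kelt := (kelt b).
Hypothesis b_deg : forall t, kdg_pr F (deg t) (b t) = b t.
Hypothesis span : forall x : F, exists (s : seq P) (a : P -> A),
  x = \sum_(p <- s) a p *: kelt p.
Hypothesis indep : forall (s : seq P) (a : P -> A), uniq s ->
  \sum_(p <- s) a p *: kelt p = 0 -> forall p, p \in s -> a p = 0.
Hypothesis filt : forall t, exists (s : seq P) (a : P -> A),
  (forall p, p \in s -> (lev p.1 < lev t)%N) /\
  kdg_d F (b t) = \sum_(p <- s) a p *: kelt p.
Variables (E : dgmx A c).
Local Notation r := (dg_rk E).
Local Notation pr j := (degpr A (dg_deg E) j).
Hypothesis E_laws : klaws f predT E.
Hypothesis E_hom : khom E.
Variable u : F -> 'rV[A]_r.
Hypothesis u_lin : forall a x y, u (a *: x + y) = a *: u x + u y.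
Hypothesis u_d : forall x, u (kdg_d F x) = u x *m dg_d E.
Hypothesis u_e : forall x i, u (kdg_e F i x) = u x *m dg_e E i.
Hypothesis u_pr : forall j x, u (kdg_pr F j x) = u x *m pr j.
Hypothesis u_inj : forall x, kdg_d F x = 0 -> (exists y, u x = y *m dg_d E) ->
  exists w, x = kdg_d F w.
Hypothesis u_surj : forall j y, y *m pr j = y -> y *m dg_d E = 0 -> exists x w,
  [/\ kdg_pr F j x = x, kdg_d F x = 0 & u x = y + w *m dg_d E].

Local Notation psi := (psi phi pi c).
Local Notation Dl := (twdiff (kdg_d F) (fun i => kdg_e F i)).
Local Notation D := (dgDelta phi pi E).
Local Notation cone := (cone F E).
Local Notation cDl := (twdiff (cone_d u) (@cone_e A c f F E)).
Local Notation semilin := (semilin phi pi).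
Local Notation bcF := (bounded_cochain phi pi (fun j => kdg_pr F j)).
Local Notation bcW := (bounded_cochain phi pi (@cone_pr A c f F E)).
Local Notation hF := (gradedcochain (fun j => kdg_pr F j)).
Local Notation hW := (gradedcochain (@cone_pr A c f F E)).

Lemma cochainE (g : F -> S^o) : cochain phi pi g <-> bcF g.
Proof.
split=> [[gl gb]|[gl gb]]; split=> // a x y; first by rewrite gl psiE.
by rewrite gl psiE.
Qed.

(** Composition with this sign operator carries the signed differential of [cochain_diff] to
    [twdiff]. *)
Lemma twist_ex : exists tau : F -> F,
  (forall a x y, tau (a *: x + y) = a *: tau x + tau y) /\
  forall j x, tau (kdg_pr F j x) = (-1) ^+ `|j| *: kdg_pr F j x.
Proof.
have [ext [e1 e2 _]] := ext_ex span indep idfun F.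
pose w (p : P) := (-1) ^+ `|pdeg deg p| *: kelt p.
exists (ext w); split=> [a x y|j x]; first exact: e1.
have e0 : ext w 0 = 0.
  by have := e1 w (-1) 0 0; rewrite scaler0 addr0 /= scaleN1r addNr.
move: x (inspanT span x); apply: inspan_ind => [|a x y hx hy|p _].
- by rewrite linear0 e0 scaler0.
- by rewrite linearP e1 hx hy scalerDr /= !scalerA mulrC.
- rewrite -(kelt_deg b_deg p) kdg_pr_pr; case: eqP => [->|_].
    by rewrite kelt_deg // e2.
  by rewrite e0 scaler0.
Qed.

Lemma pr_ext (g h : F -> S) : semilin g -> semilin h ->
  (forall j x, g (kdg_pr F j x) = h (kdg_pr F j x)) -> g =1 h.
Proof.
move=> gl hl gh x; have [s [_ ->]] := kdg_pr_sum x.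
by rewrite (semilin_sum gl) (semilin_sum hl); apply: eq_bigr => j _.
Qed.

Lemma Dl_lin g : semilin g -> semilin (Dl g).
Proof. by move=> gl; apply: twdiff_lin => // *; rewrite linearP. Qed.

Lemma zero_semilin : semilin (fun _ : F => 0 : S).
Proof. by move=> a x y; rewrite mulr0 addr0. Qed.

Lemma cochain_diff0P (g : F -> S^o) : semilin g ->
  (cochain_diff g 0 <-> forall x, Dl g x = 0).
Proof.
move=> gl; split=> [h|h j x]; last first.
  by rewrite -/(Dl g (kdg_pr F j x)) h mulr0.
apply: (pr_ext (Dl_lin gl) zero_semilin) => j x.
by have /esym/eqP := h j x; rewrite mulrI_eq0 => [/eqP //|]; apply: lreg_sign.
Qed.

Lemma cochain_diffP (g : F -> S^o) : semilin g ->
  (exists h, cochain phi pi h /\ cochain_diff h g) <->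
  exists2 h, bcF h & forall x, g x = Dl h x.
Proof.
move=> gl; have [tau [tl tpr]] := twist_ex.
have td j x h : semilin h -> Dl (fun x => - h (tau x)) (kdg_pr F j x)
    = (-1) ^+ `|j| * Dl h (kdg_pr F j x).
  move=> hl; rewrite twdiffN /twdiff kdg_d_deg tpr -kdg_d_deg (semilinZ hl).
  rewrite rmorphXn rmorphN1 sign_absz_pred mulNr -opprD opprK mulrBr; congr (_ + _).
  rewrite mulr_sumr -sumrN; apply: eq_bigr => i _.
  rewrite kdg_e_deg tpr -kdg_e_deg (semilinZ hl) rmorphXn rmorphN1 sign_absz_succ.
  by rewrite mulNr mulrN mulrCA.
have bt h : bcF h -> bcF (fun x => - h (tau x)).
  move=> [hl [n hb]]; split=> [a x y|].
    by rewrite tl hl opprD mulrN.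
  exists n => x; rewrite msizeN; split=> [|j jn]; first by have [] := hb (tau x).
  by rewrite tpr (semilinZ hl) (hb x).2 // mulr0 oppr0.
split=> [[h [/cochainE hc hd]]|[h hc hd]].
  exists (fun x => - h (tau x)); first exact: bt.
  apply: pr_ext => //; first by apply: Dl_lin; have [] := bt _ _ hc.
  by move=> j x; rewrite td ?hd //; case: hc.
exists (fun x => - h (tau x)); split; first by apply/cochainE/bt.
move=> j x; rewrite -/(Dl (fun x => - h (tau x)) (kdg_pr F j x)) td; last by case: hc.
by rewrite mulrA -exprD addnn -mul2n exprM sqrrN !expr1n mul1r hd.
Qed.

Lemma rowfun (K : 'rV[A]_r -> S) : semilin K -> forall y,
  K y = (map_mx psi y *m \col_i K (delta_mx 0 i)) 0 0.
Proof.
move=> Kl y; rewrite {1}[y]row_sum_delta (semilin_sum Kl) mxE.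
by apply: eq_bigr => i _; rewrite (semilinZ Kl) !mxE.
Qed.

Lemma rowfun_D (v : 'cV[S]_r) y (K := fun y : 'rV[A]_r => (map_mx psi y *m v) 0 0) :
  K (y *m dg_d E) - \sum_i 'X_i * K (y *m dg_e E i) = (map_mx psi y *m (D *m v)) 0 0.
Proof.
rewrite /K /D mulmxBl mulmxBr [RHS]mxE map_mxM mulmxA; congr (_ + _).
rewrite [RHS]mxE mulmx_suml mulmx_sumr summxE; congr (- _); apply: eq_bigr => i _.
by rewrite -scalemxAl -scalemxAr [RHS]mxE map_mxM mulmxA.
Qed.

Definition gv (v : 'cV[S]_r) (x : F) : S := (map_mx psi (u x) *m v) 0 0.

Lemma row_semilin (v : 'cV[S]_r) : semilin (fun y : 'rV[A]_r => (map_mx psi y *m v) 0 0).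
Proof. by move=> a x y; rewrite map_mxD map_mxZ mulmxDl -scalemxAl !mxE. Qed.

Lemma gv_lin v : semilin (gv v).
Proof. by move=> a x y; rewrite /gv u_lin row_semilin. Qed.

Lemma Dl_gv v x : Dl (gv v) x = gv (D *m v) x.
Proof.
by rewrite /twdiff /gv -rowfun_D u_d; congr (_ - _); apply: eq_bigr => i _; rewrite u_e.
Qed.

Let L : nat := \sum_i `|dg_deg E i|%N.
Let Lle i : (`|dg_deg E i| <= L)%N.
Proof. by rewrite /L (bigD1 i) //= leq_addr. Qed.

Lemma row_pr_far j (y : 'rV[A]_r) : (L < `|j|)%N -> y *m pr j = 0.
Proof.
move=> Lj; apply/rowP => i; rewrite mul_degpr [RHS]mxE; case: eqP => // e.
by have := Lle i; rewrite e leqNgt Lj.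
Qed.

Lemma row_msize (v : 'cV[S]_r) (y : 'rV[A]_r) :
  (msize ((map_mx psi y *m v) 0%R 0%R) <= \sum_i msize (v i 0%R))%N.
Proof.
rewrite mxE; apply: leq_trans (msize_sum _ _ _) _; apply/bigmax_leqP => i _.
rewrite mxE psiE; apply: leq_trans (msizeZ_le _ _) _.
by rewrite (bigD1 i) //= leq_addr.
Qed.

Lemma gv_bounded v : bcF (gv v).
Proof.
split; first exact: gv_lin.
exists (\sum_i msize (v i 0%R) + L)%N => x; split.
  by apply: leq_trans (leq_addr _ _); apply: row_msize.
move=> j jn; rewrite /gv u_pr row_pr_far; last by apply: leq_ltn_trans jn; rewrite leq_addl.
by rewrite map_mx0 mul0mx mxE.
Qed.

Lemma gv_graded n v : colhom (dg_deg E) n v -> hF n (gv v).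
Proof.
move=> vn j x m; rewrite /gv u_pr mxE => /msupp_sum_le /flatten_mapP[i _].
rewrite mxE mul_degpr; case: eqP => [<-|_]; last by rewrite rmorph0 mul0r msupp0.
by rewrite psiE => /msuppZ_le; apply: vn.
Qed.

(** The contraction of the cone is not compatible with the [e_i], so it solves the equation only up
    to a remainder in lower degrees. Finitely many rounds push the remainder below all of [E], where
    the [K]-linear contraction of [F] finishes. *)
Lemma cone_acyclic (G : cone -> S) : bcW G -> (forall w, cDl G w = 0) ->
  exists2 H, bcW H & (forall w, G w = cDl H w) /\
    forall n, hW n G -> hW (n - 1) H.
Proof.
move=> Gb G0.
have [sg [sgl sgpr sgd]] := contraction_ex b_deg span indep filt E_laws E_hom
  u_lin u_d u_pr u_inj u_surj.
have [Gl [N Gn]] := Gb.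
have dl := cone_d_lin u_lin.
have el i := @cone_e_lin A c f F E i.
have dd := cone_dd E_laws u_d.
have leib := cone_leibniz E_laws u_e.
have alt : altops (@cone_e A c f F E).
  have [_ ee eC _] := E_laws.
  split=> [i|i x|i x|i j x].
  - by rewrite /cone_e /= raddf0 mul0mx oppr0.
  - by rewrite /cone_e /= raddfN mulNmx.
  - by rewrite /cone_e /= kdg_ee mulNmx opprK -mulmxA ee mulmx0.
  - by rewrite /cone_e /= kdg_eC !mulNmx !opprK -!mulmxA eC mulmxN.
(* [G] vanishes from degree [N.+1] on; after [(N + L).+2] steps of length two the remainder vanishes
   from degree [- L - 1] on. *)
have [|H [R [Hb Rb HR RN HRn]]] := @cochain_descent A B k phi pi c f phi_f cone
    (@cone_pr A c f F E) (cone_d u) (@cone_e A c f F E) sg el dd alt leib sgl sgd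
    sgpr (fun i j w => cone_pr_e E_hom j i w) (@cone_pr_lin A c f F E)
    G N.+1 (N + L).+2 Gb G0.
  by move=> j x Nj; rewrite (Gn x).2 //; lia.
have Rl := Rb.1.
(* In the cone the summand from [E] occupies degrees at least [a], where the remainder vanishes; so
   the remainder lives on [F] alone, in degrees where [F] is exact. *)
pose a : int := - L%:Z - 1.
have Ra j x : (a <= j)%R -> R (cone_pr j x) = 0.
  by move=> ja; apply: RN; rewrite /a in ja; lia.
have R2 (y : 'rV[A]_r) : R ((0, y) : cone) = 0.
  have R0l : semilin (fun y : 'rV[A]_r => R ((0, y) : cone)).
    move=> x y1 y2; rewrite -Rl; congr R.
    by rewrite [RHS](_ : _ = (x *: 0 + 0, x *: y1 + y2)) // scaler0 addr0.
  rewrite [y]row_sum_delta (semilin_sum R0l) big1 // => i _.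
  rewrite (semilinZ R0l).
  have := cone_elt_deg (b := b) (deg := deg) b_deg (E := E) (inr i) (dg_deg E i - 1).
  rewrite eqxx /= => <-; rewrite Ra ?mulr0 // /a.
  by have := Lle i; lia.
pose R1 (x : F) : S := R ((x, 0) : cone).
have R1l : semilin R1.
  move=> t x y; rewrite -Rl; congr R.
  by rewrite [RHS](_ : _ = (t *: x + y, t *: 0 + 0)) // scaler0 addr0.
have RE w : R w = R1 w.1.
  by rewrite {1}(cone_split w) (semilinD Rl) R2 addr0.
have R1a j x : (a <= j)%R -> R1 (kdg_pr F j x) = 0.
  by move=> ja; rewrite -(Ra j (x, 0) ja) /cone_pr /= mul0mx.
have [|s [sl se spr sd]] := @low_contraction_ex A c f F T b deg lev b_deg span indep filt a.
  move=> j x ja xj dx; apply: u_inj dx _; exists 0; rewrite mul0mx.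
  by rewrite -xj u_pr row_pr_far //; rewrite /a in ja; lia.
have R10 x : R1 (kdg_d F x) = \sum_i 'X_i * R1 (kdg_e F i x).
  have [_ /eqP] := HR ((x, 0) : cone); rewrite /twdiff subr_eq0 RE /= => /eqP ->.
  by apply: eq_bigr => i _; rewrite RE.
have R1s x : R1 x = Dl (R1 \o s) x.
  move: x; apply: pr_ext => //.
    by apply: Dl_lin => t x y; rewrite /= sl R1l.
  move=> j x; set z := kdg_pr F j x.
  have -> : Dl (R1 \o s) z = R1 (kdg_d F (s z) + s (kdg_d F z)).
    rewrite (semilinD R1l) R10 /twdiff /= [RHS]addrC; congr (_ + _).
    rewrite -sumrN; apply: eq_bigr => i _.
    by rewrite se (semilinN R1l) mulrN opprK.
  have [ja|ja] := ltrP j a; first by rewrite (sd j) // /z kdg_prK.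
  rewrite [LHS]R1a //.
  have -> : kdg_d F (s z) + s (kdg_d F z) = kdg_pr F j (kdg_d F (s z) + s (kdg_d F z)).
    have := spr (j - 1) (kdg_d F z); rewrite subrK kdg_pr_d subrK /z kdg_prK => e.
    by rewrite linearD /= kdg_pr_d spr kdg_prK e.
  by rewrite R1a.
exists (fun w => H w + R1 (s w.1)).
  apply: bounded_cochainD => //; split=> [t x y|].
    by rewrite /= sl R1l.
  have [_ [n Rn]] := Rb; exists n.+1 => x; split.
    by apply: leq_trans (Rn _).1 _.
  move=> j jn; rewrite /= -spr; have := (Rn ((s x.1, 0) : cone)).2 (j + 1).
  by rewrite /cone_pr /= mul0mx; apply; lia.
split=> [w|n Gh].
  have [-> _] := HR w; rewrite twdiffD; congr (_ + _).
  by rewrite RE R1s.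
have [Hh Rh] := HRn n Gh; apply: gradedcochainD => // j x m.
rewrite /= -spr => hm; have := Rh (j + 1) ((s x.1, 0) : cone) m.
by rewrite /cone_pr /= mul0mx => /(_ hm); lia.
Qed.

(** A cochain on the cone is a pair of a cochain on [F] and a column over [S], and the twisted
    differential of the pair involves [gv] and [D]. *)
Lemma cone_cochain (G : cone -> S) (g := fun x : F => G ((x, 0) : cone))
    (v := \col_i G ((0, delta_mx 0 i) : cone)) : semilin G ->
  (forall x y, G ((x, y) : cone) = g x + (map_mx psi y *m v) 0 0) /\
  forall x y, cDl G ((x, y) : cone) = Dl g x + gv v x - (map_mx psi y *m (D *m v)) 0 0.
Proof.
move=> Gl.
have G2l : semilin (fun y : 'rV[A]_r => G ((0, y) : cone)).
  move=> x y1 y2; rewrite -Gl; congr G.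
  by rewrite [RHS](_ : _ = (x *: 0 + 0, x *: y1 + y2)) // scaler0 addr0.
have GE x y : G ((x, y) : cone) = g x + (map_mx psi y *m v) 0 0.
  by rewrite (cone_split (x, y)) (semilinD Gl) -(rowfun G2l).
split=> // x y; rewrite {1}/twdiff /cone_d /cone_e /= GE.
under eq_bigr => i _ do rewrite GE mulrDr.
rewrite big_split /= opprD addrACA -[g _ - _]/(Dl g x) -[RHS]addrA; congr (_ + _).
have vl := row_semilin v.
rewrite (semilinD vl) (semilinN vl) -/(gv v x) -[LHS]addrA; congr (_ + _).
rewrite -rowfun_D opprB addrC; congr (_ - _).
by rewrite -sumrN; apply: eq_bigr => i _; rewrite (semilinN vl) mulrN opprK.
Qed.

(** Extended by 0 to [E], the cocycle [g] is a cocycle on the cone. The two components of a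
    primitive are [h] and [v]. *)
Lemma gv_surj (g : F -> S) : bcF g -> (forall x, Dl g x = 0) ->
  exists v h, [/\ D *m v = 0, bcF h, forall x, g x = gv v x + Dl h x
    & forall n, hF n g -> colhom (dg_deg E) n v].
Proof.
move=> [gl [n gb]] g0.
have [||H [Hl [m Hb]] [HE Hn]] := @cone_acyclic (fun w => g w.1).
- split=> [a x y|]; first exact: gl.
  by exists n => w; split=> [|j jn]; [have [] := gb w.1|apply: (gb w.1).2].
- by move=> w; rewrite -(g0 w.1).
have [HE1 HE2] := cone_cochain Hl.
set h := fun x : F => _ in HE1 HE2; set v := \col_i _ in HE1 HE2.
have Dv : D *m v = 0.
  apply/matrixP => i j; rewrite (ord1 j) [RHS]mxE.
  have := HE ((0, delta_mx 0 i) : cone); rewrite HE2 /= (semilin0 gl).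
  have Dl0 : Dl h 0 = 0.
    apply: (semilin0 (phi := phi) (pi := pi)); apply: Dl_lin => a x y.
    rewrite /h -Hl; congr H.
    by rewrite [RHS](_ : _ = (a *: x + y, a *: 0 + 0)) // scaler0 addr0.
  rewrite Dl0 (semilin0 (gv_lin v)) add0r sub0r => /eqP; rewrite eq_sym oppr_eq0 => /eqP.
  by rewrite map_delta_mx -rowE mxE.
exists v, h; split=> //.
- split=> [a x y|].
    rewrite /h -Hl; congr H.
    by rewrite [RHS](_ : _ = (a *: x + y, a *: 0 + 0)) // scaler0 addr0.
  exists m => x; split=> [|j jm]; first by have [] := Hb ((x, 0) : cone).
  by rewrite -[RHS]((Hb ((x, 0) : cone)).2 j jm) /cone_pr /= mul0mx.
- move=> x; have := HE ((x, 0) : cone); rewrite HE2 /= map_mx0 mul0mx mxE subr0 addrC.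
  by [].
- move=> n' /= gh i mm; rewrite mxE.
  have e := cone_elt_deg b_deg (E := E) (inr i) (dg_deg E i - 1).
  rewrite eqxx /= in e; rewrite -e => hm.
  by have := Hn _ (fun j w => gh j w.1) _ _ _ hm; lia.
Qed.

(** The equation makes the pair of [- h] and [v] a cocycle on the cone, and the column of a
    primitive is [w] up to sign. *)
Lemma gv_exact v h : D *m v = 0 -> bcF h -> (forall x, gv v x = Dl h x) ->
  exists w, v = D *m w.
Proof.
move=> Dv [hl [m hb]] hv.
pose G (w : cone) := - h w.1 + (map_mx psi w.2 *m v) 0 0.
have Gl : semilin G.
  move=> a x y; rewrite /G /= hl row_semilin opprD addrACA -mulrN -mulrDr; congr (_ + _).
have Gv : \col_i G ((0, delta_mx 0 i) : cone) = v.
  apply/matrixP => i j; rewrite mxE /G /= (semilin0 hl) oppr0 add0r (ord1 j).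
  by rewrite map_delta_mx -rowE mxE.
have [_ GD] := cone_cochain Gl; rewrite Gv Dv in GD.
have [||H [Hl _] [HE _]] := @cone_acyclic G.
- split=> //; exists (m + \sum_i msize (v i 0%R) + L.+1)%N => w; split.
    apply: leq_trans (msizeD_le _ _) _; rewrite msizeN geq_max; apply/andP; split.
      by apply: leq_trans (hb _).1 _; rewrite -addnA leq_addr.
    by apply: leq_trans (row_msize _ _) _; rewrite addnAC leq_addl.
  move=> j jm; rewrite /G /= (hb _).2; last by lia.
  by rewrite row_pr_far ?map_mx0 ?mul0mx ?mxE ?subr0 ?oppr0 ?addr0 //; lia.
- move=> [x y]; rewrite GD mulmx0 [X in _ - X]mxE subr0.
  have -> : Dl (fun x : F => G ((x, 0) : cone)) x = Dl (fun x => - h x) x.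
    have e z : G ((z, 0) : cone) = - h z by rewrite /G /= map_mx0 mul0mx mxE addr0.
    by rewrite /twdiff e; congr (_ - _); apply: eq_bigr => i _; rewrite e.
  by rewrite twdiffN -hv addNr.
have [HE1 HE2] := cone_cochain Hl; set w := \col_i _ in HE1 HE2.
exists (- w); apply/matrixP => i j; rewrite (ord1 j).
have := HE ((0, delta_mx 0 i) : cone); rewrite HE2 /G /= (semilin0 hl) oppr0 add0r.
have h'0 : Dl (fun x : F => H ((x, 0) : cone)) 0 = 0.
  apply: (semilin0 (phi := phi) (pi := pi)); apply: Dl_lin => a x y.
  rewrite -Hl; congr H.
  by rewrite [RHS](_ : _ = (a *: x + y, a *: 0 + 0)) // scaler0 addr0.
rewrite h'0 (semilin0 (gv_lin w)) add0r sub0r !map_delta_mx -!rowE mulmxN.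
by rewrite !mxE.
Qed.

Theorem cochain_models : models phi pi F (dg_deg E) D.
Proof.
have gvc v : D *m v = 0 -> (gv v : F -> S^o) \in cocycle phi pi (F := F).
  move=> Dv; apply/asboolP; split; first exact/cochainE/gv_bounded.
  by apply/cochain_diff0P => [|x]; [exact: gv_lin|rewrite Dl_gv Dv /gv mulmx0 mxE].
pose cv v : cocycles phi pi F := insubd 0 (gv v : F -> S^o).
have cvE v : D *m v = 0 -> cocycle_val (cv v) = gv v by move=> /gvc; apply: insubdK.
pose q := quot_pi (cobound_closed phi pi F).
have qP (x y : cocycles phi pi F) : (exists2 h, bcF h & forall z, x z = y z + Dl h z) ->
    q x = q y.
  move=> [h hb hE]; apply/eqP; rewrite -subr_eq0; apply/eqP.
  have -> : q x - q y = q (x - y).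
    by rewrite -[q x - q y]/(q x + - q y) -scaleN1r /q quot_piD -[- y]scaleN1r -quot_piZ.
  apply/quot_pi_eq0/asboolP/cochain_diffP.
    have /asboolP[/cochainE[] ? _ _] := cocycle_valP (x - y). by [].
  exists h => // z.
  by rewrite -[LHS]/(x z - y z) hE addrC addKr.
exists (fun v => q (cv v)); split.
- move=> s v w Dv Dw; rewrite -[s *: q (cv v)]/(quot_scale s (q (cv v))) /q quot_piZ -quot_piD; congr quot_pi.
  apply: val_inj => /=; apply: funext => x.
  rewrite cvE; last by rewrite mulmxDr -scalemxAr Dv Dw scaler0 addr0.
  rewrite -[RHS]/(s * (cocycle_val (cv v) x) + cocycle_val (cv w) x) !cvE //.
  by rewrite /gv mulmxDr -scalemxAr !mxE.
- elim/quot_piP => g; have /asboolP[/cochainE gb gd] := cocycle_valP g.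
  have [|v [h [Dv hb gE _]]] := gv_surj gb; first by apply/cochain_diff0P => //; case: gb.
  by exists v => //; apply: qP; exists h => // z; rewrite cvE.
- move=> v Dv; split=> [/quot_pi_eq0/asboolP|[w vw]].
    rewrite cochain_diffP; last by rewrite cvE //; apply: gv_lin.
    case=> h hb hE; apply: (gv_exact Dv hb) => x.
    by rewrite -hE cvE.
  apply/quot_pi_eq0/asboolP/cochain_diffP; first by rewrite cvE //; apply: gv_lin.
  by exists (gv w) => [|x]; [exact: gv_bounded|rewrite cvE // Dl_gv vw].
- move=> n x; split=> [/asboolP[g gh ->]|[v [Dv vn ->]]].
    have /asboolP[/cochainE gb gd] := cocycle_valP g.
    have [|v [h [Dv hb gE vn]]] := gv_surj gb; first by apply/cochain_diff0P => //; case: gb.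
    by exists v; split=> //; [apply: vn|apply: qP; exists h => // z; rewrite cvE].
  by apply/asboolP; exists (cv v) => //; rewrite cvE //; apply: gv_graded.
Qed.
End Model.

Theorem resolution_models (A B : comNzRingType) (k : fieldType)
    (phi : {rmorphism A -> B}) (pi : {rmorphism B -> k}) (c : nat) (f : 'I_c -> A)
    (F : koszul_dgmod f) (N : cochain_complex B) (E : dgmx A c)
    (th : forall n, 'rV[A]_(dg_rk E) -> N n) :
  (forall i, phi (f i) = 0) -> semifree_resolution phi F N ->
  row_model phi f E N th -> models phi pi F (dg_deg E) (dgDelta phi pi E).
Proof.
move=> phi_f [[T [b [deg [lev [b_deg span indep filt]]]]] [eps eps_q]] hE.
have [u [u_lin u_de u_pr u_inj u_surj]] :=
  lift_qiso b_deg span indep filt eps_q phi_f hE.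
have H := (cochain_models pi phi_f b_deg span indep filt (rm_laws hE) (rm_hom hE) u_lin).
apply: H => //.
- by move=> x; have [] := u_de x.
- by move=> x; have [] := u_de x.
Qed.

(** * The models of [M] and of its dual *)

Section Apply.
Variables (A B : comNzRingType) (phi : {rmorphism A -> B}).
Variables (c : nat) (f : 'I_c -> A) (M : lmodType B) (G : free_resolution M).
Variables (E : dgmx A c) (eta : 'rV[A]_(dg_rk E) -> M).
Variable th : forall j, 'M[B]_(fr_rank G j, dg_rk E).
Hypothesis h : finite_model phi f E eta th.
Local Notation r := (dg_rk E).

Definition single_th (n : nat) : 'rV[A]_r -> single_ob M n :=
  match n return 'rV[A]_r -> single_ob M n with 0 => eta | _ => fun=> 0 end.

Lemma row_model_single : row_model phi f E (single_complex M) single_th.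
Proof.
have d0 (x : 'rV[A]_r) : x *m degpr A (dg_deg E) 0 = x -> x *m dg_d E = 0.
  move=> <-; have [dh _] := fm_hom h.
  rewrite -mulmxA (hommx_degpr _ dh) mulmxA; apply/rowP => b.
  rewrite mul_degpr [RHS]mxE; have := fm_pos h b.
  by case: eqP => // ->.
have eta0 : eta 0 = 0.
  by have := fm_lin h (-1) 0 0; rewrite scaler0 addr0 rmorphN1 scaleN1r addNr.
split.
- exact: fm_laws h.
- exact: fm_hom h.
- by case=> [|n] a x y /=; [apply: fm_lin h _ _ _|rewrite scaler0 addr0].
- by case=> [|n] x //=; rewrite oppr0 (fm_eta_deg h).
- exact: fm_eta_d h.
- by case=> [|n] x /=.
- by case=> [|n] i x //=; apply: fm_eta_e h _ _.
- by move=> l x xl xd hx; apply: (fm_exact h xl xd); apply: (hx 0%N).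
- case=> [|n] z _ /=.
    have [x [xz x0]] := fm_surj h z.
    by exists x; rewrite oppr0 xz subrr; split=> //; apply: d0.
  exists 0; rewrite !mul0mx; split=> //.
  by exists 0; apply/matrixP => i [].
Qed.

Definition dual_dgmx : dgmx A c :=
  @DgMx A c r (fun a => c%:Z - dg_deg E a) (dg_d E)^T (fun i => (dg_e E i)^T).

(** The sign of [dual_d] in degree [n - 1] is [(-1)^n], and [fm_th_d] contributes [(-1)^c]; these
    are accumulated so that [dual_th] commutes with the differentials. *)
Fixpoint dual_sign (n : nat) : nat :=
  if n is n'.+1 then (n + c + dual_sign n')%N else 0%N.

Definition dual_th (n : nat) (y : 'rV[A]_r) : dual_ob G n :=
  (-1) ^+ dual_sign n *: (th n *m map_mx phi y^T).

Lemma dual_degpr n : degpr A (dg_deg dual_dgmx) (- n%:Z) = degpr A (dg_deg E) (n%:Z + c%:Z).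
Proof.
congr diag_mx; apply/rowP => a; rewrite !mxE /=; congr (nat_of_bool _)%:R.
by apply/eqP/eqP; lia.
Qed.

Lemma dual_degpr' l : degpr A (dg_deg dual_dgmx) l = degpr A (dg_deg E) (c%:Z - l).
Proof.
congr diag_mx; apply/rowP => a; rewrite !mxE /=; congr (nat_of_bool _)%:R.
by apply/eqP/eqP; lia.
Qed.

Lemma row_model_dual : row_model phi f dual_dgmx (dual_complex G) dual_th.
Proof.
have [dd ee eC de] := fm_laws h; have [dh eh] := fm_hom h.
have sK (R : comNzRingType) n : (-1) ^+ n * (-1) ^+ n = 1 :> R.
  by rewrite -exprD addnn -mul2n exprM sqrrN !expr1n.
split.
- split=> [|i|i j|i] /=; rewrite -?trmx_mul.
  + by rewrite dd trmx0.
  + by rewrite ee trmx0.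
  + by rewrite eC linearN.
  + by rewrite -linearD /= addrC de tr_scalar_mx.
- have flip w M' : hommx (dg_deg E) (dg_deg E) w M' ->
      hommx (dg_deg dual_dgmx) (dg_deg dual_dgmx) w M'^T.
    by move=> hM a b; rewrite mxE /= => /hM ->; lia.
  by split=> [|i]; apply: flip.
- move=> n a x y; rewrite /dual_th linearP /= map_mxD map_mxZ mulmxDr -scalemxAr.
  by rewrite scalerDr !scalerA mulrC.
- move=> n x; rewrite /dual_th dual_degpr trmx_mul degpr_tr map_mxM map_degpr mulmxA.
  have hh : hommx (fun=> n%:Z) (dg_deg E) c%:Z (th n) by have [] := h.
  have := hommx_degpr n%:Z hh.
  have -> : degpr B (fun=> n%:Z) n%:Z = 1%:M :> 'M_(fr_rank G n).
    by apply/matrixP => i j; rewrite !mxE eqxx.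
  by rewrite mul1mx => <-.
- by move=> x; rewrite /dual_th trmx_mul trmxK map_mxM mulmxA (fm_th_d0 h) mul0mx scaler0.
- move=> n x; rewrite /dual_th trmx_mul trmxK map_mxM mulmxA (fm_th_d h).
  rewrite /cc_d /= /dual_d /= -!scalemxAl -!scalemxAr !scalerA mulmxA; congr (_ *: _).
  by rewrite /= !exprD mulrAC -[X in X * _]mulrA sK mulr1.
- by move=> n i x; rewrite /dual_th trmx_mul trmxK map_mxM mulmxA (fm_th_e h) mul0mx scaler0.
- move=> l x xl xd hx.
  have [||||w wP] := fm_th_inj h (l := c%:Z - l) (y := x^T).
  + by rewrite -dual_degpr' -degpr_tr -trmx_mul xl.
  + by rewrite -[dg_d E]trmxK -trmx_mul xd trmx0.
  + by have /= := hx 0%N; rewrite /dual_th /= expr0 scale1r.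
  + move=> j; have [w wP] := hx j.+1; exists ((-1) ^+ (dual_sign j.+1 + j.+1) *: w).
    have := congr1 (fun z => (-1) ^+ dual_sign j.+1 *: z) wP.
    rewrite {1}/dual_th scalerA sK scale1r => ->.
    by rewrite /cc_d /= /dual_d /= -scalemxAl scalerA -exprD -scalemxAr.
  by exists w^T; rewrite -[LHS]trmxK wP trmx_mul.
- move=> n z dz.
  have [|y [yd yl yz]] := fm_th_surj h (v := z).
    have := congr1 (fun z => (-1) ^+ n.+1 *: z) dz.
    by rewrite /cc_d /= /dual_d /= -scalemxAl scalerA sK scale1r scaler0.
  exists ((-1) ^+ dual_sign n *: y^T); split.
  + by rewrite -scalemxAl /= -trmx_mul yd trmx0 scaler0.
  + by rewrite dual_degpr -scalemxAl -degpr_tr -trmx_mul yl.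
  + have -> : dual_th n ((-1) ^+ dual_sign n *: y^T) = th n *m map_mx phi y.
      rewrite /dual_th linearZ /= trmxK map_mxZ -scalemxAr scalerA rmorphXn rmorphN1 sK.
      by rewrite scale1r.
    case: n z dz yl yz => [|n] z dz yl /=; first by move=> ->; rewrite subrr.
    move=> [w ->]; exists ((-1) ^+ n.+1 *: w); rewrite addrAC subrr add0r.
    by rewrite /dual_d /= -scalemxAl -scalemxAr scalerA sK scale1r.
Qed.
End Apply.

Lemma dgDelta_dual (A B : comNzRingType) (k : fieldType) (phi : {rmorphism A -> B})
    (pi : {rmorphism B -> k}) (c : nat) (E : dgmx A c) :
  dgDelta phi pi (dual_dgmx E) = (dgDelta phi pi E)^T.
Proof.
apply/matrixP => i j; rewrite /dgDelta !mxE !summxE; congr (_ - _).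
by apply: eq_bigr => l _; rewrite !mxE.
Qed.

(** Columns are multiplied from the left: generator [j] has weight [a j], each [chi_i] has weight 2,
    and [D] raises weights by one. *)
Definition wthom (k : fieldType) c r (a : 'I_r -> nat) (D : 'M[{mpoly k[c]}]_r) : Prop :=
  forall i j m, m \in msupp (D i j) -> (a i + 2 * mdeg m = (a j).+1)%N.

Theorem ext_models (A B : comNzRingType) (k : fieldType)
    (phi : {rmorphism A -> B}) (pi : {rmorphism B -> k})
    (c : nat) (f : 'I_c -> A) (M : lmodType B) (G : free_resolution M)
    (F F' : koszul_dgmod f) :
  local_ring A -> surjective phi -> surjective pi -> regular_sequence f ->
  (forall a : A, phi a = 0 <-> in_ideal f predT a) -> finite_proj_dim phi M ->
  semifree_resolution phi F (single_complex M) ->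
  semifree_resolution phi F' (dual_complex G) ->
  exists r (a : 'I_r -> nat) (D : 'M[{mpoly k[c]}]_r),
    [/\ D *m D = 0, wthom a D, models phi pi F (fun i => a i) D
      & models phi pi F' (fun i => c%:Z - (a i)%:Z) D^T].
Proof.
move=> loc phi_surj pi_surj reg kerP pd F_res F'_res.
have rho_surj : surjective (pi \o phi).
  by move=> x; have [y <-] := pi_surj x; have [z <-] := phi_surj y; exists z.
have phi_f i : phi (f i) = 0.
  apply/kerP; exists (fun j => (i == j)%:R).
  by rewrite (bigD1 i) //= eqxx mul1r big1 ?addr0 // => j; rewrite eq_sym => /negbTE ->; rewrite mul0r.
have [E [eta [th h]]] := @finite_model_ex A B phi k (pi \o phi) c f M G rho_surj loc phi_surj reg kerP pd.
have posE i : (`|dg_deg E i|%N)%:Z = dg_deg E i by rewrite gez0_abs // (fm_pos h).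
have m1 := resolution_models pi phi_f F_res (row_model_single h).
have m2 := resolution_models pi phi_f F'_res (row_model_dual h).
have [dd ee eC de] := fm_laws h; have [dh eh] := fm_hom h.
exists (dg_rk E), (fun i => `|dg_deg E i|%N), (dgDelta phi pi E); split.
- rewrite /dgDelta; set ps := psi phi pi c.
  rewrite mulmxBl !mulmxBr -map_mxM dd map_mx0 sub0r.
  have -> : (\sum_i 'X_i *: map_mx ps (dg_e E i)) *m (\sum_i 'X_i *: map_mx ps (dg_e E i)) = 0.
    rewrite mulmx_suml; under eq_bigr => i _ do rewrite mulmx_sumr.
    apply: sum_alternating => [i|i j]; rewrite -scalemxAl -scalemxAr -map_mxM.
      by rewrite ee map_mx0 !scaler0.
    rewrite -scalemxAl -scalemxAr -map_mxM eC map_mxN !scalerN !scalerA.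
    by rewrite [in RHS]mulrC.
  rewrite subr0 mulmx_sumr mulmx_suml -opprD -big_split big1 ?oppr0 // => i _ /=.
  rewrite -scalemxAl -scalemxAr -scalerDr -!map_mxM -map_mxD de map_scalar_mx.
  by rewrite /ps psi_f // -scalemx1 scale0r scaler0.
- move=> i j m; rewrite /dgDelta !mxE => /msuppB_le; rewrite mem_cat => /orP[|].
    rewrite msuppC; case: eqP => //= ne; rewrite inE => /eqP ->.
    have := dh i j; rewrite mdeg0; case: eqP => [e|_ /(_ isT)]; last first.
      by have := fm_pos h i; have := fm_pos h j; lia.
    by case: ne; rewrite e !rmorph0.
  rewrite summxE => /msupp_sum_le /flatten_mapP[l _].
  rewrite !mxE; have [e|ne] := eqVneq (dg_e E l i j) 0.
    by rewrite e rmorph0 mulr0 msupp0.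
  rewrite mulrC /psi /= mul_mpolyC => /msuppZ_le; rewrite msuppX inE => /eqP ->.
  have := eh l i j ne; rewrite mdeg1.
  by have := fm_pos h i; have := fm_pos h j; lia.
- have -> : (fun i => (`|dg_deg E i|%N)%:Z) = dg_deg E by apply: funext => i.
  exact: m1.
- rewrite -dgDelta_dual.
  have -> : (fun i => c%:Z - (`|dg_deg E i|%N)%:Z) = dg_deg (dual_dgmx E).
    by apply: funext => i; rewrite posE.
  exact: m2.
Qed.

(** * Dimensions and Hilbert functions *)

Section Dim.
Variables (k : fieldType) (V : lmodType k).
Implicit Types U W T : V -> Prop.

Definition subsp U : Prop := U 0 /\ forall a x y, U x -> U y -> U (a *: x + y).

Section Subspace.
Variables (U : V -> Prop) (hU : subsp U).
Lemma subspD x y : U x -> U y -> U (x + y).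
Proof. by move=> hx hy; rewrite -[x]scale1r; apply: hU.2. Qed.
Lemma subspZ a x : U x -> U (a *: x).
Proof. by move=> hx; rewrite -[_ *: _]addr0; apply: hU.2 => //; apply: hU.1. Qed.
Lemma subspN x : U x -> U (- x).
Proof. by rewrite -scaleN1r; apply: subspZ. Qed.
Lemma subspB x y : U x -> U y -> U (x - y).
Proof. by move=> hx hy; apply: subspD => //; apply: subspN. Qed.
Lemma subsp_sum (J : Type) (l : seq J) (P : pred J) (F : J -> V) :
  (forall j, P j -> U (F j)) -> U (\sum_(j <- l | P j) F j).
Proof. by move=> h; elim/big_rec: _ => [|j x Pj]; [apply: hU.1|apply/subspD/h]. Qed.
Lemma subsp_comb n (v : 'I_n -> V) (a : 'I_n -> k) :
  (forall i, U (v i)) -> U (\sum_i a i *: v i).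
Proof. by move=> h; apply: subsp_sum => i _; apply: subspZ. Qed.
Lemma subsp_trans x y : U (x - y) -> U y -> U x.
Proof. by move=> h hy; rewrite -(subrK y x); apply: subspD. Qed.
End Subspace.

Definition indq W n (v : 'I_n -> V) : Prop :=
  forall a : 'I_n -> k, W (\sum_i a i *: v i) -> forall i, a i = 0.
Definition spanq U W n (v : 'I_n -> V) : Prop :=
  forall x, U x -> exists a : 'I_n -> k, W (x - \sum_i a i *: v i).
Definition dimq U W n : Prop := exists v : 'I_n -> V,
  [/\ forall i, U (v i), spanq U W v & indq W v].

Lemma steinitz U W n m (v : 'I_n -> V) (w : 'I_m -> V) : subsp W ->
  spanq U W v -> (forall j, U (w j)) -> indq W w -> (m <= n)%N.
Proof.
move=> hW sv wU iw; rewrite leqNgt; apply/negP => nm.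
have /choice[A AP] j : exists a : 'I_n -> k, W (w j - \sum_i a i *: v i) by apply: sv.
pose M : 'M[k]_(m, n) := \matrix_(j, i) A j i.
have : kermx M != 0.
  by rewrite -mxrank_eq0 mxrank_ker -lt0n subn_gt0; apply: leq_ltn_trans nm; apply: rank_leq_col.
case/rowV0Pn => u /sub_kermxP uM u0; case/negP: u0; apply/eqP/rowP => j.
rewrite [RHS]mxE; apply: (iw (fun j => u 0 j)).
have -> : \sum_j u 0 j *: w j = \sum_j u 0 j *: (w j - \sum_i A j i *: v i).
  transitivity (\sum_j u 0 j *: w j - \sum_i (u *m M) 0 i *: v i).
    by rewrite uM [X in _ - X]big1 ?subr0 // => i _; rewrite mxE scale0r.
  under [X in _ - X]eq_bigr => i _ do rewrite mxE scaler_suml.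
  rewrite exchange_big -sumrB; apply: eq_bigr => i _ /=.
  rewrite scalerBr; congr (_ - _); rewrite scaler_sumr; apply: eq_bigr => l _.
  by rewrite mxE scalerA.
exact: subsp_comb.
Qed.

Lemma dimq_uniq U W n m : subsp W -> dimq U W n -> dimq U W m -> n = m.
Proof.
move=> hW [v [vU sv iv]] [w [wU sw iw]]; apply/eqP; rewrite eqn_leq.
by rewrite (steinitz hW sw vU iv) (steinitz hW sv wU iw).
Qed.

Lemma dimq_ge U W n m (w : 'I_m -> V) : subsp W -> dimq U W n ->
  (forall j, U (w j)) -> indq W w -> (m <= n)%N.
Proof. by move=> hW [v [vU sv iv]] wU iw; apply: steinitz sv wU iw. Qed.

Lemma dimq_le U W n m (w : 'I_m -> V) : subsp W -> dimq U W n -> spanq U W w -> (n <= m)%N.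
Proof. by move=> hW [v [vU sv iv]] sw; apply: steinitz sw vU iv. Qed.

Lemma dimq_ex U W m (w : 'I_m -> V) : subsp W -> subsp U -> spanq U W w ->
  exists2 n, (n <= m)%N & dimq U W n.
Proof.
move=> hW hU sw.
pose P n := `[< exists v : 'I_n -> V, (forall i, U (v i)) /\ indq W v >].
have Pm n : P n -> (n <= m)%N by move=> /asboolP[v [vU iv]]; apply: steinitz sw vU iv.
have P0 : exists n, P n.
  by exists 0%N; apply/asboolP; exists (fun=> 0); split=> [[]|a _ []].
case: (ex_maxnP P0 Pm) => n Pn nmax; exists n; first exact: Pm.
have /asboolP[v [vU iv]] := Pn; exists v; split=> // x Ux.
case: (pselect (exists a : 'I_n -> k, W (x - \sum_i a i *: v i))) => // no.
suff : P n.+1 by move/nmax; rewrite ltnn.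
apply/asboolP; exists (fun i => oapp v x (unlift ord0 i)); split.
  by move=> i; case: (unlift _ _) => /=.
have vS (a : 'I_n.+1 -> k) :
    \sum_i a i *: oapp v x (unlift ord0 i) = a ord0 *: x + \sum_i a (lift ord0 i) *: v i.
  by rewrite big_ord_recl unlift_none; congr (_ + _); apply: eq_bigr => i _; rewrite liftK.
move=> a; rewrite vS => Wa.
have a0 : a ord0 = 0.
  apply/eqP/negPn/negP => a0; apply: no; exists (fun i => - (a ord0)^-1 * a (lift ord0 i)).
  have := subspZ hW (a ord0)^-1 Wa; rewrite scalerDr scalerA mulVf // scale1r.
  rewrite scaler_sumr -sumrN; congr (W (_ + _)); apply: eq_bigr => i _.
  by rewrite scalerA mulNr scaleNr opprK.
move=> i; case: (unliftP ord0 i) => [j ->|-> //].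
by rewrite a0 scale0r add0r in Wa; apply: (iv (fun j => a (lift ord0 j))).
Qed.

Lemma dimq_add U T W n m : subsp W -> subsp T -> (forall x, T x -> U x) ->
  (forall x, W x -> T x) -> dimq U T n -> dimq T W m -> dimq U W (n + m).
Proof.
move=> hW hT TU WT [v [vU sv iv]] [w [wT sw iw]].
pose z (i : 'I_(n + m)) := match fintype.split i with inl i => v i | inr i => w i end.
have zE (a : 'I_(n + m) -> k) : \sum_i a i *: z i
    = \sum_i a (lshift m i) *: v i + \sum_i a (rshift n i) *: w i.
  rewrite big_split_ord /=; congr (_ + _); apply: eq_bigr => i _; rewrite /z.
    by rewrite (unsplitK (inl i)).
  by rewrite (unsplitK (inr i)).
exists z; split.
- by move=> i; rewrite /z; case: (fintype.split i) => // j; apply: TU.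
- move=> x /sv[a /sw[b Wb]].
  exists (fun i => match fintype.split i with inl i => a i | inr i => b i end).
  rewrite zE; move: Wb; rewrite -addrA -opprD; congr (W (_ - (_ + _))).
    by apply: eq_bigr => i _; rewrite (unsplitK (inl i)).
  by apply: eq_bigr => i _; rewrite (unsplitK (inr i)).
- move=> a; rewrite zE => Wa.
  have a1 : forall i, a (lshift m i) = 0.
    apply: (iv (fun i => a (lshift m i))).
    by apply: (subsp_trans hT (y := - \sum_i a (rshift n i) *: w i));
      [rewrite opprK; exact: WT|apply/(subspN hT)/(subsp_comb hT)].
  have a2 : forall i, a (rshift n i) = 0.
    apply: (iw (fun i => a (rshift n i))).
    by move: Wa; rewrite big1 ?add0r // => i _; rewrite a1 scale0r.
  by move=> i; case: (split_ordP i) => j ->.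
Qed.

Lemma dimq_quot U W W' n n' : subsp W' -> (forall x, W x -> W' x) ->
  dimq U W n -> dimq U W' n' -> (n' <= n)%N.
Proof.
move=> hW' WW' [v [vU sv iv]] d'; apply: (dimq_le (w := v) hW' d') => // x /sv[a Wa].
by exists a; apply: WW'.
Qed.

Lemma dimq0 U W n : subsp W -> (forall x, U x -> W x) -> dimq U W n -> n = 0%N.
Proof.
move=> hW UW dn; apply: dimq_uniq dn _ => //; exists (fun=> 0); split=> [[]||a _ []] //.
by move=> x /UW; exists (fun=> 0); rewrite big_ord0 subr0.
Qed.

Lemma dimq_eq0 U W : dimq U W 0 -> forall x, U x -> W x.
Proof. by move=> [v [_ sv _]] x /sv[a]; rewrite big_ord0 subr0. Qed.

Lemma eq_dimq U W U' W' n : (forall x, U x <-> U' x) -> (forall x, W x <-> W' x) ->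
  dimq U W n -> dimq U' W' n.
Proof.
move=> UU' WW' [v [vU sv iv]]; exists v; split.
- by move=> i; apply/UU'.
- by move=> x /UU'/sv[a /WW']; exists a.
- by move=> a /WW'; apply: iv.
Qed.
End Dim.

Section Transport.
Variables (k : fieldType) (V V' : lmodType k).
Variables (U W : V -> Prop) (U' W' : V' -> Prop) (g : V -> V').
Hypothesis g_lin : forall a x y, g (a *: x + y) = a *: g x + g y.
Hypotheses (hU : subsp U) (hW : subsp W) (hW' : subsp W').
Hypothesis gU : forall x, U x -> U' (g x).
Hypothesis gW : forall x, U x -> (W x <-> W' (g x)).
Hypothesis gS : forall y, U' y -> exists2 x, U x & W' (y - g x).

Let g0 : g 0 = 0.
Proof. by have := g_lin (-1) 0 0; rewrite scaler0 addr0 scaleN1r addNr. Qed.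
Let gZ a x : g (a *: x) = a *: g x.
Proof. by have := g_lin a x 0; rewrite g0 !addr0. Qed.
Let gD x y : g (x + y) = g x + g y.
Proof. by have := g_lin 1 x y; rewrite !scale1r. Qed.
Let gB x y : g (x - y) = g x - g y.
Proof. by rewrite gD -scaleN1r gZ scaleN1r. Qed.
Let g_comb n (a : 'I_n -> k) v : g (\sum_i a i *: v i) = \sum_i a i *: g (v i).
Proof. by elim/big_rec2: _ => [|i x y _ <-]; rewrite ?g0 ?gD ?gZ. Qed.

Lemma dimq_img n : dimq U W n -> dimq U' W' n.
Proof.
move=> [v [vU sv iv]]; exists (fun i => g (v i)); split.
- by move=> i; apply: gU.
- move=> y /gS[x Ux Wx]; have [a Wa] := sv x Ux; exists a.
  apply: (subsp_trans hW' (y := g (x - \sum_i a i *: v i))).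
    by rewrite gB g_comb opprB addrA subrK.
  by apply/gW => //; apply: subspB => //; apply: subsp_comb.
- by move=> a; rewrite -g_comb -gW => [/iv|]; last exact: subsp_comb.
Qed.

Lemma dimq_preimg n : dimq U' W' n -> dimq U W n.
Proof.
move=> [w [wU sw iw]].
have /choice[v vP] i : exists x, U x /\ W' (w i - g x).
  by have [x] := gS (wU i); exists x.
have gv (a : 'I_n -> k) : W' (g (\sum_i a i *: v i) - \sum_i a i *: w i).
  rewrite g_comb -sumrB; apply: subsp_sum => // i _; rewrite -scalerBr.
  by apply: subspZ => //; rewrite -opprB; apply: subspN => //; have [] := vP i.
exists v; split.
- by move=> i; have [] := vP i.
- move=> x Ux; have [a Wa] := sw _ (gU Ux); exists a.
  have Uc : U (\sum_i a i *: v i) by apply: subsp_comb => // i; have [] := vP i.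
  apply/gW; first exact: subspB.
  rewrite gB -[g x](subrK (\sum_i a i *: w i)) -addrA.
  apply: subspD => //; rewrite -opprB; exact: subspN.
- move=> a Wa; apply: iw; apply: (subsp_trans hW' (y := - (g (\sum_i a i *: v i) - \sum_i a i *: w i) + g (\sum_i a i *: v i))).
    by rewrite opprB subrK subrr; apply: hW'.1.
  apply: subspD => //; first exact: subspN.
  by apply/gW => //; apply: subsp_comb => // i; have [] := vP i.
Qed.
End Transport.

Notation monsof c d := [seq s2m t | t : d.-tuple 'I_c <- enum (basis c d)].

Section Graded.
Variables (k : fieldType) (c : nat).
Local Notation S := {mpoly k[c]}.

Definition mpart (P : pred 'X_{1..c}) (p : S) : S :=
  \sum_(m <- msupp p | P m) p@_m *: 'X_[m].

Lemma mcoeff_mpart P p m : (mpart P p)@_m = if P m then p@_m else 0.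
Proof.
rewrite /mpart -big_filter raddf_sum /=.
have E m' : (p@_m' *: 'X_[m'])@_m = if m' == m then p@_m else 0.
  by rewrite mcoeffZ mcoeffX; case: eqP => [->|_]; rewrite ?mulr1 ?mulr0.
under eq_bigr do rewrite E.
rewrite -big_mkcond /=; have [mp|mp] := boolP (m \in [seq x <- msupp p | P x]).
  rewrite -big_filter (filter_pred1_uniq (x := m)) ?filter_uniq ?msupp_uniq //.
  by rewrite big_seq1; move: mp; rewrite mem_filter => /andP[->].
rewrite big1_seq => [|m' /andP[/eqP -> h]]; last by rewrite h in mp.
by move: mp; rewrite mem_filter negb_and; case: (P m) => //= /memN_msupp_eq0 ->.
Qed.

Section Cols.
Variables (r : nat) (a : 'I_r -> nat).
Definition cvk : lmodType k := res 'cV[S]_r (@mpolyC c k).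
Implicit Types v w : cvk.

Definition cf (p : 'I_r * 'X_{1..c}) (v : cvk) : k := ((v : 'cV[S]_r) p.1 0)@_p.2.
Definition ev (p : 'I_r * 'X_{1..c}) : cvk := ('X_[p.2] : S) *: delta_mx p.1 0 : 'cV[S]_r.
Definition wt (p : 'I_r * 'X_{1..c}) : nat := (a p.1 + 2 * mdeg p.2)%N.

Lemma cvkE t v i j : ((t *: v : cvk) : 'cV[S]_r) i j = t *: (v : 'cV[S]_r) i j.
Proof. by rewrite -mul_mpolyC -[LHS]/((t%:MP *: (v : 'cV[S]_r)) i j) mxE. Qed.

Lemma cf_lin p t v w : cf p (t *: v + w) = t * cf p v + cf p w.
Proof. by rewrite /cf mxE cvkE mcoeffD mcoeffZ. Qed.
Lemma cf0 p : cf p 0 = 0. Proof. by rewrite /cf mxE mcoeff0. Qed.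
Lemma cf_sum p (J : Type) (l : seq J) (P : pred J) (F : J -> cvk) :
  cf p (\sum_(j <- l | P j) F j) = \sum_(j <- l | P j) cf p (F j).
Proof.
elim/big_rec2: _ => [|j x y _ <-]; first exact: cf0.
by rewrite -[F j]scale1r cf_lin mul1r scale1r.
Qed.
Lemma cfZ p t v : cf p (t *: v) = t * cf p v.
Proof. by rewrite -[t *: v]addr0 cf_lin cf0 addr0. Qed.
Lemma cfP v w : (forall p, cf p v = cf p w) -> v = w.
Proof.
move=> h; apply/matrixP => i j; rewrite (ord1 j); apply/mpolyP => m.
exact: (h (i, m)).
Qed.
Lemma cf_ev p q : cf p (ev q) = (p == q)%:R.
Proof.
rewrite /cf /ev mxE mxE eqxx andbT; case: p q => i m [j m'] /=.
rewrite xpair_eqE; have [_|_] := eqVneq i j; last by rewrite mulr0 mcoeff0.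
by rewrite mulr1 mcoeffX eq_sym.
Qed.

Definition hom (n : nat) (v : cvk) : Prop := forall p, cf p v != 0 -> wt p = n.

Definition hpart (n : nat) (v : cvk) : cvk :=
  \col_i mpart (fun m => wt (i, m) == n) ((v : 'cV[S]_r) i 0) : 'cV[S]_r.

Lemma cf_hpart p n v : cf p (hpart n v) = if wt p == n then cf p v else 0.
Proof. by case: p => i m; rewrite /cf /hpart mxE mcoeff_mpart. Qed.

Lemma hpart_lin n t v w : hpart n (t *: v + w) = t *: hpart n v + hpart n w.
Proof.
apply: cfP => p; rewrite cf_lin !cf_hpart cf_lin; case: ifP => // _.
by rewrite mulr0 addr0.
Qed.

Lemma hom_subsp n : subsp (hom n).
Proof.
split=> [p|t v w hv hw p]; first by rewrite cf0 eqxx.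
rewrite cf_lin; have [->|/hv //] := eqVneq (cf p v) 0.
by rewrite mulr0 add0r => /hw.
Qed.

Lemma hpart_hom n v : hom n (hpart n v).
Proof. by move=> p; rewrite cf_hpart; case: ifP => [/eqP //|_]; rewrite eqxx. Qed.

Lemma hpart_id n v : hom n v -> hpart n v = v.
Proof.
move=> hv; apply: cfP => p; rewrite cf_hpart; case: eqP => // ne.
by have [->|/hv] := eqVneq (cf p v) 0.
Qed.

Lemma hpart_other n m v : hom n v -> m != n -> hpart m v = 0.
Proof.
move=> hv ne; apply: cfP => p; rewrite cf_hpart cf0; case: eqP => // e.
by have [->|/hv en] := eqVneq (cf p v) 0; last by rewrite -en e eqxx in ne.
Qed.

Lemma wt_bound v : exists N, forall p, cf p v != 0 -> (wt p < N)%N.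
Proof.
exists (\sum_i (a i + 2 * msize ((v : 'cV[S]_r) i 0%R))).+1%N => -[i m]; rewrite /cf /wt /= => h.
rewrite ltnS (bigD1 i) //=; apply: leq_trans (leq_addr _ _).
rewrite leq_add2l leq_mul2l /=; apply: ltnW.
by apply: msize_mdeg_lt; rewrite mcoeff_msupp.
Qed.

Lemma hpart_sum v : exists N, forall M, (N <= M)%N -> v = \sum_(n < M) hpart n v.
Proof.
have [N hN] := wt_bound v; exists N => M NM; apply: cfP => p; rewrite cf_sum.
under eq_bigr do rewrite cf_hpart.
have [->|ne] := eqVneq (cf p v) 0; first by rewrite big1 // => i _; rewrite if_same.
have lt : (wt p < M)%N by apply: leq_trans NM; apply: hN.
rewrite (bigD1 (Ordinal lt)) //= eqxx big1 ?addr0 // => i ne'.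
by case: eqP => // e; case/eqP: ne'; apply: val_inj.
Qed.

Definition tmons (n w : nat) : seq 'X_{1..c} :=
  if (w <= n)%N && ~~ odd (n - w) then monsof c (n - w)./2 else [::].

Lemma mem_tmons n (w : nat) m : (m \in tmons n w) = ((w + 2 * mdeg m)%N == n).
Proof.
rewrite /tmons; case: ifP => [/andP[wn ev]|]; first rewrite -basis_cover.
  by apply/eqP/eqP; lia.
by move=> h; rewrite in_nil; apply/esym/negbTE/eqP; lia.
Qed.

Definition wbasis n : seq ('I_r * 'X_{1..c}) :=
  [seq (i, m) | i <- enum 'I_r, m <- tmons n (a i)].

Lemma mem_wbasis n p : (p \in wbasis n) = (wt p == n).
Proof.
case: p => i m; rewrite /wt /= -mem_tmons; apply/allpairsPdep/idP.
  by move=> [j [m' [_ h [-> ->]]]].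
by move=> h; exists i, m; rewrite mem_enum.
Qed.

Lemma uniq_wbasis n : uniq (wbasis n).
Proof.
apply: allpairs_uniq_dep; first exact: enum_uniq.
  by move=> i _; rewrite /tmons; case: ifP => // _; apply: uniq_basis.
by move=> [i m] [j m'] _ _ /= [-> ->].
Qed.

Lemma size_wbasis n : size (wbasis n) = (\sum_i size (tmons n (a i)))%N.
Proof. by rewrite /wbasis size_allpairs_dep sumnE big_map big_enum. Qed.

Lemma cf_expand (l : seq ('I_r * 'X_{1..c})) v : uniq l ->
  (forall p, cf p v != 0 -> p \in l) -> v = \sum_(p <- l) cf p v *: ev p.
Proof.
move=> ul hl; apply: cfP => q; rewrite cf_sum.
under eq_bigr do rewrite cfZ cf_ev.
have [ql|ql] := boolP (q \in l).
  rewrite (bigD1_seq q) //= eqxx mulr1 big1 ?addr0 // => p ne.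
  by rewrite eq_sym (negbTE ne) mulr0.
rewrite big1_seq => [|p /= pl].
  by apply/eqP/negPn; apply: contra ql => /hl.
by have [e|_] := eqVneq q p; [rewrite e pl in ql|rewrite mulr0].
Qed.

Lemma dimq_basis (U : cvk -> Prop) (l : seq ('I_r * 'X_{1..c})) : uniq l ->
  (forall v, U v <-> forall p, cf p v != 0 -> p \in l) ->
  dimq U (fun v => v = 0) (size l).
Proof.
move=> ul hU; exists (fun j => ev (tnth (in_tuple l) j)); split.
- move=> j; apply/hU => p; rewrite cf_ev.
  have [-> _|_] := eqVneq p (tnth (in_tuple l) j); last by rewrite eqxx.
  exact: mem_tnth.
- move=> v /hU/(cf_expand ul) e; exists (fun j => cf (tnth (in_tuple l) j) v).
  by rewrite {1}e big_tnth subrr.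
- have inj : injective (tnth (in_tuple l)) by apply/tuple_uniqP.
  move=> t /(congr1 (fun v => cf _ v)) h j; have := h (tnth (in_tuple l) j).
  rewrite cf_sum cf0 (bigD1 j) //= cfZ cf_ev eqxx mulr1 big1 ?addr0 // => i ne.
  rewrite cfZ cf_ev; case: eqP => [/inj e|_]; last by rewrite mulr0.
  by rewrite e eqxx in ne.
Qed.

Lemma dimq_hom n : dimq (hom n) (fun v => v = 0) (\sum_i size (tmons n (a i)))%N.
Proof.
rewrite -size_wbasis; apply: dimq_basis => [|v]; first exact: uniq_wbasis.
by split=> h p /h; rewrite mem_wbasis => /eqP.
Qed.

Lemma subsp0 : subsp (fun v => v = 0).
Proof. by split=> // t x y -> ->; rewrite scaler0 addr0. Qed.
End Cols.
End Graded.

Section Homology.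
Variables (k : fieldType) (c r : nat) (a : 'I_r -> nat).
Local Notation S := {mpoly k[c]}.
Local Notation V := (cvk k c r).
Variable D : 'M[S]_r.
Hypothesis DD : D *m D = 0.
Hypothesis D_hom : wthom a D.
Implicit Types v w : V.

Definition dact v : V := D *m (v : 'cV[S]_r).

Lemma dact_lin t v w : dact (t *: v + w) = t *: dact v + dact w.
Proof.
rewrite /dact -[(t *: v + w : V)]/(t%:MP *: (v : 'cV[S]_r) + (w : 'cV[S]_r)).
by rewrite mulmxDr -scalemxAr.
Qed.

Lemma dact0 : dact 0 = 0. Proof. exact: mulmx0. Qed.
Lemma dact2 v : dact (dact v) = 0.
Proof. by rewrite /dact mulmxA DD mul0mx. Qed.
Lemma dact_sum (J : Type) (l : seq J) (G : J -> V) :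
  dact (\sum_(j <- l) G j) = \sum_(j <- l) dact (G j).
Proof. exact: mulmx_sumr. Qed.
Lemma dactD v w : dact (v + w) = dact v + dact w. Proof. exact: mulmxDr. Qed.
Lemma dactB v w : dact (v - w) = dact v - dact w. Proof. exact: mulmxBr. Qed.

Lemma dact_hom n v : hom a n v -> hom a n.+1 (dact v).
Proof.
move=> hv [i m]; rewrite /cf /dact mxE /= => h.
have : m \in msupp (\sum_j D i j * (v : 'cV[S]_r) j 0) by rewrite mcoeff_msupp.
move=> /msupp_sum_le /flatten_mapP[j _] /msuppM_le /allpairsP[[m1 m2] /= [h1 h2 ->]].
have e1 := D_hom h1; have e2 : (a j + 2 * mdeg m2 = n)%N.
  by apply: (hv (j, m2)); rewrite /cf /= -mcoeff_msupp.
by rewrite /wt /= mdegD; lia.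
Qed.

Lemma dact_hpart n v : dact (hpart a n v) = hpart a n.+1 (dact v).
Proof.
have [N hN] := hpart_sum a v; set M := (N + n.+1)%N.
have e := hN M (leq_addr _ _); rewrite [in RHS]e dact_sum.
have hl : forall l : seq 'I_M, hpart a n.+1 (\sum_(j <- l) dact (hpart a j v))
    = \sum_(j <- l) hpart a n.+1 (dact (hpart a j v)).
  elim=> [|j l IH]; rewrite ?big_nil ?big_cons.
    by apply: hpart_id; apply: (hom_subsp k c a n.+1).1.
  by rewrite -[dact _ + _](congr1 (fun x => x + _) (scale1r _)) hpart_lin IH scale1r.
have lt : (n < M)%N by rewrite /M; lia.
rewrite hl (bigD1 (Ordinal lt)) //= big1 ?addr0 => [|j ne].
  by apply/esym/hpart_id/dact_hom/hpart_hom.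
apply: hpart_other; first exact/dact_hom/hpart_hom.
by apply: contra ne => /eqP[e']; apply/eqP/val_inj; rewrite /= e'.
Qed.

Lemma hpart0_dact v : hpart a 0 (dact v) = 0.
Proof.
have [N hN] := hpart_sum a v; rewrite (hN N (leqnn N)) dact_sum.
elim: (index_enum _) => [|j l IH]; rewrite ?big_nil ?big_cons.
  by apply: hpart_id; apply: (hom_subsp k c a 0).1.
rewrite -[dact _ + _](congr1 (fun x => x + _) (scale1r _)) hpart_lin IH addr0 scale1r.
by apply: hpart_other; first exact/dact_hom/hpart_hom.
Qed.

Definition cyc n v := hom a n v /\ dact v = 0.
Definition bnd n v := hom a n v /\ exists w, v = dact w.

Lemma bndS n v : bnd n.+1 v <-> exists2 w, hom a n w & v = dact w.
Proof.
split=> [[hv [w vw]]|[w hw ->]]; last by split; [apply: dact_hom|exists w].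
exists (hpart a n w); first exact: hpart_hom.
by rewrite dact_hpart -vw hpart_id.
Qed.

Lemma bnd0 v : bnd 0 v -> v = 0.
Proof. by move=> [hv [w vw]]; rewrite -(hpart_id hv) vw hpart0_dact. Qed.

Lemma cyc_subsp n : subsp (cyc n).
Proof.
have [h0 hl] := hom_subsp k c a n.
split=> [|t v w [hv dv] [hw dw]]; first by split; [|apply: dact0].
by split; [apply: hl|rewrite dact_lin dv dw scaler0 addr0].
Qed.

Lemma bnd_subsp n : subsp (bnd n).
Proof.
have [h0 hl] := hom_subsp k c a n.
split=> [|t v w [hv [v' ve]] [hw [w' we]]].
  by split=> //; exists 0; rewrite dact0.
split; last by exists (t *: v' + w'); rewrite dact_lin ve we.
exact: hl.
Qed.

Lemma bnd_cyc n v : bnd n v -> cyc n v.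
Proof. by move=> [hv [w vw]]; split=> //; rewrite vw dact2. Qed.

Definition fdim n : nat := (\sum_i size (tmons c n (a i)))%N.
Definition hilb (h : nat -> nat) : Prop := forall n, dimq (cyc n) (bnd n) (h n).
Definition bdim (b : nat -> nat) : Prop := forall n, dimq (bnd n) (fun v => v = 0) (b n).

Lemma dimq_hom_sub (U W : V -> Prop) n : subsp U -> subsp W -> (forall v, U v -> hom a n v) ->
  exists m, dimq U W m.
Proof.
move=> hU hW Uh; have [v [vh sv iv]] := dimq_hom k c a n.
have [|m _ hm] := @dimq_ex _ _ U W _ v hW hU; last by exists m.
move=> x Ux; have [t xt] := sv x (Uh x Ux); exists t; rewrite xt; exact: hW.1.
Qed.

Lemma hilb_ex : exists h, hilb h.
Proof.
have /choice[h hP] n : exists m, dimq (cyc n) (bnd n) m.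
  by apply: (@dimq_hom_sub _ _ n); [exact: cyc_subsp|exact: bnd_subsp|by move=> v []].
by exists h.
Qed.

Lemma bdim_ex : exists b, bdim b.
Proof.
have /choice[h hP] n : exists m, dimq (bnd n) (fun v : V => v = 0) m.
  by apply: (@dimq_hom_sub _ _ n); [exact: bnd_subsp|exact: subsp0|by move=> v []].
by exists h.
Qed.

(** In weight [n] the free module splits numerically into homology, boundaries, and the image under
    [D], which is the space of boundaries in weight [n.+1]. *)
Lemma hilb_bdim h b : hilb h -> bdim b -> forall n, fdim n = (h n + b n + b n.+1)%N.
Proof.
move=> hh hb n; have sp0 := subsp0 k c r.
have d1 : dimq (cyc n) (fun v => v = 0) (h n + b n).
  by apply: (dimq_add sp0 (bnd_subsp n) _ _ (hh n) (hb n)) => [v /bnd_cyc|v ->] //;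
    apply: (bnd_subsp n).1.
have d2 : dimq (hom a n) (cyc n) (b n.+1).
  apply: (@dimq_preimg _ _ _ (hom a n) (cyc n) (bnd n.+1) (fun v => v = 0) dact).
  - exact: dact_lin.
  - exact: hom_subsp.
  - exact: sp0.
  - by move=> v hv; apply/bndS; exists v.
  - by move=> v hv; split=> [[]|].
  - by move=> y /bndS[w hw ->]; exists w; rewrite ?subrr.
  - exact: hb.
have := dimq_add sp0 (cyc_subsp n) _ _ d2 d1; rewrite addnC => d3.
apply: dimq_uniq (dimq_hom k c a n) (d3 _ _) => // [v []|v ->] //.
exact: (cyc_subsp n).1.
Qed.
End Homology.

Section Extension.
Variables (k K : fieldType) (g : {rmorphism k -> K}) (c r : nat) (a : 'I_r -> nat).
Local Notation S := {mpoly k[c]}.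
Variable D : 'M[S]_r.
Hypothesis DD : D *m D = 0.
Hypothesis D_hom : wthom a D.

Definition extmx m n (M : 'M[S]_(m, n)) : 'M[{mpoly K[c]}]_(m, n) := map_mx (map_mpoly g) M.

Lemma extD_hom : wthom a (extmx D).
Proof.
move=> i j m; rewrite mcoeff_msupp mxE mcoeff_map_mpoly => h; apply: D_hom.
by move: h; rewrite mcoeff_msupp fmorph_eq0.
Qed.

Lemma extDD : extmx D *m extmx D = 0.
Proof. by rewrite /extmx -map_mxM DD map_mx0. Qed.

Definition extv (v : cvk k c r) : cvk K c r := extmx (v : 'cV[S]_r).

Lemma cf_extv p v : cf p (extv v) = g (cf p v).
Proof. by rewrite /cf mxE mcoeff_map_mpoly. Qed.

Lemma extv_ev p : extv (ev k p) = ev K p.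
Proof. by apply: cfP => q; rewrite cf_extv !cf_ev rmorph_nat. Qed.

Lemma extv_dact v : extv (dact D v) = dact (extmx D) (extv v).
Proof. by rewrite /extv /dact /extmx -map_mxM. Qed.

Lemma extv_comb n (t : 'I_n -> k) (v : 'I_n -> cvk k c r) :
  extv (\sum_i t i *: v i) = \sum_i g (t i) *: extv (v i).
Proof.
apply: cfP => p; rewrite cf_extv !cf_sum rmorph_sum; apply: eq_bigr => i _.
by rewrite !cfZ cf_extv rmorphM.
Qed.

Lemma extv_hom n v : hom a n v -> hom a n (extv v).
Proof. by move=> hv p; rewrite cf_extv fmorph_eq0 => /hv. Qed.

Lemma extv_indep n b (v : 'I_b -> cvk k c r) : (forall i, hom a n (v i)) ->
  indq (fun v => v = 0) v -> indq (fun v => v = 0) (fun i => extv (v i)).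
Proof.
move=> hv iv; pose l := in_tuple (wbasis c a n).
pose M : 'M[k]_(b, size (wbasis c a n)) := \matrix_(i, j) cf (tnth l j) (v i).
have cfM p : p \in wbasis c a n -> exists j, p = tnth l j by move=> /(tnthP l).
have Mf : row_free M.
  apply/row_freeP; apply/row_freeP; rewrite -kermx_eq0.
  apply/negPn/negP => /rowV0Pn[u /sub_kermxP uM u0]; case/negP: u0; apply/eqP/rowP => i.
  rewrite [RHS]mxE; apply: (iv (fun i => u 0 i)); apply: cfP => p; rewrite cf_sum cf0.
  have [|np] := boolP (p \in wbasis c a n).
    move=> /cfM[j ->]; have := congr1 (fun x : 'rV_ _ => x 0 j) uM; rewrite !mxE => e.
    by rewrite -[RHS]e; apply: eq_bigr => i' _; rewrite cfZ mxE.
  rewrite big1 // => i' _; rewrite cfZ; have [->|/hv] := eqVneq (cf p (v i')) 0.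
    by rewrite mulr0.
  by move/eqP; rewrite -mem_wbasis (negbTE np).
move=> t ht i; have : (\row_i t i) *m map_mx g M = 0.
  apply/rowP => j; have := congr1 (cf (tnth l j)) ht; rewrite cf_sum cf0 => e; rewrite [RHS]mxE.
  by rewrite -[RHS]e mxE; apply: eq_bigr => i' _; rewrite cfZ cf_extv !mxE.
have Mf' : row_free (map_mx g M) by rewrite row_free_map.
rewrite -(mul0mx _ (map_mx g M)) => /(row_free_inj Mf') /rowP/(_ i).
by rewrite !mxE.
Qed.

Lemma bdim_ext b : bdim a D b -> bdim a (extmx D) b.
Proof.
move=> hb n; have [v [vb sv iv]] := hb n; exists (fun i => extv (v i)); split.
- move=> i; have [hv [w vw]] := vb i; split; first exact: extv_hom.
  by exists (extv w); rewrite vw extv_dact.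
- case: n v vb sv iv => [|n] v vb sv iv x xb.
    have -> : x = 0 by apply: (bnd0 extD_hom xb).
    by exists (fun=> 0); rewrite big1 ?subr0 // => i _; rewrite scale0r.
  have /(bndS extD_hom)[w hw ->] := xb.
  have -> : w = \sum_(p <- wbasis c a n) cf p w *: ev K p.
    by apply: cf_expand => [|p /hw/eqP]; rewrite ?uniq_wbasis ?mem_wbasis.
  rewrite dact_sum big_seq; elim/big_rec: _ => [|p y pl [t yt]].
    by exists (fun=> 0); rewrite big1 ?subr0 // => i _; rewrite scale0r.
  have [|s es] := sv (dact D (ev k p)).
    apply/bndS => //; exists (ev k p) => // q; rewrite cf_ev.
    have [->|_] := eqVneq q p; last by rewrite eqxx.
    by move: pl; rewrite mem_wbasis => /eqP.
  exists (fun i => cf p w * g (s i) + t i).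
  have -> : dact (extmx D) (cf p w *: ev K p) = cf p w *: \sum_i g (s i) *: extv (v i).
    rewrite -[_ *: ev K p]addr0 dact_lin dact0 addr0 -extv_ev -extv_dact; congr (_ *: _).
    by rewrite -extv_comb; congr extv; apply/eqP; rewrite -subr_eq0 es.
  apply/eqP; rewrite subr_eq0; apply/eqP; have /eqP := yt; rewrite subr_eq0 => /eqP ->.
  rewrite scaler_sumr -big_split; apply: eq_bigr => i _ /=.
  by rewrite scalerDl scalerA.
- by apply: (@extv_indep n) iv => i; have [] := vb i.
Qed.

(** By [hilb_bdim] the Hilbert function is determined by the dimensions of boundaries, and a basis
    of boundaries over [k] stays a basis over [K]. *)
Lemma hilb_ext h : hilb a D h -> hilb a (extmx D) h.
Proof.
move=> hh; have [b hb] := bdim_ex a D; have hb' := bdim_ext hb.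
have [h' hh'] := hilb_ex a (extmx D).
move=> n; suff -> : h n = h' n by [].
have := hilb_bdim DD D_hom hh hb n.
have -> := hilb_bdim extDD extD_hom hh' hb' n.
by move/addIn/addIn.
Qed.
End Extension.

Section RankBounds.
Variables (k : fieldType) (c r : nat) (a : 'I_r -> nat).
Local Notation S := {mpoly k[c]}.
Local Notation tf := (@FracField.tofrac S).
Variable D : 'M[S]_r.
Hypothesis DD : D *m D = 0.
Hypothesis D_hom : wthom a D.

Lemma map_tofrac_inj m n (M N : 'M[S]_(m, n)) : map_mx tf M = map_mx tf N -> M = N.
Proof. by move=> h; apply/matrixP => i j; apply/eqP; rewrite -tofrac_eq; have := congr1 (fun X : 'M_(m, n) => X i j) h; rewrite !mxE => ->. Qed.

Lemma bdim_le b : bdim a D b -> exists I : 'I_(\rank (map_mx tf D)) -> 'I_r,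
  forall n, (b n <= \sum_i size (tmons c n (a (I i))))%N.
Proof.
move=> hb; pose M := map_mx tf D; pose f := maxrankfun M; exists f => n.
have [L LM] : exists L, M = L *m rowsub f M.
  by apply/submxP; rewrite eq_maxrowsub.
have [v [vb sv iv]] := hb n.
pose g (v : cvk k c r) : cvk k c _ := rowsub f (v : 'cV[S]_r).
have cg p v' : cf p (g v') = cf (f p.1, p.2) v' by rewrite /cf /g !mxE.
have ginj v' : (exists w, v' = dact D w) -> g v' = 0 -> v' = 0.
  move=> [w ->] g0; apply: map_tofrac_inj; rewrite map_mx0 /dact map_mxM -/M LM -mulmxA.
  have -> : rowsub f M *m map_mx tf (w : 'cV[S]_r) = map_mx tf (g (dact D w)).
    by rewrite /g /dact map_mxsub map_mxM mul_rowsub_mx.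
  by rewrite g0 map_mx0 mulmx0.
apply: (dimq_ge (w := fun i => g (v i)) (subsp0 _ _ _) (dimq_hom k c (fun i => a (f i)) n)).
  move=> j p; rewrite cg => h; have [hv _] := vb j.
  exact: (hv _ h).
move=> t ht; apply: iv; apply: ginj.
  have [_ hB] := subsp_comb (bnd_subsp a D n) t vb.
  exact: hB.
rewrite -[RHS]ht; apply: cfP => p; rewrite cg !cf_sum; apply: eq_bigr => i _.
by rewrite !cfZ cg.
Qed.

(** [D] is injective on the free submodule spanned by the generators whose columns are independent
    over the fraction field. *)
Lemma bdim_ge b : bdim a D b -> exists J : 'I_(\rank (map_mx tf D)) -> 'I_r,
  forall n, (\sum_j size (tmons c n (a (J j))) <= b n.+1)%N.
Proof.
move=> hb; pose M := map_mx tf D; rewrite -mxrank_tr map_trmx.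
pose f := maxrankfun (map_mx tf D^T); exists f => n.
have := dimq_hom k c (fun i => a (f i)) n.
move: (\sum_i _)%N => n0 [v [vh sv iv]].
pose g (w : cvk k c _) : cvk k c r := colsub f 1%:M *m (w : 'cV[S]_(\rank (map_mx tf D^T))).
have g_lin t x y : g (t *: x + y) = t *: g x + g y.
  rewrite /g -[(t *: x + y)]/(t%:MP *: (x : 'cV[S]__) + (y : 'cV[S]__)).
  by rewrite mulmxDr -scalemxAr.
have g0 : g 0 = 0 by apply: mulmx0.
have g_hom w : hom (fun i => a (f i)) n w -> hom a n (g w).
  move=> hw [i m]; rewrite /cf /g mxE /= => h.
  have : m \in msupp (\sum_j (colsub f 1%:M : 'M[S]_(r, _)) i j * (w : 'cV[S]__) j 0).
    by rewrite mcoeff_msupp.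
  move=> /msupp_sum_le /flatten_mapP[j _]; rewrite !mxE.
  have [->|_] := eqVneq i (f j); last by rewrite mul0r msupp0.
  by rewrite mul1r mcoeff_msupp => /(hw (j, m)).
have ginj w : dact D (g w) = 0 -> w = 0.
  rewrite /dact /g mulmxA mulmx_colsub mulmx1 => e; apply: map_tofrac_inj; rewrite map_mx0.
  have := congr1 (fun X => (map_mx tf X)^T) e; rewrite map_mxM trmx_mul map_mx0 trmx0.
  have -> : (map_mx tf (colsub f D))^T = rowsub f (map_mx tf D^T).
    by apply/matrixP => i j; rewrite !mxE.
  rewrite -(mul0mx _ (rowsub f (map_mx tf D^T))) => /(row_free_inj (maxrowsub_free _)) e'.
  by rewrite -[LHS]trmxK e' trmx0.
apply: (dimq_ge (w := fun i => dact D (g (v i))) (subsp0 _ _ _) (hb n.+1)).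
  by move=> j; apply/bndS => //; exists (g (v j)) => //; apply: g_hom.
move=> t ht; apply: iv; apply: ginj; rewrite -[RHS]ht.
elim/big_rec2: _ => [|i y1 y2 _ <-]; first by rewrite g0 dact0.
by rewrite g_lin dact_lin.
Qed.
End RankBounds.

(** * Orders of growth of partial sums *)

Definition cum (h : nat -> nat) (N : nat) : nat := (\sum_(n < N.+1) h n)%N.

(** This is [f = O(N^(d - 1))], multiplied out so that [d = 0] makes sense: [f] then vanishes beyond
    [C]. *)
Definition bigO (d : nat) (f : nat -> nat) : Prop :=
  exists C, forall N, (f N * N <= C * N ^ d)%N.

Section Growth.
Local Open Scope nat_scope.

Lemma cumS h N : cum h N.+1 = cum h N + h N.+1.
Proof. by rewrite /cum big_ord_recr. Qed.
Lemma cum0 h : cum h 0 = h 0. Proof. by rewrite /cum big_ord1. Qed.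
Lemma cum_mono h M N : M <= N -> cum h M <= cum h N.
Proof.
move=> /subnK <-; elim: (N - M) => // n IH.
by rewrite addSn cumS; apply: leq_trans IH (leq_addr _ _).
Qed.
Lemma leq_cum f g N : (forall n, f n <= g n) -> cum f N <= cum g N.
Proof. by move=> h; apply: leq_sum. Qed.
Lemma cumD f g N : cum (fun n => f n + g n) N = cum f N + cum g N.
Proof. exact: big_split. Qed.
Lemma cum_sum (J : finType) (F : J -> nat -> nat) N :
  cum (fun n => \sum_j F j n) N = \sum_j cum (F j) N.
Proof. exact: exchange_big. Qed.
Lemma eq_cum f g N : f =1 g -> cum f N = cum g N.
Proof. by move=> h; apply: eq_bigr. Qed.

Lemma bigO_le d f g : (forall n, f n <= g n) -> bigO d g -> bigO d f.
Proof. by move=> fg [C hC]; exists C => N; apply: leq_trans (hC N); rewrite leq_mul2r fg orbT. Qed.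
Lemma bigOD d f g : bigO d f -> bigO d g -> bigO d (fun n => f n + g n).
Proof. by move=> [C hC] [C' hC']; exists (C + C') => N; rewrite !mulnDl leq_add. Qed.
Lemma bigO_0 d : bigO d (fun=> 0). Proof. by exists 0. Qed.
Lemma bigO_sum d (J : finType) (F : J -> nat -> nat) :
  (forall j, bigO d (F j)) -> bigO d (fun n => \sum_j F j n).
Proof.
move=> h; have e n : \sum_j F j n = \sum_(j <- index_enum J) F j n by [].
elim: (index_enum J) => [|j l IH].
  by apply: bigO_le (bigO_0 d) => n; rewrite big_nil.
by apply: bigO_le (bigOD (h j) IH) => n; rewrite big_cons.
Qed.
Lemma bigOM d q f : bigO d f -> bigO d (fun n => q * f n).
Proof. by move=> [C hC]; exists (q * C) => N; rewrite -!mulnA leq_mul2l hC orbT. Qed.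

Lemma leq_expW m n d : m <= n -> m ^ d <= n ^ d.
Proof. by case: d => // d; rewrite leq_exp2r. Qed.

Lemma bigO_shift d w f : bigO d f -> bigO d (fun n => f (n + w)).
Proof.
move=> [C hC]; exists (C * w.+1 ^ d) => -[|N]; first by rewrite muln0.
apply: leq_trans (_ : f (N.+1 + w) * (N.+1 + w) <= _); first by rewrite leq_mul2l leq_addr orbT.
apply: leq_trans (hC _) _; rewrite -mulnA leq_mul2l -expnMn; apply/orP; right.
apply: leq_expW; nia.
Qed.

Definition lowerb d h : Prop := exists C N0, forall N, N0 <= N -> N ^ d <= C * cum h N.
Definition cum_close d h h' : Prop := exists2 G, bigO d G &
  forall N, cum h N <= cum h' N + G N /\ cum h' N <= cum h N + G N.

Lemma lowerb_sub d g h G : lowerb d g -> bigO d G ->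
  (forall N, cum g N <= cum h N + G N) -> lowerb d h.
Proof.
move=> [C [N0 hC]] [C' hC'] gh; exists (2 * C), (maxn 1 (maxn N0 (2 * (C * C')))) => N.
rewrite !geq_max => /and3P[N1 hN0 hN].
have h1 : N ^ d * N <= C * cum h N * N + C * C' * N ^ d.
  apply: leq_trans (_ : (C * (cum h N + G N)) * N <= _).
    by rewrite leq_mul2r (leq_trans (hC _ hN0)) ?orbT // leq_mul2l gh orbT.
  by rewrite mulnDr mulnDl leq_add2l -!mulnA leq_mul2l hC' orbT.
have h2 : 2 * (C * C' * N ^ d) <= N ^ d * N by rewrite mulnA [N ^ d * N]mulnC leq_mul2r hN orbT.
rewrite -(leq_pmul2r N1) -mulnA mul2n -addnn; nia.
Qed.

(** The statement carried through the induction on variables. Zero homology is set apart since it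
    satisfies [lowerb d] for no [d]. *)
Definition dual_growth h h' : Prop := (forall n, h n = 0 /\ h' n = 0) \/
  exists d, [/\ lowerb d h, bigO d h, bigO d h' & cum_close d h h'].

Section Monomials.
Variable c : nat.
Local Notation tm w n := (size (tmons c n w)).

Lemma tmS w n : tm w.+1 n.+1 = tm w n.
Proof. by rewrite /tmons ltnS subSS. Qed.
Lemma tmS0 w : tm w.+1 0 = 0.
Proof. by []. Qed.

Lemma cum_tmS w N : cum (fun n => tm w n) N = cum (fun n => tm w.+1 n) N + tm w N.
Proof.
elim: N => [|N IH]; first by rewrite !cum0 tmS0.
by rewrite cumS IH [in RHS]cumS tmS.
Qed.

(** Changing the weight of a generator alters partial sums only by terms of lower order, so all
    generators can be compared with one of weight 0. *)
Lemma cum_tm0 w N : cum (fun n => tm 0 n) N = cum (fun n => tm w n) N + \sum_(i < w) tm i N.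
Proof.
elim: w => [|w IH]; first by rewrite big_ord0 addn0.
by rewrite IH cum_tmS big_ord_recr /= -addnA [tm w N + _]addnC.
Qed.
End Monomials.

Lemma binD_le c d : 'C(d + c, c) <= d.+1 ^ c.
Proof.
elim: c => [|c IH]; first by rewrite bin0.
have e := mul_bin_diag (d + c.+1) c; rewrite addnS /= in e.
rewrite addnS -(leq_pmul2l (ltn0Sn c)) -e expnS.
apply: leq_trans (leq_mul (leqnn _) IH) _; rewrite mulnA leq_mul2r.
by apply/orP; right; nia.
Qed.

Lemma binD_ge c d : d.+1 ^ c <= c`! * 'C(d + c, c).
Proof.
elim: c => [|c IH]; first by rewrite bin0.
have e := mul_bin_diag (d + c.+1) c; rewrite addnS /= in e.
rewrite addnS factS -mulnA mulnCA -e mulnCA expnS.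
by apply: leq_mul => //; lia.
Qed.

Lemma size_mons c d : size (monsof c d) = if c is c'.+1 then 'C(d + c', c') else (d == 0).
Proof.
case: c => [|c'].
  have m0 (m : 'X_{1..0}) : m = 0%MM by apply/mnmP => -[].
  case: d => [|d].
    apply/eqP; rewrite /= eqn_leq; apply/andP; split.
      apply: (@uniq_leq_size _ (monsof 0 0) [:: 0%MM]); first exact: uniq_basis.
      by move=> m _; rewrite inE (m0 m).
    rewrite lt0n size_eq0; apply/eqP => e; have := basis_cover 0 (0%MM : 'X_{1..0}).
    by rewrite e mdeg0.
  apply/eqP; rewrite size_eq0; apply/eqP.
  case e: (monsof 0 d.+1) => [//|m l]; have := basis_cover d.+1 m.
  by rewrite e mem_head (m0 m) mdeg0.
by have := bin_sub (leq_addl d c'); rewrite addnK size_basis => ->.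
Qed.

Section MonomialGrowth.
Variable c : nat.
Local Notation tm w n := (size (tmons c n w)).

Lemma bigO_tm w : bigO c (fun n => tm w n).
Proof.
have le n d : size (monsof c d) * n <= (d == 0) * n + (d + 2) ^ c.-1 * n.
  rewrite -mulnDl leq_mul2r; apply/orP; right; rewrite size_mons.
  case: c => [|c'] /=; first exact: leq_addr.
  apply: leq_trans (binD_le _ _) (leq_trans (leq_expW _ _) (leq_addl _ _)); lia.
move: le; rewrite /tmons; case: c => [|c'] le.
  exists w => n; rewrite expn0 muln1; case: ifP => [/andP[wn ev]|_]; last by [].
  rewrite size_mons; case: eqP => [e|_]; last by rewrite mul0n.
  by rewrite mul1n; lia.
exists (2 ^ c') => n; case: ifP => [/andP[wn ev]|_]; last by [].
rewrite size_mons expnS mulnCA mulnC -expnMn leq_mul2l.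
case: n wn ev => [//|n] wn ev.
apply/orP; right; apply: leq_trans (binD_le _ _) (leq_expW _ _); lia.
Qed.

Lemma lowerb_tm w : lowerb c (fun n => tm w n).
Proof.
have low M : 'C(M + c, c) <= cum (fun n => tm w n) (w + 2 * M).
  have tE d : tm w (w + 2 * d) = size (monsof c d).
    rewrite /tmons leq_addr addKn mul2n odd_double /= doubleK.
    by [].
  elim: M => [|M IH].
    rewrite muln0 addn0 add0n binn; apply: leq_trans (_ : tm w w <= _).
      have := tE 0; rewrite muln0 addn0 => ->; rewrite size_mons.
      by case: c => [//|c']; rewrite add0n binn.
    by rewrite /cum big_ord_recr /= leq_addl.
  have -> : w + 2 * M.+1 = (w + 2 * M).+2 by lia.
  rewrite !cumS; have := tE M.+1; have -> : w + 2 * M.+1 = (w + 2 * M).+2 by lia.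
  move=> ->; rewrite size_mons.
  apply: leq_trans (leq_add (leq_trans IH (leq_addr _ _)) (leqnn _)).
  case: c => [|c'] //=; first by rewrite !bin0.
  by rewrite addSn binS addSnnS.
exists (c`! * (w + 2) ^ c), w => N wN; pose M := (N - w) %/ 2.
apply: leq_trans (_ : ((w + 2) * M.+1) ^ c <= _).
  apply: leq_expW; rewrite /M; have := divn_eq (N - w) 2; have := ltn_pmod (N - w) (isT : 0 < 2).
  nia.
rewrite expnMn mulnAC [X in _ <= X]mulnC leq_mul2l; apply/orP; right.
apply: leq_trans (binD_ge _ _) _; rewrite leq_mul2l; apply/orP; right.
apply: leq_trans (low M) (cum_mono _ _); rewrite /M; have := divn_eq (N - w) 2; lia.
Qed.
End MonomialGrowth.
End Growth.

(* The homology has positive rank, so its Hilbert function is that of a free module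
   of that rank up to lower order terms. *)
Theorem dual_growth_generic (k : fieldType) (c r : nat) (a a' : 'I_r -> nat)
    (D : 'M[{mpoly k[c]}]_r) h h' : D *m D = 0 -> wthom a D -> wthom a' D^T ->
  hilb a D h -> hilb a' D^T h' -> (2 * \rank (map_mx (@FracField.tofrac _) D) < r)%N ->
  dual_growth h h'.
Proof.
set q := \rank _ => DD Da Da' hh hh' qr.
pose w := (\sum_i (a i + a' i)).+1%N.
have aw i : (a i < w)%N by rewrite ltnS (bigD1 i) //= -addnA leq_addr.
have aw' i : (a' i < w)%N by rewrite ltnS (bigD1 i) //= -addnA addnCA leq_addr.
pose T := cum (fun n => size (tmons c n 0)).
pose E N := (\sum_(i < w) size (tmons c N i))%N.
have EO : bigO c E by apply: bigO_sum => i; apply: bigO_tm.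
have tmT v N : (v <= w)%N -> (cum (fun n => size (tmons c n v)) N <= T N)%N /\
    (T N <= cum (fun n => size (tmons c n v)) N + E N)%N.
  move=> vw; rewrite /T (cum_tm0 c v N); split; first exact: leq_addr.
  by rewrite leq_add2l /E -(subnKC vw) big_split_ord /= leq_addr.
(* [key] says that [cum h1] is [(r - 2 q) T] up to [G], without subtraction. The numbers [r] and [q]
   are the same for [D] and its transpose. *)
suff key (a1 : 'I_r -> nat) (D1 : 'M[{mpoly k[c]}]_r) h1 : D1 *m D1 = 0 -> wthom a1 D1 ->
    (forall i, a1 i < w)%N -> \rank (map_mx (@FracField.tofrac _) D1) = q ->
    hilb a1 D1 h1 -> exists G, [/\ bigO c G, bigO c h1,
      forall N, (cum h1 N + 2 * q * T N <= r * T N + G N)%N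
      & forall N, (r * T N <= cum h1 N + 2 * q * T N + G N)%N].
  have [G [GO hO h1 h2]] := key a D h DD Da aw erefl hh.
  have [||G' [GO' hO' h1' h2']] := key a' D^T h' _ Da' aw' _ hh'.
  - by rewrite -trmx_mul DD trmx0.
  - by rewrite -map_trmx mxrank_tr.
  right; exists c; split=> //.
    apply: (lowerb_sub (lowerb_tm c 0) GO) => N; have := h2 N; rewrite -/(T N).
    have : (2 * q * T N + T N <= r * T N)%N by rewrite -mulSnr leq_mul2r qr orbT.
    lia.
  exists (fun N => G N + G' N)%N; first exact: bigOD.
  by move=> N; have := h1 N; have := h2 N; have := h1' N; have := h2' N; lia.
move=> DD1 Da1 aw1 rk hh1; have [b hb] := bdim_ex a1 D1.
have := bdim_le hb; have := bdim_ge Da1 hb; rewrite rk => -[J bJ] [I bI].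
have fhb := hilb_bdim DD1 Da1 hh1 hb.
have fO : bigO c (fdim c a1) by apply: bigO_sum => i; apply: bigO_tm.
have hO : bigO c h1 by apply: bigO_le fO => n; rewrite fhb -addnA leq_addr.
have bO : bigO c (fun N => b N.+1).
  by apply: bigO_le fO => n; rewrite fhb leq_addl.
have b0 : b 0%N = 0%N.
  apply: dimq0 (hb 0%N); first exact: subsp0.
  by move=> v; apply: bnd0.
(* The sums of [b n] and of [b n.+1] differ by one boundary term, because [b 0 = 0]. *)
have cumf N : cum (fdim c a1) N = (cum h1 N + (2 * cum b N + b N.+1))%N.
  rewrite (eq_cum (g := fun n => h1 n + (b n + b n.+1))%N); last by move=> n; rewrite fhb addnA.
  rewrite !cumD; congr (_ + _)%N.
  have : (cum b N + b N.+1 = b 0 + cum (fun n => b n.+1) N)%N.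
    by rewrite -cumS /cum big_ord_recl.
  by rewrite b0; lia.
exists (fun N => r * E N + 2 * q * E N + b N.+1)%N; split=> //.
- by apply: bigOD => //; apply: bigOD; apply: bigOM.
- move=> N.
  have bl : (q * T N <= cum b N + q * E N)%N.
    apply: leq_trans (_ : (\sum_(j < q) (cum (fun n => size (tmons c n (a1 (J j)).+1)) N + E N) <= _)%N).
      rewrite -[q in (q * _)%N]card_ord -sum_nat_const; apply: leq_sum => j _.
      by have [] := tmT (a1 (J j)).+1 N (aw1 _).
    rewrite big_split /= sum_nat_const card_ord leq_add2r -cum_sum.
    apply: leq_cum => -[|n]; first by rewrite b0 big1.
    by apply: leq_trans (bJ n); apply: leq_sum => j _; rewrite tmS.
  have fl : (cum (fdim c a1) N <= r * T N)%N.
    rewrite cum_sum -[r in (r * _)%N]card_ord -sum_nat_const; apply: leq_sum => j _.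
    by have [] := tmT (a1 j) N (ltnW (aw1 _)).
  by move: fl bl; rewrite cumf; nia.
- move=> N.
  have bu : (cum b N <= q * T N)%N.
    apply: leq_trans (leq_cum _ bI) _.
    rewrite cum_sum -[q in (q * _)%N]card_ord -sum_nat_const; apply: leq_sum => j _.
    by have [] := tmT (a1 (I j)) N (ltnW (aw1 _)).
  have fu : (r * T N <= cum (fdim c a1) N + r * E N)%N.
    rewrite cum_sum -[r in (r * _)%N]card_ord -sum_nat_const.
    rewrite -[r in (r * E N)%N]card_ord -sum_nat_const -big_split; apply: leq_sum => j _.
    by have [] := tmT (a1 j) N (ltnW (aw1 _)).
  by move: bu fu; rewrite cumf; nia.
Qed.

(** * Growth for a matrix and its transpose *)

(** The rank makes kernel and image of [M] equal. The rows of [E] lie in the kernel, hence in the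
    image, which gives [E = E P M]; so [E P] is a contraction. *)
Lemma contraction_of_rank (K : fieldType) r (M : 'M[K]_r) : M *m M = 0 ->
  (r <= 2 * \rank M)%N -> exists T : 'M[K]_r, M *m T + T *m M = 1%:M.
Proof.
move=> MM rk; pose P := pinvmx M; pose E := 1%:M - M *m P.
have EM : E *m M = 0.
  rewrite mulmxBl mul1mx; apply/eqP; rewrite subr_eq0; apply/eqP.
  by rewrite mulmxKpV // submx_refl.
have kerM : (kermx M <= M)%MS.
  have MK : (M <= kermx M)%MS by apply/sub_kermxP.
  have rkE : \rank (kermx M) = \rank M.
    apply/eqP; rewrite eqn_leq (mxrankS MK) andbT mxrank_ker.
    by lia.
  have /eqP := rkE; rewrite eq_sym (mxrank_leqif_eq MK) => /andP[_ h].
  exact: h.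
have EE : E = E *m P *m M.
  by rewrite mulmxKpV //; apply: submx_trans kerM; apply/sub_kermxP.
exists (E *m P); rewrite -EE mulmxA.
have -> : M *m E = M by rewrite mulmxBr mulmx1 mulmxA MM mul0mx subr0.
by rewrite /E addrC subrK.
Qed.

Lemma frac_numden (R : idomainType) (x : {fraction R}) :
  exists n d : R, d != 0 /\ @FracField.tofrac R d * x = @FracField.tofrac R n.
Proof.
elim/quotP: x => x _; exists (frac x).1, (frac x).2; split; first exact: denom_ratioP.
rewrite -[@FracField.tofrac R _ * _]/(FracField.mul _ _) !piE.
apply/eqmodP; rewrite /= FracField.equivfE /FracField.mulf /=.
by rewrite !numden_Ratio ?mulf_neq0 ?denom_ratioP ?oner_neq0 //= mul1r mulr1 mulrC.
Qed.

Lemma common_denominator (R : idomainType) m n (M : 'M[{fraction R}]_(m, n)) :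
  exists s (N : 'M[R]_(m, n)), s != 0 /\
    map_mx (@FracField.tofrac R) N = @FracField.tofrac R s *: M.
Proof.
have /choice[nd ndP] (p : 'I_m * 'I_n) : exists nd : R * R, nd.2 != 0 /\
    @FracField.tofrac R nd.2 * M p.1 p.2 = @FracField.tofrac R nd.1.
  by have [n' [d h]] := frac_numden (M p.1 p.2); exists (n', d).
exists (\prod_p (nd p).2), (\matrix_(i, j) ((nd (i, j)).1 * \prod_(p | p != (i, j)) (nd p).2)).
split; first by apply/prodf_neq0 => p _; have [] := ndP p.
apply/matrixP => i j; rewrite !mxE rmorphM /= [in RHS](bigD1 (i, j)) //= [in RHS]rmorphM /=.
by have [_ <-] := ndP (i, j); rewrite /= mulrAC.
Qed.

Section Parts.
Variables (k : fieldType) (c : nat).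
Local Notation S := {mpoly k[c]}.

Lemma mpart_lin P t (p q : S) : mpart P (t *: p + q) = t *: mpart P p + mpart P q.
Proof.
apply/mpolyP => m; rewrite mcoeffD mcoeffZ !mcoeff_mpart mcoeffD mcoeffZ.
by case: ifP; rewrite ?mulr0 ?addr0.
Qed.

Lemma mpartD P (p q : S) : mpart P (p + q) = mpart P p + mpart P q.
Proof. by rewrite -[p]scale1r mpart_lin !scale1r. Qed.

Lemma mpart_sum P (J : Type) (l : seq J) (F : J -> S) :
  mpart P (\sum_(j <- l) F j) = \sum_(j <- l) mpart P (F j).
Proof.
elim/big_rec2: _ => [|j x y _ <-]; last by rewrite mpartD.
by apply/mpolyP => m; rewrite mcoeff_mpart mcoeff0 if_same.
Qed.

Lemma mpart_in (P : pred 'X_{1..c}) (p : S) : (forall m, m \in msupp p -> P m) -> mpart P p = p.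
Proof.
move=> h; apply/mpolyP => m; rewrite mcoeff_mpart.
case: ifP => // Pm; apply/esym/memN_msupp_eq0/negP => /h.
by rewrite Pm.
Qed.

Lemma mpart_out (P : pred 'X_{1..c}) (p : S) : (forall m, m \in msupp p -> ~~ P m) -> mpart P p = 0.
Proof.
move=> h; apply/mpolyP => m; rewrite mcoeff_mpart mcoeff0.
case: ifP => // Pm; apply/memN_msupp_eq0/negP => /h.
by rewrite Pm.
Qed.

Lemma msupp_mpart P (p : S) m : m \in msupp (mpart P p) -> P m && (m \in msupp p).
Proof. by rewrite !mcoeff_msupp mcoeff_mpart; case: ifP; rewrite ?eqxx. Qed.

Lemma mpartMl (P Q : pred 'X_{1..c}) (d p : S) :
  (forall m m', m \in msupp d -> P (m + m')%MM = Q m') -> mpart P (d * p) = d * mpart Q p.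
Proof.
move=> h; have e : p = mpart Q p + mpart (predC Q) p.
  by apply/mpolyP => m; rewrite mcoeffD !mcoeff_mpart /=; case: (Q m); rewrite ?addr0 ?add0r.
have h1 : mpart P (d * mpart Q p) = d * mpart Q p.
  apply: mpart_in => m /msuppM_le /allpairsP[[m1 m2] /= [m1d /msupp_mpart/andP[h2 _] ->]].
  by rewrite h.
have h2 : mpart P (d * mpart (predC Q) p) = 0.
  apply: mpart_out => m /msuppM_le /allpairsP[[m1 m2] /= [m1d /msupp_mpart/andP[h2 _] ->]].
  by rewrite h.
by rewrite {1}e mulrDr mpartD h1 h2 addr0.
Qed.
End Parts.

Section NullHomotopy.
Variables (k : fieldType) (c r : nat) (a : 'I_r -> nat).
Local Notation S := {mpoly k[c]}.
Local Notation tf := (@FracField.tofrac S).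
Variable D : 'M[S]_r.
Hypothesis DD : D *m D = 0.
Hypothesis D_hom : wthom a D.
Hypothesis D_rk : (r <= 2 * \rank (map_mx tf D))%N.

Lemma nullhomotopy_ex : exists s (T : 'M[S]_r), s != 0 /\ D *m T + T *m D = s%:M.
Proof.
have [|T0 T0P] := contraction_of_rank _ D_rk; first by rewrite -map_mxM DD map_mx0.
have [s [T [s0 TP]]] := common_denominator T0; exists s, T; split=> //.
apply: map_tofrac_inj; rewrite map_mxD !map_mxM TP -scalemxAl -scalemxAr -scalerDr T0P.
by rewrite map_scalar_mx scalemx1.
Qed.

(* A square-zero matrix of half rank over a field is contractible; clear denominators
   in a contraction and take a homogeneous component. *)
Lemma homogeneous_nullhomotopy : exists (s : S) (e : nat) (T : 'M[S]_r),
  [/\ s != 0, forall m, m \in msupp s -> mdeg m = e,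
      forall i j m, m \in msupp (T i j) -> (a i + 2 * mdeg m + 1 = a j + 2 * e)%N
    & D *m T + T *m D = s%:M].
Proof.
have [s [T [s0 TP]]] := nullhomotopy_ex.
have [m0 m0s] : exists m, m \in msupp s.
  by case E: (msupp s) => [|m l]; [rewrite (eqP (_ : s == 0)) ?eqxx // -msupp_eq0 E in s0|exists m; rewrite mem_head].
pose e := mdeg m0.
pose T' := \matrix_(i, j) mpart (fun m => a i + 2 * mdeg m + 1 == a j + 2 * e)%N (T i j) : 'M[S]_r.
exists (mpart (fun m => mdeg m == e) s), e, T'; split.
- apply: contraTneq m0s => h; rewrite mcoeff_msupp negbK.
  by have := congr1 (mcoeff m0) h; rewrite mcoeff_mpart eqxx mcoeff0 => ->.
- by move=> m /msupp_mpart/andP[/eqP].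
- by move=> i j m; rewrite mxE => /msupp_mpart/andP[/eqP].
- apply/matrixP => i j; pose P (m : 'X_{1..c}) := (a i + 2 * mdeg m == a j + 2 * e)%N.
  have := congr1 (fun X : 'M_r => mpart P (X i j)) TP; rewrite !mxE mpartD !mpart_sum => h.
  transitivity (mpart P (s *+ (i == j))); last first.
    rewrite /P; have [->|_] := eqVneq i j; last first.
      by rewrite !mulr0n; apply/mpolyP => m; rewrite mcoeff_mpart mcoeff0 if_same.
    rewrite !mulr1n; apply/mpolyP => m; rewrite !mcoeff_mpart eqn_add2l.
    by rewrite eqn_pmul2l.
  rewrite -h; congr (_ + _); apply: eq_bigr => l _.
    rewrite mxE; apply/esym/mpartMl => m m' /D_hom e1; rewrite /P mdegD.
    by apply/eqP/eqP; lia.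
  rewrite mxE [LHS]mulrC [T i l * D l j]mulrC; apply/esym/mpartMl => m m' /D_hom e1; rewrite /P mdegD.
  by apply/eqP/eqP; lia.
Qed.
End NullHomotopy.

Lemma dimq_triv (k : fieldType) (V : lmodType k) (U W : V -> Prop) :
  subsp W -> (forall x, U x -> W x) -> dimq U W 0.
Proof.
move=> hW UW; exists (fun=> 0); split=> [[]||a _ []] //.
by move=> x /UW; exists (fun=> 0); rewrite big_ord0 subr0.
Qed.

(** * Homology modulo a form that kills the homology *)

Section Quotient.
Variables (k : fieldType) (c r : nat) (a : 'I_r -> nat).
Local Notation S := {mpoly k[c]}.
Local Notation V := (cvk k c r).
Variables (D T : 'M[S]_r) (s : S) (e : nat).
Hypothesis DD : D *m D = 0.
Hypothesis D_hom : wthom a D.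
Hypothesis s0 : s != 0.
Hypothesis s_hom : forall m, m \in msupp s -> mdeg m = e.
Hypothesis T_hom : forall i j m, m \in msupp (T i j) -> (a i + 2 * mdeg m + 1 = a j + 2 * e)%N.
Hypothesis TP : D *m T + T *m D = s%:M.
Variables (c' r' : nat) (a' : 'I_r' -> nat) (D' : 'M[{mpoly k[c']}]_r').
Local Notation V' := (cvk k c' r').
Variable red : V -> V'.
Hypothesis red_lin : forall t v w, red (t *: v + w) = t *: red v + red w.
Hypothesis red_hom : forall n v, hom a n v -> hom a' n (red v).
Definition smul (u : V) : V := s *: (u : 'cV[S]_r).
Hypothesis red_ker : forall v, red v = 0 <-> exists u, v = smul u.
Hypothesis red_surj : forall y, exists v, red v = y.
Hypothesis red_D : forall v, red (dact D v) = dact D' (red v).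

Let red0 : red 0 = 0.
Proof. by have := red_lin (-1) 0 0; rewrite scaler0 addr0 scaleN1r addNr. Qed.
Let redB v w : red (v - w) = red v - red w.
Proof. by rewrite -scaleN1r addrC red_lin scaleN1r addrC. Qed.
Let red_sum (J : Type) (l : seq J) (F : J -> V) :
  red (\sum_(j <- l) F j) = \sum_(j <- l) red (F j).
Proof.
elim/big_rec2: _ => [|j x y _ <-]; first exact: red0.
by rewrite -[F j]scale1r red_lin !scale1r.
Qed.

Lemma red_hpart n v : red (hpart a n v) = hpart a' n (red v).
Proof.
have [N hN] := hpart_sum a v; set M := (N + n.+1)%N.
rewrite [in RHS](hN M (leq_addr _ _)) red_sum.
have hl : forall l : seq 'I_M, hpart a' n (\sum_(j <- l) red (hpart a j v))
    = \sum_(j <- l) hpart a' n (red (hpart a j v)).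
  elim=> [|j l IH]; rewrite ?big_nil ?big_cons.
    by apply: hpart_id; apply: (hom_subsp k c' a' n).1.
  by rewrite -[red _ + _](congr1 (fun x => x + _) (scale1r _)) hpart_lin IH scale1r.
have lt : (n < M)%N by rewrite /M; lia.
rewrite hl (bigD1 (Ordinal lt)) //= big1 ?addr0 => [|j ne].
  by apply/esym/hpart_id/red_hom/hpart_hom.
apply: hpart_other; first exact/red_hom/hpart_hom.
by apply: contra ne => /eqP e'; apply/eqP/val_inj; rewrite /= e'.
Qed.

Lemma red_surj_hom n y : hom a' n y -> exists2 v, hom a n v & red v = y.
Proof.
move=> hy; have [v vy] := red_surj y; exists (hpart a n v); first exact: hpart_hom.
by rewrite red_hpart vy hpart_id.
Qed.

Lemma quot_DD : D' *m D' = 0.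
Proof.
apply/matrixP => i j; have [v vj] := red_surj (delta_mx j 0 : 'cV[_]_r').
have := congr1 (fun x : 'cV[{mpoly k[c']}]_r' => x i 0) (red_D (dact D v)).
rewrite dact2 // red0 red_D vj /dact mulmxA -colE [RHS]mxE => <-.
by rewrite !mxE.
Qed.

Lemma quot_hom : wthom a' D'.
Proof.
move=> i j m mD; have hj : hom a' (a' j) (ev k (j, 0%MM) : V').
  move=> p; rewrite cf_ev; have [-> _|_] := eqVneq p (j, 0%MM); last by rewrite eqxx.
  by rewrite /wt /= mdeg0 muln0 addn0.
have [v hv vj] := red_surj_hom hj.
have := red_hom (dact_hom D_hom hv); rewrite red_D vj => /(_ (i, m)).
apply; rewrite /cf /ev /dact /= mpolyX0 scale1r -colE mxE.
by rewrite -mcoeff_msupp.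
Qed.

(** The component of [u] of weight [n - 2 e], with the condition written additively so that it is 0
    for [n < 2 e]; multiplied by [s] it has weight [n]. *)
Definition spart n (u : V) : V :=
  \col_i mpart (fun m => wt a (i, m) + 2 * e == n)%N ((u : 'cV[S]_r) i 0) : 'cV[S]_r.

Lemma cf_spart p n u : cf p (spart n u) = if (wt a p + 2 * e == n)%N then cf p u else 0.
Proof. by case: p => i m; rewrite /cf /spart mxE mcoeff_mpart. Qed.

Lemma hpart_smul n u : hpart a n (smul u) = smul (spart n u).
Proof.
apply/matrixP => i j; rewrite (ord1 j) !mxE; apply: mpartMl => m m' /s_hom me.
by rewrite /wt /= mdegD me; apply/eqP/eqP; lia.
Qed.

Lemma smul_inj u v : smul u = smul v -> u = v.
Proof.
move=> h; apply/matrixP => i j; apply: (mulfI s0).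
by have := congr1 (fun x : 'cV[S]_r => x i j) h; rewrite !mxE.
Qed.

Lemma smul0 : smul 0 = 0. 
Proof. exact: (@scaler0 S 'cV[S]_r s). Qed.
Lemma smulD u v : smul (u + v) = smul u + smul v. 
Proof. exact: (@scalerDr S 'cV[S]_r s). Qed.
Lemma smulZ t u : smul (t *: u) = t *: smul u.
Proof.
rewrite /smul -[(t *: u : V)]/(t%:MP *: (u : 'cV[S]_r)) scalerA mulrC -scalerA.
by [].
Qed.
Lemma dact_smul u : dact D (smul u) = smul (dact D u).
Proof. by rewrite /dact /smul -scalemxAr. Qed.

Definition tact (u : V) : V := T *m (u : 'cV[S]_r).
Lemma tactP u : smul u = dact D (tact u) + tact (dact D u).
Proof. by rewrite /dact /tact !mulmxA -mulmxDl TP mul_scalar_mx. Qed.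
Lemma tact_lin t v w : tact (t *: v + w) = t *: tact v + tact w.
Proof. exact: (dact_lin T). Qed.
Lemma tact0 : tact 0 = 0.
Proof. exact: mulmx0. Qed.

Lemma tact_hom n u : (2 * e <= n.+1)%N -> hom a (n.+1 - 2 * e) u -> hom a n (tact u).
Proof.
move=> en hu [i m]; rewrite /cf /tact mxE /= => h.
have : m \in msupp (\sum_j T i j * (u : 'cV[S]_r) j 0) by rewrite mcoeff_msupp.
move=> /msupp_sum_le /flatten_mapP[j _] /msuppM_le /allpairsP[[m1 m2] /= [h1 h2 ->]].
have e1 := T_hom h1; have e2 : (a j + 2 * mdeg m2 = n.+1 - 2 * e)%N.
  by apply: (hu (j, m2)); rewrite /cf /= -mcoeff_msupp.
by rewrite /wt /= mdegD; lia.
Qed.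

(** Upstairs version of the reduction: [zt] are the cycles modulo [s], [bt] the boundaries modulo
    [s], and [mt] the true cycles plus multiples of [s]. In the filtration of [zt] by [mt] and [bt]
    the lower quotient is the homology of [D] and the upper one is the same homology in weight
    [n + 1 - 2 e]. *)
Definition zt n v := hom a n v /\ exists u, dact D v = smul u.
Definition bt n v := hom a n v /\ exists w u, v = dact D w + smul u.
Definition mt n v := hom a n v /\ exists z u, dact D z = 0 /\ v = z + smul u.

Lemma zt_subsp n : subsp (zt n).
Proof.
have [h0 hl] := hom_subsp k c a n.
split=> [|t v w [hv [v' ve]] [hw [w' we]]].
  by split=> //; exists 0; rewrite dact0 smul0.
split; first exact: hl.
by exists (t *: v' + w'); rewrite dact_lin smulD smulZ ve we.
Qed.

Lemma bt_subsp n : subsp (bt n).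
Proof.
have [h0 hl] := hom_subsp k c a n.
split=> [|t v w [hv [v1 [v2 ve]]] [hw [w1 [w2 we]]]].
  by split=> //; exists 0, 0; rewrite dact0 smul0 addr0.
split; first exact: hl.
exists (t *: v1 + w1), (t *: v2 + w2); rewrite dact_lin smulD smulZ ve we scalerDr.
by rewrite addrACA.
Qed.

Lemma mt_subsp n : subsp (mt n).
Proof.
have [h0 hl] := hom_subsp k c a n.
split=> [|t v w [hv [v1 [v2 [vz ve]]]] [hw [w1 [w2 [wz we]]]]].
  by split=> //; exists 0, 0; rewrite dact0 smul0 addr0.
split; first exact: hl.
exists (t *: v1 + w1), (t *: v2 + w2); rewrite dact_lin vz wz scaler0 addr0; split=> //.
by rewrite smulD smulZ ve we scalerDr addrACA.
Qed.

(** If [D w + s u] is a cycle then [D u = 0], since [s] is a nonzero element of a domain, and so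
    [s u = D (T u)]. Hence dividing by multiples of [s] makes no further cycle trivial. *)
Lemma mid_dim h n : hilb a D h -> dimq (mt n) (bt n) (h n).
Proof.
move=> hh; apply: (@dimq_img _ _ _ (cyc a D n) (bnd a D n) _ _ id) (hh n) => //.
- exact: cyc_subsp.
- exact: bt_subsp.
- by move=> x [hx dx]; split=> //; exists x, 0; rewrite smul0 addr0.
- move=> x [hx dx]; split=> [[_ [w xw]]|[_ [w [u xw]]]].
    by split=> //; exists w, 0; rewrite smul0 addr0.
  split=> //; exists (w + tact u); rewrite dactD xw; congr (_ + _).
  have du : dact D u = 0.
    apply: smul_inj; rewrite -dact_smul smul0.
    by have := dx; rewrite xw dactD dact2 // add0r.
  by rewrite tactP du tact0 addr0.
- move=> y [hy [z [u [dz yz]]]]; exists (hpart a n z).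
    by split; [exact: hpart_hom|rewrite dact_hpart // dz; apply: hpart_id; apply: (hom_subsp k c a n.+1).1].
  have hD t v w : hpart a n (t *: v + w) = t *: hpart a n v + hpart a n w by apply: hpart_lin.
  have -> : y - hpart a n z = smul (spart n u).
    rewrite -hpart_smul -{1}(hpart_id hy) -scaleN1r addrC -hD scaleN1r yz.
    by rewrite addrA addNr add0r.
  split; last by exists 0, (spart n u); rewrite dact0 add0r.
  by rewrite -hpart_smul; apply: hpart_hom.
Qed.

Lemma zt_div n v : zt n v -> exists u, [/\ dact D v = smul u, dact D u = 0
  & forall p, cf p u != 0 -> (wt a p + 2 * e = n.+1)%N].
Proof.
move=> [hv [u du]]; exists (spart n.+1 u); have e1 : dact D v = smul (spart n.+1 u).
  by rewrite -hpart_smul -du hpart_id //; apply: dact_hom.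
split=> // [|p]; last by rewrite cf_spart; case: ifP => [/eqP //|_]; rewrite eqxx.
by apply: smul_inj; rewrite -dact_smul -e1 dact2 // smul0.
Qed.

(** The connecting map takes [v] with [D v = s u] to [u], of weight [n + 1 - 2 e]. Multiplication by
    [T] inverts it: [D (T u) = s u] for a cycle [u]. *)
Lemma top_dim h n : hilb a D h ->
  dimq (zt n) (mt n) (if (2 * e <= n.+1)%N then h (n.+1 - 2 * e)%N else 0%N).
Proof.
move=> hh; case: leqP => en; last first.
  apply: dimq_triv; first exact: mt_subsp.
  move=> v hv; have [u [du _ uw]] := zt_div hv; split; first by case: hv.
  exists v, 0; rewrite smul0 addr0; split=> //.
  rewrite du (_ : u = 0) ?smul0 //; apply: cfP => p; rewrite cf0.
  by apply/eqP/negPn/negP => /uw; lia.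
apply: (@dimq_img _ _ _ (cyc a D (n.+1 - 2 * e)) (bnd a D (n.+1 - 2 * e)) _ _ tact) (hh _).
- exact: tact_lin.
- exact: cyc_subsp.
- exact: mt_subsp.
- move=> u [hu du]; split; first exact: tact_hom.
  by exists u; rewrite tactP du tact0 addr0.
- move=> u [hu du]; split=> [[_ [w uw]]|[_ [z [w [dz tw]]]]].
    split; first exact: tact_hom.
    exists (- dact D (tact w)), w; split; first by rewrite -scaleN1r -[_ *: _]addr0 dact_lin dact2 // dact0 scaler0 addr0.
    by rewrite tactP uw addrA addNr add0r.
  split=> //; exists w; apply: smul_inj; rewrite -dact_smul tactP du tact0 addr0 tw.
  by rewrite dactD dz add0r.
- move=> v hv; have [u [du uz uw]] := zt_div hv; exists u.
    split=> // p /uw; lia.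
  have hu : hom a n (tact u) by apply: tact_hom => // p /uw; lia.
  split; first by apply: (subspB (hom_subsp k c a n)) => //; case: hv.
  exists (v - tact u), 0; rewrite smul0 addr0; split=> //.
  by rewrite dactB du tactP uz tact0 addr0 subrr.
Qed.

Theorem quot_hilb h h' : hilb a D h -> hilb a' D' h' ->
  forall n, h' n = ((if (2 * e <= n.+1)%N then h (n.+1 - 2 * e) else 0) + h n)%N.
Proof.
move=> hh hh' n.
have d1 := dimq_add (bt_subsp n) (mt_subsp n) _ _ (top_dim n hh) (mid_dim n hh).
have d2 : dimq (zt n) (bt n) (h' n).
  apply: (@dimq_preimg _ _ _ (zt n) (bt n) (cyc a' D' n) (bnd a' D' n) red red_lin) (hh' n).
  - exact: zt_subsp.
  - exact: bnd_subsp.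
  - move=> x [hx [u du]]; split; first exact: red_hom.
    by rewrite -red_D; apply/red_ker; exists u.
  - move=> x [hx _]; split=> [[_ [w [u xw]]]|[_ [y yx]]].
      split; first exact: red_hom.
      exists (red w); rewrite -red_D; apply/eqP; rewrite -subr_eq0 -redB; apply/eqP/red_ker.
      by exists u; rewrite xw addrC addKr.
    split=> //; have [w wy] := red_surj y.
    have /red_ker[u xu] : red (x - dact D w) = 0 by rewrite redB red_D wy yx subrr.
    by exists w, u; rewrite -xu addrC subrK.
  - move=> y [hy dy]; have [v hv vy] := red_surj_hom hy; exists v.
      by split=> //; apply/red_ker; rewrite red_D vy.
    by rewrite vy subrr; apply: (bnd_subsp a' D' n).1.
apply: dimq_uniq d2 (d1 _ _); first exact: bt_subsp.
  move=> v [hv [z [u [dz vz]]]]; split=> //.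
  by exists (dact D u); rewrite vz dactD dz add0r dact_smul.
move=> v [hv [w [u vw]]]; split=> //; exists (dact D w), u.
by rewrite dact2.
Qed.
End Quotient.

Lemma mpoly_rmorph_ext (R : comNzRingType) n (Z : comNzRingType)
    (g h : {rmorphism {mpoly R[n]} -> Z}) :
  (forall t, g t%:MP = h t%:MP) -> (forall i, g 'X_i = h 'X_i) -> g =1 h.
Proof.
move=> gC gX p; rewrite [p]mpolyE !rmorph_sum; apply: eq_bigr => m _.
rewrite -mul_mpolyC !rmorphM gC mpolyXE_id !rmorph_prod; congr (_ * _).
by apply: eq_bigr => i _; rewrite !rmorphXn gX.
Qed.

Section PolyHom.
Variables (K : fieldType) (c : nat).
Local Notation R := {mpoly K[c]}.
Implicit Types (p q : {poly R}).

Definition phom (d : nat) p : Prop :=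
  forall i m, m \in msupp p`_i -> (i + mdeg m = d)%N.

Lemma phom0 d : phom d 0.
Proof. by move=> i m; rewrite coef0 msupp0. Qed.
Lemma phomD d p q : phom d p -> phom d q -> phom d (p + q).
Proof.
move=> hp hq i m; rewrite coefD => /msuppD_le; rewrite mem_cat.
by move=> /orP[/hp|/hq].
Qed.
Lemma phomN d p : phom d p -> phom d (- p).
Proof. by move=> hp i m; rewrite coefN (perm_mem (msuppN _)); apply: hp. Qed.
Lemma phom_sum d (J : Type) (l : seq J) (P : pred J) (F : J -> {poly R}) :
  (forall j, P j -> phom d (F j)) -> phom d (\sum_(j <- l | P j) F j).
Proof. by move=> h; elim/big_rec: _ => [|j x Pj]; [apply: phom0|apply/phomD/h]. Qed.
Lemma phomM d d' p q : phom d p -> phom d' q -> phom (d + d') (p * q).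
Proof.
move=> hp hq i m; rewrite coefM => /msupp_sum_le /flatten_mapP[j _].
move=> /msuppM_le /allpairsP[[m1 m2] /= [/hp h1 /hq h2 ->]].
by rewrite mdegD; have := ltn_ord j; lia.
Qed.
Lemma phomC (t : K) : phom 0 (t%:MP)%:P.
Proof.
move=> i m; rewrite coefC; case: eqP => [->|_]; last by rewrite msupp0.
by rewrite msuppC; case: ifP => _ //; rewrite inE => /eqP ->; rewrite mdeg0.
Qed.
Lemma phomX d : phom d 'X^d.
Proof.
move=> i m; rewrite coefXn; case: eqP => [->|_]; last by rewrite msupp0.
by rewrite mulr1n msupp1 inE => /eqP ->; rewrite mdeg0 addn0.
Qed.
Lemma phomXi i : phom 1 ('X_i)%:P.
Proof.
move=> j m; rewrite coefC; case: eqP => [->|_]; last by rewrite msupp0.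
by rewrite msuppX inE => /eqP ->; rewrite mdeg1.
Qed.
Lemma phom_exp d p n : phom d p -> phom (d * n) (p ^+ n).
Proof.
move=> hp; elim: n => [|n IH]; first by rewrite muln0 expr0; apply: (@phomX 0).
by rewrite exprS mulnS; apply: phomM.
Qed.

Lemma phom_size d p : phom d p -> (size p <= d.+1)%N.
Proof.
move=> hp; apply/leq_sizeP => j dj; apply/eqP; rewrite -msupp_eq0.
by apply/eqP; case E: (msupp _) => [//|m l]; have := hp j m; rewrite E mem_head => /(_ isT); lia.
Qed.

Section Mod.
Variables (P : {poly R}) (e : nat).
Hypothesis Pm : P \is monic.
Hypothesis Ps : size P = e.+1.
Hypothesis Ph : phom e P.

Lemma phom_rmodp d p : phom d p -> phom d (rmodp p P).
Proof.
suff h n : forall p, (size p <= n)%N -> phom d p -> exists q, (size (p - q * P)%R <= e)%N /\ phom d (p - q * P).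
  move=> hp; have [q [qs qh]] := h _ p (leqnn _) hp.
  by rewrite -[p](subrK (q * P)) rmodpD // rmodp_mull // addr0 rmodp_small // Ps ltnS.
elim: n => [|n IH] {}p sp hp.
  by exists 0; rewrite mul0r subr0 (leq_trans sp).
have [pe|pe] := leqP (size p) e; first by exists 0; rewrite mul0r subr0.
pose q := lead_coef p *: 'X^((size p).-1 - e).
have hq : phom (d - e) q.
  move=> i m; rewrite coefZ coefXn; case: eqP => [->|_]; last by rewrite mulr0 msupp0.
  by rewrite mulr1 => /hp; lia.
have de : (e <= d)%N by have := phom_size hp; lia.
have hqP : phom d (q * P) by rewrite -(subnK de); apply: phomM.
have [||q' [h1 h2]] := IH (p - q * P).
- apply/leq_sizeP => j nj; rewrite coefB.
  have [->|ne] := eqVneq j (size p).-1.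
    have -> : (q * P)`_(size p).-1 = lead_coef p.
      rewrite /q -scalerAl coefZ coefXnM; case: ifP => [|_]; first lia.
      have pe' : (e <= (size p).-1)%N by rewrite -ltnS prednK // (leq_ltn_trans _ pe).
      rewrite subKn // -[in P`_e](congr1 predn Ps : (size P).-1 = e).
      by have /monicP := Pm; rewrite /lead_coef => ->; rewrite mulr1.
    by rewrite -/(lead_coef p) subrr.
  have jp : (size p <= j)%N by move: sp pe nj ne; set sz := size p; lia.
  rewrite (nth_default _ jp) nth_default ?subr0 //.
  apply: leq_trans (size_polyMleq _ _) _; rewrite Ps.
  have : (size q <= ((size p).-1 - e).+1)%N.
    by apply: leq_trans (size_scale_leq _ _) _; rewrite size_polyXn.
  by move: sp pe nj ne; set sz := size p; set sq := size q; lia.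
- by apply: phomD => //; apply: phomN.
by exists (q + q'); rewrite mulrDl opprD addrA.
Qed.

Lemma rmodp_monic_eq0P p : rmodp p P = 0 <-> exists q, p = q * P.
Proof.
split=> [h|[q ->]]; last by rewrite rmodp_mull.
by exists (rdivp p P); rewrite {1}(rdivp_eq Pm p) h addr0.
Qed.

Lemma size_rmodp p : (size (rmodp p P) <= e)%N.
Proof. by rewrite -ltnS -Ps ltn_rmodpN0 // monic_neq0. Qed.

Definition tr p : R := (rmodp p P)`_e.-1.

Lemma trD p q : tr (p + q) = tr p + tr q.
Proof. by rewrite /tr rmodpD // coefD. Qed.
Lemma trZ t p : tr (t *: p) = t * tr p.
Proof. by rewrite /tr rmodpZ // coefZ. Qed.
Lemma tr_mod p q : tr (p * rmodp q P) = tr (p * q).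
Proof. by rewrite /tr rmodp_mulmr. Qed.
Lemma tr_sum (J : Type) (l : seq J) (Q : pred J) (F : J -> {poly R}) :
  tr (\sum_(j <- l | Q j) F j) = \sum_(j <- l | Q j) tr (F j).
Proof. by rewrite /tr rmodp_sum // coef_sum. Qed.

(** Nondegeneracy of the trace form. For a nonzero remainder [q], multiplication by
    ['X^(e - size q)] brings the leading coefficient into position [e - 1] without reduction. *)
Lemma tr_ker p : (forall j, (j < e)%N -> tr ('X^j * p) = 0) -> rmodp p P = 0.
Proof.
move=> h; set q := rmodp p P; apply/eqP/negPn/negP => q0.
have sq : (0 < size q <= e)%N by rewrite size_poly_gt0 q0 size_rmodp.
have := h (e - size q)%N; rewrite -tr_mod -/q => H.
have : lead_coef q = 0; last by move/eqP; rewrite lead_coef_eq0 (negbTE q0).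
rewrite -H; last by lia.
rewrite /tr rmodp_small; last first.
  rewrite Ps ltnS mulrC size_mulXn //; lia.
rewrite coefXnM; case: ifP => [|_]; first by lia.
by rewrite /lead_coef; congr (q`_ _); lia.
Qed.

(** The form is unitriangular on the powers ['X^j] and ['X^(e - 1 - t)], so prescribed values are
    reached one index at a time. *)
Lemma tr_surj (y : nat -> R) : exists p, forall j, (j < e)%N -> tr ('X^j * p) = y j.
Proof.
suff h t : (t <= e)%N -> exists p, forall j, (j < t)%N -> tr ('X^j * p) = y j by apply: h.
elim: t => [|t IH] te; first by exists 0.
have [p hp] := IH (ltnW te); pose dl := y t - tr ('X^t * p).
exists (p + dl *: 'X^(e.-1 - t)) => j; rewrite ltnS => jt.
have trX : tr ('X^j * (dl *: 'X^(e.-1 - t))) = dl *+ (j == t).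
  rewrite -scalerAr trZ -exprD /tr rmodp_small ?size_polyXn ?Ps; last by lia.
  rewrite coefXn; have -> : (e.-1 == j + (e.-1 - t))%N = (j == t) by apply/eqP/eqP; lia.
  by rewrite mulr_natr.
rewrite mulrDr trD trX; case: eqP => [->|ne]; first by rewrite mulr1n addrC subrK.
by rewrite mulr0n addr0 hp //; lia.
Qed.
End Mod.
End PolyHom.

(** * Making a form monic in one variable *)

Section ChangeOfVariables.
Variables (K : fieldType) (c : nat) (lam : 'I_c.+1 -> K).
Local Notation S := {mpoly K[c.+1]}.
Local Notation R := {mpoly K[c]}.
Hypothesis lam_max : lam ord_max != 0.

(** Each of the first [c] variables is translated by [lam i] times the new variable, and the last
    becomes a multiple of it. A form of degree [e] then has its value at [lam] as coefficient of
    ['X^e]. *)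
Definition Phi_X (i : 'I_c.+1) : {poly R} :=
  (if unlift ord_max i is Some j then ('X_j)%:P else 0) + ((lam i)%:MP)%:P * 'X.
Definition Phi : {rmorphism S -> {poly R}} :=
  mmap (@polyC R \o @mpolyC c K) Phi_X.

Lemma PhiC t : Phi t%:MP = (t%:MP)%:P.
Proof. exact: mmapC. Qed.
Lemma PhiXi i : Phi 'X_i = Phi_X i.
Proof. by rewrite /Phi /= mmapX mmap1U. Qed.

Definition iota : {rmorphism R -> S} := mmap (@mpolyC c.+1 K)
  (fun j => 'X_(lift ord_max j) - (lam (lift ord_max j) / lam ord_max)%:MP * 'X_ord_max).
Definition Psi : {rmorphism {poly R} -> S} :=
  horner_eval (((lam ord_max)^-1)%:MP * 'X_ord_max : S) \o map_poly iota.

Lemma iotaC t : iota t%:MP = t%:MP.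
Proof. exact: mmapC. Qed.
Lemma iotaX j : iota 'X_j = 'X_(lift ord_max j) - (lam (lift ord_max j) / lam ord_max)%:MP * 'X_ord_max.
Proof. by rewrite /iota /= mmapX mmap1U. Qed.

Lemma PsiC t : Psi t%:P = iota t.
Proof. by rewrite /Psi /= /horner_eval map_polyC hornerC. Qed.
Lemma PsiX : Psi 'X = ((lam ord_max)^-1)%:MP * 'X_ord_max.
Proof. by rewrite /Psi /= /horner_eval map_polyX hornerX. Qed.

Lemma PhiK : cancel Phi Psi.
Proof.
move=> p; apply: (mpoly_rmorph_ext (g := Psi \o Phi) (h := idfun)) => [t|i].
  rewrite -[LHS]/(Psi (Phi _)) -[RHS]/(t%:MP).
  by rewrite PhiC PsiC iotaC.
rewrite -[LHS]/(Psi (Phi _)) -[RHS]/('X_i).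
rewrite PhiXi /Phi_X rmorphD rmorphM PsiC iotaC PsiX.
case: unliftP => [j ->|->].
  rewrite PsiC iotaX mulrA -mpolyCM.
  by rewrite subrK.
by rewrite rmorph0 add0r mulrA -mpolyCM divff // mpolyC1 mul1r.
Qed.

Lemma PhiX_max : Phi (((lam ord_max)^-1)%:MP * 'X_ord_max) = 'X.
Proof.
rewrite rmorphM PhiC PhiXi /Phi_X unlift_none add0r mulrA -polyCM -mpolyCM.
by rewrite mulVf // mpolyC1 mul1r.
Qed.

Lemma Phi_iota q : Phi (iota q) = q%:P.
Proof.
apply: (mpoly_rmorph_ext (g := Phi \o iota) (h := @polyC R)) => [t|j]; rewrite -[LHS]/(Phi (iota _)).
  by rewrite iotaC PhiC.
rewrite iotaX rmorphB rmorphM PhiC !PhiXi /Phi_X liftK unlift_none add0r.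
rewrite mulrA -polyCM -mpolyCM divfK //.
by rewrite addrK.
Qed.

Lemma PsiK : cancel Psi Phi.
Proof.
elim/poly_ind => [|p t IH]; first by rewrite !rmorph0.
by rewrite rmorphD rmorphM PsiC PsiX [LHS]rmorphD [Phi (_ * (_ * _))]rmorphM IH PhiX_max Phi_iota.
Qed.

Lemma Phi_X_hom i : phom 1 (Phi_X i).
Proof.
apply: phomD; last by apply: (@phomM K c 0 1); [apply: phomC|apply: (@phomX K c 1)].
by case: unlift => [j|]; [apply: phomXi|apply: phom0].
Qed.

Lemma Phi_hom d (p : S) : (forall m, m \in msupp p -> mdeg m = d) -> phom d (Phi p).
Proof.
move=> hp; rewrite /Phi /= /mmap big_seq; apply: phom_sum => m /hp <-.
rewrite -[mdeg m]add0n; apply: phomM; first exact: phomC.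
rewrite /mmap1 mdegE; elim/big_rec2: _ => [|i x y _ h]; first exact: (@phomX K c 0).
by apply: phomM => //; have hX : phom 1 (Phi_X i) by [apply: Phi_X_hom]; have := phom_exp (n := m i) hX; rewrite mul1n.
Qed.

(** Setting the variables of [R] to 0 and ['X] to 1 reads off the top coefficient of a homogeneous
    polynomial; after [Phi] it is evaluation at [lam]. *)
Definition lead1 : {rmorphism {poly R} -> K} :=
  horner_eval (1 : K) \o map_poly (meval (fun=> 0 : K)).

Lemma lead1_Phi p : lead1 (Phi p) = p.@[lam].
Proof.
apply: (mpoly_rmorph_ext (g := lead1 \o Phi) (h := meval lam)) => [t|i]; rewrite -[LHS]/(lead1 (Phi _)).
  by rewrite PhiC /lead1 /= /horner_eval map_polyC hornerC /= !mevalC.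
rewrite PhiXi /Phi_X /lead1 /= /horner_eval rmorphD rmorphM /= !map_polyC /= map_polyX.
rewrite hornerD hornerM hornerC hornerX mulr1 mevalC mevalXU.
by case: unlift => [j|]; rewrite ?rmorph0 ?map_polyC ?horner0 ?hornerC /= ?mevalXU add0r.
Qed.

Lemma phom_lead1 d p : phom d p -> p`_d = (lead1 p)%:MP.
Proof.
move=> hp; rewrite /lead1 /= /horner_eval horner_coef.
have cE i m : m \in msupp p`_i -> (i + mdeg m = d)%N by apply: hp.
have pd : p`_d = (p`_d).@[fun=> 0]%:MP.
  have h : msupp p`_d = [::] \/ forall m, m \in msupp p`_d -> m = 0%MM.
    by right=> m /hp /eqP; rewrite -{2}[d]addn0 eqn_add2l mdeg_eq0 => /eqP.
  have e : p`_d = ((p`_d)@_(0%MM : 'X_{1..c}))%:MP.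
    apply/mpolyP => m; rewrite mcoeffC; have [->|ne] := eqVneq m (0%MM : 'X_{1..c}).
      by rewrite mulr1.
    rewrite mulr0; apply/memN_msupp_eq0/negP.
    by case: h => [-> //|h /h e]; rewrite e eqxx in ne.
  by rewrite {2}e mevalC.
have ev0 i : i != d -> (p`_i).@[fun=> 0 : K] = 0.
  move=> id; rewrite mevalE big_seq big1 // => m /hp hm.
  have [j mj] : exists j, m j != 0%N.
    apply/existsP; rewrite -negb_forall; apply/negP => /forallP h.
    have m0 : mdeg m = 0%N by rewrite mdegE big1 // => j _; apply/eqP.
    by rewrite -hm m0 addn0 eqxx in id.
  by rewrite (bigD1 j) //= expr0n (negbTE mj) mul0r mulr0.
rewrite {1}pd; congr (_%:MP).
have [sd|sd] := ltnP d (size (map_poly (meval (fun=> 0 : K)) p)).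
  rewrite (bigD1 (Ordinal sd)) //= coef_map expr1n mulr1 big1 ?addr0 // => i ne.
  rewrite coef_map /= ev0 ?mul0r //.
rewrite big1 => [|i _]; last first.
  by rewrite coef_map /= ev0 ?mul0r // neq_ltn (leq_trans (ltn_ord i) sd).
by have := nth_default 0 sd; rewrite coef_map.
Qed.

Lemma Phi_monic (s : S) e : (forall m, m \in msupp s -> mdeg m = e) -> s.@[lam] = 1 ->
  [/\ Phi s \is monic, size (Phi s) = e.+1 & phom e (Phi s)].
Proof.
move=> hs s1; have ph := Phi_hom hs; have := phom_lead1 ph; rewrite lead1_Phi s1 mpolyC1 => le.
have sz : size (Phi s) = e.+1.
  apply/eqP; rewrite eqn_leq phom_size //=.
  by rewrite ltnNge; apply/negP => /leq_sizeP/(_ e (leqnn _))/eqP; rewrite le oner_eq0.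
by split=> //; apply/monicP; rewrite /lead_coef sz.
Qed.
End ChangeOfVariables.

Lemma poly_expand (R : nzRingType) (p : {poly R}) e : (size p <= e)%N ->
  p = \sum_(i < e) p`_i *: 'X^i.
Proof.
move=> sp; rewrite -poly_def; apply/polyP => i; rewrite coef_poly.
by case: ltnP => // ei; rewrite nth_default // (leq_trans sp).
Qed.

Lemma cvk_lin (k : fieldType) c r t (v w : cvk k c r) i j :
  ((t *: v + w : cvk k c r) : 'cV[{mpoly k[c]}]_r) i j =
  t *: (v : 'cV[{mpoly k[c]}]_r) i j + (w : 'cV[{mpoly k[c]}]_r) i j.
Proof.
by rewrite mxE cvkE.
Qed.

Section Reduction.
Variables (K : fieldType) (c : nat) (lam : 'I_c.+1 -> K).
Local Notation S := {mpoly K[c.+1]}.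
Local Notation R := {mpoly K[c]}.
Hypothesis lam_max : lam ord_max != 0.
Variables (s : S) (e : nat).
Hypothesis s_hom : forall m, m \in msupp s -> mdeg m = e.
Hypothesis s_lam : s.@[lam] = 1.
Variables (r : nat) (a : 'I_r -> nat).
Variables (N : nat) (ix : 'I_N -> 'I_r * 'I_e) (rk : 'I_r * 'I_e -> 'I_N).
Hypotheses (ixK : cancel ix rk) (rkK : cancel rk ix).
Local Notation Phi := (Phi lam).
Local Notation P := (Phi s).

Let Pm : P \is monic. Proof. by have [] := Phi_monic s_hom s_lam. Qed.
Let Ps : size P = e.+1. Proof. by have [] := Phi_monic s_hom s_lam. Qed.
Let Ph : phom e P. Proof. by have [] := Phi_monic s_hom s_lam. Qed.

Lemma sum_pairs (V : nmodType) (F : 'I_r -> 'I_e -> V) :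
  \sum_(x < N) F (ix x).1 (ix x).2 = \sum_i \sum_j F i j.
Proof.
rewrite pair_big /= (reindex ix) //=.
by exists rk => x _; [apply: ixK|apply: rkK].
Qed.

(** The matrix of [D] on [(S / s)^r] over [R], in the basis of multiples by ['X^j], [j < e], of the
    coordinate vectors; [ix] numbers these pairs. *)
Definition redD (D : 'M[S]_r) : 'M[R]_N := \matrix_(x, y)
  (rmodp ('X^((ix y).2 : 'I_e) * Phi (D (ix x).1 (ix y).1)) P)`_(ix x).2.

Definition red1 (v : cvk K c.+1 r) : cvk K c N :=
  \col_x (rmodp (Phi ((v : 'cV[S]_r) (ix x).1 0)) P)`_(ix x).2 : 'cV[R]_N.
(** Coordinates with respect to the basis dual to the powers of ['X] under the trace form. *)
Definition red2 (v : cvk K c.+1 r) : cvk K c N :=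
  \col_x tr P e ('X^((ix x).2 : 'I_e) * Phi ((v : 'cV[S]_r) (ix x).1 0)) : 'cV[R]_N.

Definition deg1 (x : 'I_N) : nat := (a (ix x).1 + 2 * (ix x).2)%N.
(** The dual of ['X^j] has degree [e - 1 - j], so the weights of a basis and its dual basis add up
    to a constant again. *)
Definition deg2 (x : 'I_N) : nat := (a (ix x).1 + 2 * (e.-1 - (ix x).2))%N.

Lemma red1E v x j : (red1 v : 'cV[R]_N) x j =
  (rmodp (Phi ((v : 'cV[S]_r) (ix x).1 0)) P)`_((ix x).2).
Proof.
by rewrite /red1 mxE.
Qed.

Lemma red2E v x j : (red2 v : 'cV[R]_N) x j =
  tr P e ('X^((ix x).2) * Phi ((v : 'cV[S]_r) (ix x).1 0)).
Proof.
by rewrite /red2 mxE.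
Qed.

Lemma redDE D x y : redD D x y =
  (rmodp ('X^((ix y).2) * Phi (D (ix x).1 (ix y).1)) P)`_((ix x).2).
Proof.
by rewrite /redD mxE.
Qed.

Lemma red1_lin t v w : red1 (t *: v + w) = t *: red1 v + red1 w.
Proof.
apply/matrixP => x j; rewrite [LHS]red1E (cvk_lin t v w) (cvk_lin t (red1 v) (red1 w)) [X in _ = _ *: X + _]red1E [X in _ = _ + X]red1E rmorphD.
rewrite rmodpD // coefD -mul_mpolyC rmorphM PhiC mul_polyC rmodpZ // coefZ.
by rewrite mul_mpolyC.
Qed.

Lemma red2_lin t v w : red2 (t *: v + w) = t *: red2 v + red2 w.
Proof.
apply/matrixP => x j; rewrite [LHS]red2E (cvk_lin t v w) (cvk_lin t (red2 v) (red2 w)) [X in _ = _ *: X + _]red2E [X in _ = _ + X]red2E rmorphD.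
rewrite mulrDr trD // -mul_mpolyC rmorphM PhiC mul_polyC -scalerAr trZ //.
by rewrite mul_mpolyC.
Qed.

Lemma hom_entry n (v : cvk K c.+1 r) i : hom a n v ->
  exists2 d, forall m, m \in msupp ((v : 'cV[S]_r) i 0) -> mdeg m = d
  & (v : 'cV[S]_r) i 0 = 0 \/ (a i + 2 * d = n)%N.
Proof.
move=> hv; have h m : m \in msupp ((v : 'cV[S]_r) i 0) -> (a i + 2 * mdeg m = n)%N.
  by rewrite mcoeff_msupp; apply: (hv (i, m)).
exists ((n - a i)./2) => [m /h <-|]; first by rewrite addKn mul2n doubleK.
case E: (msupp ((v : 'cV[S]_r) i 0)) => [|m l].
  by left; apply/eqP; rewrite -msupp_eq0 E.
by right; have <- := h m; rewrite ?addKn ?mul2n ?doubleK // E mem_head.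
Qed.

Lemma red1_hom n v : hom a n v -> hom deg1 n (red1 v).
Proof.
move=> hv [x m]; rewrite /cf red1E -mcoeff_msupp => hm.
have [d vd [v0|dn]] := hom_entry (ix x).1 hv.
  by move: hm; rewrite v0 rmorph0 rmod0p coef0 msupp0.
have := phom_rmodp Pm Ps Ph (@Phi_hom K c lam d _ vd) hm.
by rewrite /wt /deg1 /= => h; lia.
Qed.

Lemma red2_hom n v : hom a n v -> hom deg2 n (red2 v).
Proof.
move=> hv [x m]; rewrite /cf red2E -mcoeff_msupp => hm.
have [d vd [v0|dn]] := hom_entry (ix x).1 hv.
  by move: hm; rewrite v0 rmorph0 mulr0 /tr rmod0p coef0 msupp0.
have h := phom_rmodp Pm Ps Ph (phomM (@phomX K c (ix x).2) (@Phi_hom K c lam d _ vd)) hm.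
by move: h; rewrite /wt /deg2 /= => h; have := ltn_ord (ix x).2; lia.
Qed.

Let quotE (p : S) : (exists q, Phi p = q * P) <-> exists q, p = s * q.
Proof.
split=> [[q pq]|[q ->]].
  exists (Psi lam q).
  have e1 : Phi (s * Psi lam q) = Phi p := etrans (rmorphM Phi s _)
    (etrans (congr1 (fun z => P * z) (PsiK lam_max q)) (etrans (mulrC P q) (esym pq))).
  exact: (can_inj (PhiK lam_max) (esym e1)).
exists (Phi q); exact: etrans (rmorphM Phi s q) (mulrC _ _).
Qed.

Let col_quot (v : cvk K c.+1 r) :
  (forall i, exists q, (v : 'cV[S]_r) i 0 = s * q) <-> exists u, v = smul s u.
Proof.
split=> [/choice[q qP]|[u -> i]].
  exists (\col_i q i : 'cV[S]_r); apply/matrixP => i j.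
  by rewrite (ord1 j) qP !mxE.
by exists ((u : 'cV[S]_r) i 0); rewrite mxE.
Qed.

Lemma red1_ker v : red1 v = 0 <-> exists u, v = smul s u.
Proof.
rewrite -col_quot; split=> [h i|h].
  suff : rmodp (Phi ((v : 'cV[S]_r) i 0)) P = 0 by move/(rmodp_monic_eq0P Pm)/quotE.
  apply/polyP => j; rewrite coef0; have [je|ej] := ltnP j e; last first.
    by rewrite nth_default // (leq_trans (size_rmodp Pm Ps _)).
  have := congr1 (fun X : 'cV[R]_N => X (rk (i, Ordinal je)) 0) h.
  by rewrite [RHS]mxE (red1E v _ 0) rkK.
apply/matrixP => x j; rewrite !mxE.
have /quotE/(rmodp_monic_eq0P Pm _).2 -> := h (ix x).1; by rewrite coef0.
Qed.

Lemma red2_ker v : red2 v = 0 <-> exists u, v = smul s u.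
Proof.
rewrite -col_quot; split=> [h i|h].
  suff : rmodp (Phi ((v : 'cV[S]_r) i 0)) P = 0 by move/(rmodp_monic_eq0P Pm)/quotE.
  apply: (tr_ker Pm Ps) => j je.
  have := congr1 (fun X : 'cV[R]_N => X (rk (i, Ordinal je)) 0) h.
  by rewrite [RHS]mxE (red2E v _ 0) rkK.
apply/matrixP => x j; rewrite !mxE -tr_mod //.
have /quotE/(rmodp_monic_eq0P Pm _).2 -> := h (ix x).1; by rewrite mulr0 /tr rmod0p coef0.
Qed.

Lemma red1_surj y : exists v, red1 v = y.
Proof.
pose p i := \sum_(j < e) (y : 'cV[R]_N) (rk (i, j)) 0 *: 'X^j : {poly R}.
exists (\col_i Psi lam (p i) : 'cV[S]_r); apply/matrixP => x j; rewrite (ord1 j) !mxE.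
rewrite (PsiK lam_max) rmodp_small; last first.
  rewrite Ps ltnS /p; apply: leq_trans (size_sum _ _ _) _; apply/bigmax_leqP => t _.
  by apply: leq_trans (size_scale_leq _ _) _; rewrite size_polyXn.
rewrite /p coef_sum (bigD1 (ix x).2) //= coefZ coefXn eqxx mulr1 big1 ?addr0.
  by rewrite -surjective_pairing ixK.
move=> i ne; rewrite coefZ coefXn eq_sym.
by case: eqP => [/val_inj e'|_]; [rewrite e' eqxx in ne|rewrite mulr0].
Qed.

Lemma red2_surj y : exists v, red2 v = y.
Proof.
have /choice[p hp] i : exists p : {poly R}, forall j : 'I_e,
    tr P e ('X^j * p) = (y : 'cV[R]_N) (rk (i, j)) 0.
  pose z j := if insub j is Some j' then (y : 'cV[R]_N) (rk (i, j' : 'I_e)) 0 else 0.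
  have [p hp] := tr_surj Pm Ps z; exists p => j.
  by rewrite hp // /z valK.
exists (\col_i Psi lam (p i) : 'cV[S]_r); apply/matrixP => x j; rewrite (ord1 j) !mxE.
by rewrite (PsiK lam_max) hp -surjective_pairing ixK.
Qed.

Lemma rmodp_mul_expand p q l :
  (rmodp (p * q) P)`_l = \sum_(t < e) (rmodp ('X^t * p) P)`_l * (rmodp q P)`_t.
Proof.
rewrite -rmodp_mulmr // {1}(poly_expand (size_rmodp Pm Ps q)).
rewrite mulr_sumr rmodp_sum // coef_sum; apply: eq_bigr => t _.
by rewrite -scalerAr rmodpZ // coefZ mulrC [p * _]mulrC.
Qed.

Lemma tr_mul_expand p q :
  tr P e (q * p) = \sum_(t < e) (rmodp q P)`_t * tr P e ('X^t * p).
Proof.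
rewrite mulrC -(tr_mod e Pm) {1}(poly_expand (size_rmodp Pm Ps q)).
rewrite mulr_sumr (tr_sum e Pm); apply: eq_bigr => t _.
by rewrite -scalerAr trZ // [p * _]mulrC.
Qed.

Lemma red1_D (D : 'M[S]_r) v : red1 (dact D v) = dact (redD D) (red1 v).
Proof.
apply/matrixP => x j; rewrite (ord1 j) !mxE.
set i := (ix x).1; set l := (ix x).2.
have E y : redD D x y * (red1 v : 'cV[R]_N) y 0 =
    (rmodp ('X^((ix y).2) * Phi (D i (ix y).1)) P)`_l *
    (rmodp (Phi ((v : 'cV[S]_r) (ix y).1 0)) P)`_((ix y).2).
  by rewrite redDE red1E.
rewrite (eq_bigr _ (fun y _ => E y)).
rewrite (sum_pairs (fun b t => (rmodp ('X^t * Phi (D i b)) P)`_l *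
  (rmodp (Phi ((v : 'cV[S]_r) b 0)) P)`_t)).
rewrite rmorph_sum rmodp_sum // coef_sum.
apply: eq_bigr => b _; rewrite (rmorphM Phi); exact: rmodp_mul_expand.
Qed.

(** Multiplication in [S / s] is self-adjoint for the trace form, so in dual coordinates [D^T] acts
    by the transpose of the reduced matrix. *)
Lemma red2_D (D : 'M[S]_r) v : red2 (dact D^T v) = dact (redD D)^T (red2 v).
Proof.
apply/matrixP => x j; rewrite (ord1 j) !mxE.
set i := (ix x).1; set l := (ix x).2.
have E y : (redD D)^T x y * (red2 v : 'cV[R]_N) y 0 =
    (rmodp ('X^l * Phi (D (ix y).1 i)) P)`_((ix y).2) *
    tr P e ('X^((ix y).2) * Phi ((v : 'cV[S]_r) (ix y).1 0)).
  by rewrite mxE redDE red2E.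
rewrite (eq_bigr _ (fun y _ => E y)).
rewrite (sum_pairs (fun b t => (rmodp ('X^l * Phi (D b i)) P)`_t *
  tr P e ('X^t * Phi ((v : 'cV[S]_r) b 0)))).
rewrite rmorph_sum mulr_sumr (tr_sum e Pm); apply: eq_bigr => b _.
rewrite mxE (rmorphM Phi) mulrA; exact: tr_mul_expand.
Qed.
End Reduction.

Section Shift.
Local Open Scope nat_scope.
(** Summation turns the shifted relation into [cum H = 2 cum h] up to the last [2 e - 1] values of
    [h], which are of lower order. *)
Lemma dual_growth_shift e h h' H H' : 0 < e ->
  (forall n, H n = (if 2 * e <= n.+1 then h (n.+1 - 2 * e) else 0) + h n) ->
  (forall n, H' n = (if 2 * e <= n.+1 then h' (n.+1 - 2 * e) else 0) + h' n) ->
  dual_growth H H' -> dual_growth h h'.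
Proof.
move=> e0 hH hH' [Z|[d [lo HO HO' [G GO cl]]]].
  by left=> n; have [] := Z n; rewrite hH hH'; lia.
have hO : bigO d h by apply: bigO_le HO => n; rewrite hH leq_addl.
have hO' : bigO d h' by apply: bigO_le HO' => n; rewrite hH' leq_addl.
pose w := (2 * e).-1.
have cumH g Hg : (forall n, Hg n = (if 2 * e <= n.+1 then g (n.+1 - 2 * e) else 0) + g n) ->
    forall N, cum Hg N + \sum_(i < w) (if i <= N then g (N - i) else 0) = cum g N + cum g N.
  move=> hg N; rewrite (eq_cum _ hg) cumD addnC addnA; congr (_ + _).
  have F : forall v N, cum (fun n => if v <= n then g (n - v) else 0) N
      + \sum_(i < v) (if i <= N then g (N - i) else 0) = cum g N.
    elim=> [|v IH] N'; first by rewrite big_ord0 addn0; apply: eq_cum => n; rewrite subn0.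
    rewrite big_ord_recr /= -(IH N') [in RHS]addnC [RHS]addnC addnA addnAC; congr (_ + _).
    elim: N' {IH} => [|N' IH']; first by rewrite !cum0; case: v.
    rewrite cumS [in RHS]cumS -IH' addnAC subSS ltnS.
    by rewrite addnAC -addnA.
  rewrite addnC -(F w N); congr (_ + _); apply: eq_cum => n.
  by rewrite /w; case: leqP => h1; case: leqP => h2 //; try lia; congr g; lia.
have cH := cumH h H hH; have cH' := cumH h' H' hH'.
pose E N := \sum_(i < w) (if i <= N then h (N - i) else 0) + \sum_(i < w) (if i <= N then h' (N - i) else 0).
have EO : bigO d E.
  have sh g i : bigO d g -> bigO d (fun N => if i <= N then g (N - i) else 0).
    (* For [N > i] this uses [N <= (N - i) * i.+1]; the second summand takes care of [N = i]. *)
    move=> [C hC]; exists (C * i.+1 + g 0 * i) => N; case: (leqP i N) => // iN.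
    have [Ni|ne] := eqVneq N i.
      rewrite Ni subnn mulnDl; apply: leq_trans (leq_addl _ _).
      by case: (i) => [|i']; [rewrite !muln0|rewrite leq_pmulr // expn_gt0].
    have e1 : g (N - i) * N <= g (N - i) * (N - i) * i.+1.
      by rewrite -mulnA leq_mul2l; apply/orP; right; move: iN ne; nia.
    apply: leq_trans e1 _; rewrite mulnDl; apply: leq_trans (leq_addr _ _).
    rewrite [C * _ * _]mulnAC leq_mul2r (leq_trans (hC _)) ?orbT // leq_mul2l leq_expW ?orbT //.
    exact: leq_subr.
  by apply: bigOD; apply: bigO_sum => i; apply: sh.
right; exists d; split=> //.
- have [C [N0 hC]] := lo; exists (2 * C), N0 => N hN.
  apply: leq_trans (hC N hN) _; rewrite [2 * C]mulnC -mulnA leq_mul2l; apply/orP; right.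
  by have := cH N; lia.
- exists (fun N => G N + E N); first exact: bigOD.
  move=> N; have [c1 c2] := cl N; have := cH N; have := cH' N.
  by rewrite /E; lia.
Qed.
End Shift.

(** If a nonzero constant is null-homotopic, so is the identity, and the homology vanishes. *)
Lemma hilb_unit (k : fieldType) c r (a : 'I_r -> nat) (D T : 'M[{mpoly k[c]}]_r) t h :
  D *m D = 0 -> t != 0 -> D *m T + T *m D = (t%:MP)%:M -> hilb a D h ->
  forall n, h n = 0%N.
Proof.
move=> DD t0 TP hh n; apply: dimq0 (hh n); first exact: bnd_subsp.
move=> v [hv dv]; split=> //; exists (t^-1 *: tact T v).
have := tactP (T := T) TP v; rewrite dv tact0 addr0 => e.
have vE : v = t^-1 *: (smul t%:MP v : cvk k c r).
  rewrite -[RHS]/((t^-1)%:MP *: (t%:MP *: (v : 'cV_r))) scalerA -mpolyCM mulVf //.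
  by rewrite scale1r.
by have := dact_lin D t^-1 (tact T v) 0; rewrite dact0 !addr0 => ->; rewrite -e.
Qed.

Theorem dual_growth_all c (k : fieldType) r (a b : 'I_r -> nat) g
    (D : 'M[{mpoly k[c]}]_r) h h' :
  D *m D = 0 -> wthom a D -> (forall i, (a i + b i = g)%N) ->
  hilb a D h -> hilb b D^T h' -> dual_growth h h'.
Proof.
elim: c k r a b g D h h' => [|c IH] k r a b g D h h' DD Da ab hh hh'.
(* The cases of no variable and of [c.+1] variables run in parallel up to the point where a variable
   is eliminated. *)
all: have Db : wthom b D^T by move=> i j m; rewrite mxE => /Da; have := ab i; have := ab j; lia.
all: have [rk|rk] := ltnP (2 * \rank (map_mx (@FracField.tofrac _) D)) r;
  first exact: (dual_growth_generic DD Da Db hh hh' rk).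
all: have [s [e [T [s0 s_hom T_hom TP]]]] := homogeneous_nullhomotopy DD Da rk.
all: have TP' : D^T *m T^T + T^T *m D^T = s%:M
  by rewrite -!trmx_mul -linearD /= addrC TP tr_scalar_mx.
all: have DD' : D^T *m D^T = 0 by rewrite -trmx_mul DD trmx0.
all: have unit_case : e = 0%N -> dual_growth h h'.
  1,3: move=> e0; have sC : s = (s@_(0%MM : 'X_{1.._}))%:MP.
  1,3: apply/mpolyP => m; rewrite mcoeffC; have [->|ne] := eqVneq m (0%MM : 'X_{1.._});
    [by rewrite mulr1|rewrite mulr0; apply/memN_msupp_eq0/negP => /s_hom];
    by rewrite e0 => /eqP; rewrite mdeg_eq0 (negbTE ne).
  1,2: left=> n; rewrite sC in TP TP'; split;
    [apply: (hilb_unit DD _ TP hh)|apply: (hilb_unit DD' _ TP' hh')];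
    by apply: contraNneq s0 => h0; rewrite sC h0 mpolyC0.
(* Without variables every monomial has degree 0, which forces [e = 0]. *)
- apply: unit_case; have [m ms] : exists m, m \in msupp s.
    by case E: (msupp s) => [|m l]; [rewrite -msupp_eq0 E in s0|exists m; rewrite mem_head].
  by rewrite -(s_hom m ms) mdegE big_ord0.
have [e0|e0] := posnP e; first exact: unit_case.
(* A point with [s(lam) != 0] may not exist over a finite field. At the generic point, whose
   coordinates are the variables in the fraction field, the value of [s] is [s] itself. *)
pose K : fieldType := {fraction {mpoly k[c.+1]}}.
pose f : {rmorphism k -> K} := @FracField.tofrac {mpoly k[c.+1]} \o @mpolyC c.+1 k.
pose lam (i : 'I_c.+1) : K := @FracField.tofrac {mpoly k[c.+1]} 'X_i.
have lam_max : lam ord_max != 0 by rewrite /lam tofrac_eq0 -msupp_eq0 msuppX.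
pose sK := map_mpoly f s.
have sKlam : sK.@[lam] = @FracField.tofrac {mpoly k[c.+1]} s.
  apply: (mpoly_rmorph_ext (g := [the {rmorphism _ -> _} of meval lam \o map_mpoly f])
    (h := @FracField.tofrac {mpoly k[c.+1]})) => [t|i] /=.
    by rewrite map_mpolyC mevalC.
  by rewrite map_mpolyX mevalX (bigD1 i) //= mnm1E eqxx expr1 big1 ?mulr1 // => j ji; rewrite mnm1E eq_sym (negbTE ji).
pose mu := sK.@[lam]; have mu0 : mu != 0 by rewrite /mu sKlam tofrac_eq0.
pose s1 := mu^-1 *: sK.
have msK m : m \in msupp s1 -> m \in msupp s.
  move=> /msuppZ_le; rewrite !mcoeff_msupp mcoeff_map_mpoly fmorph_eq0.
  by [].
have s1_hom m : m \in msupp s1 -> mdeg m = e by move=> /msK/s_hom.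
have s1_lam : s1.@[lam] = 1 by rewrite mevalZ mulVf.
have s10 : s1 != 0 by apply/eqP => z; have := s1_lam; rewrite z meval0 => /eqP; rewrite eq_sym oner_eq0.
pose T1 : 'M[{mpoly K[c.+1]}]_r := (mu^-1)%:MP *: extmx f T.
pose DK := extmx f D.
have T1P : DK *m T1 + T1 *m DK = s1%:M.
  have TK : DK *m extmx f T + extmx f T *m DK = sK%:M.
    by have := congr1 (map_mx (map_mpoly f)) TP; rewrite map_mxD !map_mxM map_scalar_mx.
  by rewrite /T1 -scalemxAr -scalemxAl -scalerDr TK scale_scalar_mx mul_mpolyC.
have T1_hom i j m : m \in msupp (T1 i j) -> (a i + 2 * mdeg m + 1 = a j + 2 * e)%N.
  rewrite !mxE mul_mpolyC => /msuppZ_le hm; apply: T_hom; move: hm.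
  by rewrite !mcoeff_msupp mcoeff_map_mpoly fmorph_eq0.
have DKK : DK *m DK = 0 by apply: extDD.
have DKa : wthom a DK by apply: extD_hom.
have DKT : DK^T = extmx f D^T by rewrite /DK /extmx map_trmx.
have DKb : wthom b DK^T by rewrite DKT; apply: extD_hom.
have DKK' : DK^T *m DK^T = 0 by rewrite -trmx_mul DKK trmx0.
have T1P' : DK^T *m T1^T + T1^T *m DK^T = s1%:M.
  by rewrite -!trmx_mul -linearD /= addrC T1P tr_scalar_mx.
have T1_hom' i j m : m \in msupp (T1^T i j) -> (b i + 2 * mdeg m + 1 = b j + 2 * e)%N.
  by rewrite mxE => /T1_hom; have := ab i; have := ab j; lia.
have hhK : hilb a DK h by apply: hilb_ext.
have hhK' : hilb b DK^T h' by rewrite DKT; apply: hilb_ext.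
have [N [ix [rx [ixK rxK]]]] : exists N (ix : 'I_N -> 'I_r * 'I_e) rx,
    cancel ix rx /\ cancel rx ix.
  exists #|{: 'I_r * 'I_e}|%N, enum_val, enum_rank.
  by split; [apply: enum_valK|apply: enum_rankK].
pose D' := redD lam s1 ix DK.
pose R1 := red1 lam s1 ix.
have l1 t v w : R1 (t *: v + w) = t *: R1 v + R1 w by apply: red1_lin.
have o1 n v : hom a n v -> hom (deg1 a ix) n (R1 v) by apply: red1_hom.
have k1 v : R1 v = 0 <-> exists u, v = smul s1 u by apply: red1_ker rxK _.
have u1 y : exists v, R1 v = y by apply: red1_surj ixK _.
have d1 v : R1 (dact DK v) = dact D' (R1 v) by apply: red1_D ixK rxK _ _.
pose R2 := red2 lam s1 ix.
have l2 t v w : R2 (t *: v + w) = t *: R2 v + R2 w by apply: red2_lin.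
have o2 n v : hom b n v -> hom (deg2 b ix) n (R2 v) by apply: red2_hom.
have k2 v : R2 v = 0 <-> exists u, v = smul s1 u by apply: red2_ker rxK _.
have u2 y : exists v, R2 v = y by apply: red2_surj ixK _.
have d2 v : R2 (dact DK^T v) = dact D'^T (R2 v) by apply: red2_D ixK rxK _ _.
have DD1 := quot_DD DKK l1 u1 d1.
have Da1 := quot_hom DKa s10 l1 o1 u1 d1.
have [H HP] := hilb_ex (deg1 a ix) D'.
have [H' HP'] := hilb_ex (deg2 b ix) D'^T.
apply: (@dual_growth_shift e h h' H H' e0).
- exact: (quot_hilb DKK DKa s10 s1_hom T1_hom T1P l1 o1 k1 u1 d1 hhK HP).
- exact: (quot_hilb DKK' DKb s10 s1_hom T1_hom' T1P' l2 o2 k2 u2 d2 hhK' HP').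
(* The summand [2 * e.-1] is the joint weight of a power of ['X] and of its dual. *)
apply: (IH K _ _ _ (g + 2 * e.-1)%N D' H H' DD1 Da1 _ HP HP') => x.
by rewrite /deg1 /deg2; have := ab (ix x).1; have := ltn_ord (ix x).2; lia.
Qed.

(** * Noetherian modules, chains of primes and Krull dimension *)

Section Span.
Variables (R : comNzRingType) (V : lmodType R).
Implicit Types (U : V -> Prop) (f : nat -> V).

Definition lsub U : Prop := U 0 /\ forall a x y, U x -> U y -> U (a *: x + y).

Lemma lsubZ U a x : lsub U -> U x -> U (a *: x).
Proof.
by move=> [U0 Ul] Ux; rewrite -[a *: x]addr0; apply: Ul.
Qed.

Lemma lsubD U x y : lsub U -> U x -> U y -> U (x + y).
Proof.
by move=> [_ Ul] Ux Uy; rewrite -[x]scale1r; apply: Ul.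
Qed.

Lemma lsubB U x y : lsub U -> U x -> U y -> U (x - y).
Proof.
move=> hU Ux Uy; apply: lsubD => //; rewrite -scaleN1r; exact: lsubZ.
Qed.

Lemma lsub_sum U (J : Type) (l : seq J) (P : pred J) (F : J -> V) : lsub U ->
  (forall j, P j -> U (F j)) -> U (\sum_(j <- l | P j) F j).
Proof.
by move=> hU h; elim/big_rec: _ => [|j x Pj Ux]; [apply: hU.1|apply: lsubD => //; apply: h].
Qed.

Definition fgen U : Prop := exists (n : nat) (v : 'I_n -> V),
  (forall i, U (v i)) /\ forall x, U x -> exists a : 'I_n -> R, x = \sum_i a i *: v i.

Definition spanN f n (x : V) : Prop := exists a : nat -> R, x = \sum_(i < n) a i *: f i.

Lemma spanN_lsub f n : lsub (spanN f n).
Proof.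
split=> [|a _ _ [b ->] [b' ->]].
  by exists (fun=> 0); rewrite big1 // => i _; rewrite scale0r.
exists (fun i => a * b i + b' i); rewrite scaler_sumr -big_split.
by apply: eq_bigr => i _; rewrite scalerDl scalerA.
Qed.

Lemma spanN_mem f n i : (i < n)%N -> spanN f n (f i).
Proof.
move=> lt; exists (fun j => (j == i)%:R); rewrite (bigD1 (Ordinal lt)) //= eqxx scale1r.
by rewrite big1 ?addr0 // => j; rewrite -val_eqE /= => /negbTE ->; rewrite scale0r.
Qed.

Lemma spanN_le f n m x : (n <= m)%N -> spanN f n x -> spanN f m x.
Proof.
move=> nm [a ->]; apply: lsub_sum => [|i _]; first exact: spanN_lsub.
by apply: lsubZ; [exact: spanN_lsub|apply: spanN_mem; apply: leq_trans nm].
Qed.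

(* Ascending chain condition on the submodules [spanN f n]. *)
Definition acc : Prop := forall f, exists n, spanN f n (f n).

Lemma acc_chain (U : nat -> V -> Prop) : acc -> (forall n, lsub (U n)) ->
  (forall n x, U n x -> U n.+1 x) -> exists n, forall x, U n.+1 x -> U n x.
Proof.
move=> A hU mono; apply: contrapT => /forallNP nU.
have /choice[f fP] n : exists x, U n.+1 x /\ ~ U n x.
  by have /existsNP[x /not_implyP h] := nU n; exists x.
have [n [a fn]] := A f; have [_] := fP n; apply; rewrite fn.
apply: lsub_sum => // i _; apply: lsubZ => //.
have up m l x : (m <= l)%N -> U m x -> U l x.
  by move/subnKC <-; elim: (l - m)%N => [|d IH]; rewrite ?addn0 // addnS => /IH/mono.
by apply: up (fP i).1.
Qed.

Lemma fgen_acc : (forall U, lsub U -> fgen U) -> acc.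
Proof.
move=> fg f; pose U x := exists n, spanN f n x.
have hU : lsub U.
  split=> [|a x y [n hx] [m hy]]; first by exists 0%N; apply: (spanN_lsub _ _).1.
  exists (n + m)%N; apply: (spanN_lsub _ _).2; first exact: spanN_le (leq_addr _ _) hx.
  exact: spanN_le (leq_addl _ _) hy.
have [n [v [vU sv]]] := fg U hU; have /choice[N vN] i : exists m, spanN f m (v i) := vU i.
pose M := \max_i N i; exists M.
have [|a ->] := sv (f M); first by exists M.+1; apply: spanN_mem.
apply: lsub_sum => [|i _]; first exact: spanN_lsub.
apply: lsubZ; first exact: spanN_lsub.
exact: spanN_le (leq_bigmax i) (vN i).
Qed.

(** Successive choice of elements outside the span of the previous ones, each of least [mu]. With
    [mu] the size of a polynomial it serves the basis theorem, and with [mu] constant the converse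
    of [fgen_acc]. *)
Lemma not_fgen_seq U (mu : V -> nat) : ~ fgen U ->
  exists f, forall n, [/\ U (f n), ~ spanN f n (f n) &
    forall x, U x -> ~ spanN f n x -> (mu (f n) <= mu x)%N].
Proof.
move=> nfg; pose sp (s : seq V) := spanN (nth 0 s) (size s).
have /choice[g gP] s : exists x, (forall y, y \in s -> U y) ->
    [/\ U x, ~ sp s x & forall y, U y -> ~ sp s y -> (mu x <= mu y)%N].
  have [sU|?] := pselect (forall y, y \in s -> U y); last by exists 0.
  have ex : exists n, `[< exists x, [/\ U x, ~ sp s x & mu x = n] >].
    apply: contrapT => h; apply: nfg; exists (size s), (fun i => s`_i); split.
      by move=> i; apply: sU; rewrite mem_nth.
    move=> x Ux; apply: contrapT => nx; apply: h; exists (mu x); apply/asboolP.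
    by exists x; split=> // -[a xa]; apply: nx; exists a.
  case: (ex_minnP ex) => n /asboolP[x [Ux xs xn]] mn; exists x => _; split=> // y Uy ys.
  by rewrite xn; apply: mn; apply/asboolP; exists y.
pose st n := iter n (fun s => rcons s (g s)) [::]; pose f n := g (st n).
have st_size n : size (st n) = n by elim: n => //= n IH; rewrite size_rcons IH.
have st_nth n i : (i < n)%N -> (st n)`_i = f i.
  elim: n => //= n IH; rewrite ltnS nth_rcons st_size.
  by case: ltngtP => // [/IH //|->].
have st_U n y : y \in st n -> U y.
  elim: n y => //= n IH y; rewrite mem_rcons inE => /orP[/eqP ->|/IH //].
  by have [] := gP _ IH.
have spE n x : sp (st n) x <-> spanN f n x.
  by rewrite /sp st_size; split=> -[a ->]; exists a; apply: eq_bigr => i _; rewrite st_nth.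
exists f => n; have [fU fs fm] := gP _ (@st_U n); split=> // [/spE //|y Uy ys].
by apply: fm => // /spE.
Qed.

Lemma acc_fgen U : acc -> fgen U.
Proof.
move=> A; apply: contrapT => /(@not_fgen_seq U (fun=> 0%N))[f fP].
by have [n fn] := A f; have [] := fP n.
Qed.
End Span.

(** Hilbert's argument: a relation between leading coefficients of the chosen sequence yields an
    element of smaller degree which is still outside the span, against minimality. *)
Lemma acc_poly (R : comNzRingType) : acc R^o -> acc {poly R}^o.
Proof.
move=> A; apply: fgen_acc => U hU; apply: contrapT.
move=> /(@not_fgen_seq _ _ _ (fun p : {poly R}^o => size (p : {poly R})))[f fP].
have [n [a la]] := A (fun i => lead_coef (f i : {poly R})).
have ns i : (i <= n)%N -> ~ spanN f i (f n).
  by move=> le h; have [_ + _] := fP n; apply; apply: spanN_le h.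
have sz (i : 'I_n) : (size (f i : {poly R}) <= size (f n : {poly R}))%N.
  by have [_ _] := fP i; apply; [have [] := fP n|apply: ns; apply: ltnW].
have f0 i : (f i : {poly R}) != 0.
  apply/eqP => z; have [_ + _] := fP i; apply; rewrite z.
  exact: (spanN_lsub f i).1.
pose q : {poly R} := \sum_(i < n) ((a i)%:P * 'X^(size (f n : {poly R}) - size (f i : {poly R}))) * (f i : {poly R}).
have spanU x : spanN f n x -> U x.
  case=> b ->; apply: lsub_sum => // i _; apply: lsubZ => //.
  by have [] := fP i.
have qs : spanN f n (q : {poly R}^o).
  exists (fun i => ((a i)%:P * 'X^(size (f n : {poly R}) - size (f i : {poly R})))).
  by [].
pose y : {poly R}^o := (f n : {poly R}) - q.
have yU : U y.
  have [Un _ _] := fP n; exact: (lsubB hU Un (spanU _ qs)).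
have ys : ~ spanN f n y.
  move=> h; apply: (ns n (leqnn n)); rewrite -[f n](subrK (q : {poly R}^o)).
  exact: (lsubD (spanN_lsub f n)).
have [_ _ /(_ y yU ys)] := fP n; apply/negP; rewrite -ltnNge.
have szn : (0 < size (f n : {poly R}))%N by rewrite size_poly_gt0.
rewrite -(prednK szn) ltnS; apply/leq_sizeP => j hj; rewrite coefB.
have cq : q`_j = \sum_(i < n) a i * (if (j < size (f n : {poly R}) - size (f i : {poly R}))%N then 0
     else (f i : {poly R})`_(j - (size (f n : {poly R}) - size (f i : {poly R})))).
  by rewrite coef_sum; apply: eq_bigr => i _; rewrite -mulrA coefCM coefXnM.
have [je|ne] := eqVneq j (size (f n : {poly R})).-1; last first.
  have hj' : (size (f n : {poly R}) <= j)%N by move: hj ne szn; clear; lia.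
  rewrite nth_default // sub0r cq big1 ?oppr0 // => i _; case: ifP => _; rewrite ?mulr0 //.
  have aux (u w : nat) : (u <= w -> w <= j -> u <= j - (w - u))%N by clear; lia.
  by rewrite nth_default ?mulr0 //; apply: aux (sz i) hj'.
apply/eqP; rewrite subr_eq0 cq je; apply/eqP; rewrite -/(lead_coef (f n : {poly R})) la.
apply: eq_bigr => i _; congr (_ * _).
have sf : (0 < size (f i : {poly R}))%N by rewrite size_poly_gt0.
have := sz i; rewrite /lead_coef; case: ifP => h le; first by exfalso; lia.
by congr (_`_ _); lia.
Qed.

Lemma acc_inj (R R' : comNzRingType) (g : {rmorphism R -> R'}) (g' : {rmorphism R' -> R}) :
  cancel g g' -> acc R'^o -> acc R^o.
Proof.
move=> gK A f; have [n [a fn]] := A (g \o f); exists n, (g' \o a).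
rewrite -[LHS]gK -[g _]/((g \o f) n) fn rmorph_sum; apply: eq_bigr => i _.
by rewrite -[a i *: _]/(a i * g (f i)) rmorphM gK.
Qed.

Lemma acc_field (k : fieldType) c : c = 0%N -> acc {mpoly k[c]}^o.
Proof.
move=> c0 f; have cst (p : {mpoly k[c]}) : exists t, p = t%:MP.
  exists p@_0%MM; apply/mpolyP => m.
  have -> : m = 0%MM by apply/mnmP => -[i ic]; exfalso; rewrite c0 in ic.
  by rewrite mcoeffC eqxx mulr1.
have [t ft] := cst (f 0%N); have [u fu] := cst (f 1%N).
have [t0|t0] := eqVneq t 0.
  by exists 0%N, (fun=> 0); rewrite big_ord0 ft t0 mpolyC0.
exists 1%N, (fun=> (u / t)%:MP); rewrite big_ord1 fu ft.
by rewrite -[RHS]/((u / t)%:MP * t%:MP) -mpolyCM divfK.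
Qed.

Theorem acc_mpoly (k : fieldType) c : acc {mpoly k[c]}^o.
Proof.
elim: c => [|c IH]; first exact: acc_field.
(* For [lam] constantly 1 the change of variables embeds the ring into polynomials in one variable
   over the ring with one variable less. *)
have K := @PhiK k c (fun=> 1) (oner_neq0 k).
exact: acc_inj K (acc_poly IH).
Qed.

(** Induction on the number of coordinates allowed to be nonzero: generators are lifted from the
    ideal of values of the last one and joined to generators of the rest. *)
Lemma acc_col (R : comNzRingType) r : acc R^o -> acc 'cV[R]_r.
Proof.
move=> A; apply: fgen_acc => U hU.
suff h t : (t <= r)%N -> fgen (fun v => U v /\ forall i : 'I_r, (t <= i)%N -> v i 0 = 0).
  have [n [v [vU sv]]] := h r (leqnn r); exists n, v; split=> [i|x Ux]; first by have [] := vU i.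
  by apply: sv; split=> // i; rewrite leqNgt ltn_ord.
elim: t => [_|t IH tr].
  exists 0%N, (fun=> 0); split=> [[]//|x [_ x0]]; exists (fun=> 0).
  by rewrite big_ord0; apply/matrixP => i j; rewrite (ord1 j) x0 ?mxE.
pose it := Ordinal tr; pose Ut t v := U v /\ forall i : 'I_r, (t <= i)%N -> v i 0 = 0.
have hUt s : lsub (Ut s).
  split=> [|a x y [Ux x0] [Uy y0]]; first by split=> [|i _]; [apply: hU.1|rewrite mxE].
  by split=> [|i si]; [apply: hU.2|rewrite !mxE x0 // y0 // mulr0 addr0].
pose L (a : R^o) := exists2 v, Ut t.+1 v & a = v it 0.
have hL : lsub L.
  split=> [|a _ _ [v hv ->] [w hw ->]]; first by exists 0; [apply: (hUt _).1|rewrite mxE].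
  by exists (a *: v + w); [apply: (hUt _).2|rewrite !mxE].
have [n [z [zL sz]]] := acc_fgen L A; have /choice[v vP] i : exists v, Ut t.+1 v /\ z i = v it 0.
  by have [v] := zL i; exists v.
have [m [w [wU sw]]] := IH (ltnW tr).
exists (n + m)%N, (fun i => match fintype.split i with inl i => v i | inr i => w i end).
split=> [i|x Ux].
  case: (fintype.split i) => j; first exact: (vP j).1.
  by have [Uw w0] := wU j; split=> // l /ltnW; apply: w0.
have [|a xa] := sz (x it 0); first by exists x.
have [|b xb] := sw (x - \sum_i a i *: v i).
  have [] : Ut t.+1 (x - \sum_i a i *: v i).
    apply: lsubB => //; apply: lsub_sum => // i _; apply: lsubZ => //; exact: (vP i).1.
  move=> Ud d0; split=> // i; rewrite leq_eqVlt => /orP[/eqP ti|/d0 //].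
  have -> : i = it by apply: val_inj.
  rewrite !mxE summxE xa; apply/eqP; rewrite subr_eq0; apply/eqP.
  by apply: eq_bigr => j _; rewrite mxE -(vP j).2.
exists (fun i => match fintype.split i with inl i => a i | inr i => b i end).
rewrite big_split_ord /=; under eq_bigr do rewrite (unsplitK (inl _)).
by under [X in _ = _ + X]eq_bigr do rewrite (unsplitK (inr _)); rewrite -xb addrC subrK.
Qed.

Section Combinations.
Variables (k : fieldType) (V V' : lmodType k).

(** The span of a list, in recursive form so that concatenations and images of lists are handled
    without indices. *)
Fixpoint cmb (s : seq V) (x : V) : Prop :=
  if s is v :: s' then exists t y, cmb s' y /\ x = t *: v + y else x = 0.

Lemma cmb_cat s1 s2 x y : cmb s1 x -> cmb s2 y -> cmb (s1 ++ s2) (x + y).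
Proof.
elim: s1 x => [|v s1 IH] x /=; first by move=> -> h; rewrite add0r.
by move=> [t [z [hz ->]]] h; exists t, (z + y); split; [apply: IH|rewrite addrA].
Qed.

Lemma cmb_sum s x : cmb s x -> exists b : 'I_(size s) -> k, x = \sum_i b i *: s`_i.
Proof.
elim: s x => [|v s IH] x /=; first by move=> ->; exists (fun=> 0); rewrite big_ord0.
move=> [t [y [/IH[b ->] ->]]].
exists (fun i => if unlift ord0 i is Some j then b j else t).
rewrite big_ord_recl unlift_none; congr (_ + _); apply: eq_bigr => i _.
by rewrite liftK.
Qed.
End Combinations.

Lemma cmb_map (k : fieldType) (V V' : lmodType k) (g : V -> V') s x :
  (forall t v w, g (t *: v + w) = t *: g v + g w) -> cmb s x -> cmb (map g s) (g x).
Proof.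
move=> gl; have g0 : g 0 = 0.
  by have := gl (-1) 0 0; rewrite scaler0 addr0 scaleN1r addNr.
elim: s x => [|v s IH] x /=; first by move=> ->.
by move=> [t [y [hy ->]]]; exists t, (g y); split; [apply: IH|rewrite gl].
Qed.

(** * Chains of primes bound the growth of a graded quotient *)

Section Ideals.
Variables (k : fieldType) (c : nat).
Local Notation S := {mpoly k[c]}.
Implicit Types (I J : S -> Prop) (p q : S).

Definition ideal I : Prop := I 0 /\ forall a p q, I p -> I q -> I (a * p + q).
Definition hp n p : S := mpart (fun m => mdeg m == n) p.
Definition trc n p : S := mpart (fun m => mdeg m <= n)%N p.
Definition hideal I : Prop := ideal I /\ forall n p, I p -> I (hp n p).
Definition homdeg n p : Prop := forall m, m \in msupp p -> mdeg m = n.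

Lemma poly_idealM I a p : ideal I -> I p -> I (a * p).
Proof.
by move=> [I0 Il] Ip; rewrite -[a * p]addr0; apply: Il.
Qed.
Lemma poly_idealD I p q : ideal I -> I p -> I q -> I (p + q).
Proof.
by move=> [I0 Il] Ip Iq; rewrite -[p]mul1r; apply: Il.
Qed.
Lemma idealB I p q : ideal I -> I p -> I q -> I (p - q).
Proof.
move=> hI Ip Iq; apply: poly_idealD => //; rewrite -mulN1r; exact: poly_idealM.
Qed.
Lemma poly_ideal_sum I (T : eqType) (l : seq T) (P : pred T) (F : T -> S) : ideal I ->
  (forall j, j \in l -> P j -> I (F j)) -> I (\sum_(j <- l | P j) F j).
Proof.
move=> hI h; rewrite big_seq_cond; elim/big_rec: _ => [|j x /andP[jl Pj] Ix]; first exact: hI.1.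
by apply: poly_idealD => //; apply: h.
Qed.

Lemma hp_homdeg n p : homdeg n (hp n p).
Proof.
by move=> m /msupp_mpart/andP[/eqP].
Qed.

Lemma mcoeff_hp_sum N p m : (\sum_(i < N) hp i p)@_m = if (mdeg m < N)%N then p@_m else 0.
Proof.
rewrite raddf_sum /=; under eq_bigr do rewrite mcoeff_mpart eq_sym.
have [mN|Nm] := ltnP (mdeg m) N.
  rewrite (bigD1 (Ordinal mN)) //= eqxx big1 ?addr0 // => i.
  by rewrite -val_eqE /= => /negbTE ->.
rewrite big1 // => i _; case: eqP => // im; have := ltn_ord i.
by rewrite im ltnNge Nm.
Qed.

Lemma hp_sum N p : (msize p <= N)%N -> p = \sum_(i < N) hp i p.
Proof.
move=> sp; apply/mpolyP => m; rewrite mcoeff_hp_sum; case: ltnP => // Nm.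
apply: memN_msupp_eq0; apply/negP => /msize_mdeg_lt; rewrite ltnNge.
by rewrite (leq_trans sp).
Qed.

Lemma trc_sum N p : trc N p = \sum_(i < N.+1) hp i p.
Proof.
by apply/mpolyP => m; rewrite mcoeff_hp_sum /trc mcoeff_mpart.
Qed.

Lemma trc_lin n (t : k) p q : trc n (t *: p + q) = t *: trc n p + trc n q.
Proof. exact: mpart_lin. Qed.

Lemma trcB n p q : trc n (p - q) = trc n p - trc n q.
Proof.
by rewrite -scaleN1r addrC trc_lin scaleN1r addrC.
Qed.

Lemma hideal_trc I n p : hideal I -> I p -> I (trc n p).
Proof.
by move=> [hI hh] Ip; rewrite trc_sum; apply: poly_ideal_sum => // i _ _; apply: hh.
Qed.

Lemma hp_mul e a n p : homdeg e a -> hp n (a * p) = if (e <= n)%N then a * hp (n - e)%N p else 0.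
Proof.
move=> ha; case: leqP => h; last first.
  by apply: mpart_out => m /msuppM_le /allpairsP[[m1 m2] /= [/ha h1 _ ->]]; rewrite mdegD; lia.
by apply: mpartMl => m m' /ha h1; rewrite mdegD; apply/eqP/eqP; lia.
Qed.

Lemma trc_mul e a n p : homdeg e a -> trc n (a * p) = if (e <= n)%N then a * trc (n - e)%N p else 0.
Proof.
move=> ha; case: leqP => h; last first.
  by apply: mpart_out => m /msuppM_le /allpairsP[[m1 m2] /= [/ha h1 _ ->]]; rewrite mdegD; lia.
by apply: mpartMl => m m' /ha h1; rewrite mdegD; apply/idP/idP; lia.
Qed.

Definition adj I a p : Prop := exists q u, I u /\ p = a * q + u.

Lemma adj_hideal I e a : hideal I -> homdeg e a -> hideal (adj I a).
Proof.
move=> [hI hh] ha; split; first split.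
- by exists 0, 0; rewrite mulr0 addr0; split=> //; apply: hI.1.
- move=> b _ _ [q [u [Iu ->]]] [q' [u' [Iu' ->]]].
  exists (b * q + q'), (b * u + u'); split; first exact: hI.2.
  by ring.
- move=> n _ [q [u [Iu ->]]]; rewrite /hp mpartD -!/(hp _ _) (hp_mul _ _ ha).
  by exists (if (e <= n)%N then hp (n - e)%N q else 0), (hp n u); split;
    [apply: hh|case: ifP; rewrite ?mulr0].
Qed.

Lemma adj_sub I a p : I p -> adj I a p.
Proof.
by move=> Ip; exists 0, p; rewrite mulr0 add0r.
Qed.

Lemma adj_mem I a : ideal I -> adj I a a.
Proof.
by move=> hI; exists 1, 0; rewrite mulr1 addr0; split=> //; apply: hI.1.
Qed.

Definition lowdeg n p : Prop := forall m, m \in msupp p -> (mdeg m <= n)%N.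

Lemma trc_low n p : lowdeg n (trc n p).
Proof.
by move=> m /msupp_mpart/andP[].
Qed.
Lemma trc_id n p : lowdeg n p -> trc n p = p.
Proof.
by move=> h; apply: mpart_in.
Qed.

(** [M] bounds the dimension of the image in [S / I] of the polynomials of degree at most [N]. *)
Definition spn I N M : Prop := exists s : seq S, (size s <= M)%N /\
  forall p, lowdeg N p -> exists x, cmb s x /\ I (p - x).

(** The count belonging to the exact sequence of [S / (I : a)], shifted by [e], [S / I] and
    [S / (I + a)]. Here [K] is contained in the colon ideal and [J] in [I + a]. *)
Lemma spn_ext I J K e a N M1 M2 : hideal I -> homdeg e a -> (forall p, J p -> adj I a p) ->
  (forall p, K p -> I (a * p)) -> spn J N M1 -> ((e <= N)%N -> spn K (N - e)%N M2) ->
  spn I N (M1 + M2)%N.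
Proof.
move=> hI ha hJ hK [s1 [z1 sp1]] h2.
have [s2 [z2 sp2]] : exists s : seq S, (size s <= M2)%N /\ ((e <= N)%N ->
    forall p, lowdeg (N - e)%N p -> exists x, cmb s x /\ K (p - x)).
  have [/h2[s [sz sp]]|Ne] := leqP e N; first by exists s.
  by exists [::].
exists (map (trc N) s1 ++ map (fun p => a * p) s2); split.
  by rewrite size_cat !size_map leq_add.
move=> p pN; have [x [xs Jx]] := sp1 p pN.
have [q [u [Iu pE]]] := hJ _ Jx.
have tx : cmb (map (trc N) s1) (trc N x) by apply: cmb_map xs => t v w; apply: trc_lin.
have pE' : p - trc N x = trc N (a * q) + trc N u.
  by rewrite -{1}(trc_id pN) -trcB pE; apply: mpartD.
have Itu : I (trc N u) by apply: hideal_trc.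
have al (t : k) v w : a * (t *: v + w) = t *: (a * v) + a * w by rewrite mulrDr scalerAr.
have [eN|Ne] := leqP e N; last first.
  exists (trc N x); split; last by rewrite pE' (trc_mul _ _ ha) leqNgt Ne add0r.
  rewrite -[trc N x]addr0; apply: cmb_cat => //.
  elim: (s2) => //= v s IH; exists 0, 0; split=> //; by rewrite scale0r addr0.
have [y [ys Ky]] := sp2 eN (trc (N - e)%N q) (@trc_low _ _).
exists (trc N x + a * y); split; first by apply: cmb_cat => //; apply: (cmb_map al ys).
rewrite opprD addrA pE' (trc_mul _ _ ha) eN addrAC -mulrBr.
by apply: poly_idealD => //; [exact: hI.1|exact: hK].
Qed.

Lemma spn_le I N M N' M' : (N' <= N)%N -> (M <= M')%N -> spn I N M -> spn I N' M'.
Proof.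
move=> NN MM [s [z sp]]; exists s; split; first exact: leq_trans MM.
by move=> p h; apply: sp => m /h; move/leq_trans; apply.
Qed.

Definition chain (I : S -> Prop) (n : nat) (p : nat -> {pred S}) : Prop :=
  (forall i, (i <= n)%N -> prime_ideal (p i) /\ forall s, I s -> s \in p i) /\
  (forall i, (i < n)%N -> {subset p i <= p i.+1} /\ ~ {subset p i.+1 <= p i}).

(** Without a chain of length [d] the dimension is at most [d - 1], which is the exponent for
    partial sums; for [d = 0] the quotient is zero. *)
Definition gb C d N : nat := if d is d'.+1 then (C * N.+1 ^ d')%N else 0%N.

(** The witnesses are the top components outside [I] of two arbitrary ones: in that degree of the
    product every other term lies in [I]. *)
Lemma not_prime I : hideal I -> ~ I 1 -> ~ prime_ideal (fun p => `[< I p >]) ->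
  exists e f a b, [/\ homdeg e a, homdeg f b, I (a * b), ~ I a & ~ I b].
Proof.
move=> hI I1 np; have [hi hh] := hI.
have [p [q [Ipq Ip Iq]]] : exists p q, [/\ I (p * q), ~ I p & ~ I q].
  apply: contrapT => h; apply: np; split.
    split; [exact/asboolP/hi.1|exact/asboolPn|].
    by move=> a p q /asboolP Ip /asboolP Iq; apply/asboolP; apply: hi.2.
  move=> p q /asboolP Ipq; have [Ip|Ip] := pselect (I p); first by apply/orP; left; apply/asboolP.
  by have [Iq|Iq] := pselect (I q); [apply/orP; right; apply/asboolP|case: h; exists p, q].
have top u : ~ I u -> exists e, ~ I (hp e u) /\ forall i, (e < i)%N -> I (hp i u).
  move=> Iu; have ex : exists i, `[< ~ I (hp i u) >].
    apply: contrapT => /forallNP nI; apply: Iu; rewrite (hp_sum (leqnn (msize u))).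
    by apply: poly_ideal_sum => // i _ _; apply: contrapT => h; apply: (nI i); apply/asboolP.
  have ub i : `[< ~ I (hp i u) >] -> (i <= msize u)%N.
    move=> /asboolP ni; rewrite leqNgt; apply/negP => lt; apply: ni.
    suff -> : hp i u = 0 by apply: hi.1.
    by apply: mpart_out => m /msize_mdeg_lt; lia.
  case: (ex_maxnP ex ub) => e /asboolP he mx; exists e; split=> // i ei.
  by apply: contrapT => h; have := mx i; rewrite leqNgt ei; move/(_ (asboolT h)).
have [e [he hee]] := top p Ip; have [f [hf hff]] := top q Iq.
exists e, f, (hp e p), (hp f q); split=> //; try exact: hp_homdeg.
pose N := (msize p + e.+1)%N.
have : I (hp (e + f)%N (p * q)) by apply: hh.
rewrite {1}(hp_sum (leq_addr e.+1 (msize p))) -/N mulr_suml /hp mpart_sum.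
have eN : (e < N)%N by rewrite /N; lia.
rewrite (bigD1 (Ordinal eN)) //= -!/(hp _ _) (hp_mul _ _ (@hp_homdeg e p)) leq_addr addKn.
set w := (X in _ + X); move=> h; rewrite -[_ * _](addrK w); apply: idealB => //.
rewrite /w; elim/big_rec: _ => [|i x ne Ix]; first exact: hi.1.
apply: poly_idealD => //; rewrite -!/(hp _ _) (hp_mul _ _ (@hp_homdeg i p)).
case: leqP => [le|_]; last exact: hi.1.
have [lt|gt|eq] := ltngtP i e.
- by apply: poly_idealM => //; apply: hff; lia.
- by rewrite mulrC; apply: poly_idealM => //; apply: hee.
- by move: ne; rewrite -val_eqE /= eq eqxx.
Qed.

Lemma hideal_ind (P : (S -> Prop) -> Prop) :
  (forall I, hideal I ->
    (forall J, hideal J -> (forall p, I p -> J p) -> (exists2 p, J p & ~ I p) -> P J) -> P I) ->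
  forall I, hideal I -> P I.
Proof.
move=> step I hI; apply: contrapT => nP.
have next J : hideal J /\ ~ P J -> exists2 J', hideal J' /\ ~ P J' &
    (forall p, J p -> J' p) /\ exists2 p, J' p & ~ J p.
  move=> [hJ nJ]; apply: contrapT => h; apply: nJ; apply: step => // J' hJ' sub str.
  by apply: contrapT => nJ'; apply: h; exists J'.
have [g gP] : exists g : nat -> S -> Prop, forall n, hideal (g n) /\
    (forall p, g n p -> g n.+1 p) /\ exists2 p, g n.+1 p & ~ g n p.
  have [g [_ g1 g2]] := @dep_choice (fun=> S -> Prop) (fun _ J => hideal J /\ ~ P J)
    (fun _ J J' => (forall p, J p -> J' p) /\ exists2 p, J' p & ~ J p) I (conj hI nP) (fun _ => next).
  by exists g => n; split; [have [] := g1 n|exact: g2].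
have [n gn] : exists n, forall x, g n.+1 x -> g n x.
  apply: (@acc_chain S S^o g (@acc_mpoly k c)) => [n|n x gx].
    by have [[hg _] _] := gP n; exact: hg.
  by have [_ [h _]] := gP n; apply: h.
by have [_ [_ [p /gn]]] := gP n.
Qed.
Lemma chain_sub I J d (p : nat -> {pred S}) : (forall x, I x -> J x) -> chain J d p -> chain I d p.
Proof.
move=> IJ [h1 h2]; split=> // i id; have [pr sub] := h1 i id; split=> // s /IJ.
exact: sub.
Qed.

Lemma idealX I p : ideal I -> (forall i, I 'X_i) -> I (p - (p@_0%MM)%:MP).
Proof.
move=> hI hX; have -> : p - (p@_0%MM)%:MP = \sum_(m <- msupp p | m != 0%MM) p@_m *: 'X_[m].
  apply/mpolyP => m; rewrite mcoeffB mcoeffC {1}(mpolyE p) !raddf_sum /=.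
  under eq_bigr do rewrite mcoeffZ mcoeffX.
  under [RHS]eq_bigr do rewrite mcoeffZ mcoeffX.
  have [m0|m0] := boolP (0%MM \in msupp p).
    rewrite (bigD1_seq 0%MM) //= ?msupp_uniq // addrC eq_sym -addrA [X in _ + X](_ : _ = 0).
      by rewrite addr0; apply: eq_bigl.
    by rewrite subrr.
  rewrite (memN_msupp_eq0 m0) mul0r subr0 big_seq_cond [RHS]big_seq_cond.
  by apply: eq_bigl => m'; rewrite andbT; have [->|_] := eqVneq m' 0%MM; rewrite ?andbT ?(negbTE m0).
apply: poly_ideal_sum => // m _ m0; rewrite -mul_mpolyC; apply: poly_idealM => //.
have [i mi] : exists i, (0 < m i)%N.
  apply: contrapT => /forallNP h; move/negP: m0; apply; apply/eqP/mnmP => i.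
  by rewrite mnm0E; have := h i; case: (m i).
have -> : m = ((m - U_(i)) + U_(i))%MM.
  apply/mnmP => j; rewrite mnmDE mnmBE mnm1E; case: eqP => [<-|_]; last by rewrite subn0 addn0.
  by rewrite subnK.
by rewrite mpolyXD; apply: poly_idealM.
Qed.

(* Noetherian induction on [I]: if [I] is not prime, split [S / I] by means of a
   product [a * b] in [I]; if it is, divide out a variable. *)
Theorem chain_spn I : hideal I -> forall d, (forall p : nat -> {pred S}, ~ chain I d p) ->
  exists C, forall N, spn I N (gb C d N).
Proof.
move=> hI; elim/hideal_ind: hI => {}I hI IH d nc; have [hi hh] := hI.
have [I1|I1] := pselect (I 1).
  exists 0%N => N; exists [::]; split=> // p _; exists 0; split=> //.
  by rewrite subr0 -[p]mulr1; apply: poly_idealM.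
have [pr|npr] := pselect (prime_ideal (fun p => `[< I p >])); last first.
  have [e [f [a [b [ha hb Iab Ia Ib]]]]] := not_prime hI I1 npr.
  have sub x (p : nat -> {pred S}) : ~ chain (adj I x) d p.
    by move=> /(chain_sub (@adj_sub I x)); apply: nc.
  have [C1 h1] := IH _ (adj_hideal hI ha) (@adj_sub I a) (ex_intro2 _ _ a (adj_mem a hi) Ia) d (sub a).
  have [C2 h2] := IH _ (adj_hideal hI hb) (@adj_sub I b) (ex_intro2 _ _ b (adj_mem b hi) Ib) d (sub b).
  exists (C1 + C2)%N => N.
  apply: (@spn_le _ N (gb C1 d N + gb C2 d N)%N) => //; first by case: (d) => //= d'; rewrite mulnDl.
  apply: (@spn_ext I _ (adj I b) e a N _ _ hI ha (fun p h => h) _ (h1 N)) => [p [q [u [Iu ->]]]|eN].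
    rewrite mulrDr mulrA; apply: poly_idealD => //; last exact: poly_idealM.
    by rewrite mulrC; apply: poly_idealM.
  by apply: spn_le (h2 N) => //; apply: leq_subr.
(* For [d = 0] the prime [I] is by itself a chain of length 0. *)
case: d nc => [|d] nc.
  by case: (nc (fun=> fun p => `[< I p >])); split=> // i _; split=> // s Is; apply/asboolP.
(* If [I] contains all variables, the constants span [S / I]. *)
have [aX|/existsNP[i niX]] := pselect (forall i, I 'X_i).
  exists 1%N => N; exists [:: 1]; split=> [|p _]; first by rewrite /= mul1n expn_gt0.
  exists (p@_0%MM *: 1); split; first by exists p@_0%MM, 0; rewrite addr0.
  by rewrite -mul_mpolyC mulr1; apply: idealX.
have hX : homdeg 1 ('X_i : S) by move=> m; rewrite msuppX inE => /eqP ->; rewrite mdeg1.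
(* A chain of length [d] above [I + (X_i)] is prolonged downwards by [I], which is prime and does
   not contain [X_i]. *)
have [|C hC] := IH _ (adj_hideal hI hX) (@adj_sub I 'X_i) (ex_intro2 _ _ 'X_i (adj_mem _ hi) niX) d.
  move=> p [p1 p2]; apply: (nc (fun n => if n is n'.+1 then p n' else fun p => `[< I p >])).
  split=> [[|j] jd|[|j] jd].
  - by split=> // s Is; apply/asboolP.
  - by have [h1 h2] := p1 j jd; split=> // s /(adj_sub 'X_i); apply: h2.
  - have [_ h2] := p1 0%N (leq0n d); split=> [x /asboolP /(adj_sub 'X_i)|h]; first exact: h2.
    by apply: niX; apply/asboolP/h/h2; apply: adj_mem.
  - exact: p2.
(* Division by [X_i] lowers the degree bound by one, so the bounds for [I + (X_i)] add up and the
   exponent rises by one. *)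
have st N : spn I N (\sum_(j < N.+1) gb C d j).
  elim: N => [|N IHN].
    rewrite big_ord1 -[gb C d 0]addn0.
    exact: (@spn_ext I _ (fun=> False) 1 'X_i 0 _ 0 hI hX (fun p h => h) _ (hC 0%N)).
  rewrite big_ord_recr /= addnC.
  by apply: (spn_ext hI hX (fun p h => h) (fun p => poly_idealM _ hi) (hC N.+1)) => _; rewrite subn1.
exists C => N; apply: spn_le (leqnn N) _ (st N); case: d {nc IH st} hC => [|d] hC /=.
  by rewrite big1.
apply: leq_trans (_ : \sum_(j < N.+1) C * N.+1 ^ d <= _)%N.
  by apply: leq_sum => j _; rewrite leq_mul2l; apply/orP; right; apply: leq_expW; apply: ltn_ord.
by rewrite sum_nat_const card_ord expnS mulnCA.
Qed.
End Ideals.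

(** * Degree filtration and adic filtration on the homology *)

Section VectorLevel.
Variables (k : fieldType) (c r : nat) (a : 'I_r -> nat).
Local Notation S := {mpoly k[c]}.
Local Notation V := (cvk k c r).
Variable D : 'M[S]_r.
Hypothesis DD : D *m D = 0.
Hypothesis D_hom : wthom a D.
Implicit Types (v w : V) (s : S).

Definition Zc v : Prop := dact D v = 0.
Definition Bc v : Prop := exists w, v = dact D w.

Lemma smul_linr s t v w : smul s (t *: v + w) = t *: smul s v + smul s w.
Proof.
rewrite /smul scalerDr; congr (_ + _).
by rewrite -[t *: v]/(t%:MP *: (v : 'cV[S]_r)) scalerA mulrC -scalerA.
Qed.

Lemma smul_linl t s s' v : smul (t *: s + s') v = t *: smul s v + smul s' v.
Proof.
rewrite /smul scalerDl; congr (_ + _).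
by rewrite -[RHS]/(t%:MP *: (s *: (v : 'cV[S]_r))) scalerA mul_mpolyC.
Qed.

Lemma dact_smulr s v : dact D (smul s v) = smul s (dact D v).
Proof.
by rewrite /dact /smul -scalemxAr.
Qed.

Lemma Zc_smul s v : Zc v -> Zc (smul s v).
Proof.
by rewrite /Zc dact_smulr => ->; rewrite /smul scaler0.
Qed.

Lemma Bc_smul s v : Bc v -> Bc (smul s v).
Proof.
by move=> [w ->]; exists (smul s w); rewrite dact_smulr.
Qed.

Lemma Zc_subsp : subsp Zc.
Proof.
split=> [|t v w hv hw]; first exact: dact0.
by rewrite /Zc dact_lin hv hw scaler0 addr0.
Qed.

Lemma Bc_subsp : subsp Bc.
Proof.
split=> [|t _ _ [v ->] [w ->]]; first by exists 0; rewrite dact0.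
by exists (t *: v + w); rewrite dact_lin.
Qed.

Lemma Bc_Zc v : Bc v -> Zc v.
Proof.
by move=> [w ->]; apply: dact2.
Qed.

Lemma hpart_Zc n v : Zc v -> Zc (hpart a n v).
Proof.
move=> hv; rewrite /Zc dact_hpart // hv.
by apply: hpart_id; apply: (hom_subsp k c a _).1.
Qed.

Lemma hpart_Bc n v : Bc v -> Bc (hpart a n v).
Proof.
move=> [w ->]; case: n => [|n]; last by exists (hpart a n w); rewrite dact_hpart.
by rewrite hpart0_dact //; apply: Bc_subsp.1.
Qed.

Lemma hpart0v n : hpart a n (0 : V) = 0.
Proof. by apply: hpart_id; apply: (hom_subsp k c a n).1. Qed.

Lemma hpart_big n (J : Type) (l : seq J) (P : pred J) (F : J -> V) :
  hpart a n (\sum_(j <- l | P j) F j) = \sum_(j <- l | P j) hpart a n (F j).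
Proof.
elim/big_rec2: _ => [|j x y _ <-]; first exact: hpart0v.
by rewrite -[F j]scale1r hpart_lin !scale1r.
Qed.

Lemma hpartB n v w : hpart a n (v - w) = hpart a n v - hpart a n w.
Proof.
by rewrite -scaleN1r addrC hpart_lin scaleN1r addrC.
Qed.

Definition low N v : V := \sum_(n < N) hpart a n v.

Lemma low_lin N t v w : low N (t *: v + w) = t *: low N v + low N w.
Proof.
rewrite /low scaler_sumr -big_split; apply: eq_bigr => n _.
exact: hpart_lin.
Qed.

Lemma hpart_hpart m n v : hpart a m (hpart a n v) = if m == n then hpart a n v else 0.
Proof.
case: eqP => [->|/eqP ne]; first by apply: hpart_id; apply: hpart_hom.
exact: (hpart_other (@hpart_hom _ _ _ a n v)).
Qed.

Lemma hpart_low N n v : hpart a n (low N v) = if (n < N)%N then hpart a n v else 0.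
Proof.
rewrite /low hpart_big; under eq_bigr do rewrite hpart_hpart.
case: ltnP => h.
  rewrite (bigD1 (Ordinal h)) //= eqxx big1 ?addr0 // => i.
  by rewrite -val_eqE /= eq_sym => /negbTE ->.
by rewrite big1 // => i _; case: eqP => // e; have := ltn_ord i; rewrite -e ltnNge h.
Qed.

Lemma homog_sub (U : V -> Prop) v : subsp U -> (forall n, U (hpart a n v)) -> U v.
Proof.
move=> hU h; have [N hN] := hpart_sum a v; rewrite (hN N (leqnn N)).
exact: subsp_sum.
Qed.

(** Modulo boundaries, [Ulow N] is the homology in weights below [N] and [Uhigh N] the homology in
    weights at least [N]. *)
Definition Ulow N v : Prop := Zc v /\ forall n, (N <= n)%N -> Bc (hpart a n v).
Definition Uhigh N v : Prop := Zc v /\ forall n, (n < N)%N -> Bc (hpart a n v).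

Lemma Ulow_subsp N : subsp (Ulow N).
Proof.
have [Z0 Zl] := Zc_subsp; have [B0 Bl] := Bc_subsp.
split=> [|t v w [zv bv] [zw bw]]; first by split=> // n _; rewrite hpart0v.
split; first exact: Zl.
by move=> n h; rewrite hpart_lin; apply: Bl; [apply: bv|apply: bw].
Qed.

Lemma Uhigh_subsp N : subsp (Uhigh N).
Proof.
have [Z0 Zl] := Zc_subsp; have [B0 Bl] := Bc_subsp.
split=> [|t v w [zv bv] [zw bw]]; first by split=> // n _; rewrite hpart0v.
split; first exact: Zl.
by move=> n h; rewrite hpart_lin; apply: Bl; [apply: bv|apply: bw].
Qed.

Lemma low_Zc N v : Zc v -> Zc (low N v).
Proof.
by move=> zv; apply: subsp_sum => [|n _]; [apply: Zc_subsp|apply: hpart_Zc].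
Qed.

Variable h : nat -> nat.
Hypothesis hh : hilb a D h.

Lemma dimq_Ulow N : dimq (Ulow N) Bc (\sum_(n < N) h n).
Proof.
have BUlow M v : Bc v -> Ulow M v.
  by move=> bv; split=> [|n _]; [apply: Bc_Zc|apply: hpart_Bc].
elim: N => [|N IH].
  rewrite big_ord0; apply: dimq_triv; first exact: Bc_subsp.
  by move=> v [_ bv]; apply: homog_sub => [|n]; [apply: Bc_subsp|apply: bv].
rewrite big_ord_recr /= addnC.
apply: (dimq_add Bc_subsp (Ulow_subsp N)) IH.
- by move=> v [zv bv]; split=> // n /ltnW; apply: bv.
- exact: BUlow.
apply: (@dimq_preimg _ _ _ (Ulow N.+1) (Ulow N) (cyc a D N) (bnd a D N) (hpart a N)) (hh N).
- by move=> t v w; apply: hpart_lin.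
- exact: Ulow_subsp.
- exact: bnd_subsp.
- by move=> v [zv _]; split; [apply: hpart_hom|apply: hpart_Zc].
- move=> v [zv bv]; split=> [[_ bv']|[_ bv']].
    by split; [apply: hpart_hom|apply: bv'].
  split=> // n; rewrite leq_eqVlt => /orP[/eqP <- //|]; exact: bv.
- move=> v [hv zv]; exists v; last by rewrite hpart_id // subrr; apply: (bnd_subsp a D N).1.
  split=> // n Nn; rewrite (hpart_other hv); first exact: Bc_subsp.1.
  by rewrite gtn_eqF.
Qed.

Lemma dimq_Uhigh N : dimq Zc (Uhigh N) (\sum_(n < N) h n).
Proof.
apply: (@dimq_preimg _ _ _ Zc (Uhigh N) (Ulow N) Bc (low N)) (dimq_Ulow N).
- by move=> t v w; apply: low_lin.
- exact: Zc_subsp.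
- exact: Bc_subsp.
- move=> v zv; split=> [|n Nn]; first exact: low_Zc.
  by rewrite hpart_low ltnNge Nn; apply: Bc_subsp.1.
- move=> v zv; split=> [[_ bv]|bv]; first by apply: subsp_sum => [|n _]; [apply: Bc_subsp|apply: bv].
  by split=> // n nN; have := hpart_Bc n bv; rewrite hpart_low nN.
- move=> v [zv bv]; exists v => //; apply: homog_sub => [|n]; first exact: Bc_subsp.
  rewrite hpartB hpart_low; case: ltnP => nN; first by rewrite subrr; apply: Bc_subsp.1.
  by rewrite subr0; apply: bv.
Qed.

Lemma hpart_smulr e n s v : hom a e v ->
  hpart a n (smul s v) = smul (mpart (fun m => e + 2 * mdeg m == n)%N s) v.
Proof.
move=> hv; apply/matrixP => i j; rewrite (ord1 j) /hpart /smul !mxE.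
rewrite mulrC [RHS]mulrC; apply: mpartMl => m m' hm.
have := hv (i, m); rewrite /cf /wt -mcoeff_msupp /= => /(_ hm) <-.
by rewrite mdegD; apply/eqP/eqP; lia.
Qed.

Lemma hpart_smull e n s v : homdeg e s ->
  hpart a n (smul s v) = if (2 * e <= n)%N then smul s (hpart a (n - 2 * e) v) else 0.
Proof.
move=> hs; apply: cfP => -[i m]; rewrite cf_hpart.
case: leqP => le; last first.
  rewrite cf0 /cf /wt /smul /= !mxE; case: eqP => // em.
  apply: memN_msupp_eq0; apply/negP => /msuppM_le /allpairsP[[m1 m2] /= [/hs h1 _ e2]].
  by move: em; rewrite e2 mdegD; lia.
rewrite /cf /smul !mxE /=; set p := (v : 'cV[S]_r) i 0.
rewrite -(@mpartMl _ _ (fun m => wt a (i, m) == n)) ?mcoeff_mpart //.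
by move=> m1 m2 /hs h1; rewrite /wt /= mdegD; apply/eqP/eqP; lia.
Qed.

(** The cycles whose class lies in the [n]-th power of [(chi)] times the homology. *)
Fixpoint mpow n v : Prop := if n is n'.+1 then
  Zc v /\ exists y : 'I_c -> V, (forall i, mpow n' (y i)) /\
    Bc (v - \sum_i smul 'X_i (y i)) else Zc v.

Lemma mpow_Zc n v : mpow n v -> Zc v.
Proof. by case: n => [|n] // []. Qed.

Lemma mpow_subsp n : subsp (mpow n).
Proof.
have [B0 Bl] := Bc_subsp; have [Z0 Zl] := Zc_subsp.
elim: n => [|n [IH0 IHl]] //=; split=> [|t v w [zv [y [yn hy]]] [zw [z [zn hz]]]].
  split=> //; exists (fun=> 0); split=> //.
  by rewrite big1 ?subr0 // => i _; apply: scaler0.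
split; first exact: Zl.
exists (fun i => t *: (y i : V) + (z i : V)); split=> [i|]; first exact: IHl.
have -> : \sum_i smul 'X_i (t *: (y i : V) + (z i : V)) = t *: \sum_i smul 'X_i (y i) + \sum_i smul 'X_i (z i).
  by rewrite scaler_sumr -big_split; apply: eq_bigr => i _; rewrite smul_linr.
have -> : t *: v + w - (t *: \sum_i smul 'X_i (y i) + \sum_i smul 'X_i (z i)) =
    t *: (v - \sum_i smul 'X_i (y i)) + (w - \sum_i smul 'X_i (z i)).
  by rewrite scalerBr opprD addrACA.
exact: Bl.
Qed.

Lemma mpow_Bc n v : Bc v -> mpow n v.
Proof.
move=> bv; case: n => [|n] /=; first exact: Bc_Zc.
split; first exact: Bc_Zc.
exists (fun=> 0); split=> [i|]; first exact: (mpow_subsp n).1.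
by rewrite big1 ?subr0 // => i _; apply: scaler0.
Qed.

(** Weights are nonnegative and each [chi_i] has weight 2. *)
Lemma mpow_Uhigh n v : mpow n v -> Uhigh (2 * n) v.
Proof.
elim: n v => [|n IH] v /=; first by split=> // n; rewrite ltn0.
move=> [zv [y [yn bv]]]; split=> // m mn.
have := hpart_Bc m bv; rewrite hpartB hpart_big => h'; apply: subsp_trans h' _; first exact: Bc_subsp.
apply: subsp_sum => [|i _]; first exact: Bc_subsp.
have hX : homdeg 1 ('X_i : S) by move=> m'; rewrite msuppX inE => /eqP ->; rewrite mdeg1.
rewrite (hpart_smull _ _ hX); case: ifP => le; last by exists 0; rewrite dact0.
by apply: Bc_smul; have [_] := IH _ (yn i); apply; lia.
Qed.

Lemma mpow_smul n s v : (forall m, m \in msupp s -> (n <= mdeg m)%N) -> Zc v -> mpow n (smul s v).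
Proof.
move=> hs zv; have st m : (n <= mdeg m)%N -> mpow n (smul 'X_[m] v).
  elim: n m {hs} => [|n IH] m nm /=; first exact: Zc_smul.
  split; first exact: Zc_smul.
  have [i mi] : exists i, (0 < m i)%N.
    apply: contrapT => /forallNP h0; move: nm; rewrite mdegE big1 // => i _.
    by have := h0 i; case: (m i).
  have mE : m = (U_(i) + (m - U_(i)))%MM.
    apply/mnmP => j; rewrite mnmDE mnmBE mnm1E; case: eqP => [<-|_]; last by rewrite subn0.
    by rewrite addnC subnK.
  exists (fun j => if j == i then smul 'X_[m - U_(i)] v else 0); split=> [j|].
    case: ifP => _; last exact: (mpow_subsp n).1.
    by apply: IH; move: nm; rewrite {1}mE mdegD mdeg1.
  rewrite (bigD1 i) //= eqxx big1 => [|j /negbTE ->]; last exact: scaler0.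
  by rewrite addr0 /smul scalerA -mpolyXD -mE subrr; apply: Bc_subsp.1.
have -> : smul s v = \sum_(m <- msupp s) s@_m *: smul 'X_[m] v.
  rewrite /smul {1}(mpolyE s) scaler_suml; apply: eq_bigr => m _.
  by rewrite -mul_mpolyC -scalerA.
rewrite big_seq; apply: subsp_sum => [|m /hs hm]; first exact: mpow_subsp.
by apply: subspZ; [exact: mpow_subsp|exact: st].
Qed.

(** The homogeneous components of finitely many generators of the module of cycles. *)
Lemma generators : exists g (z : 'I_g -> V) (e : 'I_g -> nat),
  [/\ forall i, hom a (e i) (z i), forall i, Zc (z i) &
      forall v, Zc v -> exists s : 'I_g -> S, v = \sum_i smul (s i) (z i)].
Proof.
have [|g [z [Zz sz]]] := @acc_fgen S 'cV[S]_r Zc.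
  by apply: acc_col; apply: acc_mpoly.
have /choice[b bP] i : exists N, forall M, (N <= M)%N -> (z i : V) = \sum_(n < M) hpart a n (z i).
  exact: hpart_sum.
pose N := \max_i b i.
have [G [ix [rk [ixK rkK]]]] : exists G (ix : 'I_G -> 'I_g * 'I_N) rk, cancel ix rk /\ cancel rk ix.
  exists #|{: 'I_g * 'I_N}|%N, enum_val, enum_rank.
  by split; [apply: enum_valK|apply: enum_rankK].
exists G, (fun x => hpart a (ix x).2 (z (ix x).1)), (fun x => (ix x).2 : nat); split.
- by move=> x; apply: hpart_hom.
- by move=> x; apply: hpart_Zc; apply: Zz.
- move=> v /sz[s ->]; exists (fun x => s (ix x).1).
  rewrite [RHS](reindex rk) /=; last by exists ix => x _; [apply: rkK|apply: ixK].
  under [RHS]eq_bigr do rewrite rkK.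
  rewrite -(pair_bigA _ (fun i (j : 'I_N) => smul (s i) (hpart a j (z i)))) /=.
  apply: eq_bigr => i _; rewrite /smul -scaler_sumr; congr (_ *: _).
  by apply: bP; apply: leq_bigmax.
Qed.
End VectorLevel.

Section Primes.
Variables (k : fieldType) (c : nat).
Local Notation S := {mpoly k[c]}.

Lemma cmb_flatten (V : lmodType k) (J : Type) (l : seq J) (F : J -> seq V) (x : J -> V) :
  (forall j, cmb (F j) (x j)) -> cmb (flatten [seq F j | j <- l]) (\sum_(j <- l) x j).
Proof.
move=> h; elim: l => [|j l IH]; first by rewrite big_nil.
by rewrite big_cons; apply: cmb_cat.
Qed.

Lemma lowdegM m n (p q : S) : lowdeg m p -> lowdeg n q -> lowdeg (m + n) (p * q).
Proof.
move=> hp hq m' /msuppM_le /allpairsP[[m1 m2] /= [/hp h1 /hq h2 ->]].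
by rewrite mdegD leq_add.
Qed.

Lemma lowdeg1 : lowdeg 0 (1 : S).
Proof.
by move=> m; rewrite msupp1 inE => /eqP ->; rewrite mdeg0.
Qed.

Lemma lowdegX d (p : S) t : lowdeg d p -> lowdeg (t * d) (p ^+ t).
Proof.
move=> h; elim: t => [|t IH]; first by rewrite expr0; apply: lowdeg1.
by rewrite exprS mulSn; apply: lowdegM.
Qed.

Lemma lowdeg_le m n (p : S) : (m <= n)%N -> lowdeg m p -> lowdeg n p.
Proof.
by move=> mn h m' /h /leq_trans; apply.
Qed.

Lemma lowdeg_msize (p : S) : lowdeg (msize p) p.
Proof.
by move=> m /msize_mdeg_lt /ltnW.
Qed.

Lemma prime_prod (P : {pred S}) (J : Type) (l : seq J) (s : J -> S) : prime_ideal P ->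
  (forall j, s j \notin P) -> \prod_(j <- l) s j \notin P.
Proof.
move=> [[_ P1 _] pr] h; elim: l => [|j l IH]; first by rewrite big_nil.
rewrite big_cons; apply/negP => /pr /orP[]; first by apply/negP.
exact/negP.
Qed.

(* If [y] is in [p 1] but not in [p 0], a relation modulo [p 0] of least order in [y]
   restricts to a relation modulo [p 1]. *)
Lemma chain_indep I L (p : nat -> {pred S}) : chain I L p ->
  exists dg, forall M, exists (J : finType) (v : J -> S),
    [/\ #|J| = (M.+1 ^ L)%N, forall j, lowdeg (dg * M) (v j) &
        forall b : J -> k, \sum_j b j *: v j \in p 0%N -> forall j, b j = 0].
Proof.
elim: L p => [|L IH] p ch.
  exists 0%N => M; exists unit, (fun=> 1); split.
  - by rewrite card_unit.
  - by move=> _; apply: lowdeg1.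
  - move=> b; rewrite (big_pred1 tt) => [|[]] // hb [].
    have [[[_ p1 pl] _] _] := ch.1 0%N isT; apply/eqP/negPn/negP => b0; move/negP: p1; apply.
    have p00 : 0 \in p 0%N by have [[[]]] := ch.1 0%N isT.
    have := pl (b tt)^-1%:MP _ _ hb p00.
    by rewrite addr0 mul_mpolyC scalerA mulVf // scale1r.
have [ch1 ch2] := ch; have [sub /existsNP[y /not_implyP[y1 y0]]] := ch2 0%N isT.
have [|dg hd] := IH (fun i => p i.+1).
  by split=> i iL; [apply: ch1|apply: ch2].
have [[[p00 _ p0l] pr0] _] := ch1 0%N isT.
have [[[p10 _ p1l] _] _] := ch1 1%N isT.
exists (dg + msize y)%N => M; have [J [v [cJ vl vi]]] := hd M.
exists ('I_M.+1 * J)%type, (fun x : 'I_M.+1 * J => y ^+ x.1 * v x.2); split.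
- by rewrite card_prod card_ord cJ expnS.
- move=> [t j] /=.
  have h1 : lowdeg (t * msize y) (y ^+ t) by apply: lowdegX; apply: lowdeg_msize.
  have h2 : lowdeg (t * msize y + dg * M) (y ^+ t * v j) by apply: lowdegM => //; apply: vl.
  by apply: lowdeg_le h2; have := ltn_ord t; nia.
move=> b.
have key m (b' : nat -> J -> k) : \sum_(t < m) y ^+ t * (\sum_j b' t j *: v j) \in p 0%N ->
    forall t j, (t < m)%N -> b' t j = 0.
  elim: m b' => [|m IHm] b' //.
  rewrite big_ord_recl expr0 mul1r.
  set w' := \sum_(_ < m) _; pose w := \sum_(t < m) y ^+ t * \sum_j b' t.+1 j *: v j.
  have -> : w' = y * w.
    by rewrite mulr_sumr; apply: eq_bigr => t _; rewrite mulrA -exprS.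
  move=> h.
  have u1 : \sum_j b' 0%N j *: v j \in p 1%N.
    have := p1l (- w) _ _ y1 (sub _ h); rewrite mulNr [w * y]mulrC addrCA addNr addr0.
    exact.
  have b0 := vi _ u1; move: h; rewrite big1 ?add0r => [h|j _]; last by rewrite b0 scale0r.
  have wp : w \in p 0%N by have := pr0 _ _ h; case/orP => // /y0.
  by case=> [|t] j //= tm; apply: (IHm (fun t => b' t.+1)).
have -> : \sum_x b x *: (y ^+ x.1 * v x.2) = \sum_t \sum_j b (t, j) *: (y ^+ t * v j).
  by rewrite pair_bigA; apply: eq_bigr => -[].
move=> hb [t j].
have := key M.+1 (fun t j => b (inord t, j)) _ t j (ltn_ord t); rewrite inord_val; apply.
rewrite [X in X \in _](_ : _ = \sum_t \sum_j b (t, j) *: (y ^+ t * v j)) //.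
apply: eq_bigr => t' _; rewrite mulr_sumr.
by apply: eq_bigr => j' _; rewrite inord_val scalerAr.
Qed.
End Primes.

Section Krull.
Variables (k : fieldType) (c r : nat) (a : 'I_r -> nat).
Local Notation S := {mpoly k[c]}.
Local Notation V := (cvk k c r).
Variable D : 'M[S]_r.
Hypothesis DD : D *m D = 0.
Hypothesis D_hom : wthom a D.
Implicit Types (v w : V) (s : S).
Local Notation Zc := (Zc D).
Local Notation Bc := (Bc D).

Definition Ann s : Prop := forall v, Zc v -> Bc (smul s v).

Let Bs : subsp Bc := Bc_subsp D.

Lemma smulA s t v : smul s (smul t v) = smul (s * t) v.
Proof. by rewrite /smul scalerA. Qed.
Lemma smulDl s t v : smul (s + t) v = smul s v + smul t v.
Proof. by rewrite /smul scalerDl. Qed.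
Lemma smulBl s t v : smul (s - t) v = smul s v - smul t v.
Proof. by rewrite /smul scalerBl. Qed.
Lemma smul_sumr s (J : Type) (l : seq J) (F : J -> V) :
  smul s (\sum_(j <- l) F j) = \sum_(j <- l) smul s (F j).
Proof.
have s0 : smul s (0 : V) = 0.
  by have := smul_linr s (-1) (0 : V) 0; rewrite scaler0 addr0 scaleN1r addNr.
elim/big_rec2: _ => [|j x y _ <-] //.
by rewrite -[F j]scale1r smul_linr !scale1r.
Qed.

Lemma Ann_ideal : ideal Ann.
Proof.
split=> [v _|t s s' hs hs' v zv]; first by rewrite /smul scale0r; apply: Bs.1.
rewrite smulDl -smulA; apply: subspD => //; last exact: hs'.
by apply: Bc_smul; apply: hs.
Qed.

Lemma Ann_hideal : hideal Ann.
Proof.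
split=> [|n s hs v zv]; first exact: Ann_ideal.
pose U v := Bc (smul (hp n s) v).
suff : U v by [].
apply: (@homog_sub _ _ _ a) => [|e].
  split=> [|t x y hx hy]; first by rewrite /U /smul scaler0; apply: Bs.1.
  by rewrite /U smul_linr; apply: Bs.2.
have zh : Zc (hpart a e v) by apply: hpart_Zc.
have := hpart_Bc D_hom (e + 2 * n) (hs _ zh).
rewrite (hpart_smulr _ _ (@hpart_hom _ _ _ a e v)) /U /hp.
congr (Bc (smul _ _)); apply/mpolyP => m; rewrite !mcoeff_mpart eqn_add2l.
by rewrite eqn_pmul2l.
Qed.

Variable h : nat -> nat.
Hypothesis hh : hilb a D h.
Variables (g : nat) (z : 'I_g -> V) (e : 'I_g -> nat).
Hypothesis z_hom : forall i, hom a (e i) (z i).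
Hypothesis z_Zc : forall i, Zc (z i).
Hypothesis z_gen : forall v, Zc v -> exists s : 'I_g -> S, v = \sum_i smul (s i) (z i).

Lemma hom_gen n v : Zc v -> exists s : 'I_g -> S,
  hpart a n v = \sum_i smul (s i) (z i) /\
  forall i m, m \in msupp (s i) -> (e i + 2 * mdeg m = n)%N.
Proof.
move=> /z_gen[s ->]; exists (fun i => mpart (fun m => e i + 2 * mdeg m == n)%N (s i)); split.
  by rewrite hpart_big; apply: eq_bigr => i _; apply: hpart_smulr.
by move=> i m /msupp_mpart/andP[/eqP].
Qed.

(** Written in homogeneous generators, a cycle of weight at least [2 n + max e] has coefficients of
    degree at least [n]. *)
Lemma Uhigh_mpow n v : Uhigh a D (2 * n + \max_i e i) v -> mpow D n v.
Proof.
move=> [zv bv]; apply: (@homog_sub _ _ _ a) => [|m]; first exact: mpow_subsp.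
have [lt|ge] := ltnP m (2 * n + \max_i e i); first by apply: mpow_Bc => //; apply: bv.
have [s [-> hs]] := hom_gen m zv; apply: subsp_sum => [|i _]; first exact: mpow_subsp.
apply: mpow_smul => // m' /hs h1; have : (e i <= \max_i e i)%N by apply: leq_bigmax.
by move: ge h1; lia.
Qed.

(** The [n]-th adic step contains everything of weight at least [2 n + max e] and, modulo
    boundaries, nothing of weight below [2 n]. *)
Lemma rank_bounds n : exists rho,
  [/\ dimq Zc (mpow D n) rho, (\sum_(i < 2 * n) h i <= rho)%N &
      (rho <= \sum_(i < 2 * n + \max_i e i) h i)%N].
Proof.
have Ms := mpow_subsp D n.
have d2 := dimq_Uhigh DD D_hom hh (2 * n + \max_i e i).
have [v [vU sv iv]] := d2.
have [|rho le dr] := dimq_ex (w := v) Ms (Zc_subsp D).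
  by move=> x /sv[b hb]; exists b; apply: Uhigh_mpow.
exists rho; split=> //.
apply: dimq_quot (dimq_Uhigh DD D_hom hh (2 * n)) => //; last exact: dr.
  exact: Uhigh_subsp.
by move=> x; apply: mpow_Uhigh.
Qed.

(** Classes of weight at most [N] are combinations of the [g] generators with coefficients of degree
    at most [N], which matter only modulo the annihilator. *)
Lemma spn_cum N M : spn Ann N M -> (cum h N <= g * M)%N.
Proof.
move=> [s [sM sp]]; apply: leq_trans (_ : g * size s <= _)%N; last by rewrite leq_mul2l sM orbT.
pose L : seq V := flatten [seq [seq smul x (z i) | x <- s] | i <- enum 'I_g].
have sL : size L = (g * size s)%N.
  rewrite size_flatten /shape -map_comp sumnE big_map.
  under eq_bigr do rewrite /= size_map.
  by rewrite big_enum sum_nat_const card_ord.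
rewrite -sL; apply: (dimq_le (w := fun i : 'I_(size L) => L`_i) Bs (dimq_Ulow DD D_hom hh N.+1)).
move=> v [zv bv].
suff [y [/cmb_sum[b yb] By]] : exists y, cmb L y /\ Bc (v - y) by exists b; rewrite -yb.
have /choice[s' hs'] n := hom_gen n zv.
pose t i : S := \sum_(n < N.+1) s' n i.
have tl i : lowdeg N (t i).
  move=> m /msupp_sum_le /flatten_mapP[n _ hm]; have [_ /(_ i m hm)] := hs' n.
  by have := ltn_ord n; lia.
have lt : low a N.+1 v = \sum_i smul (t i) (z i).
  rewrite /low; under eq_bigr => n _ do rewrite (hs' n).1.
  by rewrite exchange_big; apply: eq_bigr => i _; rewrite /smul /t scaler_suml.
have /choice[x hx] i := sp (t i) (tl i).
exists (\sum_i smul (x i) (z i)); split.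
  rewrite -big_enum; apply: cmb_flatten => i.
  apply: cmb_map (hx i).1 => b u w; exact: smul_linl.
apply: (subsp_trans Bs (y := low a N.+1 v - \sum_i smul (x i) (z i))).
  rewrite opprB addrA subrK; apply: (@homog_sub _ _ _ a) => [|n] //.
  rewrite hpartB hpart_low; case: ltnP => nN; first by rewrite subrr; apply: Bs.1.
  by rewrite subr0; apply: bv.
rewrite lt -sumrB; apply: subsp_sum => // i _; rewrite -smulBl.
exact: (hx i).2.
Qed.

Theorem chain_hilb d : (forall p : nat -> {pred S}, ~ chain Ann d p) ->
  exists C, forall N, (cum h N <= gb C d N)%N.
Proof.
move=> /(chain_spn Ann_hideal)[C hC]; exists (g * C)%N => N.
apply: leq_trans (spn_cum (hC N)) _; case: (d) => [|d']; first by rewrite /= muln0.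
by rewrite /= mulnA.
Qed.

(** Otherwise each generator has an annihilator outside the prime; their product kills all
    generators, so it lies in the annihilator of the homology but not in the prime. *)
Lemma chain_gen L (p : nat -> {pred S}) : chain Ann L p ->
  exists j, forall s, Bc (smul s (z j)) -> s \in p 0%N.
Proof.
move=> [ch _]; have [pr sub] := ch 0%N isT; apply: contrapT => /forallNP nj.
have /choice[s hs] j : exists s, Bc (smul s (z j)) /\ s \notin p 0%N.
  by have /existsNP[s /not_implyP[h1 /negP h2]] := nj j; exists s.
have := prime_prod (index_enum 'I_g) pr (fun j => (hs j).2).
move/negP; apply; apply: sub => v /z_gen[t ->]; rewrite smul_sumr.
apply: subsp_sum => // i _; rewrite (bigD1 i) //= smulA.
rewrite mulrC mulrA -mulrA [s i * _]mulrC mulrA -smulA; apply: Bc_smul.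
exact: (hs i).1.
Qed.

(** The polynomials of [chain_indep] are independent modulo [p 0], so their multiples of the
    generator of [chain_gen] are independent modulo boundaries. *)
Theorem chain_lower L (p : nat -> {pred S}) : chain Ann L p ->
  exists e0 dg, forall M, (M.+1 ^ L <= cum h (e0 + dg * M))%N.
Proof.
move=> ch; have [j hj] := chain_gen ch; have [dg hd] := chain_indep ch.
exists (e j), (2 * dg)%N => M; have [J [v [<- vl vi]]] := hd M.
apply: (dimq_ge (w := fun i : 'I_#|J| => smul (v (enum_val i)) (z j)) Bs
  (dimq_Ulow DD D_hom hh (e j + 2 * dg * M).+1)) => [i|b hb i].
  split=> [|n hn]; first exact: Zc_smul.
  rewrite (@hpart_smulr k c r a (e j) n (v (enum_val i)) (z j) (@z_hom j)) mpart_out => [|m /vl hm]; last by apply/negP; lia.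
  by rewrite /smul scale0r; apply: Bs.1.
have := vi (fun x => b (enum_rank x)) _ (enum_val i); rewrite enum_valK; apply.
apply: hj; move: hb; congr Bc.
have E0 (t : k) (s : S) : smul (t *: s) (z j) = t *: smul s (z j).
  have := smul_linl t s 0 (z j); rewrite addr0 => ->.
  by rewrite [smul 0 _]scale0r addr0.
have -> : smul (\sum_x b (enum_rank x) *: v x) (z j) = \sum_x b (enum_rank x) *: smul (v x) (z j).
  by rewrite {1}/smul scaler_suml; apply: eq_bigr => x _; apply: E0.
rewrite [RHS](reindex (fun i : 'I_#|J| => enum_val i)) /=.
  by apply: eq_bigr => x _; rewrite enum_valK.
by exists enum_rank => x _; [apply: enum_valK|apply: enum_rankK].
Qed.
End Krull.

(** * Comparison of growth exponents *)

Section GrowthEstimates.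
Local Open Scope nat_scope.
Implicit Types h f G : nat -> nat.

Lemma cum_bound d h : bigO d h -> exists C, forall N, cum h N <= C * N.+1 ^ d.
Proof.
move=> [C hC]; case: d hC => [|d] hC.
  exists (cum h C) => N; rewrite muln1; elim: N => [|N IH]; first exact: cum_mono.
  have [NC|CN] := leqP N.+1 C; first exact: cum_mono.
  rewrite cumS; suff -> : h N.+1 = 0 by rewrite addn0.
  by have := hC N.+1; rewrite muln1; case: (h N.+1) => // m; nia.
exists (h 0 + C); elim=> [|N IH]; first by rewrite cum0 exp1n muln1 leq_addr.
rewrite cumS; have hN : h N.+1 <= C * N.+1 ^ d.
  by have := hC N.+1; rewrite expnS mulnCA [N.+1 * _]mulnC leq_pmul2r.
apply: leq_trans (leq_add IH hN) _.
have e1 : N.+1 ^ d.+1 + N.+1 ^ d <= N.+2 ^ d.+1.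
  have e2 : N.+1 ^ d <= N.+2 ^ d by apply: leq_expW.
  by rewrite !expnS; move: (N.+1 ^ d) (N.+2 ^ d) e2 => x y; nia.
apply: leq_trans (_ : (h 0 + C) * (N.+1 ^ d.+1 + N.+1 ^ d) <= _); last first.
  by rewrite leq_mul2l e1 orbT.
by rewrite mulnDr leq_add2l leq_mul2r leq_addl orbT.
Qed.

Lemma bigO_comp d f (u : nat -> nat) K : (forall n, 0 < n -> n <= u n <= K * n) ->
  bigO d f -> bigO d (fun n => f (u n)).
Proof.
move=> hu [C hC]; exists (C * K ^ d) => -[|n]; first by rewrite muln0.
have /andP[h1 h2] := hu n.+1 isT.
apply: leq_trans (_ : f (u n.+1) * u n.+1 <= _); first by rewrite leq_mul2l h1 orbT.
apply: leq_trans (hC _) _; rewrite -mulnA leq_mul2l -expnMn leq_expW ?orbT //.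
Qed.

Lemma lowerb_cum_close d h h' : lowerb d h -> cum_close d h h' -> lowerb d h'.
Proof.
by move=> lo [G GO cl]; apply: lowerb_sub lo GO _ => N; have [] := cl N.
Qed.

Lemma cum_close_sym d h h' : cum_close d h h' -> cum_close d h' h.
Proof.
by move=> [G GO cl]; exists G => // N; have [] := cl N.
Qed.

Lemma cum_shift s h N : cum (fun n => h (n + s)) N + \sum_(i < s) h i = cum h (N + s).
Proof.
elim: N => [|N IH]; first by rewrite cum0 add0n addnC /cum big_ord_recr.
by rewrite cumS addSn cumS addnAC IH.
Qed.

Lemma cum_tail s h N : cum h (N + s) = cum h N + \sum_(i < s) h (N + i.+1).
Proof.
elim: s => [|s IH]; first by rewrite addn0 big_ord0 addn0.
by rewrite addnS cumS IH big_ord_recr /= addnA addnS.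
Qed.

(* Unlike [cum_close] and [lowerb], these weaker relations are invariant under shifts of
   the index, also for [d = 0]. *)
Definition wclose d h h' : Prop := exists G K, bigO d G /\
  forall N, cum h N <= cum h' N + G N + K /\ cum h' N <= cum h N + G N + K.
Definition wlower d h : Prop := exists C N0, forall N, N0 <= N -> N ^ d <= C * cum h N + C.

Lemma wclose_sym d h h' : wclose d h h' -> wclose d h' h.
Proof.
by move=> [G [K [GO cl]]]; exists G, K; split=> // N; have [] := cl N.
Qed.

Lemma wclose_shift d s h h' : bigO d h' -> cum_close d h h' -> wclose d h (fun n => h' (n + s)).
Proof.
move=> hO [G GO cl]; pose K := \sum_(i < s) h' i.
exists (fun N => G N + \sum_(i < s) h' (N + i.+1)), K; split.
  by apply: bigOD => //; apply: bigO_sum => i; apply: bigO_shift.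
move=> N; have := cum_shift s h' N; rewrite -/K cum_tail => e.
by have [] := cl N; lia.
Qed.

Lemma lowerb_wlower d h : lowerb d h -> wlower d h.
Proof.
by move=> [C [N0 lo]]; exists C, N0 => N /lo h1; apply: leq_trans h1 (leq_addr _ _).
Qed.

Lemma wlower_shift d s h : lowerb d h -> wlower d (fun n => h (n + s)).
Proof.
move=> [C [N0 lo]]; pose K := \sum_(i < s) h i; exists (C * K.+1), N0 => N /lo h1.
apply: leq_trans h1 _; have := cum_shift s h N; rewrite -/K => e.
have : cum h N <= cum h (N + s) by apply: cum_mono; apply: leq_addr.
by rewrite -e; nia.
Qed.

Lemma expn_cum e N : N ^ e.+1 <= e.+1 * cum (fun n => n ^ e) N.
Proof.
have st n (f : nat) : n.+1 ^ f.+1 <= n ^ f.+1 + f.+1 * n.+1 ^ f.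
  elim: f => [|f IH]; first by rewrite !expn1 expn0 muln1 addn1.
  rewrite expnS; apply: leq_trans (leq_mul (leqnn n.+1) IH) _.
  rewrite [n ^ f.+2]expnS [n.+1 ^ f.+1]expnS; have := leq_expW f.+1 (leqnSn n).
  by rewrite [n.+1 ^ f.+1]expnS; nia.
elim: N => [|N IH]; first by rewrite exp0n.
by rewrite cumS mulnDr; apply: leq_trans (st N e) _; rewrite leq_add2r.
Qed.

(** Summed up, the gap separates the partial sums by order [N^(e + 1)]. The upper bound on [h] with
    [wlower] gives [N^d = O(N^(e + 1))], so [wclose] allows a difference of order [N^e] only. *)
Lemma growth_gap e d A B n1 h h' : wclose d h h' -> wlower d h ->
  (forall n, n1 <= n -> A * h n + n ^ e <= A * h' n) ->
  (forall n, n1 <= n -> h n <= B * n ^ e) -> False.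
Proof.
move=> [G [K [[C GO] cl]]] [C1 [N0 lo]] gap up.
pose P := cum (fun n => n ^ e).
have low N : A * cum h N + P N <= A * cum h' N + (A * cum h n1 + P n1).
  elim: N => [|N IH].
    rewrite addnC [X in _ <= X]addnC; apply: leq_trans (leq_addr _ _).
    by rewrite addnC leq_add // ?leq_mul2l cum_mono // orbT.
  have [h1|h1] := leqP n1 N.+1; first by rewrite /P !cumS -/P; have := gap _ h1; lia.
  apply: leq_trans (leq_addl _ _); rewrite leq_add // ?leq_mul2l; last first.
    by apply: cum_mono; apply: ltnW.
  by rewrite cum_mono ?orbT // ltnW.
have upP N : cum h N <= cum h n1 + B * P N.
  elim: N => [|N IH]; first by apply: leq_trans (leq_addr _ _); apply: cum_mono.
  have [h1|h1] := leqP n1 N.+1; first by rewrite /P !cumS -/P; have := up _ h1; nia.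
  by apply: leq_trans (leq_addr _ _); apply: cum_mono; apply: ltnW.
have P2 N : 0 < N -> P N <= 2 * N ^ e.+1.
  move=> N0'; apply: leq_trans (_ : \sum_(n < N.+1) N ^ e <= _).
    by apply: leq_sum => n _; apply: leq_expW; rewrite -ltnS.
  by rewrite sum_nat_const card_ord expnS mulnA leq_mul2r; apply/orP; right; lia.
pose K1 := A * cum h n1 + P n1 + A * K.
have PG N : P N <= A * G N + K1.
  by have := low N; have [_ ] := cl N; rewrite /K1; nia.
pose C3 := C1 * (cum h n1 + 2 * B) + C1.
have Nd N : N0 <= N -> 0 < N -> N ^ d <= C3 * N ^ e.+1.
  move=> h0 h1; apply: leq_trans (lo _ h0) _; have := upP N; have := P2 N h1.
  have : 0 < N ^ e.+1 by rewrite expn_gt0 h1.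
  rewrite /C3; move: (N ^ e.+1) (P N) (cum h N) (cum h n1) => x p y z x0 px yz.
  have h2 : y <= (z + 2 * B) * x by nia.
  have h3 : C1 * y <= C1 * ((z + 2 * B) * x) by rewrite leq_mul2l h2 orbT.
  by nia.
(* [C4] collects the constants of an inequality [N^(e + 1) * N <= C4 * N^(e + 1)], which fails for
   the [N] chosen next. *)
pose C4 := e.+1 * (A * (C * C3) + K1).
pose N := N0 + C4.+1.
have N_gt0 : 0 < N by rewrite /N addnS.
have x0 : 0 < N ^ e.+1 by rewrite expn_gt0 N_gt0.
have b1 : N ^ e.+1 * N <= C4 * N ^ e.+1.
  apply: leq_trans (leq_mul (expn_cum e N) (leqnn N)) _.
  rewrite -mulnA /C4 -mulnA leq_mul2l; apply/orP; right.
  apply: leq_trans (leq_mul (PG N) (leqnn N)) _.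
  have g1 := GO N; have g2 := Nd N (leq_addr _ _) N_gt0.
  have g3 : N <= N ^ e.+1 by rewrite expnS leq_pmulr // expn_gt0 N_gt0.
  have g4 : C * N ^ d <= C * (C3 * N ^ e.+1) by rewrite leq_mul2l g2 orbT.
  have g5 : A * (G N * N) <= A * (C * (C3 * N ^ e.+1)) by rewrite leq_mul2l (leq_trans g1) ?orbT.
  have g6 : K1 * N <= K1 * N ^ e.+1 by rewrite leq_mul2l g3 orbT.
  by rewrite mulnDl -mulnA; apply: leq_trans (leq_add g5 g6) _; rewrite mulnDl -!mulnA.
by move: b1; rewrite mulnC leq_pmul2r // /N; lia.
Qed.

(** The sums up to [2 n] are compared by [cum_close]; the [w] extra values of [h] are of lower
    order. *)
Lemma rank_close d w h h' (rho rho' : nat -> nat) :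
  bigO d h -> cum_close d h h' ->
  (forall n, \sum_(i < 2 * n) h' i <= rho' n) ->
  (forall n, rho n <= \sum_(i < 2 * n + w) h i) ->
  exists2 E, bigO d E & forall n, 0 < n -> rho n <= rho' n + E n.
Proof.
move=> hO [G GO cl] lo up.
exists (fun n => G (2 * n).-1 + \sum_(i < w) h (2 * n + i)).
  apply: bigOD; first by apply: (@bigO_comp _ _ (fun n => (2 * n).-1) 2) => // n n0; lia.
  apply: bigO_sum => i; apply: (@bigO_comp _ _ (fun n => 2 * n + i) (2 + i)) => // n n0; nia.
move=> n n0; apply: leq_trans (up n) _; rewrite big_split_ord /=.
rewrite addnA leq_add2r; have [c1 _] := cl (2 * n).-1.
have e1 f : cum f (2 * n).-1 = \sum_(i < 2 * n) f i by rewrite /cum prednK //; lia.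
by move: c1; rewrite !e1 => c1; apply: leq_trans c1 _; rewrite leq_add2r.
Qed.

End GrowthEstimates.

Definition chain_dim (k : fieldType) c (I : {mpoly k[c]} -> Prop) (d : nat) : Prop :=
  (exists p, chain I d p) /\ forall n p, chain I n p -> (n <= d)%N.

(** If there were no chain of length [d], partial sums would grow with exponent at most [d - 1],
    against [lowerb]; a chain of length [n > d] would make them grow with exponent [n], against
    [bigO]. *)
Theorem krull_growth (k : fieldType) c r (a : 'I_r -> nat) (D : 'M[{mpoly k[c]}]_r) h d :
  D *m D = 0 -> wthom a D -> hilb a D h -> lowerb d h -> bigO d h ->
  chain_dim (Ann D) d.
Proof.
move=> DD Da hh [C [N0 lo]] hO.
have [g [z [e [z_hom z_Zc z_gen]]]] := generators Da.
split=> [|n p ch].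
  apply: contrapT => /forallNP nc.
  have [C' hC'] := chain_hilb DD Da hh z_hom z_Zc z_gen nc.
  case: d lo {hO} nc hC' => [|d] lo _ hC'.
    by have := lo N0 (leqnn _); rewrite expn0; have := hC' N0; rewrite /=; case: (cum h N0) => // _; rewrite muln0.
  pose K := (C * C' * 2 ^ d)%N; pose N := (N0 + K.+1)%N.
  have N_gt0 : (0 < N)%N by rewrite /N addnS.
  have h1 := lo N (leq_addr _ _); have h2 := hC' N; rewrite /= in h2.
  have h3 : (N.+1 ^ d <= 2 ^ d * N ^ d)%N by rewrite -expnMn leq_expW //; lia.
  have h4 : (N ^ d.+1 <= K * N ^ d)%N.
    apply: leq_trans h1 _; rewrite /K -!mulnA leq_mul2l; apply/orP; right.
    by apply: leq_trans h2 _; rewrite leq_mul2l h3 orbT.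
  by move: h4; rewrite expnS leq_pmul2r ?expn_gt0 ?N_gt0 // /N; lia.
have [e0 [dg hd]] := chain_lower DD Da hh z_hom z_Zc z_gen ch.
have [C' hC'] := cum_bound hO; rewrite leqNgt; apply/negP => dn.
pose K := (C' * (e0 + dg).+1 ^ d)%N.
have h1 : (K.+1 ^ n <= K * K.+1 ^ d)%N.
  apply: leq_trans (hd K) _; apply: leq_trans (hC' _) _.
  rewrite /K -mulnA leq_mul2l -expnMn leq_expW ?orbT //; nia.
move: h1; rewrite -(subnK (ltnW dn)) expnD leq_pmul2r ?expn_gt0 //.
have : (0 < n - d)%N by rewrite subn_gt0.
by case: (n - d)%N => // m _; rewrite expnS => h1; have : (0 < K.+1 ^ m)%N by [rewrite expn_gt0]; nia.
Qed.

(** * Multiplicities and Betti numbers *)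

Lemma subBB (Z : zmodType) (y p q : Z) : y - q - (y - p) = p - q.
Proof.
by rewrite opprB addrC addrA subrK.
Qed.

Section Model.
Variables (k : fieldType) (c : nat).
Local Notation S := {mpoly k[c]}.
Variables (X : lmodType S) (r : nat) (D : 'M[S]_r) (kap : 'cV[S]_r -> X).
Local Notation V := (cvk k c r).
Hypothesis DD : D *m D = 0.
Hypothesis kap_lin : forall s v w, D *m v = 0 -> D *m w = 0 -> kap (s *: v + w) = s *: kap v + kap w.
Hypothesis kap_surj : forall x, exists2 v, D *m v = 0 & x = kap v.
Hypothesis kap_eq0 : forall v, D *m v = 0 -> (kap v = 0 <-> exists w, v = D *m w).
Implicit Types (U W : {pred X}) (v w : V).
Local Notation Zc := (Zc D).
Local Notation Bc := (Bc D).

Lemma kapk t v w : Zc v -> Zc w -> kap (t *: v + w : V) = t%:MP *: kap v + kap w.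
Proof. exact: kap_lin. Qed.

Lemma kap0 : kap 0 = 0.
Proof.
by apply/kap_eq0; [rewrite mulmx0|exists 0; rewrite mulmx0].
Qed.

Lemma kap_smul s v : Zc v -> kap (smul s v) = s *: kap v.
Proof.
move=> zv; have := kap_lin s zv (mulmx0 _ D); rewrite kap0 !addr0.
exact.
Qed.

Lemma kapD v w : Zc v -> Zc w -> kap (v + w : V) = kap v + kap w.
Proof.
by move=> zv zw; have := kap_lin 1 zv zw; rewrite !scale1r.
Qed.

Lemma kapB v w : Zc v -> Zc w -> kap (v - w : V) = kap v - kap w.
Proof.
move=> zv zw; have := kap_lin (-1) zw zv; rewrite !scaleN1r ![- _ + _]addrC.
exact.
Qed.

Lemma kap_sum (J : Type) (l : seq J) (F : J -> V) : (forall j, Zc (F j)) ->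
  kap (\sum_(j <- l) F j : V) = \sum_(j <- l) kap (F j).
Proof.
move=> zF; elim: l => [|j l IH]; first by rewrite !big_nil kap0.
rewrite !big_cons kapD ?IH //; apply: subsp_sum => //; exact: Zc_subsp.
Qed.

Lemma kap_Bc v : Zc v -> (kap v = 0 <-> Bc v).
Proof. exact: kap_eq0. Qed.

(** Subsets of [Ext] are pulled back to cycles, where [dimq] applies. *)
Definition lft U v : Prop := Zc v /\ kap v \in U.

Lemma kap_comb n (b : 'I_n -> k) (v : 'I_n -> V) : (forall i, Zc (v i)) ->
  kap (\sum_i b i *: v i : V) = \sum_i (b i)%:MP *: kap (v i).
Proof.
move=> zv; have zb i : Zc (b i *: v i) by apply: subspZ; [apply: Zc_subsp|].
rewrite (kap_sum _ zb); apply: eq_bigr => i _.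
have := kapk (b i) (zv i) (mulmx0 _ D); rewrite kap0 !addr0.
exact.
Qed.

Lemma is_rank_modP U W n : subsp (lft U) -> subsp (lft W) ->
  dimq (lft U) (lft W) n <-> is_rank_mod U W n.
Proof.
move=> hU hW; split=> [[v [vU sv iv]]|[x [xU xP]]].
  have zv i : Zc (v i) by case: (vU i).
  exists (fun i => kap (v i)); split=> [i|x xU]; first by case: (vU i).
  have [y Dy xy] := kap_surj x.
  have [|b [zb hb]] := sv y; first by split=> //; rewrite -xy.
  have zc (b' : 'I_n -> k) : Zc (\sum_i b' i *: v i).
    by apply: subsp_sum => [|i _]; [|apply: subspZ => //]; apply: Zc_subsp.
  exists [ffun i => b i]; split.
    move: hb; rewrite kapB // kap_comb // xy.
    by under [in X in _ -> X]eq_bigr do rewrite ffunE.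
  move=> b'; rewrite xy -kap_comb // -kapB // => hb'.
  have e : lft W (\sum_i (b i - b' i) *: v i).
    have -> : \sum_i (b i - b' i) *: v i = (y - \sum_i b' i *: v i) - ((y : V) - \sum_i b i *: v i).
      rewrite (subBB (y : V)) -sumrB; apply: eq_bigr => i _.
      by rewrite scalerBl.
    have zb' : Zc ((y : V) - \sum_i b' i *: v i) := subspB (Zc_subsp D) Dy (zc b').
    exact: (subspB hW (conj zb' hb') (conj zb hb)).
  apply/ffunP => i; rewrite ffunE; apply/eqP; rewrite -subr_eq0.
  by rewrite (iv _ e).
have /choice[v vP] i : exists v, Zc v /\ x i = kap v by have [v] := kap_surj (x i); exists v.
have zv i : Zc (v i) by case: (vP i).
have zc (b' : 'I_n -> k) : Zc (\sum_i b' i *: v i).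
  by apply: subsp_sum => [|i _]; [|apply: subspZ => //]; apply: Zc_subsp.
have kx (b' : 'I_n -> k) : kap (\sum_i b' i *: v i : V) = \sum_i (b' i)%:MP *: x i.
  by rewrite kap_comb //; apply: eq_bigr => i _; rewrite (vP i).2.
exists v; split=> [i|y [zy yU]|b [_ hb] i].
- by split; [|rewrite -(vP i).2].
- have [b [hb _]] := xP _ yU; exists b; split; last by rewrite kapB // kx.
  by apply: subspB => //; apply: Zc_subsp.
have U0 : (0 : X) \in U by have [_] := hU.1; rewrite kap0.
(* Uniqueness of the coefficients of 0 is linear independence: both 0 and [- b] qualify. *)
have [b0 [_ b0u]] := xP 0 U0.
have z0 : b0 = [ffun=> 0].
  apply: b0u; rewrite big1 ?subr0 => [|j _]; last by rewrite ffunE mpolyC0 scale0r.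
  by have [_] := hW.1; rewrite kap0.
have zb : b0 = [ffun j => - b j].
  apply: b0u; rewrite sub0r -sumrN.
  have -> : \sum_j - (([ffun j => - b j] j)%:MP *: x j) = \sum_j (b j)%:MP *: x j.
    by apply: eq_bigr => j _; rewrite ffunE mpolyCN scaleNr opprK.
  by rewrite -kx.
have := congr1 (fun f : {ffun 'I_n -> k} => f i) zb; rewrite z0 !ffunE => /eqP.
by rewrite eq_sym oppr_eq0 => /eqP.
Qed.

Lemma rank_modE U W n : subsp (lft U) -> subsp (lft W) -> dimq (lft U) (lft W) n -> rank_mod U W = n.
Proof.
move=> hU hW dn; rewrite /rank_mod; case: xgetP => [m _ /(is_rank_modP m hU hW) dm|h].
  exact: dimq_uniq dm dn.
by case: (h n); apply/(is_rank_modP n hU hW).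
Qed.

Lemma kills_Ann s : (forall x : X, s *: x = 0) <-> Ann D s.
Proof.
split=> [h v zv|h x]; first by apply/(kap_Bc (Zc_smul s zv)); rewrite kap_smul.
have [v Dv ->] := kap_surj x; rewrite -[_ *: _](kap_smul s (v := v)) //.
by apply/kap_Bc; [apply: Zc_smul|apply: h].
Qed.

Lemma krull_dimE d : chain_dim (Ann D) d -> krull_dim X = d.
Proof.
have E n p : prime_chain X n p <-> chain (Ann D) n p.
  split=> -[h1 h2]; split=> // i id; have [h3 h4] := h1 i id; split=> // s hs; apply: h4.
    exact/kills_Ann.
  exact/kills_Ann.
move=> [[p cp] mx]; rewrite /krull_dim; case: xgetP => [m _ [[p' cp'] mx']|h].
  by apply/eqP; rewrite eqn_leq (mx _ _ ((E _ _).1 cp')) (mx' _ _ ((E _ _).2 cp)).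
case: (h d); split; first by exists p; apply/E.
by move=> n p' /E; apply: mx.
Qed.

Lemma lft_predT v : lft predT v <-> Zc v.
Proof.
by split=> [[]|] //.
Qed.

Lemma lft_power n v : lft (@power_submod k c X n) v <-> mpow D n v.
Proof.
suff h w : Zc w -> (in_power_submod n (kap w) <-> mpow D n w).
  split=> [[zv /asboolP /(h v zv)]//|mv]; have zv := mpow_Zc mv.
  by split=> //; apply/asboolP/(h v zv).
elim: n w => [|n IH] w zw //=; split.
  move=> [y [yn wy]]; split=> //.
  have /choice[u uP] i : exists u, Zc u /\ y i = kap u by have [u] := kap_surj (y i); exists u.
  have zu i : Zc (u i) by case: (uP i).
  have zX i : Zc (smul 'X_i (u i)) by apply: Zc_smul.
  have zs : Zc (\sum_i smul 'X_i (u i)) by apply: subsp_sum => //; apply: Zc_subsp.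
  exists u; split=> [i|]; first by apply/IH => //; rewrite -(uP i).2.
  apply/kap_Bc; first by apply: subspB => //; apply: Zc_subsp.
  rewrite kapB // kap_sum // wy; apply/eqP; rewrite subr_eq0; apply/eqP.
  by apply: eq_bigr => i _; rewrite kap_smul // -(uP i).2.
move=> [_ [u [un bu]]]; have zu i : Zc (u i) by apply: mpow_Zc (un i).
have zX i : Zc (smul 'X_i (u i)) by apply: Zc_smul.
have zs : Zc (\sum_i smul 'X_i (u i)) by apply: subsp_sum => //; apply: Zc_subsp.
exists (fun i => kap (u i)); split=> [i|]; first by apply/IH.
have := (kap_Bc (subspB (Zc_subsp D) zw zs)).2 bu; rewrite kapB // kap_sum // => /eqP.
rewrite subr_eq0 => /eqP ->; apply: eq_bigr => i _; exact: kap_smul.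
Qed.

Lemma rank_power n rho : dimq Zc (mpow D n) rho -> rank_mod predT (@power_submod k c X n) = rho.
Proof.
have sub (U W : V -> Prop) : subsp U -> (forall v, U v <-> W v) -> subsp W.
  by move=> [h0 hl] UW; split=> [|t v w /UW hv /UW hw]; apply/UW; [|apply: hl].
move=> dr; apply: rank_modE.
- by apply: sub (Zc_subsp D) _ => v; rewrite lft_predT.
- by apply: sub (mpow_subsp D n) _ => v; rewrite lft_power.
- by apply: eq_dimq dr => v; rewrite ?lft_predT ?lft_power.
Qed.
End Model.

From mathcomp Require Import topology normedtype sequences.
Import numFieldNormedType.Exports.

Section Limits.
Variable R : realType.
Local Open Scope classical_set_scope.

(** [limn] is total. If one sequence converges, so does the other; if neither does, both sides are
    the same default value. *)
Lemma limn_close (u v : R^nat) : (fun n => u n - v n) @ \oo --> (0 : R) -> limn u = limn v.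
Proof.
have key (u' v' : R^nat) : (fun n => u' n - v' n) @ \oo --> (0 : R) -> cvgn u' -> limn v' = limn u'.
  move=> uv cu; apply: cvg_lim => //.
  have -> : v' = (fun n => u' n - (u' n - v' n)) by apply: funext => n; rewrite opprB addrC subrK.
  by rewrite -[X in _ --> X]subr0; apply: cvgB.
move=> uv; have vu : (fun n => v n - u n) @ \oo --> (0 : R).
  have -> : (fun n => v n - u n) = (fun n => - (u n - v n)) by apply: funext => n; rewrite opprB.
  by rewrite -[X in _ --> X]oppr0; apply: cvgN.
have [cu|ncu] := pselect (cvgn u); first by rewrite (key u v).
have [cv|ncv] := pselect (cvgn v); first by rewrite (key v u).
by rewrite (dvgP ncu) (dvgP ncv).
Qed.

Lemma cvg0_harmonic (u : R^nat) K : (forall n, (0 < n)%N -> `|u n| <= K / n%:R) ->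
  u @ \oo --> (0 : R).
Proof.
(* The factor 2 makes up for [harmonic n] being [1 / (n + 1)]. *)
move=> h; have hc : (fun n => 2 * K * harmonic n : R) @ \oo --> (0 : R).
  by rewrite -[X in _ --> X](mulr0 (2 * K)); apply: cvgMr => //; apply: cvg_harmonic.
apply: norm_cvg0; apply: (@squeeze_cvgr _ _ _ _ (fun=> 0) (fun n => 2 * K * harmonic n)) => //.
  exists 1%N => // n /= n0; rewrite normr_ge0 /=; apply: le_trans (h n n0) _.
  have K0 : 0 <= K by have := le_trans (normr_ge0 _) (h 1%N isT); rewrite divr1.
  rewrite /harmonic /= ler_pdivrMr ?ltr0n // mulrAC ler_pdivlMr ?ltr0n //.
  have : (n.+1%:R : R) <= 2 * n%:R by rewrite -natrM ler_nat; lia.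
  by nra.
exact: cvg_cst.
Qed.
End Limits.

Lemma multiplicity_close (R : realType) (k : fieldType) c (X X' : lmodType {mpoly k[c]})
    (rho rho' E E' : nat -> nat) d :
  ~ (forall x : X, x = 0) -> ~ (forall x : X', x = 0) ->
  krull_dim X = d -> krull_dim X' = d ->
  (forall n, rank_mod predT (@power_submod k c X n) = rho n) ->
  (forall n, rank_mod predT (@power_submod k c X' n) = rho' n) ->
  bigO d E -> bigO d E' ->
  (forall n, (0 < n)%N -> (rho n <= rho' n + E n)%N) ->
  (forall n, (0 < n)%N -> (rho' n <= rho n + E' n)%N) ->
  multiplicity X R = multiplicity X' R.
Proof.
move=> X0 X0' dX dX' rX rX' EO EO' le1 le2; rewrite /multiplicity.
do 2!(rewrite asboolF //).
have [C hC] := bigOD EO EO'.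
apply: limn_close; apply: (@cvg0_harmonic _ _ (d`!%:R * C%:R)) => n n0.
rewrite dX dX' rX rX' -mulrBl -mulrBr -mulrA normrM normr_nat -mulrA.
apply: ler_wpM2l; first exact: ler0n.
rewrite normrM normfV (ger0_norm (exprn_ge0 _ _)) ?ler0n //.
rewrite ler_pdivrMr ?exprn_gt0 ?ltr0n // mulrAC ler_pdivlMr ?ltr0n //.
apply: le_trans (_ : (E n + E' n)%:R * n%:R <= _).
  apply: ler_wpM2r; first exact: ler0n.
  rewrite ler_norml; have := le1 n n0; have := le2 n n0.
  rewrite -!(ler_nat R) !natrD => h1 h2.
  have e1 : (0 : R) <= (E n)%:R by apply: ler0n.
  have e2 : (0 : R) <= (E' n)%:R by apply: ler0n.
  by apply/andP; split; lra.
by rewrite -natrM -natrX -natrM ler_nat.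
Qed.

Section Leading.
Local Notation Q := rat.

Lemma poly_asym (f : {poly Q}) e : (size f <= e.+1)%N -> exists2 K, 0 <= K &
  forall n, (0 < n)%N -> `|f.[n%:R] - f`_e * n%:R ^+ e| * n%:R <= K * n%:R ^+ e.
Proof.
move=> sf; exists (\sum_(i < e) `|f`_i|); first by apply: sumr_ge0.
move=> n n0; rewrite (horner_coef_wide _ sf) big_ord_recr /= addrK.
apply: le_trans (ler_wpM2r (ler0n _ _) (ler_norm_sum _ _ _)) _.
rewrite !mulr_suml; apply: ler_sum => i _; rewrite normrM normrX normr_nat -mulrA.
apply: ler_wpM2l => //; rewrite -exprSr; apply: ler_weXn2l; last exact: ltn_ord.
by rewrite ler1n.
Qed.

Lemma size_lead_term (q : {poly Q}) : size (lead_term q) = size q.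
Proof.
rewrite /lead_term; have [->|q0] := eqVneq q 0; first by rewrite lead_coef0 scale0r size_poly0.
by rewrite size_scale ?lead_coef_eq0 // size_polyXn prednK // lt0n size_poly_eq0.
Qed.

Lemma coef_lead_term (q : {poly Q}) e : (size q <= e.+1)%N -> (lead_term q)`_e = q`_e.
Proof.
rewrite leq_eqVlt => /orP[/eqP sq|lt]; last by rewrite !nth_default // size_lead_term.
by rewrite /lead_term /lead_coef sq /= coefZ coefXn eqxx mulr1.
Qed.

Lemma lead_term_eq (q q' : {poly Q}) : let e := (maxn (size q) (size q')).-1 in
  q`_e = q'`_e -> lead_term q = lead_term q'.
Proof.
move=> e; wlog le : q q' @e / (size q' <= size q)%N.
  by move=> h; case: (leqP (size q') (size q)) => [/h//|/ltnW/h]; rewrite maxnC => h' /esym/h' ->.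
have -> : e = (size q).-1 by rewrite /e; congr _.-1; apply/maxn_idPl.
have [q0|q0] := eqVneq q 0.
  by move: le; rewrite q0 size_poly0 leqn0 size_poly_eq0 => /eqP ->.
move=> ee; have ne : q'`_(size q).-1 != 0 by rewrite -ee lead_coef_eq0.
have sq : (0 < size q)%N by rewrite lt0n size_poly_eq0.
have se : size q' = size q.
  apply/eqP; rewrite eqn_leq le -(prednK sq) ltnNge; apply: contra ne => h.
  by rewrite nth_default.
by rewrite /lead_term /lead_coef se ee.
Qed.

(** If [t < t'], a multiple of the difference of [h'] and [h] eventually exceeds [n^e] in both
    parities, which [growth_gap] excludes. *)
Lemma lead_gap (h h' : nat -> nat) (q : bool -> {poly Q}) (q' : bool -> {poly Q}) e d t t' n0 :
  (forall b, (size (q b) <= e.+1)%N /\ (q b)`_e = t) ->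
  (forall b, (size (q' b) <= e.+1)%N /\ (q' b)`_e = t') ->
  (forall n, (n0 <= n)%N -> (h n)%:R = (q (odd n)).[n%:R]) ->
  (forall n, (n0 <= n)%N -> (h' n)%:R = (q' (odd n)).[n%:R]) ->
  wclose d h h' -> wlower d h -> ~ t < t'.
Proof.
move=> sq sq' hq hq' cl lo tt.
have B (p : bool -> {poly Q}) s : (forall b, (size (p b) <= e.+1)%N /\ (p b)`_e = s) ->
    exists2 K, 0 <= K & forall b n, (0 < n)%N -> `|(p b).[n%:R] - s * n%:R ^+ e| * n%:R <= K * n%:R ^+ e.
  move=> sp; have [K1 K1_ge0 h1] := poly_asym (sp true).1; have [K2 K2_ge0 h2] := poly_asym (sp false).1.
  exists (K1 + K2); first exact: addr_ge0.
  move=> b n n_gt0; have x0 : 0 <= n%:R ^+ e :> Q by rewrite exprn_ge0 ?ler0n.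
  case: b; rewrite mulrDl; [have := h1 n n_gt0; rewrite (sp true).2|have := h2 n n_gt0; rewrite (sp false).2].
    by have := mulr_ge0 K2_ge0 x0; lra.
  by have := mulr_ge0 K1_ge0 x0; lra.
have [K K_ge0 hK] := B q t sq; have [K' K'_ge0 hK'] := B q' t' sq'.
pose dl := t' - t; have dl0 : 0 < dl by rewrite subr_gt0.
(* [A] turns half the gap into at least [n^e], [B0] bounds [h] by a multiple of [n^e], and beyond
   [n1] the error terms take up at most half the gap. *)
pose A := Num.bound (2 / dl); pose B0 := Num.bound (`|t| + K).
pose n1 := (n0 + (Num.bound (2 * (K + K') / dl)).+1)%N.
have bd (x : Q) : 0 <= x -> x < (Num.bound x)%:R by apply: archi_boundP.
have A1 : 1 <= A%:R * (dl / 2).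
  have := bd (2 / dl); rewrite -/A => /(_ _)/ltW; rewrite ler_pdivrMr // => h1.
  have /h1 : 0 <= 2 / dl by rewrite divr_ge0 // ltW.
  by lra.
apply: (@growth_gap e d A B0 n1 h h' cl lo) => n hn.
all: have n_gt0 : (0 < n)%N by move: hn; rewrite /n1; lia.
all: have nn0 : (n0 <= n)%N by move: hn; rewrite /n1; lia.
all: have x0 : 0 < n%:R ^+ e :> Q by rewrite exprn_gt0 ?ltr0n.
all: have := hK (odd n) n n_gt0; rewrite -hq // => k1.
  have := hK' (odd n) n n_gt0; rewrite -hq' // => k2.
  have nb : 2 * (K + K') <= dl * n%:R.
    have := bd (2 * (K + K') / dl); rewrite ltr_pdivrMr // => /(_ _)/ltW => b1.
    have /b1 b2 : 0 <= 2 * (K + K') / dl by apply: divr_ge0; [lra|apply: ltW].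
    apply: le_trans b2 _; rewrite mulrC ler_pM2l // ler_nat.
    by move: hn; rewrite /n1; lia.
  rewrite -(ler_nat Q) natrD !natrM natrX; set x := n%:R ^+ e in x0 k1 k2 *.
  have n0' : 0 < n%:R :> Q by rewrite ltr0n.
  have d1 : (h' n)%:R - (h n)%:R >= dl / 2 * x :> Q.
    rewrite -(ler_pM2r n0').
    have a1 : (h n)%:R - t * x <= `|(h n)%:R - t * x| :> Q by apply: ler_norm.
    have a2 : - ((h' n)%:R - t' * x) <= `|(h' n)%:R - t' * x| :> Q by rewrite -normrN; apply: ler_norm.
    have b1 := le_trans (ler_wpM2r (ltW n0') a1) k1.
    have b2 := le_trans (ler_wpM2r (ltW n0') a2) k2.
    have b3 := ler_wpM2r (ltW x0) nb.
    by move: b1 b2 b3; rewrite /dl; nra.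
  have A0 : 0 <= A%:R :> Q by apply: ler0n.
  have := ler_wpM2l A0 d1; have := ler_wpM2r (ltW x0) A1.
  by rewrite mul1r mulrBr !mulrA; lra.
rewrite -(ler_nat Q) natrM natrX; set x := n%:R ^+ e in x0 k1 *.
have b2 : `|(h n)%:R - t * x| <= K * x :> Q.
  apply: le_trans k1; rewrite -{1}[`|_|]mulr1 ler_wpM2l // ler1n //.
have b3 : (h n)%:R <= (`|t| + K) * x :> Q.
  have a1 : (h n)%:R - t * x <= `|(h n)%:R - t * x| :> Q by apply: ler_norm.
  have a2 : t * x <= `|t| * x by rewrite ler_pM2r // ler_norm.
  by rewrite mulrDl; lra.
apply: le_trans b3 _; rewrite ler_pM2r //; apply/ltW/bd.
by rewrite addr_ge0.
Qed.

(** All four polynomials are compared at one exponent [e], the larger degree, where the coefficient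
    does not depend on the parity; equality there forces equal degrees too. *)
Lemma lead_agree (h h' : nat -> nat) (qe qo qe' qo' : {poly Q}) d :
  quasi_poly_models h qe qo -> quasi_poly_models h' qe' qo' ->
  wclose d h h' -> wlower d h -> wlower d h' -> lead_term qe = lead_term qe'.
Proof.
move=> [lq [n0 hq]] [lq' [n0' hq']] cl lo lo'.
apply: lead_term_eq; set e := _.-1; pose q (b : bool) := if b then qo else qe.
pose q' (b : bool) := if b then qo' else qe'.
have so : size qo = size qe by rewrite -size_lead_term -lq size_lead_term.
have so' : size qo' = size qe' by rewrite -size_lead_term -lq' size_lead_term.
have se : (size qe <= e.+1)%N by apply: leq_trans (leqSpred _); rewrite leq_maxl.
have se' : (size qe' <= e.+1)%N by apply: leq_trans (leqSpred _); rewrite leq_maxr.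
have sq b : (size (q b) <= e.+1)%N /\ (q b)`_e = qe`_e.
  case: b => //=; rewrite so; split=> //.
  by rewrite -coef_lead_term ?so // -lq coef_lead_term.
have sq' b : (size (q' b) <= e.+1)%N /\ (q' b)`_e = qe'`_e.
  case: b => //=; rewrite so'; split=> //.
  by rewrite -coef_lead_term ?so' // -lq' coef_lead_term.
have hqq n : (n0 + n0' <= n)%N -> (h n)%:R = (q (odd n)).[n%:R].
  by move=> hn; rewrite hq; [rewrite /q; case: odd|lia].
have hqq' n : (n0 + n0' <= n)%N -> (h' n)%:R = (q' (odd n)).[n%:R].
  by move=> hn; rewrite hq'; [rewrite /q'; case: odd|lia].
case: (ltgtP qe`_e qe'`_e) => // tt.
  by case: (lead_gap sq sq' hqq hqq' cl lo tt).
by case: (lead_gap sq' sq hqq' hqq (wclose_sym cl) lo' tt).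
Qed.
End Leading.

Section ExtModels.
Variables (A B : comNzRingType) (k : fieldType).
Variables (phi : {rmorphism A -> B}) (pi : {rmorphism B -> k}).
Variables (c : nat) (f : 'I_c -> A) (F : koszul_dgmod f).
Local Notation S := {mpoly k[c]}.
Variables (r : nat) (dg : 'I_r -> int) (a : 'I_r -> nat) (D : 'M[S]_r) (h : nat -> nat).
Hypothesis DD : D *m D = 0.
Hypothesis D_hom : wthom a D.
Hypothesis hh : hilb a D h.
Hypothesis mF : models phi pi F dg D.
Local Notation X := (Ext phi pi F).

Lemma models_krull d : chain_dim (Ann D) d -> krull_dim X = d.
Proof.
have [kap [k1 k2 k3 k4]] := mF; exact: (krull_dimE k1 k2 k3).
Qed.

Lemma models_rank : exists (rho : nat -> nat) w, forall n,
  [/\ rank_mod predT (@power_submod k c X n) = rho n, (\sum_(i < 2 * n) h i <= rho n)%N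
    & (rho n <= \sum_(i < 2 * n + w) h i)%N].
Proof.
have [kap [k1 k2 k3 k4]] := mF.
have [g [z [e [z_hom z_Zc z_gen]]]] := generators D_hom.
have /choice[rho hr] n := rank_bounds DD D_hom hh z_hom z_Zc z_gen n.
exists rho, (\max_i e i)%N => n; have [dr lo up] := hr n.
by split=> //; apply: (rank_power k1 k2 k3).
Qed.

Lemma models_eq0 : (forall x : X, x = 0) <-> forall n, h n = 0%N.
Proof.
have [kap [k1 k2 k3 k4]] := mF; split=> [X0 n|h0 x].
  apply: dimq0 (hh n); first exact: bnd_subsp.
  by move=> v [hv zv]; split=> //; apply/(k3 v zv); apply: X0.
have [v zv ->] := k2 x; apply/(k3 v zv).
apply: (@homog_sub _ _ _ a (Bc D)) => [|n]; first exact: Bc_subsp.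
have := hh n; rewrite h0 => /dimq_eq0 /(_ (hpart a n v)) [].
  by split; [apply: hpart_hom|apply: hpart_Zc].
by [].
Qed.

Lemma betti_hilb (n : int) N : (forall v : cvk k c r, colhom dg n v <-> hom a N v) ->
  betti phi pi F n = h N.
Proof.
have [kap [k1 k2 k3 k4]] := mF => hN; rewrite /betti.
have lB v : lft D kap (pred1 0) v <-> Bc D v.
  split=> [[zv]|bv]; first by move=> e0; apply: (proj1 (k3 v zv)); apply/eqP; exact: e0.
  have zv := Bc_Zc DD bv; split=> //; apply/eqP; exact: (k3 v zv).2.
have lE v : lft D kap (@Ext_degree A B k phi pi c f F n) v <->
    Zc D v /\ exists v', cyc a D N v' /\ Bc D (v - v').
  split=> -[zv].
    move=> /k4[v' [zv' /hN hv' e]]; split=> //; exists v'; split=> //.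
    have zd : Zc D (v - v') by apply: subspB => //; apply: Zc_subsp.
    by apply/(k3 _ zd); rewrite (kapB k1) // e subrr.
  move=> [v' [[hv' zv'] bd]]; split=> //; apply/k4; exists v'; split=> //; first exact/hN.
  have zd : Zc D (v - v') by apply: subspB => //; apply: Zc_subsp.
  have := (k3 _ zd).2 bd; rewrite (kapB k1) // => /eqP; rewrite subr_eq0 => /eqP.
  by [].
have hC := cyc_subsp a D N.
have sE : subsp (lft D kap (@Ext_degree A B k phi pi c f F n)).
  split=> [|t v w]; first by apply/lE; split; [apply: (Zc_subsp D).1|];
    exists 0; split; [apply: hC.1|rewrite subrr; apply: (Bc_subsp D).1].
  move=> /lE[zv [v' [cv bv]]] /lE[zw [w' [cw bw]]]; apply/lE.
  split; first exact: (Zc_subsp D).2.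
  exists (t *: v' + w'); split; first exact: hC.2.
  have -> : t *: v + w - (t *: v' + w') = t *: (v - v') + (w - w').
    by rewrite scalerBr opprD addrACA.
  exact: (Bc_subsp D).2.
have sB : subsp (lft D kap (pred1 0)).
  by split=> [|t v w /lB hv /lB hw]; apply/lB; [apply: (Bc_subsp D).1|apply: (Bc_subsp D).2].
apply: (rank_modE k1 k2 k3 sE sB).
apply: (@dimq_img _ _ _ (cyc a D N) (bnd a D N) _ _ id) (hh N) => //.
- move=> v cv; apply/lE; split; first by case: cv.
  by exists v; split=> //; rewrite subrr; apply: (Bc_subsp D).1.
- by move=> v [hv zv]; rewrite lB; split=> [[]|].
- by move=> v /lE[zv [v' [cv' bv']]]; exists v' => //; apply/lB.
Qed.
End ExtModels.

Lemma dual_growth_lead h h' s : dual_growth h h' -> exists d,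
  [/\ wclose d h (fun n => h' (n + s)%N), wlower d h & wlower d (fun n => h' (n + s)%N)].
Proof.
move=> [Z|[d [lo hO hO' cl]]]; last first.
  exists d; split; [exact: wclose_shift|exact: lowerb_wlower|].
  by apply: wlower_shift; apply: lowerb_cum_close lo cl.
(* For zero homology [d = 0] serves, owing to the additive constant in [wlower]. *)
exists 0%N; split.
- exists (fun=> 0%N), 0%N; split; first exact: bigO_0.
  have z g : (forall n, g n = 0%N) -> forall N, cum g N = 0%N by move=> g0 N; apply: big1.
  by move=> N; rewrite !z // => n; have [] := Z n => //; have [] := Z (n + s)%N.
- by exists 1%N, 0%N => N _; rewrite leq_addl.
- by exists 1%N, 0%N => N _; rewrite leq_addl.
Qed.

Theorem theorem1 (R : realType) (A B : comNzRingType) (k : fieldType)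
    (phi : {rmorphism A -> B}) (pi : {rmorphism B -> k})
    (c : nat) (f : 'I_c -> A) (M : lmodType B)
    (A_local : local_ring A) (A_noetherian : noetherian A)
    (B_local : local_ring B) (B_noetherian : noetherian B)
    (phi_surj : surjective phi) (pi_surj : surjective pi)
    (f_regular : regular_sequence f)
    (ker_phi : forall a : A, phi a = 0 <-> in_ideal f predT a)
    (M_fg : finitely_generated (predT : {pred M}))
    (M_pd : finite_proj_dim phi M)
    (G : free_resolution M)
    (F F' : koszul_dgmod f)
    (F_res : semifree_resolution phi F (single_complex M))
    (F'_res : semifree_resolution phi F' (dual_complex G)) :
  multiplicity (Ext phi pi F) R = multiplicity (Ext phi pi F') R /\
  forall q_ev q_odd q'_ev q'_odd : {poly rat},
    quasi_poly_models (fun i => betti phi pi F i%:Z) q_ev q_odd ->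
    quasi_poly_models (fun i => betti phi pi F' i%:Z) q'_ev q'_odd ->
    lead_term q_ev = lead_term q'_ev.
Proof.
have [r [a [D [DD Da mF mF']]]] := ext_models A_local phi_surj pi_surj f_regular
  ker_phi M_pd F_res F'_res.
(* The dual model has integer weights [c - a i]; adding the sum of all [a i] makes them natural
   numbers. *)
pose g := (c + \sum_i a i)%N; pose b i := (g - a i)%N.
have ag i : (a i <= g)%N by rewrite /g (bigD1 i) //= addnCA leq_addr.
have ab i : (a i + b i = g)%N by rewrite /b subnKC.
have DD' : D^T *m D^T = 0 by rewrite -trmx_mul DD trmx0.
have Db : wthom b D^T by move=> i j m; rewrite mxE => /Da; have := ab i; have := ab j; lia.
have [h hh] := hilb_ex a D; have [h' hh'] := hilb_ex b D^T.
have dual := dual_growth_all DD Da ab hh hh'.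
split.
  have X0 := models_eq0 Da hh mF; have X0' := models_eq0 Db hh' mF'.
  case: dual => [Z|[d [lo hO hO' cl]]].
    rewrite /multiplicity !asboolT //; first by apply/X0' => n; case: (Z n).
    by apply/X0 => n; case: (Z n).
  have lo' := lowerb_cum_close lo cl.
  have nz (u : nat -> nat) : lowerb d u -> ~ forall n, u n = 0%N.
    move=> [C [N0 low]] u0; have := low N0.+1 (leqnSn _).
    by rewrite [cum _ _]big1 // muln0 leqn0 expn_eq0.
  have [rho [w hr]] := models_rank DD Da hh mF.
  have [rho' [w' hr']] := models_rank DD' Db hh' mF'.
  have [E EO hE] := @rank_close d w h h' rho rho' hO cl
    (fun n => let: And3 _ l _ := hr' n in l) (fun n => let: And3 _ _ u := hr n in u).
  have [E' EO' hE'] := @rank_close d w' h' h rho' rho hO' (cum_close_sym cl)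
    (fun n => let: And3 _ l _ := hr n in l) (fun n => let: And3 _ _ u := hr' n in u).
  apply: (@multiplicity_close R k c _ _ rho rho' E E' d) => //.
  - by rewrite X0; apply: nz.
  - by rewrite X0'; apply: nz.
  - by apply: (models_krull mF); apply: krull_growth hh lo hO.
  - by apply: (models_krull mF'); apply: krull_growth hh' lo' hO'.
  - by move=> n; case: (hr n).
  - by move=> n; case: (hr' n).
move=> q_ev q_odd q'_ev q'_odd hq hq'.
(* Undoing this shift of weights, the Betti number in degree [n] of the dual is [h'] at [n + s]. *)
pose s := (\sum_i a i)%N.
have [d [cl lo lo']] := dual_growth_lead s dual.
have e1 : (fun i : nat => betti phi pi F i%:Z) = h.
  apply: funext => n; apply: (betti_hilb DD hh mF) => v; split=> hv.
    by move=> [i m]; rewrite /cf -mcoeff_msupp => /hv; rewrite /wt /=; lia.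
  by move=> i m hm; have := hv (i, m); rewrite /cf -mcoeff_msupp => /(_ hm); rewrite /wt /=; lia.
have e2 : (fun i : nat => betti phi pi F' i%:Z) = (fun n => h' (n + s)%N).
  apply: funext => n; apply: (betti_hilb DD' hh' mF') => v; split=> hv.
    move=> [i m]; rewrite /cf -mcoeff_msupp => /hv; rewrite /wt /=.
    by have := ab i; rewrite /g -/s; lia.
  move=> i m hm; have := hv (i, m); rewrite /cf -mcoeff_msupp => /(_ hm); rewrite /wt /=.
  by have := ab i; rewrite /g -/s; lia.
rewrite e1 in hq; rewrite e2 in hq'.
exact: lead_agree hq hq' cl lo lo'.
Qed.
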